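(* Let $n\ge1$ and let $Y$ be one of the Fréchet spaces $\mathcal X$, $\mathcal X_{\mathrm c}$, $\mathcal X_{1+}$, or $\mathcal X_p$ with fixed $1<p<\infty$. Then the set $\{g\in Y: g^{(1/4)}\in L^\infty(\mathbb{C}^n)\}$ is meager in $Y$.
   Context: Let $v$ be Lebesgue measure on $\mathbb{C}^n$ and $d\mu(z)=(2\pi)^{-n}e^{-|z|^2/2}\,dv(z)$. The Fock space $F^2$ is the closed subspace of entire functions in $L^2(d\mu)$, and $P:L^2(d\mu)\to F^2$ is the orthogonal projection. For $a\in\mathbb{C}^n$, $k_a(z)=e^{z\cdot\overline a/2-|a|^2/4}$ (with $z\cdot\overline a=\sum_j z_j\overline{a_j}$). A measurable $g:\mathbb{C}^n\to\mathbb{C}$ is admissible if $gk_a\in L^2(d\mu)$ for all $a\in\mathbb{C}^n$. For such $g$, $T_gf=P(gf)$ is defined on the dense set $\mathcal D_g=\{f\in F^2:gf\in L^2(d\mu)\}$; a bounded extension to $F^2$, if it exists, is also denoted $T_g$, and statements such as ''$T_g\in\mathcal B(F^2)$'', ''$T_g$ is compact'', ''$T_g\in S_p$'' mean that the bounded extension exists and has the stated property. $\mathcal B(F^2)$ is the space of bounded operators with operator norm $\|\cdot\|$, and $S_p=S_p(F^2)$ is the Schatten-$p$ class. The endpoint heat transform is $g^{(1/4)}(a)=\pi^{-n}\int_{\mathbb{C}^n}g(w)e^{-|w-a|^2}\,dv(w)$. For $m\in\mathbb{N}_0$ set $$q_m(g)^2=(2\pi)^{-n}\int_{\mathbb{C}^n}|g(z)|^2e^{-|z|^2/2+m|z|}\,dv(z),\qquad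 \mathcal E=\bigcap_{m\ge0}\{g: q_m(g)<\infty\},$$ where functions are identified if equal a.e. ($\mathcal E$ coincides with the class of admissible symbols.) Define $$\mathcal X=\{g\in\mathcal E:T_g\in\mathcal B(F^2)\},\qquad \mathcal X_{\mathrm c}=\{g\in\mathcal E:T_g\text{ is compact}\},$$ $$\mathcal X_p=\{g\in\mathcal E:T_g\in S_p\}\ (1<p<\infty),\qquad \mathcal X_{1+}=\{g\in\mathcal E:T_g\in\textstyle\bigcap_{p>1}S_p\}.$$ These spaces are topologized by the following sequences of norms, $m\in\mathbb{N}_0$: $q_m(g)+\|T_g\|$ on $\mathcal X$ and $\mathcal X_{\mathrm c}$; $q_m(g)+\|T_g\|_{S_p}$ on $\mathcal X_p$; and $q_m(g)+\|T_g\|_{S_{p_m}}$ with $p_m=1+1/(m+1)$ on $\mathcal X_{1+}$. With these topologies each space is a Fréchet space. *)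

(* Defs.v *)
From HB Require Import structures.
From mathcomp Require Import all_boot all_order all_algebra complex.
From mathcomp Require Import ring lra.
From mathcomp Require Import all_classical all_reals all_analysis.
From mathcomp Require Import measurable_realfun ess_sup_inf.

Set Implicit Arguments.
Unset Strict Implicit.
Unset Printing Implicit Defensive.

Import Order.TTheory GRing.Theory Num.Theory.
Import numFieldNormedType.Exports.

Local Open Scope classical_set_scope.
Local Open Scope ring_scope.
Local Open Scope complex_scope.

Notation normc := Normc.normc.

(* [R[i]] as a normed space over itself, with its usual topology. *)
HB.instance Definition _ (R : realType) := NormedModule.copy R[i] R[i]^o.

(* [C^n] is ['rV[R[i]]_n].  The sigma-algebras on [R[i]] and ['rV[R[i]]_n] are
   the Borel ones, generated by the real coordinates. *)

Section complex_measurable.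
Variable R : realType.

Let re : R[i] -> measurableTypeR R := @complex.Re R.
Let im : R[i] -> measurableTypeR R := @complex.Im R.

Let complex_set0 : g_sigma_preimageU re im set0.
Proof. exact: sigma_algebra0. Qed.

Let complex_setC A :
  g_sigma_preimageU re im A -> g_sigma_preimageU re im (~` A).
Proof. by move=> ?; rewrite -setTD; exact: sigma_algebraCD. Qed.

Let complex_bigcup (F : _^nat) : (forall i, g_sigma_preimageU re im (F i)) ->
  g_sigma_preimageU re im (\bigcup_i (F i)).
Proof. exact: sigma_algebra_bigcup. Qed.

HB.instance Definition _ := @isMeasurable.Build default_measure_display
  R[i] (g_sigma_preimageU re im) complex_set0 complex_setC complex_bigcup.

Lemma measurable_Re :
  measurable_fun [set: R[i]] (@complex.Re R : R[i] -> measurableTypeR R).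
Proof.
by move=> _ A mA; apply: sub_sigma_algebra; left; exists A.
Qed.

Lemma measurable_Im :
  measurable_fun [set: R[i]] (@complex.Im R : R[i] -> measurableTypeR R).
Proof.
by move=> _ A mA; apply: sub_sigma_algebra; right; exists A.
Qed.

Lemma measurable_complexP d (T : measurableType d) (f : T -> R[i]) :
  measurable_fun setT (fun x => complex.Re (f x) : measurableTypeR R) ->
  measurable_fun setT (fun x => complex.Im (f x) : measurableTypeR R) ->
  measurable_fun setT f.
Proof.
move=> mr mi; apply: (@measurability _ _ _ _ _ _ (preimage_set_system setT re measurable `|`
  preimage_set_system setT im measurable) erefl).
move=> _ [_ [[A mA <-]|[A mA <-]] <-]; rewrite !setTI.
- by rewrite -[X in measurable X]setTI; exact: mr.
- by rewrite -[X in measurable X]setTI; exact: mi.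
Qed.

End complex_measurable.

Section row_measurable.
Variables (R : realType) (n : nat).

Let coor (i : 'I_n) (z : 'rV[R[i]]_n) : R[i] := z ord0 i.

Let row_set0 : g_sigma_preimage coor set0.
Proof. exact: sigma_algebra0. Qed.

Let row_setC A : g_sigma_preimage coor A -> g_sigma_preimage coor (~` A).
Proof. by move=> ?; rewrite -setTD; exact: sigma_algebraCD. Qed.

Let row_bigcup (F : _^nat) : (forall i, g_sigma_preimage coor (F i)) ->
  g_sigma_preimage coor (\bigcup_i (F i)).
Proof. exact: sigma_algebra_bigcup. Qed.

HB.instance Definition _ := @isMeasurable.Build default_measure_display
  'rV[R[i]]_n (g_sigma_preimage coor) row_set0 row_setC row_bigcup.

Lemma measurable_coor (i : 'I_n) :
  measurable_fun [set: 'rV[R[i]]_n] (fun z => z ord0 i : R[i]).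
Proof.
move=> _ A mA; apply: sub_sigma_algebra.
rewrite -bigcup_seq/=; exists i => /=; first by rewrite mem_index_enum.
by exists A.
Qed.

Lemma measurable_rowP d (T : measurableType d) (f : T -> 'rV[R[i]]_n) :
  (forall i, measurable_fun setT (fun x => f x ord0 i : R[i])) ->
  measurable_fun setT f.
Proof.
move=> mf; apply: (@measurability _ _ _ _ _ _ (\big[setU/set0]_(i < n)
  preimage_set_system setT (coor i) measurable) erefl).
move=> _ [B + <-]; rewrite -bigcup_seq/= => -[i _ [A mA <-]]; rewrite !setTI.
by rewrite -[X in measurable X]setTI; exact: mf.
Qed.

End row_measurable.

(* The library has no canonical sigma-finite instance for [m1 \x m2]. *)
Section sigma_finite_product.
Context d1 d2 (T1 : measurableType d1) (T2 : measurableType d2) (R : realType).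
Variables (m1 : {sigma_finite_measure set T1 -> \bar R}).
Variables (m2 : {sigma_finite_measure set T2 -> \bar R}).

Let sfprod : set (T1 * T2) -> \bar R := (m1 \x m2)%E.

HB.instance Definition _ := Measure.on sfprod.

Let sfprod_sigma_finite : sigma_finite setT sfprod.
Proof.
have /sigma_finiteP[F [TF ndF Foo]] := sigma_finiteT m1.
have /sigma_finiteP[G [TG ndG Goo]] := sigma_finiteT m2.
exists (fun k => F k `*` G k).
  rewrite -setXTT TF TG predeqE => -[x y]; split.
    move=> [/= [k _ Fnx] [l _ Gky]]; exists (maxn k l) => //; split.
    - by move: x Fnx; exact/subsetPset/ndF/leq_maxl.
    - by move: y Gky; exact/subsetPset/ndG/leq_maxr.
  by move=> [k _ []/= ? ?]; split; exists k.
move=> k; have [? ?] := Foo k; have [? ?] := Goo k.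
split; first exact: measurableX.
by rewrite /sfprod product_measure1E// lte_mul_pinfty// ge0_fin_numE.
Qed.

HB.instance Definition _ := Measure_isSigmaFinite.Build _ _ _ sfprod
  sfprod_sigma_finite.

Definition sigma_finite_product
  : {sigma_finite_measure set (T1 * T2)%type -> \bar R} := sfprod.

End sigma_finite_product.

(* Transport of a sigma-finite measure along an injective measurable map [f]
   with a measurable left inverse [g]. *)
Section transport.
Context d1 d2 (T1 : measurableType d1) (T2 : measurableType d2) (R : realType).
Variables (mu : {sigma_finite_measure set T1 -> \bar R}).
Variables (f : T1 -> T2) (g : T2 -> T1).
Hypotheses (mf : measurable_fun setT f) (mg : measurable_fun setT g).
Hypothesis fK : cancel f g.

Definition transport of measurable_fun setT f & measurable_fun setT g
  & cancel f g : set T2 -> \bar R := pushforward mu f.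

Local Notation nu := (transport mf mg fK).

Let preimM A : measurable A -> measurable (f @^-1` A).
Proof. by move=> mA; rewrite -[X in measurable X]setTI; exact: mf. Qed.

Let nu0 : nu set0 = 0%E.
Proof. by rewrite /transport /pushforward preimage_set0 measure0. Qed.

Let nu_ge0 A : (0 <= nu A)%E.
Proof. exact: measure_ge0. Qed.

Let nu_sigma_additive : semi_sigma_additive nu.
Proof.
move=> F mF tF mUF; rewrite /transport /pushforward preimage_bigcup.
apply: measure_semi_sigma_additive.
- by move=> k; exact: preimM.
- apply/trivIsetP => /= i j _ _ ij; rewrite -preimage_setI.
  by move/trivIsetP : tF => /(_ _ _ _ _ ij) ->//; rewrite preimage_set0.
- by rewrite -preimage_bigcup; exact: preimM.
Qed.

HB.instance Definition _ := isMeasure.Build _ _ _ nu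
  nu0 nu_ge0 nu_sigma_additive.

Let nu_sigma_finite : sigma_finite setT nu.
Proof.
have [F FT Foo] := sigma_finiteT mu; exists (fun k => g @^-1` F k).
  by rewrite -preimage_bigcup -FT preimage_setT.
move=> k; have [mFk Fkoo] := Foo k; split.
  by rewrite -[X in measurable X]setTI; exact: mg.
rewrite /transport /pushforward -comp_preimage.
by rewrite (_ : g \o f = id) //; apply/funext => x /=; rewrite fK.
Qed.

HB.instance Definition _ := Measure_isSigmaFinite.Build _ _ _ nu
  nu_sigma_finite.

Definition transported : {sigma_finite_measure set T2 -> \bar R} := nu.

End transport.

Section lebesgue_complex.
Variable R : realType.

Local Notation mR := (measurableTypeR R).

Definition of_pair (p : mR * mR) : R[i] := Complex p.1 p.2.
Definition to_pair (c : R[i]) : mR * mR := (complex.Re c, complex.Im c).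

Lemma measurable_of_pair : measurable_fun setT of_pair.
Proof.
by apply: measurable_complexP; [exact: measurable_fst|exact: measurable_snd].
Qed.

Lemma measurable_to_pair : measurable_fun setT to_pair.
Proof.
by apply: measurable_fun_pair; [exact: measurable_Re|exact: measurable_Im].
Qed.

Lemma of_pairK : cancel of_pair to_pair.
Proof. by case. Qed.

Definition lebesgueC : {sigma_finite_measure set R[i] -> \bar R} :=
  transported
    (sigma_finite_product (@lebesgue_measure R) (@lebesgue_measure R))
    measurable_of_pair measurable_to_pair of_pairK.

Definition cons_row n (p : R[i] * 'rV[R[i]]_n) : 'rV[R[i]]_n.+1 :=
  \row_i if unlift ord0 i is Some j then p.2 ord0 j else p.1.
Definition uncons_row n (z : 'rV[R[i]]_n.+1) : R[i] * 'rV[R[i]]_n :=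
  (z ord0 ord0, \row_j z ord0 (lift ord0 j)).

Lemma measurable_cons_row n : measurable_fun setT (@cons_row n).
Proof.
apply: measurable_rowP => i.
under eq_fun do rewrite mxE.
case: unlift => [j|]; last exact: measurable_fst.
exact: (measurableT_comp (measurable_coor j) measurable_snd).
Qed.

Lemma measurable_uncons_row n : measurable_fun setT (@uncons_row n).
Proof.
apply: measurable_fun_pair => /=; first exact: measurable_coor.
apply: measurable_rowP => i; under eq_fun do rewrite mxE.
exact: measurable_coor.
Qed.

Lemma cons_rowK n : cancel (@cons_row n) (@uncons_row n).
Proof.
case=> c z; rewrite /uncons_row mxE unlift_none /=; congr pair.
by apply/rowP => j; rewrite !mxE liftK.
Qed.

(* The n-fold product of [lebesgueC], transported from nested pairs to rows. *)
Fixpoint lebesgueCn n : {sigma_finite_measure set 'rV[R[i]]_n -> \bar R} :=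
  match n with
  | 0 => \d_(0 : 'rV[R[i]]_0)
  | n'.+1 => transported (sigma_finite_product lebesgueC (lebesgueCn n'))
      (@measurable_cons_row n') (@measurable_uncons_row n') (@cons_rowK n')
  end.

End lebesgue_complex.

Section integrals.
Variables (R : realType) (n : nat).
Local Notation C := R[i].
Local Notation Cn := 'rV[C]_n.
Implicit Types (f g h : Cn -> C) (z : Cn).

(* The Euclidean norm; the library norm of a matrix is the sup norm. *)
Definition enorm z : R := Num.sqrt (\sum_(j < n) normc (z ord0 j) ^+ 2).

Definition cintegral f : C :=
  Complex (\int[@lebesgueCn R n]_z complex.Re (f z))
          (\int[@lebesgueCn R n]_z complex.Im (f z)).

(* The density of [mu] with respect to Lebesgue measure. *)
Definition gaussian z : R := (2 * pi) ^- n * expR (- enorm z ^+ 2 / 2).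

Definition L2norm f : \bar R :=
  ((\int[@lebesgueCn R n]_z (normc (f z) ^+ 2 * gaussian z)%:E) `^ 2^-1)%E.

(* [f] is a representative of an element of L^2(mu). *)
Definition L2 f : Prop := measurable_fun setT f /\ (L2norm f < +oo)%E.

Definition inner f h : C :=
  cintegral (fun z => f z * (h z)^*%C * (gaussian z)%:C).

(* The seminorm [q_m]. *)
Definition weighted_norm (m : nat) g : \bar R :=
  ((((2 * pi) ^- n)%:E * \int[@lebesgueCn R n]_z
     (normc (g z) ^+ 2 * expR (- enorm z ^+ 2 / 2 + m%:R * enorm z))%:E)
   `^ 2^-1)%E.

(* [g^(1/4)]. *)
Definition heat_transform g (a : Cn) : C :=
  (pi ^- n)%:C * cintegral (fun w => g w * (expR (- enorm (w - a) ^+ 2))%:C).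

Definition Linfty f : Prop := measurable_fun setT f /\
  (ess_sup (@lebesgueCn R n) (fun a => (normc (f a))%:E) < +oo)%E.

(* Differentiability is over the scalar field [C], so [f] is holomorphic. *)
Definition entire f : Prop := forall x, differentiable f x.

End integrals.

Section fock.
Variables (R : realType) (n : nat).
Local Notation C := R[i].
Local Notation Cn := 'rV[C]_n.

Definition fock_pred : {pred Cn -> C} :=
  [pred f | `[< entire f /\ L2 f >]].

Let normc2E (c : C) : normc c ^+ 2 = complex.Re c ^+ 2 + complex.Im c ^+ 2.
Proof.
by case: c => x y /=; rewrite sqr_sqrtr// addr_ge0// sqr_ge0.
Qed.

Let measurable_normc2 d (T : measurableType d) (f : T -> C) :
  measurable_fun setT f ->
  measurable_fun setT (fun z => normc (f z) ^+ 2 : measurableTypeR R).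
Proof.
move=> mf; under eq_fun do rewrite normc2E.
apply: measurable_funD; apply: measurable_funX.
- exact: (measurableT_comp (@measurable_Re R) mf).
- exact: (measurableT_comp (@measurable_Im R) mf).
Qed.

Let measurable_gaussian :
  measurable_fun setT (@gaussian R n : Cn -> measurableTypeR R).
Proof.
apply: measurable_funM => //; apply: measurableT_comp => //.
apply: measurable_funM => //; apply: measurableT_comp => //.
have sum_ge0 (z : Cn) : 0 <= \sum_(j < n) normc (z ord0 j) ^+ 2.
  by apply: sumr_ge0 => j _; exact: sqr_ge0.
under eq_fun do rewrite /enorm sqr_sqrtr//.
apply: measurable_sum => j.
exact: (measurable_normc2 (@measurable_coor R n j)).
Qed.

Let measurable_L2 (f : Cn -> C) : measurable_fun setT f ->
  measurable_fun setT (fun z => (normc (f z) ^+ 2 * gaussian z)%:E).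
Proof.
move=> mf; apply/measurable_EFinP; apply: measurable_funM => //.
exact: measurable_normc2.
Qed.

Let gaussian_ge0 (z : Cn) : 0 <= gaussian z.
Proof. by rewrite mulr_ge0 ?expR_ge0// invr_ge0 exprn_ge0// mulr_ge0// pi_ge0. Qed.

Let L2P (f : Cn -> C) : L2 f <-> measurable_fun setT f /\
  (\int[@lebesgueCn R n]_z (normc (f z) ^+ 2 * gaussian z)%:E < +oo)%E.
Proof.
split=> -[mf fin]; split=> //; last exact: poweR_lty.
by apply: lty_poweRy fin; rewrite invr_neq0.
Qed.

Let measurable_lin (a : C) (f g : Cn -> C) : measurable_fun setT f ->
  measurable_fun setT g -> measurable_fun setT (a *: f + g).
Proof.
move=> mf mg.
have [mfr mfi] : measurable_fun setT (fun z => complex.Re (f z) : measurableTypeR R) /\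
    measurable_fun setT (fun z => complex.Im (f z) : measurableTypeR R).
  by split; [exact: (measurableT_comp (@measurable_Re R) mf)|
             exact: (measurableT_comp (@measurable_Im R) mf)].
have [mgr mgi] : measurable_fun setT (fun z => complex.Re (g z) : measurableTypeR R) /\
    measurable_fun setT (fun z => complex.Im (g z) : measurableTypeR R).
  by split; [exact: (measurableT_comp (@measurable_Re R) mg)|
             exact: (measurableT_comp (@measurable_Im R) mg)].
apply: measurable_complexP.
- rewrite (_ : (fun z => _) = fun z => complex.Re a * complex.Re (f z) -
      complex.Im a * complex.Im (f z) + complex.Re (g z)); last first.
    apply/funext => z; rewrite -[(a *: f + g) z]/(a * f z + g z).
    by case: a (f z) (g z) => [? ?] [? ?] [? ?].
  apply: measurable_funD => //; apply: measurable_funB; exact: measurable_funM.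
- rewrite (_ : (fun z => _) = fun z => complex.Re a * complex.Im (f z) +
      complex.Im a * complex.Re (f z) + complex.Im (g z)); last first.
    apply/funext => z; rewrite -[(a *: f + g) z]/(a * f z + g z).
    by case: a (f z) (g z) => [? ?] [? ?] [? ?].
  apply: measurable_funD => //; apply: measurable_funD; exact: measurable_funM.
Qed.

Let normc_lin (a x y : C) :
  normc (a * x + y) ^+ 2 <= 2 * normc a ^+ 2 * normc x ^+ 2 + 2 * normc y ^+ 2.
Proof.
have := le_normcD (a * x : Rcomplex R) y; rewrite Normc.normcM => le.
have nc0 (c : C) : 0 <= normc c by case: c => ? ?; exact: sqrtr_ge0.
have : normc (a * x + y) ^+ 2 <= (normc a * normc x + normc y) ^+ 2.
  by rewrite lerXn2r// nnegrE ?addr_ge0// mulr_ge0.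
move: (normc a) (normc x) (normc y) (normc (a * x + y)) => p q r s h.
have := sqr_ge0 (p * q - r); nra.
Qed.

Let entireD (f g : Cn -> C) : entire f -> entire g -> entire (f + g).
Proof. by move=> ef eg z; apply: differentiableD. Qed.

Let entireZ (a : C) (f : Cn -> C) : entire f -> entire (a *: f).
Proof. by move=> ef z; apply: differentiableZ. Qed.

Let weighted_le (p q r s w : R) : 0 <= w -> p <= 2 * q * r + 2 * s ->
  p * w <= 2 * q * (r * w) + 2 * (s * w).
Proof.
by move=> w0 /(ler_wpM2r w0); rewrite mulrDl -!mulrA.
Qed.

Lemma fock_submod_closed : submod_closed fock_pred.
Proof.
split.
  apply/asboolP; split; first by move=> z; exact: differentiable_cst.
  apply/L2P; split; first exact: measurable_cst.
  rewrite integral0_eq// => z _.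
  by rewrite Normc.normc0 expr0n mul0r.
move=> a f g /asboolP[ef /L2P[mf Lf]] /asboolP[eg /L2P[mg Lg]].
apply/asboolP; split.
  exact: (entireD (entireZ a ef) eg).
apply/L2P; split; first exact: measurable_lin.
pose F (h : Cn -> C) z := (normc (h z) ^+ 2 * gaussian z)%:E.
have F0 h z : (0 <= F h z)%E by rewrite lee_fin mulr_ge0// sqr_ge0.
apply: (@le_lt_trans _ _ (\int[@lebesgueCn R n]_z
  ((2 * normc a ^+ 2)%:E * F f z + 2%:E * F g z))%E).
  apply: ge0_le_integral => //.
  - by move=> z _; exact: (F0 (a *: f + g) z).
  - exact: (measurable_L2 (measurable_lin a mf mg)).
  - by apply: emeasurable_funD; apply: measurable_funeM; exact: measurable_L2.
  - move=> z _; rewrite /F -!EFinM -EFinD lee_fin.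
    exact: (weighted_le (gaussian_ge0 z) (normc_lin a (f z) (g z))).
rewrite ge0_integralD//; last 4 first.
- by move=> z _; rewrite mule_ge0// lee_fin mulr_ge0// sqr_ge0.
- by apply: measurable_funeM; exact: measurable_L2.
- by move=> z _; rewrite mule_ge0.
- by apply: measurable_funeM; exact: measurable_L2.
rewrite !ge0_integralZl_EFin//; try exact: measurable_L2;
  last by rewrite mulr_ge0// sqr_ge0.
by rewrite lte_add_pinfty// lte_mul_pinfty// lee_fin// mulr_ge0// sqr_ge0.
Qed.

HB.instance Definition _ := GRing.isSubmodClosed.Build C (Cn -> C) fock_pred
  fock_submod_closed.

Record fock := Fock { fock_fun :> Cn -> C; fockP : fock_fun \in fock_pred }.

HB.instance Definition _ := [isSub for fock_fun].
HB.instance Definition _ := [Choice of fock by <:].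
HB.instance Definition _ := [SubChoice_isSubLmodule of fock by <:].

End fock.

Section operators.
Variables (R : realType) (n : nat).
Local Notation C := R[i].
Local Notation Cn := 'rV[C]_n.
Local Notation F2 := (fock R n).
Local Open Scope ereal_scope.
Implicit Types (T : {linear F2 -> F2}) (g h : Cn -> C) (p : R).

Definition opnorm (T : F2 -> F2) : \bar R :=
  ereal_sup [set L2norm (T f) | f in [set f : F2 | L2norm f <= 1]].

Definition bounded_op T : Prop := opnorm T < +oo.

Definition compact_op T : Prop := bounded_op T /\
  forall u : F2^nat, (exists M : R, forall k, L2norm (u k) <= M%:E) ->
  exists phi : nat -> nat, {homo phi : i j / (i < j)%N} /\
  exists v : F2, L2norm (T (u (phi k)) - v)%R @[k --> \oo] --> 0.

Definition rank_le (k : nat) T : Prop :=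
  exists u : 'I_k -> F2, forall f, exists c : 'I_k -> C,
    (T f = \sum_(i < k) c i *: u i)%R.

(* The singular numbers [s_0(T) >= s_1(T) >= ...] of a bounded operator on a
   Hilbert space, as in Pietsch and Peller: [s_k(T)] is the distance from [T]
   to the operators of rank at most [k].  For compact [T] they are the
   eigenvalues of [|T|] in decreasing order, with multiplicity. *)
Definition singular_number (k : nat) T : \bar R :=
  ereal_inf [set opnorm (fun f => T f - S f)%R
            | S in [set S : {linear F2 -> F2} | bounded_op S /\ rank_le k S]].

Definition schatten_norm p T : \bar R :=
  (\sum_(0 <= k <oo) singular_number k T `^ p) `^ p^-1.

Definition schatten_class p T : Prop :=
  bounded_op T /\ schatten_norm p T < +oo.

(* The orthogonal projection L^2(mu) -> F^2: the image [u] of [h] is the only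
   element of [F2] such that [h - u] is orthogonal to [F2]. *)
Definition fock_proj h : F2 :=
  xget 0%R [set u : F2 | forall f : F2, inner (fun z => h z - u z)%R f = 0%R].

(* [T] is a bounded operator extending the densely defined [T_g]. *)
Definition toeplitz_extension g T : Prop := bounded_op T /\
  forall f : F2, L2 (fun z => g z * f z)%R ->
    T f = fock_proj (fun z => g z * f z)%R.

(* When it exists, the extension is unique for [g] in [calE] (below), because
   [T_g] is then densely defined. *)
Definition toeplitz g : {linear F2 -> F2} :=
  xget (\0 : {linear F2 -> F2})%R [set T | toeplitz_extension g T].

(* "[T_g] has the property [Q]": the bounded extension exists and has it. *)
Definition toeplitz_has g (Q : {linear F2 -> F2} -> Prop) : Prop :=
  exists2 T, toeplitz_extension g T & Q T.

End operators.

Section symbol_spaces.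
Variables (R : realType) (n : nat).
Local Notation C := R[i].
Local Notation Cn := 'rV[C]_n.

(* Symbols are measurable functions modulo a.e. equality. *)
Definition symbol : Type := {mfun_ (@lebesgueCn R n), Cn >-> C}.

HB.instance Definition _ := Choice.on symbol.

Definition symbol_fun (g : symbol) : Cn -> C := aqEqMfun_to_fun g.
Coercion symbol_fun : symbol >-> Funclass.

(* The set [Y] of symbols with the topology of the sequence of norms [rho],
   which are given on representatives. *)
Definition symbol_space (Y : set symbol) (rho : nat -> (Cn -> C) -> \bar R) :
  Type := {g : symbol | g \in Y}.

Section topology.
Variables (Y : set symbol) (rho : nat -> (Cn -> C) -> \bar R).
Local Notation X := (symbol_space Y rho).

HB.instance Definition _ := Choice.on X.

Definition space_symbol (g : X) : symbol := val g.
Coercion space_symbol : symbol_space >-> symbol.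

Definition norms_open (U : set X) : Prop := forall g, U g ->
  exists (N : nat) (e : R), 0 < e /\
    forall h : X,
      (forall m, (m <= N)%N -> (rho m (fun z => (h z - g z)%R) < e%:E)%E) -> U h.

Let openT : norms_open setT.
Proof. by move=> g _; exists 0%N, 1; split. Qed.

Let openI : setI_closed norms_open.
Proof.
move=> U V oU oV g [Ug Vg].
have [N [e [e0 Ue]]] := oU _ Ug; have [M [d [d0 Vd]]] := oV _ Vg.
exists (maxn N M), (Order.min e d); split=> [|h hg]; first by rewrite lt_min e0.
split.
- apply: Ue => m mN; apply: lt_le_trans (hg m _) _.
    by rewrite leq_max mN.
  by rewrite lee_fin ge_min lexx.
- apply: Vd => m mM; apply: lt_le_trans (hg m _) _.
    by rewrite leq_max mM orbT.
  by rewrite lee_fin ge_min lexx orbT.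
Qed.

Let open_bigU (I : Type) (f : I -> set X) :
  (forall i, norms_open (f i)) -> norms_open (\bigcup_i f i).
Proof.
move=> fo g [i _ fig]; have [N [e [e0 fe]]] := fo i _ fig.
by exists N, e; split=> // h hg; exists i => //; exact: fe.
Qed.

HB.instance Definition _ := isOpenTopological.Build X openT openI open_bigU.

End topology.

Definition calE : set symbol :=
  [set g | forall m, (weighted_norm m g < +oo)%E].

Definition X_bounded : set symbol :=
  [set g | calE g /\ toeplitz_has g (@bounded_op R n)].

Definition X_compact : set symbol :=
  [set g | calE g /\ toeplitz_has g (@compact_op R n)].

Definition X_schatten (p : R) : set symbol :=
  [set g | calE g /\ toeplitz_has g (@schatten_class R n p)].

(* [X_{1+}] *)
Definition X_schatten1p : set symbol :=
  [set g | calE g /\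
           toeplitz_has g (fun T => forall p, 1 < p -> schatten_class p T)].

Definition norms_op (m : nat) (g : Cn -> C) : \bar R :=
  (weighted_norm m g + opnorm (toeplitz g))%E.

Definition norms_schatten (p : R) (m : nat) (g : Cn -> C) : \bar R :=
  (weighted_norm m g + schatten_norm p (toeplitz g))%E.

Definition norms_schatten1p (m : nat) (g : Cn -> C) : \bar R :=
  (weighted_norm m g + schatten_norm (1 + m.+1%:R^-1) (toeplitz g))%E.

End symbol_spaces.

Section baire_category.
Variable X : topologicalType.

Definition nowhere_dense (A : set X) : Prop := interior (closure A) = set0.

Definition meager (A : set X) : Prop :=
  exists F : (set X)^nat, (forall k, nowhere_dense (F k)) /\ A = \bigcup_k F k.

End baire_category.

(* Main.v *)
(** For small [x > 0] and real [p], [q], the kernel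
    exp(w_1 q/2 - q^2/4) exp(conj z_1 p/2 - p^2/4) exp(x (w - q e_1).conj(z - p e_1)/2)
    is that of the Toeplitz operator of an explicit bounded Gaussian symbol centred
    at [t e_1], [t = (p + q)/2], whose endpoint heat transform at [t e_1] is
    (2/(1 + x))^n >= 1.  Add [D] such symbols with [p = t + j A], [q = t - j A] and
    [A] large: the pieces are almost orthogonal on both sides, so by Schur's test the
    operator norm of the sum is bounded independently of [D] and [t], whereas its heat
    transform at [t e_1] is at least [D].  Taylor expansion of the last exponential
    gives finite-rank approximations with geometric error, so the operator is compact
    and its Schatten p-norm is O(D^(1/p)).  Since [p > 1], the sum scaled by [K/D] has
    small Schatten norms and large heat transform; letting [t] tend to infinity makes
    finitely many weighted norms small too.  Adding such a symbol to any [g] escapes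
    the set where the heat transform is bounded by [N]; by continuity of
    [g |-> g^(1/4)(a)] this set is nowhere dense. *)

Require Import Defs.
From HB Require Import structures.
From mathcomp Require Import all_boot all_order all_algebra complex.
From mathcomp Require Import ring lra.
From mathcomp Require Import all_classical all_reals all_analysis.
From mathcomp Require Import measurable_realfun ess_sup_inf.
Set Implicit Arguments.
Unset Strict Implicit.
Unset Printing Implicit Defensive.
Import Order.TTheory GRing.Theory Num.Theory numFieldNormedType.Exports.
Local Open Scope classical_set_scope.
Local Open Scope ring_scope.
Local Open Scope complex_scope.

(** * The complex exponential *)

(** In these normalizations [g^(1/4)] is the Weyl symbol of [T_g]: its value at [t e_1] is [2^n]
    times the trace of [T_g] composed with the reflection about [t e_1]. Operator norm and Schatten
    norms with [p > 1] do not control this trace, since a reflection is unitary and not compact. The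
    rank-one operators with kernel [k_q(w) conj k_p(z)] exploit this: the reflection exchanges [p]
    and [q], so each contributes [2^n] at their midpoint, however far apart they are. For [p = q]
    the symbol of such an operator is a point mass, not a function; the factor with [x > 0] smooths
    it into a bounded Gaussian and only changes [2^n] to [(2/(1 + x))^n]. The price is infinite
    rank, and [x] is fixed so small that the decay [(4 x)^L] of the Taylor tails beats the growth of
    the rank of the truncations.

    All explicit formulas come from one Gaussian integral, [reproducing], which rests on a mean
    value property derived from Goursat's theorem. Membership in [Linfty] is an almost everywhere
    condition, so the pointwise sets of the category argument also require continuity of
    [g^(1/4)]. *)

Section complex_modulus.
Variable R : realType.
Local Notation C := R[i].
Implicit Types a b c : C.

Lemma normcE_sqrt c : normc c = Num.sqrt (complex.Re c ^+ 2 + complex.Im c ^+ 2).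
Proof. by case: c. Qed.

Lemma normc_ge0 c : 0 <= normc c.
Proof. by case: c => x y; exact: sqrtr_ge0. Qed.

Lemma normc_sqr c : normc c ^+ 2 = complex.Re c ^+ 2 + complex.Im c ^+ 2.
Proof. by rewrite normcE_sqrt sqr_sqrtr// addr_ge0// sqr_ge0. Qed.

Lemma normcMl a b : normc (a * b) = normc a * normc b.
Proof. exact: Normc.normcM. Qed.

Lemma normc_add a b : normc (a + b) <= normc a + normc b.
Proof. exact: (le_normcD (a : Rcomplex R) b). Qed.

Lemma normc_opp a : normc (- a) = normc a.
Proof. by case: a => x y /=; rewrite !sqrrN. Qed.

Lemma normc_sub a b : normc (a - b) <= normc a + normc b.
Proof. by rewrite -(normc_opp b) normc_add. Qed.

Lemma normc_distrC a b : normc (a - b) = normc (b - a).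
Proof. by rewrite -normc_opp opprB. Qed.

Lemma normc_conj a : normc a^*%C = normc a.
Proof. by case: a => x y /=; rewrite sqrrN. Qed.

Lemma normc_real (x : R) : normc x%:C = `|x|.
Proof. by rewrite /= expr0n addr0 sqrtr_sqr. Qed.

Lemma normc_Re a : `|complex.Re a| <= normc a.
Proof.
rewrite normcE_sqrt -sqrtr_sqr ler_sqrt ?lerDl ?sqr_ge0//.
by rewrite addr_ge0// sqr_ge0.
Qed.

Lemma normc_Im a : `|complex.Im a| <= normc a.
Proof.
rewrite normcE_sqrt -sqrtr_sqr ler_sqrt ?lerDr ?sqr_ge0//.
by rewrite addr_ge0// sqr_ge0.
Qed.

Lemma Re_le_normc a : complex.Re a <= normc a.
Proof. exact: le_trans (ler_norm _) (normc_Re a). Qed.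

Lemma normc_le_ReIm a : normc a <= `|complex.Re a| + `|complex.Im a|.
Proof.
rewrite -[leRHS]ger0_norm ?addr_ge0// -sqrtr_sqr normcE_sqrt ler_sqrt ?sqr_ge0//.
rewrite sqrrD !real_normK ?num_real// -addrA lerD2l lerDr.
by rewrite mulrn_wge0// mulr_ge0.
Qed.

Lemma normc_sum I (r : seq I) (P : pred I) (F : I -> C) :
  normc (\sum_(i <- r | P i) F i) <= \sum_(i <- r | P i) normc (F i).
Proof.
elim/big_rec2 : _ => [|i x c _ le]; first by rewrite Normc.normc0.
by rewrite (le_trans (normc_add _ _))// lerD2l.
Qed.

Lemma mulcJ_normc a : a * a^*%C = (normc a ^+ 2)%:C.
Proof. by rewrite normc_sqr; case: a => x y; apply/eqP; rewrite eq_complex/=; apply/andP; split; apply/eqP; ring. Qed.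

Lemma ReD a b : complex.Re (a + b) = complex.Re a + complex.Re b.
Proof. by case: a b => ? ? [? ?]. Qed.

Lemma ImD a b : complex.Im (a + b) = complex.Im a + complex.Im b.
Proof. by case: a b => ? ? [? ?]. Qed.

Lemma ReN a : complex.Re (- a) = - complex.Re a.
Proof. by case: a. Qed.

Lemma ImN a : complex.Im (- a) = - complex.Im a.
Proof. by case: a. Qed.

Lemma ReM a b : complex.Re (a * b) =
  complex.Re a * complex.Re b - complex.Im a * complex.Im b.
Proof. by case: a b => ? ? [? ?]. Qed.

Lemma ImM a b : complex.Im (a * b) =
  complex.Re a * complex.Im b + complex.Im a * complex.Re b.
Proof. by case: a b => ? ? [? ?]. Qed.

Lemma ReJ a : complex.Re a^*%C = complex.Re a. Proof. by case: a. Qed.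

Lemma ImJ a : complex.Im a^*%C = - complex.Im a. Proof. by case: a. Qed.

Lemma Re_sum I (r : seq I) (P : pred I) (F : I -> C) :
  complex.Re (\sum_(i <- r | P i) F i) = \sum_(i <- r | P i) complex.Re (F i).
Proof. by elim/big_rec2 : _ => // i x c _ <-; rewrite ReD. Qed.

Lemma complex_ext a b : complex.Re a = complex.Re b ->
  complex.Im a = complex.Im b -> a = b.
Proof. by case: a b => ? ? [? ?] /= -> ->. Qed.

(** Rotating by a phase turns an estimate of a modulus into an estimate of a real part, for
    integrals and for Taylor remainders alike. Asking for [normc u <= 1] instead of equality lets
    [u = 0] serve when [c = 0]. *)
Lemma complex_norm_unit c : exists2 u, normc u <= 1 & complex.Re (u * c) = normc c.
Proof.
have [->|c0] := eqVneq (normc c) 0.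
  by exists 0; rewrite ?Normc.normc0// mul0r.
have nc0 : 0 < normc c by rewrite lt_def c0 normc_ge0.
exists (c^*%C * ((normc c)^-1)%:C).
  by rewrite normcMl normc_conj normc_real ger0_norm ?invr_ge0 ?normc_ge0// divff.
rewrite mulrAC mulrC [c^*%C * c]mulrC mulcJ_normc ReM/= mulr0 subr0.
by rewrite expr2 mulrA mulVf// mul1r.
Qed.

End complex_modulus.

Section complex_exponential.
Variable R : realType.
Local Notation C := R[i].
Implicit Types a b c u : C.

Definition cexp c : C :=
  (expR (complex.Re c) * cos (complex.Im c)) +i*
  (expR (complex.Re c) * sin (complex.Im c)).

Lemma cexp0 : cexp 0 = 1.
Proof. by apply: complex_ext; rewrite /= expR0 ?cos0 ?sin0 mul1r. Qed.

Lemma cexpD a b : cexp (a + b) = cexp a * cexp b.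
Proof.
by apply: complex_ext; rewrite ?ReM ?ImM/= ReD ImD expRD ?cosD ?sinD; ring.
Qed.

Lemma normc_cexp a : normc (cexp a) = expR (complex.Re a).
Proof.
by rewrite /= !exprMn -mulrDr cos2Dsin2 mulr1 sqrtr_sqr ger0_norm// expR_ge0.
Qed.

Lemma cexp_real (x : R) : cexp x%:C = (expR x)%:C.
Proof. by apply: complex_ext; rewrite /= ?cos0 ?sin0 ?mulr1 ?mulr0. Qed.

Lemma cexp_conj a : (cexp a)^*%C = cexp a^*%C.
Proof. by apply: complex_ext; case: a => x y /=; rewrite ?cosN ?sinN ?mulrN. Qed.

(** A real function of a real variable, so that the real mean value theorem applies. Differentiation
    in [t] replaces [u] by [u * c], and lowers the order of [poly] with the same replacement; hence
    the derivative of the remainder of order [L.+1] for [u] is the remainder of order [L] for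
    [u * c], and the Taylor bound goes by induction on [L] for all [u]. *)
Let expu c u (t : R) := complex.Re (u * cexp (t%:C * c)).

Let expuE c u : expu c u = fun t : R =>
  complex.Re u * (expR (t * complex.Re c) * cos (t * complex.Im c)) -
  complex.Im u * (expR (t * complex.Re c) * sin (t * complex.Im c)).
Proof.
by apply/funext => t; rewrite /expu ReM/= ReM ImM/= !mul0r subr0 addr0.
Qed.

Let is_derive_expu c u (t : R) : is_derive t 1 (expu c u) (expu c (u * c) t).
Proof.
rewrite !expuE ReM ImM.
set p := complex.Re u; set q := complex.Im u.
set x := complex.Re c; set y := complex.Im c.
have dl (k : R) : is_derive t 1 (fun t => t * k) k.
  by apply: is_derive_eq; rewrite scaler0 add0r; exact: mulr1.
have de : is_derive t 1 (fun t => expR (t * x)) (expR (t * x) * x).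
  exact: (@is_derive1_comp _ expR).
have dc : is_derive t 1 (fun t => cos (t * y)) (- sin (t * y) * y).
  exact: (@is_derive1_comp _ cos).
have ds : is_derive t 1 (fun t => sin (t * y)) (cos (t * y) * y).
  exact: (@is_derive1_comp _ sin).
have d1 := is_deriveZ p (is_deriveM de dc).
have d2 := is_deriveZ q (is_deriveM de ds).
have := is_deriveB d1 d2.
by move=> /is_derive_eq; apply; rewrite /GRing.scale/=; ring.
Qed.

Let poly c u L (t : R) := \sum_(k < L) complex.Re (u * c ^+ k) * (t ^+ k / k`!%:R).

Let is_derive_poly c u L (t : R) : is_derive t 1 (poly c u L.+1) (poly c (u * c) L t).
Proof.
elim: L => [|L IH].
  rewrite /poly big_ord0 (_ : (fun _ => _) = cst (complex.Re u)).
    exact: is_derive_cst.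
  by apply/funext => s; rewrite big_ord1 !expr0 mulr1 fact0 divff ?oner_eq0 // mulr1.
rewrite (_ : poly c u L.+2 = poly c u L.+1 +
    (complex.Re (u * c ^+ L.+1) / L.+1`!%:R) *: (fun s : R => s) ^+ L.+1); last first.
  apply/funext => s; rewrite /poly big_ord_recr/=; congr (_ + _).
  rewrite -[RHS]/(_ * (_ ^+ _) s) exprfctE; ring.
have dX := is_deriveX L.+1 (is_derive_id t (1 : R)).
have dZ := is_deriveZ (complex.Re (u * c ^+ L.+1) / L.+1`!%:R) dX.
apply: (is_derive_eq (is_deriveD IH dZ)).
rewrite /poly [RHS]big_ord_recr/=; congr (_ + _).
rewrite /GRing.scale/= mulr1 exprS mulrA factS natrM.
have f0 : (L`!%:R : R) != 0 by rewrite pnatr_eq0 -lt0n fact_gt0.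
have L0 : (L.+1%:R : R) != 0 by rewrite pnatr_eq0.
by field; rewrite nat1r L0 f0.
Qed.

Let remu c u L t := expu c u t - poly c u L t.

Let remu_le c L u (t : R) : 0 <= t <= 1 -> remu c u L t <=
  normc u * normc c ^+ L * (t ^+ L / L`!%:R) * expR (normc c).
Proof.
elim: L u t => [|L IH] u t /andP[t0 t1].
  rewrite /remu /poly big_ord0 subr0 !expr0 fact0 mulr1 divff ?oner_eq0// mulr1.
  rewrite /expu (le_trans (Re_le_normc _))// normcMl normc_cexp.
  rewrite ler_wpM2l ?normc_ge0// ler_expR ReM/= mul0r subr0.
  rewrite (le_trans (ler_norm _))// normrM (ger0_norm t0).
  by rewrite (le_trans (ler_piMl _ t1))// normc_Re.
set K := normc u * normc c ^+ L.+1 * expR (normc c).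
(* [psi] vanishes at 0, and the induction hypothesis for [u * c] says [dpsi <= 0] on the segment;
   the mean value theorem then gives [psi t <= 0], which is the bound. *)
pose psi (s : R) := remu c u L.+1 s - K * (s ^+ L.+1 / L.+1`!%:R).
pose dpsi (s : R) := remu c (u * c) L s - K * (s ^+ L / L`!%:R).
have dp (s : R) : is_derive s 1 psi (dpsi s).
  rewrite (_ : psi = (expu c u - poly c u L.+1) -
      (K / L.+1`!%:R) *: (fun s : R => s) ^+ L.+1); last first.
    apply/funext => x; rewrite /psi /remu.
    rewrite -[RHS]/(_ - _ * (_ ^+ _) x) exprfctE; congr (_ - _); ring.
  have := is_derive_expu c u s; have := is_derive_poly c u L s => d1 d2.
  apply: is_derive_eq; rewrite /dpsi /remu; congr (_ - _).
  rewrite /GRing.scale/= mulr1 factS natrM.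
  have f0 : (L`!%:R : R) != 0 by rewrite pnatr_eq0 -lt0n fact_gt0.
  have L0 : (L.+1%:R : R) != 0 by rewrite pnatr_eq0.
  by field; rewrite nat1r L0 f0.
have [|x /[!in_itv]/= /andP[x0 xt]] := @MVT_segment _ psi dpsi 0 t t0 (fun x _ => dp x).
  apply: derivable_within_continuous => x _; have := dp x => ?; exact: ex_derive.
have -> : psi 0 = 0.
  rewrite /psi /remu /expu mul0r cexp0 expr0n/= mul0r mulr0 subr0 /poly.
  rewrite big_ord_recl expr0 mulr1 !expr0 fact0 divff ?oner_eq0// mulr1.
  rewrite big1 ?addr0 ?subrr// => i _.
  by rewrite lift0 expr0n/= mul0r mulr0.
rewrite !subr0 => psiE.
have : psi t <= 0.
  rewrite psiE mulr_le0_ge0// /dpsi subr_le0.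
  have := IH (u * c) x; rewrite x0 (le_trans xt t1) => /(_ isT).
  move=> /le_trans; apply; rewrite normcMl /K exprS.
  by rewrite le_eqVlt; apply/orP; left; apply/eqP; ring.
rewrite /psi subr_le0 => /le_trans; apply.
by rewrite /K le_eqVlt; apply/orP; left; apply/eqP; ring.
Qed.

Lemma cexp_taylor c L : normc (cexp c - \sum_(k < L) c ^+ k / k`!%:R) <=
  normc c ^+ L / L`!%:R * expR (normc c).
Proof.
(* With [u] a phase of the remainder, its modulus is the real remainder at [t = 1]. *)
set v := _ - _; have [u u1 <-] := complex_norm_unit v.
have -> : complex.Re (u * v) = remu c u L 1.
  rewrite /remu /expu /poly mul1r /v mulrBr ReD ReN mulr_sumr Re_sum.
  congr (_ - _); apply: eq_bigr => k _; rewrite expr1n mul1r mulrA.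
  by rewrite -(rmorph_nat (real_complex R)) -fmorphV/= ReM/= mulr0 subr0.
apply: (le_trans (remu_le c L u _)); first by rewrite ler01 lexx.
by rewrite expr1n mul1r -!mulrA ler_piMl// mulr_ge0 ?exprn_ge0 ?normc_ge0//.
Qed.

Lemma cexp_sub1 c : normc (cexp c - 1) <= normc c * expR (normc c).
Proof.
by have := cexp_taylor c 1; rewrite big_ord1 expr0 fact0 divr1 expr1 divr1.
Qed.

Lemma cexp_sub1_lin c : normc (cexp c - 1 - c) <= normc c ^+ 2 * expR (normc c).
Proof.
have := cexp_taylor c 2.
rewrite big_ord_recr big_ord1/= expr0 fact0 divr1 (_ : 1%N`! = 1%N)// divr1 expr1.
rewrite opprD addrA => /le_trans; apply.
rewrite ler_wpM2r ?expR_ge0// ler_pdivrMr ?ltr0n// ler_peMr ?exprn_ge0 ?normc_ge0//.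
by rewrite ler1n.
Qed.

End complex_exponential.

(** * Complex-valued integrals *)

Section complex_measurability.
Context d (T : measurableType d) (R : realType).
Local Notation C := R[i].
Implicit Types (D : set T) (f g : T -> C).

Lemma measurable_fun_Re D f : measurable_fun D f ->
  measurable_fun D (fun x => complex.Re (f x)).
Proof. by move=> mf; exact: (measurableT_comp (@measurable_Re R) mf). Qed.

Lemma measurable_fun_Im D f : measurable_fun D f ->
  measurable_fun D (fun x => complex.Im (f x)).
Proof. by move=> mf; exact: (measurableT_comp (@measurable_Im R) mf). Qed.

Lemma measurable_fun_complex D f :
  measurable_fun D (fun x => complex.Re (f x)) ->
  measurable_fun D (fun x => complex.Im (f x)) ->
  measurable_fun D f.
Proof.
move=> mr mi mD; move: (mD); apply: (@measurability _ _ _ _ _ _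
  (preimage_set_system setT (@complex.Re R : _ -> measurableTypeR R) measurable `|`
   preimage_set_system setT (@complex.Im R : _ -> measurableTypeR R) measurable)) => //.
move=> _ [_ [[A mA <-]|[A mA <-]] <-]; rewrite setTI.
- exact: mr.
- exact: mi.
Qed.

Lemma measurable_normc D f : measurable_fun D f ->
  measurable_fun D (fun x => normc (f x)).
Proof.
move=> mf; under eq_fun do rewrite normcE_sqrt.
apply: measurableT_comp; first exact: (continuous_measurable_fun (@sqrt_continuous R)).
apply: measurable_funD; apply: measurable_funX;
  [exact: measurable_fun_Re | exact: measurable_fun_Im].
Qed.

Lemma measurable_cD D f g : measurable_fun D f -> measurable_fun D g ->
  measurable_fun D (fun x => f x + g x).
Proof.
move=> mf mg; apply: measurable_fun_complex.
  under eq_fun do rewrite ReD.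
  by apply: measurable_funD; exact: measurable_fun_Re.
under eq_fun do rewrite ImD.
by apply: measurable_funD; exact: measurable_fun_Im.
Qed.

Lemma measurable_cM D f g : measurable_fun D f -> measurable_fun D g ->
  measurable_fun D (fun x => f x * g x).
Proof.
move=> mf mg; apply: measurable_fun_complex.
  under eq_fun do rewrite ReM.
  apply: measurable_funB; apply: measurable_funM;
    by [exact: measurable_fun_Re|exact: measurable_fun_Im].
under eq_fun do rewrite ImM.
apply: measurable_funD; apply: measurable_funM;
  by [exact: measurable_fun_Re|exact: measurable_fun_Im].
Qed.

Lemma measurable_cZ D (c : C) g : measurable_fun D g ->
  measurable_fun D (fun x => c * g x).
Proof. by apply: measurable_cM; exact: measurable_cst. Qed.

Lemma measurable_cN D f : measurable_fun D f -> measurable_fun D (fun x => - f x).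
Proof. by move=> /(measurable_cZ (-1)); under eq_fun do rewrite mulN1r. Qed.

Lemma measurable_cB D f g : measurable_fun D f -> measurable_fun D g ->
  measurable_fun D (fun x => f x - g x).
Proof. by move=> mf mg; apply: measurable_cD => //; exact: measurable_cN. Qed.

Lemma measurable_cJ D f : measurable_fun D f ->
  measurable_fun D (fun x => (f x)^*%C).
Proof.
move=> mf; apply: measurable_fun_complex; under eq_fun do rewrite ?ReJ ?ImJ.
  exact: measurable_fun_Re.
by apply: measurableT_comp => //; exact: measurable_fun_Im.
Qed.

Lemma measurable_cR D (f : T -> R) : measurable_fun D f ->
  measurable_fun D (fun x => (f x)%:C).
Proof. by move=> mf; apply: measurable_fun_complex => //; exact: measurable_cst. Qed.

Lemma measurable_csum D I (s : seq I) (F : I -> T -> C) :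
  (forall i, measurable_fun D (F i)) ->
  measurable_fun D (fun x => \sum_(i <- s) F i x).
Proof.
move=> mF; elim: s => [|i s IH].
  by under eq_fun do rewrite big_nil; exact: measurable_cst.
by under eq_fun do rewrite big_cons; exact: measurable_cD.
Qed.

Lemma measurable_cexp D f : measurable_fun D f ->
  measurable_fun D (fun x => cexp (f x)).
Proof.
move=> mf; apply: measurable_fun_complex => /=; apply: measurable_funM.
- by apply: measurableT_comp => //; exact: measurable_fun_Re.
- apply: measurableT_comp; last exact: measurable_fun_Im.
  exact: (continuous_measurable_fun (@continuous_cos R)).
- by apply: measurableT_comp => //; exact: measurable_fun_Re.
- apply: measurableT_comp; last exact: measurable_fun_Im.
  exact: (continuous_measurable_fun (@continuous_sin R)).
Qed.

End complex_measurability.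

Section complex_integral.
Context d (T : measurableType d) (R : realType) (mu : {measure set T -> \bar R}).
Local Notation C := R[i].
Implicit Types (D : set T) (f g : T -> C).

(** Extends [cintegral] to any measure and domain. For Lebesgue measure on [setT] the two are
    convertible, and later proofs pass between them without rewriting. *)
Definition cint D f : C :=
  Complex (\int[mu]_(x in D) complex.Re (f x)) (\int[mu]_(x in D) complex.Im (f x)).

Definition cintble D f : Prop := measurable_fun D f /\
  (\int[mu]_(x in D) (normc (f x))%:E < +oo)%E.

Lemma cintble_normc D f : cintble D f ->
  mu.-integrable D (fun x => (normc (f x))%:E).
Proof.
move=> [mf foo]; apply/integrableP; split.
  exact/measurable_EFinP/measurable_normc.
by under eq_integral do rewrite gee0_abs ?lee_fin ?normc_ge0//.
Qed.

Lemma cintbleP D f : measurable_fun D f ->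
  mu.-integrable D (fun x => (normc (f x))%:E) -> cintble D f.
Proof.
move=> mf /integrableP[_ foo]; split=> //; apply: le_lt_trans foo.
by under [leRHS]eq_integral do rewrite gee0_abs ?lee_fin ?normc_ge0//.
Qed.

Lemma cintble_Re D f : measurable D -> cintble D f ->
  mu.-integrable D (fun x => (complex.Re (f x))%:E).
Proof.
move=> mD fD; apply: le_integrable (cintble_normc fD) => //.
  by apply/measurable_EFinP/measurable_fun_Re; case: fD.
by move=> x _; rewrite /= lee_fin (ger0_norm (normc_ge0 _)) normc_Re.
Qed.

Lemma cintble_Im D f : measurable D -> cintble D f ->
  mu.-integrable D (fun x => (complex.Im (f x))%:E).
Proof.
move=> mD fD; apply: le_integrable (cintble_normc fD) => //.
  by apply/measurable_EFinP/measurable_fun_Im; case: fD.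
by move=> x _; rewrite /= lee_fin (ger0_norm (normc_ge0 _)) normc_Im.
Qed.

Lemma integrable_mull D (k : R) (f : T -> R) : measurable D ->
  mu.-integrable D (EFin \o f) -> mu.-integrable D (EFin \o (fun x => k * f x)).
Proof. by move=> mD /(integrableZl mD k). Qed.

Lemma le_cintble D f (g : T -> R) : measurable D -> measurable_fun D f ->
  mu.-integrable D (fun x => (g x)%:E) ->
  (forall x, D x -> normc (f x) <= g x) -> cintble D f.
Proof.
move=> mD mf ig fg; apply: cintbleP => //.
apply: le_integrable ig => //; first exact/measurable_EFinP/measurable_normc.
move=> x Dx; rewrite /= lee_fin (ger0_norm (normc_ge0 _)).
exact: le_trans (fg x Dx) (ler_norm _).
Qed.

Lemma cintbleD D f g : measurable D -> cintble D f -> cintble D g ->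
  cintble D (fun x => f x + g x).
Proof.
move=> mD fD gD.
apply: (@le_cintble _ _ (fun x => normc (f x) + normc (g x))) => //.
- by apply: measurable_cD; [case: fD | case: gD].
- exact: integrableD (cintble_normc fD) (cintble_normc gD).
- by move=> x _; exact: normc_add.
Qed.

Lemma cintbleZ D c f : measurable D -> cintble D f -> cintble D (fun x => c * f x).
Proof.
move=> mD fD.
apply: (@le_cintble _ _ (fun x => normc c * normc (f x))) => //.
- by apply: measurable_cZ; case: fD.
- exact: (integrable_mull _ mD (cintble_normc fD)).
- by move=> x _; rewrite normcMl.
Qed.

Lemma cintble0 D : cintble D (fun=> 0).
Proof.
split; first exact: measurable_cst.
by rewrite integral0_eq// => x _; rewrite Normc.normc0.
Qed.

Lemma cintble_sum D I (s : seq I) (F : I -> T -> C) : measurable D ->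
  (forall i, cintble D (F i)) -> cintble D (fun x => \sum_(i <- s) F i x).
Proof.
move=> mD iF; elim: s => [|i s IH].
  by under eq_fun do rewrite big_nil; exact: cintble0.
by under eq_fun do rewrite big_cons; exact: cintbleD.
Qed.

Lemma eq_cint D f g : {in D, f =1 g} -> cint D f = cint D g.
Proof.
by move=> fg; apply: complex_ext; apply: eq_Rintegral => x xD /=; rewrite fg.
Qed.

Lemma cintD D f g : measurable D -> cintble D f -> cintble D g ->
  cint D (fun x => f x + g x) = cint D f + cint D g.
Proof.
move=> mD fD gD; apply: complex_ext; rewrite ?ReD ?ImD /=.
- rewrite -RintegralD//; try exact: cintble_Re.
  by apply: eq_Rintegral => x _; rewrite ReD.
- rewrite -RintegralD//; try exact: cintble_Im.
  by apply: eq_Rintegral => x _; rewrite ImD.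
Qed.

Lemma cintZ D c f : measurable D -> cintble D f ->
  cint D (fun x => c * f x) = c * cint D f.
Proof.
move=> mD fD; have fr := cintble_Re mD fD; have fi := cintble_Im mD fD.
apply: complex_ext; rewrite ?ReM ?ImM /=.
- under eq_Rintegral do rewrite ReM.
  by rewrite RintegralB//; [rewrite !RintegralZl|exact: integrable_mull..].
- under eq_Rintegral do rewrite ImM.
  by rewrite RintegralD//; [rewrite !RintegralZl|exact: integrable_mull..].
Qed.

Lemma cint0 D : cint D (fun=> 0) = 0.
Proof. by apply: complex_ext; rewrite /= /Rintegral integral0. Qed.

Lemma cintN D f : measurable D -> cintble D f -> cint D (fun x => - f x) = - cint D f.
Proof.
move=> mD fD; rewrite -mulN1r -cintZ//; apply: eq_cint => x _; exact/esym/mulN1r.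
Qed.

Lemma cintbleN D f : measurable D -> cintble D f -> cintble D (fun x => - f x).
Proof. by move=> mD /(cintbleZ (-1) mD); under eq_fun do rewrite mulN1r. Qed.

Lemma cintbleB D f g : measurable D -> cintble D f -> cintble D g ->
  cintble D (fun x => f x - g x).
Proof. by move=> mD fD gD; apply: cintbleD => //; exact: cintbleN. Qed.

Lemma cintB D f g : measurable D -> cintble D f -> cintble D g ->
  cint D (fun x => f x - g x) = cint D f - cint D g.
Proof.
by move=> mD fD gD; rewrite cintD ?cintN//; exact: cintbleN.
Qed.

Lemma cint_sum D I (s : seq I) (F : I -> T -> C) : measurable D ->
  (forall i, cintble D (F i)) ->
  cint D (fun x => \sum_(i <- s) F i x) = \sum_(i <- s) cint D (F i).
Proof.
move=> mD iF; elim: s => [|i s IH].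
  by under eq_cint do rewrite big_nil; rewrite cint0 big_nil.
under eq_cint do rewrite big_cons.
by rewrite cintD ?IH ?big_cons//; exact: cintble_sum.
Qed.

Lemma cint_conj D f : measurable D -> cintble D f ->
  cint D (fun x => (f x)^*%C) = (cint D f)^*%C.
Proof.
move=> mD fD; apply: complex_ext; rewrite ?ReJ ?ImJ /=.
  by apply: eq_Rintegral => x _; rewrite ReJ.
rewrite -[RHS]mulN1r -RintegralZl//; last exact: cintble_Im.
by apply: eq_Rintegral => x _; rewrite ImJ mulN1r.
Qed.

Lemma cintble_conj D f : cintble D f -> cintble D (fun x => (f x)^*%C).
Proof.
move=> [mf fo]; split; first exact: measurable_cJ.
by under eq_integral do rewrite normc_conj.
Qed.

Lemma normc_cint D f : measurable D -> cintble D f ->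
  ((normc (cint D f))%:E <= \int[mu]_(x in D) (normc (f x))%:E)%E.
Proof.
move=> mD fD; have [u u1 <-] := complex_norm_unit (cint D f).
rewrite -cintZ//=.
rewrite /Rintegral fineK; last first.
  by apply: integrable_fin_num => //; apply: cintble_Re => //; exact: cintbleZ.
apply: le_integral => //.
- by apply: cintble_Re => //; exact: cintbleZ.
- exact: cintble_normc.
move=> x _; rewrite lee_fin (le_trans (Re_le_normc _))// normcMl.
by rewrite ler_piMl ?normc_ge0.
Qed.

Lemma normc_cint_le D f (g : T -> R) : measurable D -> measurable_fun D f ->
  mu.-integrable D (fun x => (g x)%:E) ->
  (forall x, D x -> normc (f x) <= g x) ->
  normc (cint D f) <= \int[mu]_(x in D) g x.
Proof.
move=> mD mf ig fg; have fD := le_cintble mD mf ig fg.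
rewrite -lee_fin (le_trans (normc_cint mD fD))// /Rintegral fineK; last first.
  exact: integrable_fin_num.
apply: le_integral => //; first exact: cintble_normc.
by move=> x /[!inE] Dx; rewrite lee_fin fg.
Qed.

Lemma cint_mkcond D f : cint D f = cint setT (f \_ D).
Proof.
by apply: complex_ext; rewrite /= Rintegral_mkcond; apply: eq_Rintegral => x _;
  rewrite !patchE; case: ifP.
Qed.

Lemma cint_eq_ae D f g : measurable D -> measurable_fun D f -> measurable_fun D g ->
  ae_eq mu D f g -> cint D f = cint D g.
Proof.
move=> mD mf mg fg; apply: complex_ext; rewrite /= /Rintegral; congr fine;
  apply: ae_eq_integral => //.
- exact/measurable_EFinP/measurable_fun_Re.
- exact/measurable_EFinP/measurable_fun_Re.
- by apply: filterS fg => x e Dx /=; rewrite e.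
- exact/measurable_EFinP/measurable_fun_Im.
- exact/measurable_EFinP/measurable_fun_Im.
- by apply: filterS fg => x e Dx /=; rewrite e.
Qed.

End complex_integral.
Arguments cint {d T R} mu D f.
Arguments cintble {d T R} mu D f.

Section complex_pushforward.
Context d1 d2 (X : measurableType d1) (Y : measurableType d2) (R : realType).
Variables (phi : X -> Y) (mphi : measurable_fun setT phi).
Variables (mu : {measure set X -> \bar R}) (nu : {measure set Y -> \bar R}).
Hypothesis nuE : forall A, measurable A -> nu A = mu (phi @^-1` A).

Let nu_pushforward A : measurable A -> A `<=` setT -> nu A = pushforward mu phi A.
Proof. by move=> mA _; rewrite nuE. Qed.

Lemma ge0_integral_image (f : Y -> \bar R) : measurable_fun setT f ->
  (forall y, 0 <= f y)%E -> (\int[nu]_y f y = \int[mu]_x f (phi x))%E.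
Proof.
move=> mf f0.
rewrite (eq_measure_integral (pushforward mu phi) nu_pushforward).
by rewrite ge0_integral_pushforward.
Qed.

Lemma cintble_image (f : Y -> R[i]) : measurable_fun setT f ->
  cintble nu setT f <-> cintble mu setT (f \o phi).
Proof.
move=> mf; rewrite /cintble ge0_integral_image; last 2 first.
  exact/measurable_EFinP/measurable_normc.
  by move=> y; rewrite lee_fin normc_ge0.
by split=> -[]; split=> //; exact: measurableT_comp.
Qed.

Lemma cint_image (f : Y -> R[i]) : cintble nu setT f ->
  cint nu setT f = cint mu setT (f \o phi).
Proof.
move=> fi; have [mf _] := fi.
have fi' := (cintble_image mf).1 fi.
apply: complex_ext; rewrite /= /Rintegral; congr fine.
- rewrite (eq_measure_integral (pushforward mu phi) nu_pushforward).
  rewrite integral_pushforward//.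
  + exact/measurable_EFinP/measurable_fun_Re.
  + exact: (cintble_Re _ fi').
- rewrite (eq_measure_integral (pushforward mu phi) nu_pushforward).
  rewrite integral_pushforward//.
  + exact/measurable_EFinP/measurable_fun_Im.
  + exact: (cintble_Im _ fi').
Qed.

End complex_pushforward.

Section complex_fubini.
Context d1 d2 (T1 : measurableType d1) (T2 : measurableType d2) (R : realType).
Variable m1 : {sigma_finite_measure set T1 -> \bar R}.
Variable m2 : {sigma_finite_measure set T2 -> \bar R}.
Variable f : T1 * T2 -> R[i].
Hypothesis fi : cintble (m1 \x m2)%E setT f.

Let fr : (m1 \x m2)%E.-integrable setT (fun z => (complex.Re (f z))%:E).
Proof. exact: cintble_Re. Qed.

Let fim : (m1 \x m2)%E.-integrable setT (fun z => (complex.Im (f z))%:E).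
Proof. exact: cintble_Im. Qed.

Lemma ae_cintble1 : {ae m1, forall x, cintble m2 setT (fun y => f (x, y))}.
Proof.
have := ae_integrable1 (cintble_normc fi); apply: filterS => x ix.
apply: cintbleP => //; have [mf _] := fi.
by apply: measurableT_comp => //; exact: measurable_pair1.
Qed.

(** [Rintegral] sends an infinite inner integral to 0 through [fine], and the inner integral can be
    infinite on a null set. The almost everywhere equality with [fubini_F] carries the extended-real
    Fubini theorem across this difference. *)
Let fine_fubini (h : T1 * T2 -> R) :
  (m1 \x m2)%E.-integrable setT (fun z => (h z)%:E) ->
  m1.-integrable setT (fun x => (\int[m2]_y h (x, y))%:E) /\
  \int[m1]_x \int[m2]_y h (x, y) = \int[(m1 \x m2)%E]_z h z.
Proof.
move=> ih; have iF := integrable_fubini_F ih.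
have mF : measurable_fun setT (fubini_F m2 (EFin \o h)) by exact: measurable_int iF.
have aeq : ae_eq m1 setT (fun x => (\int[m2]_y h (x, y))%:E)
    (fubini_F m2 (EFin \o h)).
  have := ae_integrable1 ih; apply: filterS => x ix _.
  by rewrite /Rintegral fineK//; exact: integrable_fin_num.
have mF' : measurable_fun setT (fun x => (\int[m2]_y h (x, y))%:E).
  by apply/measurable_EFinP; apply: measurableT_comp mF.
split.
  apply: le_integrable iF => // x _; rewrite /Rintegral /fubini_F /=.
  by case: (\int[m2]_y _)%E => [r||]; rewrite ?normr0 ?leey ?lexx.
rewrite [LHS]/Rintegral (ae_eq_integral (fubini_F m2 (EFin \o h)))//.
by rewrite integral12_prod_meas1.
Qed.

Lemma measurable_cint2 :
  measurable_fun setT (fun x => cint m2 setT (fun y => f (x, y))).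
Proof.
apply: measurable_fun_complex => /=.
  by have [/measurable_int/measurable_EFinP] := fine_fubini fr.
by have [/measurable_int/measurable_EFinP] := fine_fubini fim.
Qed.

Lemma cintble_cint2 : cintble m1 setT (fun x => cint m2 setT (fun y => f (x, y))).
Proof.
split; first exact: measurable_cint2.
have mf : measurable_fun setT (fun z => (normc (f z))%:E).
  by apply/measurable_EFinP/measurable_normc; case: fi.
have f0 z : (0 <= (normc (f z))%:E)%E by rewrite lee_fin normc_ge0.
have : (\int[m1]_x \int[m2]_y (normc (f (x, y)))%:E < +oo)%E.
  rewrite -(fubini_tonelli1 (fun z => (normc (f z))%:E))//.
  by have [_] := fi.
apply: le_lt_trans; apply: ae_ge0_le_integral => //.
- by move=> x _; rewrite lee_fin normc_ge0.
- exact/measurable_EFinP/measurable_normc/measurable_cint2.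
- by move=> x _; apply: integral_ge0.
- exact: (measurable_fun_fubini_tonelli_F (fun z => (normc (f z))%:E)).
- have := ae_cintble1; apply: filterS => x ix _; exact: normc_cint.
Qed.

Lemma cint_fubini1 :
  cint m1 setT (fun x => cint m2 setT (fun y => f (x, y))) =
  cint (m1 \x m2)%E setT f.
Proof.
apply: complex_ext => /=.
  by have [_] := fine_fubini fr.
by have [_] := fine_fubini fim.
Qed.

End complex_fubini.

Section complex_fubini_swap.
Context d1 d2 (T1 : measurableType d1) (T2 : measurableType d2) (R : realType).
Variable m1 : {sigma_finite_measure set T1 -> \bar R}.
Variable m2 : {sigma_finite_measure set T2 -> \bar R}.
Variable f : T1 * T2 -> R[i].
Hypothesis fi : cintble (m1 \x m2)%E setT f.

Let swap_measure A : measurable A ->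
  (m2 \x m1)%E A = (m1 \x m2)%E ((fun z => (z.2, z.1)) @^-1` A).
Proof.
move=> mA; transitivity ((m2 \x^ m1)%E A).
  by apply: product_measure_unique => //= B C mB mC; rewrite product_measure2E.
rewrite /product_measure2 /product_measure1; apply: eq_integral => x _ /=.
congr (m2 _); apply/seteqP; split => y; rewrite /xsection /ysection /= !inE//.
Qed.

(** The swap pushes one product measure forward to the other, by uniqueness of the product measure,
    so both iterated integrals equal the same double integral. *)
Lemma cint_fubini :
  cint m1 setT (fun x => cint m2 setT (fun y => f (x, y))) =
  cint m2 setT (fun y => cint m1 setT (fun x => f (x, y))).
Proof.
have ms : measurable_fun setT (fun z : T1 * T2 => (z.2, z.1)).
  by apply: measurable_fun_pair; [exact: measurable_snd|exact: measurable_fst].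
have ms' : measurable_fun setT (fun z : T2 * T1 => f (z.2, z.1)).
  have [mf _] := fi; apply: measurableT_comp => //.
  by apply: measurable_fun_pair; [exact: measurable_snd|exact: measurable_fst].
have fi' : cintble (m2 \x m1)%E setT (fun z => f (z.2, z.1)).
  apply/(cintble_image ms (mu := (m1 \x m2)%E)) => //.
  by rewrite (_ : _ \o _ = f)//; apply/funext => -[].
rewrite cint_fubini1// (cint_fubini1 fi').
rewrite (@cint_image _ _ _ _ _ _ ms (m1 \x m2)%E (m2 \x m1)%E)//.
by apply: eq_cint => -[].
Qed.

End complex_fubini_swap.

(** * Lebesgue measure on C^n *)

Section skew_products.
Context d1 d2 (T1 : measurableType d1) (T2 : measurableType d2) (R : realType).
Variable m1 : {sigma_finite_measure set T1 -> \bar R}.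
Variable m2 : {sigma_finite_measure set T2 -> \bar R}.

(** The product measure integrates the measures of sections, and each section is moved by a map that
    preserves [m2]. Letting the map depend on the base point covers shears as well as
    translations. *)
Lemma product_measure_skew2 (h : T1 -> T2 -> T2) (A : set (T1 * T2)) :
  (forall x B, measurable B -> m2 (h x @^-1` B) = m2 B) -> measurable A ->
  (m1 \x m2)%E ((fun z => (z.1, h z.1 z.2)) @^-1` A) = (m1 \x m2)%E A.
Proof.
move=> hm mA; rewrite /product_measure1; apply: eq_integral => x _ /=.
rewrite -[RHS](hm x); last exact: measurable_xsection.
by congr (m2 _); apply/seteqP; split => y; rewrite /xsection /= !inE.
Qed.

Lemma product_measure12 (A : set (T1 * T2)) : measurable A ->
  (m1 \x m2)%E A = (m1 \x^ m2)%E A.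
Proof.
move=> mA; apply: product_measure_unique => //= B C mB mC.
by rewrite product_measure2E.
Qed.

Lemma product_measure_skew1 (h : T2 -> T1 -> T1) (A : set (T1 * T2)) :
  (forall y B, measurable B -> m1 (h y @^-1` B) = m1 B) ->
  measurable ((fun z => (h z.2 z.1, z.2)) @^-1` A) -> measurable A ->
  (m1 \x m2)%E ((fun z => (h z.2 z.1, z.2)) @^-1` A) = (m1 \x m2)%E A.
Proof.
move=> hm mhA mA; rewrite !product_measure12// /product_measure2.
apply: eq_integral => y _ /=.
rewrite -[RHS](hm y); last exact: measurable_ysection.
by congr (m1 _); apply/seteqP; split => x; rewrite /ysection /= !inE.
Qed.

End skew_products.

Section measure_preserving.
Context d (T : measurableType d) (R : realType).
Implicit Types (mu : set T -> \bar R) (f g : T -> T).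

Definition preserving mu f := measurable_fun setT f /\
  forall A, measurable A -> mu (f @^-1` A) = mu A.

Lemma preserving_comp mu f g h : preserving mu f -> preserving mu g ->
  (forall x, h x = f (g x)) -> preserving mu h.
Proof.
move=> [mf fm] [mg gm] /funext ->; split; first exact: measurableT_comp.
move=> A mA; rewrite -[RHS]fm// -[RHS]gm//.
by rewrite -[X in measurable X]setTI; exact: mf.
Qed.

End measure_preserving.

Section lebesgue_plane.
Variable R : realType.
Local Notation C := R[i].
Local Notation leb := (@lebesgue_measure R).
Local Notation mR := (measurableTypeR R).

Lemma lebesgue_measure_shift (a : R) (A : set mR) : measurable A ->
  leb ((fun x => x + a) @^-1` A) = leb A.
Proof.
move=> mA.
have ma : measurable_fun [set: mR] (fun x : mR => (x + a : mR)).
  by apply: measurable_funD => //; exact: measurable_cst.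
apply/esym; apply: (@lebesgue_measure_unique R
  (pushforward leb (fun x : mR => (x + a : mR)))) => // _ [[x y] /= xy <-].
rewrite /pushforward (_ : _ @^-1` _ = `]x - a, y - a]%classic); last first.
  by apply/seteqP; split => z /=; rewrite !in_itv/= ltrBlDr lerBrDr.
rewrite !lebesgue_measure_itv/= !lte_fin ltrD2r.
by case: ifP => // _; rewrite -!EFinD opprB addrA subrK.
Qed.

(** Shears ([a = 0]) and translations ([t = 0]) at once: with the imaginary part fixed, both are
    translations of the real line. Translations and rotations of the plane are assembled from such
    maps. *)
Lemma lebesgueC_Re_shear (t a : R) : preserving (@lebesgueC R) (fun z : C =>
    Complex (complex.Re z + (t * complex.Im z + a)) (complex.Im z)).
Proof.
split.
  apply: measurable_fun_complex => /=; last exact: measurable_Im.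
  apply: measurable_funD; first exact: measurable_Re.
  apply: measurable_funD; last exact: measurable_cst.
  by apply: measurable_funM; [exact: measurable_cst|exact: measurable_Im].
move=> A mA; rewrite /lebesgueC /= /transport /pushforward.
set B := (@of_pair R) @^-1` A.
have mB : measurable B by rewrite -[B]setTI; exact: (@measurable_of_pair R measurableT A mA).
rewrite -[RHS](@product_measure_skew1 _ _ _ _ _ leb leb (fun y x => x + (t * y + a)))//.
- by move=> y D mD; exact: (lebesgue_measure_shift (t * y + a)).
- rewrite -[X in measurable X]setTI.
  suff : measurable_fun setT (fun z : mR * mR => ((z.1 + (t * z.2 + a), z.2) : mR * mR)).
    by apply.
  apply: measurable_fun_pair; last exact: measurable_snd.
  apply: measurable_funD; first exact: measurable_fst.
  apply: measurable_funD; last exact: measurable_cst.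
  by apply: measurable_funM; [exact: measurable_cst|exact: measurable_snd].
Qed.

Lemma lebesgueC_Im_shear (t a : R) : preserving (@lebesgueC R) (fun z : C =>
    Complex (complex.Re z) (complex.Im z + (t * complex.Re z + a))).
Proof.
split.
  apply: measurable_fun_complex => /=; first exact: measurable_Re.
  apply: measurable_funD; first exact: measurable_Im.
  apply: measurable_funD; last exact: measurable_cst.
  by apply: measurable_funM; [exact: measurable_cst|exact: measurable_Re].
move=> A mA; rewrite /lebesgueC /= /transport /pushforward.
set B := (@of_pair R) @^-1` A.
have mB : measurable B by rewrite -[B]setTI; exact: (@measurable_of_pair R measurableT A mA).
rewrite -[RHS](@product_measure_skew2 _ _ _ _ _ leb leb (fun x y => y + (t * x + a)))//.
by move=> y D mD; exact: (lebesgue_measure_shift (t * y + a)).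
Qed.

Lemma lebesgueC_shift (a : C) : preserving (@lebesgueC R) (fun z => z + a).
Proof.
apply: preserving_comp (lebesgueC_Re_shear 0 (complex.Re a))
  (lebesgueC_Im_shear 0 (complex.Im a)) _ => z /=.
by rewrite !mul0r !add0r; case: z a => [? ?] [? ?].
Qed.

(* A rotation is a product of three shears, except for [- 1], which is the
   square of [i]. *)
Lemma lebesgueC_rotation (c : C) : normc c = 1 ->
  preserving (@lebesgueC R) (fun z => c * z).
Proof.
have shear (b : C) : normc b = 1 -> complex.Im b != 0 ->
    preserving (@lebesgueC R) (fun z => b * z).
  (* For [b = e^(i th)] this is [- tan (th/2)], the coefficient of the two outer shears in the
     factorization of a rotation; it requires [sin th != 0]. *)
  move=> b1 b0; pose u := (complex.Re b - 1) / complex.Im b.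
  have s12 := preserving_comp (lebesgueC_Re_shear u 0)
    (lebesgueC_Im_shear (complex.Im b) 0) (fun=> erefl).
  apply: preserving_comp s12 (lebesgueC_Re_shear u 0) _ => z /=.
  have : complex.Re b ^+ 2 + complex.Im b ^+ 2 = 1 by rewrite -normc_sqr b1 expr1n.
  rewrite /u; case: b z {b1 u} b0 => [p q] [x y] /= q0 pq.
  have pE : p ^+ 2 = 1 - q ^+ 2 by rewrite -pq addrK.
  apply: complex_ext => /=; last by field.
  apply: (mulIf q0); rewrite !mulrDl; apply/eqP; rewrite -subr_eq0; apply/eqP.
  transitivity ((1 - q ^+ 2 - p ^+ 2) * y); first by field.
  by rewrite pE subrr mul0r.
move=> c1; have [ci0|] := eqVneq (complex.Im c) 0; last by move=> ?; exact: shear.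
have : complex.Re c ^+ 2 = 1.
  by have := normc_sqr c; rewrite c1 ci0 expr1n expr0n addr0.
have i1 : normc ('i : C) = 1 by rewrite /= expr0n add0r expr1n sqrtr1.
have i0 : complex.Im ('i : C) != 0 by rewrite /= oner_eq0.
move=> /eqP; rewrite sqrf_eq1 => /orP[|] /eqP cr; last first.
  apply: preserving_comp (shear 'i i1 i0) (shear 'i i1 i0) _ => z.
  by apply: complex_ext; rewrite ?(ReM, ImM) cr ci0/=; ring.
apply: preserving_comp (lebesgueC_shift 0) (lebesgueC_shift 0) _ => z.
by rewrite !addr0; apply: complex_ext; rewrite ?(ReM, ImM) cr ci0; ring.
Qed.

Lemma lebesgueC_tonelli (f : C -> \bar R) : measurable_fun setT f ->
  (forall z, 0 <= f z)%E ->
  (\int[@lebesgueC R]_z f z = \int[leb]_x \int[leb]_y f (Complex x y))%E.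
Proof.
move=> mf f0.
rewrite (@ge0_integral_image _ _ _ _ _ _ (@measurable_of_pair R) (leb \x leb)%E)//.
rewrite (fubini_tonelli1 (fun z : mR * mR => f (of_pair z)))//.
by apply: measurableT_comp => //; exact: measurable_of_pair.
Qed.

Lemma gauss_integral_shift (g a : R) : 0 < g ->
  (\int[leb]_x (expR (- g * (x - a) ^+ 2))%:E = (Num.sqrt (pi / g))%:E)%E.
Proof.
(* The standard deviation with [1 / (2 s^2) = g], so that the normal density is a multiple of the
   integrand. *)
move=> g0; pose s := Num.sqrt (2 * g)^-1.
have s0 : 0 < s by rewrite sqrtr_gt0 invr_gt0 mulr_gt0.
have s2 : s ^+ 2 = (2 * g)^-1 by rewrite sqr_sqrtr// invr_ge0 mulr_ge0// ltW.
have sn0 : s != 0 by rewrite gt_eqF.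
have peak0 := normal_peak_gt0 sn0.
have := @integral_normal_pdf R a s.
rewrite normal_pdfE//=.
under eq_integral do rewrite EFinM.
rewrite ge0_integralZl_EFin//=; last 3 first.
- by move=> x _; rewrite lee_fin normal_fun_ge0.
- by apply/measurable_EFinP; exact: measurable_normal_fun.
- exact: ltW.
rewrite (_ : (fun x => _) = (fun x => (expR (- g * (x - a) ^+ 2))%:E)); last first.
  apply/funext => x; rewrite /normal_fun s2; congr (expR _)%:E.
  by rewrite -[in RHS]mulrC -mulr_natl; field; rewrite gt_eqF.
move=> /(congr1 (fun x => (normal_peak s)^-1%:E * x)%E).
rewrite muleA -EFinM mulVf ?gt_eqF// mul1e mule1 => ->.
congr (_%:E); rewrite /normal_peak invrK s2; congr Num.sqrt.
by rewrite -mulr_natl; field; rewrite gt_eqF.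
Qed.

Lemma gauss_integralC (g : R) (a : C) : 0 < g ->
  (\int[@lebesgueC R]_z (expR (- g * normc (z - a) ^+ 2))%:E = (pi / g)%:E)%E.
Proof.
move=> g0; rewrite lebesgueC_tonelli; last 2 first.
- apply/measurable_EFinP/measurableT_comp => //.
  apply: measurable_funM; first exact: measurable_cst.
  apply: measurable_funX; apply: measurable_normc; apply: measurable_cB.
    exact: measurable_id.
  exact: measurable_cst.
- by move=> z; rewrite lee_fin expR_ge0.
have E x y : normc (Complex x y - a) ^+ 2 =
    (x - complex.Re a) ^+ 2 + (y - complex.Im a) ^+ 2.
  by rewrite normc_sqr ReD ImD ReN ImN.
have Z b (k : R) : 0 <= k -> (\int[leb]_y (k%:E * (expR (- g * (y - b) ^+ 2))%:E) =
    k%:E * (Num.sqrt (pi / g))%:E)%E.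
  move=> k0; rewrite ge0_integralZl_EFin ?gauss_integral_shift//.
  apply/measurable_EFinP/measurableT_comp => //.
  apply: measurable_funM; first exact: measurable_cst.
  by apply: measurable_funX; apply: measurable_funB => //; exact: measurable_cst.
under eq_integral => x _.
  under eq_integral => y _ do rewrite E mulrDr expRD EFinM.
  rewrite Z ?expR_ge0// muleC.
  over.
rewrite Z ?sqrtr_ge0//.
rewrite -EFinM -expr2 sqr_sqrtr//.
by rewrite divr_ge0// ?pi_ge0// ltW.
Qed.

End lebesgue_plane.

Section lebesgue_space.
Variable R : realType.
Local Notation C := R[i].
Local Notation leb n := (@lebesgueCn R n).

Lemma lebesgueCn_tonelli n (f : 'rV[C]_n.+1 -> \bar R) : measurable_fun setT f ->
  (forall z, 0 <= f z)%E ->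
  (\int[leb n.+1]_z f z = \int[@lebesgueC R]_c \int[leb n]_z f (cons_row (c, z)))%E.
Proof.
move=> mf f0.
rewrite (@ge0_integral_image _ _ _ _ _ _ (@measurable_cons_row R n)
  (@lebesgueC R \x leb n)%E)//.
rewrite (fubini_tonelli1 (fun z => f (cons_row z)))//.
by apply: measurableT_comp => //; exact: measurable_cons_row.
Qed.

Section cons.
Variables (n : nat) (F : 'rV[C]_n.+1 -> C).
Hypothesis Fi : cintble (leb n.+1) setT F.

Let Fi' : cintble (@lebesgueC R \x leb n)%E setT (fun z => F (cons_row z)).
Proof.
apply/(cintble_image (@measurable_cons_row R n) (nu := leb n.+1)) => //.
by case: Fi.
Qed.

Lemma cint_cons : cint (leb n.+1) setT F =
  cint (@lebesgueC R) setT (fun c => cint (leb n) setT (fun z => F (cons_row (c, z)))).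
Proof.
rewrite (cint_image (@measurable_cons_row R n) (mu := (@lebesgueC R \x leb n)%E))//.
by rewrite -cint_fubini1.
Qed.

Lemma cintble_cons : cintble (@lebesgueC R) setT
  (fun c => cint (leb n) setT (fun z => F (cons_row (c, z)))).
Proof. exact: cintble_cint2 Fi'. Qed.

Lemma ae_cintble_cons : {ae @lebesgueC R, forall c,
  cintble (leb n) setT (fun z => F (cons_row (c, z)))}.
Proof. exact: ae_cintble1 Fi'. Qed.

End cons.

Lemma lebesgueCn_shift n (a : 'rV[C]_n) : preserving (leb n) (fun z => z + a).
Proof.
have mt k (b : 'rV[C]_k) : measurable_fun setT (fun z : 'rV[C]_k => z + b).
  apply: measurable_rowP => i; under eq_fun do rewrite mxE.
  by apply: measurable_cD; [exact: measurable_coor|exact: measurable_cst].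
split; first exact: mt.
elim: n a => [|n IH] a A mA.
  rewrite (_ : _ @^-1` A = A)//.
  by apply/seteqP; split => z /=; rewrite [a]thinmx0 addr0.
rewrite /= /transport /pushforward.
set B := (@cons_row R n) @^-1` A.
have mB : measurable B by rewrite -[B]setTI; exact: (@measurable_cons_row R n measurableT A mA).
pose a' : 'rV[C]_n := \row_j a ord0 (lift ord0 j).
pose f1 (z : C * 'rV[C]_n) := (z.1, z.2 + a').
pose f2 (z : C * 'rV[C]_n) := (z.1 + a ord0 ord0, z.2).
have m1 : measurable_fun setT f1.
  apply: measurable_fun_pair; first exact: measurable_fst.
  by apply: (measurableT_comp (mt _ a')); exact: measurable_snd.
have m2 : measurable_fun setT f2.
  apply: measurable_fun_pair; last exact: measurable_snd.
  by apply: measurable_cD; [exact: measurable_fst|exact: measurable_cst].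
have p1 : preserving (@lebesgueC R \x leb n)%E f1.
  split=> // D mD; apply: (@product_measure_skew2 _ _ _ _ _ (@lebesgueC R) (leb n)
    (fun _ z => z + a')) => // _; exact: IH.
have p2 : preserving (@lebesgueC R \x leb n)%E f2.
  split=> // D mD; apply: (@product_measure_skew1 _ _ _ _ _ (@lebesgueC R) (leb n)
    (fun _ z => z + a ord0 ord0)) => //.
    by move=> _; have [] := lebesgueC_shift (a ord0 ord0).
  by rewrite -[X in measurable X]setTI; exact: m2.
have [_ p12] := preserving_comp p1 p2 (fun=> erefl).
rewrite -[RHS]p12//; congr (product_measure1 _ _ _).
rewrite /B; apply/seteqP; split => -[c z] /=;
  rewrite (_ : cons_row (c, z) + a = cons_row (c + a ord0 ord0, z + a'))//;
  by apply/rowP => i; rewrite !mxE; case: unliftP => [j ->|->]; rewrite ?mxE.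
Qed.

Lemma ge0_integral_shift n (a : 'rV[C]_n) (f : 'rV[C]_n -> \bar R) :
  measurable_fun setT f -> (forall z, 0 <= f z)%E ->
  (\int[leb n]_z f (z + a)%R = \int[leb n]_z f z)%E.
Proof.
move=> mf f0; have [ms sm] := lebesgueCn_shift a.
by rewrite [RHS](@ge0_integral_image _ _ _ _ _ _ ms (leb n))// => A mA; exact/esym/sm.
Qed.

Lemma cintble_shift n (a : 'rV[C]_n) (f : 'rV[C]_n -> C) :
  cintble (leb n) setT f -> cintble (leb n) setT (fun z => f (z + a)).
Proof.
move=> fi; have [ms sm] := lebesgueCn_shift a.
have nuE A : measurable A -> leb n A = leb n ((fun z => z + a) @^-1` A).
  by move=> mA; exact/esym/sm.
by have [mf _] := fi; apply: (cintble_image ms nuE mf).1.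
Qed.

Lemma cint_shift n (a : 'rV[C]_n) (f : 'rV[C]_n -> C) :
  cintble (leb n) setT f -> cint (leb n) setT (fun z => f (z + a)) = cint (leb n) setT f.
Proof.
move=> fi; have [ms sm] := lebesgueCn_shift a.
by rewrite [RHS](cint_image ms (mu := leb n))// => A mA; exact/esym/sm.
Qed.

Lemma enorm_ge0 n (z : 'rV[C]_n) : 0 <= enorm z.
Proof. exact: sqrtr_ge0. Qed.

Lemma enorm_sqr n (z : 'rV[C]_n) : enorm z ^+ 2 = \sum_j normc (z ord0 j) ^+ 2.
Proof. by rewrite sqr_sqrtr// sumr_ge0// => j _; exact: sqr_ge0. Qed.

Lemma measurable_enorm n : measurable_fun setT (@enorm R n).
Proof.
apply: measurableT_comp; first exact: (continuous_measurable_fun (@sqrt_continuous R)).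
apply: measurable_sum => j; apply: measurable_funX; apply: measurable_normc.
exact: measurable_coor.
Qed.

Lemma enorm_cons_sqr n c (z : 'rV[C]_n) :
  enorm (cons_row (c, z)) ^+ 2 = normc c ^+ 2 + enorm z ^+ 2.
Proof.
rewrite !enorm_sqr big_ord_recl /cons_row mxE unlift_none; congr (_ + _).
by apply: eq_bigr => j _; rewrite mxE liftK.
Qed.

Lemma gauss_integralCn n (g : R) (a : 'rV[C]_n) : 0 < g ->
  (\int[leb n]_z (expR (- g * enorm (z - a)%R ^+ 2))%:E = ((pi / g) ^+ n)%:E)%E.
Proof.
move=> g0.
have mg k : measurable_fun setT (fun z : 'rV[C]_k => (expR (- g * enorm z ^+ 2))%:E).
  apply/measurable_EFinP/measurableT_comp => //.
  apply: measurable_funM; first exact: measurable_cst.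
  by apply: measurable_funX; exact: measurable_enorm.
rewrite (ge0_integral_shift (- a) (f := fun z => (expR (- g * enorm z ^+ 2))%:E))//.
elim: n {a} => [|n IH].
  rewrite /= integral_dirac//; last exact: mg.
  by rewrite diracT mul1e enorm_sqr big_ord0 mulr0 expR0 expr0.
rewrite lebesgueCn_tonelli//.
under eq_integral => c _.
  under eq_integral => z _ do rewrite enorm_cons_sqr mulrDr expRD EFinM.
  rewrite ge0_integralZl_EFin; last 4 first.
  - exact: measurableT.
  - by move=> y _; rewrite lee_fin expR_ge0.
  - exact: mg.
  - exact: expR_ge0.
  rewrite IH muleC.
  over.
rewrite ge0_integralZl_EFin; last 4 first.
- exact: measurableT.
- by move=> x _; rewrite lee_fin expR_ge0.
- apply/measurable_EFinP/measurableT_comp => //.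
  apply: measurable_funM; first exact: measurable_cst.
  by apply: measurable_funX; apply: measurable_normc; exact: measurable_id.
- by rewrite exprn_ge0// divr_ge0// ?pi_ge0// ltW.
rewrite [X in (_ * X)%E](_ : _ = (pi / g)%:E); first by rewrite -EFinM -exprSr.
by rewrite -(gauss_integralC 0 g0); apply: eq_integral => c _; rewrite subr0.
Qed.

Definition cbox (e : R) (c : C) : set C :=
  [set z | `|complex.Re (z - c)| < e /\ `|complex.Im (z - c)| < e].

Lemma measurable_cbox e c : measurable (cbox e c).
Proof.
have mc : measurable_fun setT (fun z : C => z - c).
  by apply: measurable_cB; [exact: measurable_id|exact: measurable_cst].
have mn (f : C -> R) : measurable_fun setT f -> measurable [set z | `|f z| < e].
  move=> mf; rewrite (_ : mkset _ = (fun z => `|f z|) @^-1` `]-oo, e[%classic); last first.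
    by apply/seteqP; split => z /=; rewrite in_itv.
  rewrite -[X in measurable X]setTI; apply: measurableT_comp => //.
apply: measurableI; apply: mn; [exact: measurable_fun_Re|exact: measurable_fun_Im].
Qed.

Lemma lebesgueC_cbox_gt0 e c : 0 < e -> (0 < @lebesgueC R (cbox e c))%E.
Proof.
move=> e0; rewrite (_ : cbox e c = [set z | `|complex.Re z - complex.Re c| < e /\
    `|complex.Im z - complex.Im c| < e]); last first.
  by apply/seteqP; split => z /=; rewrite /cbox /mkset ReD ImD ReN ImN.
rewrite /lebesgueC /= /transport /pushforward.
rewrite (_ : _ @^-1` _ = `]complex.Re c - e, complex.Re c + e[%classic `*`
  `]complex.Im c - e, complex.Im c + e[%classic); last first.
  apply/seteqP; split => -[x y] /=;
    by rewrite !in_itv/= -!ltr_distl => -[].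
rewrite product_measure1E//= !lebesgue_measure_itv/= !lte_fin.
have lt (a : R) : a - e < a + e by rewrite ltrD2l gtrN.
by rewrite !lt -!EFinD -EFinM lte_fin mulr_gt0// subr_gt0.
Qed.

Definition box n (e : R) (a : 'rV[C]_n) : set 'rV[C]_n :=
  [set z | forall i, cbox e (a ord0 i) (z ord0 i)].

Lemma measurable_box n e (a : 'rV[C]_n) : measurable (box e a).
Proof.
rewrite (_ : box e a = \bigcap_(i in [set: 'I_n])
    ((fun z : 'rV[C]_n => z ord0 i) @^-1` cbox e (a ord0 i))); last first.
  by apply/seteqP; split => z /= h i; [move=> _|]; exact: h.
apply: fin_bigcap_measurable => // i _; rewrite -[X in measurable X]setTI.
exact: (measurable_coor i measurableT (measurable_cbox e _)).
Qed.

(** Boxes rather than balls, because [cons_row] pulls a box back to a product of lower-dimensional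
    boxes. Positive measure is what upgrades an almost everywhere bound on a continuous function to
    a bound everywhere. *)
Lemma lebesgueCn_box_gt0 n (e : R) (a : 'rV[C]_n) : 0 < e -> (0 < leb n (box e a))%E.
Proof.
move=> e0; elim: n a => [|n IH] a.
  by rewrite /= diracE mem_set ?lte01// => -[].
pose a' : 'rV[C]_n := \row_j a ord0 (lift ord0 j).
have E : (@cons_row R n) @^-1` box e a = cbox e (a ord0 ord0) `*` box e a'.
  apply/seteqP; split => -[c z] /=.
    move=> h; split; first by have := h ord0; rewrite mxE unlift_none.
    by move=> i; have := h (lift ord0 i); rewrite !mxE liftK.
  move=> [h1 h2] i; rewrite mxE; case: unliftP => [j ->|->//].
  by have := h2 j; rewrite mxE.
have -> : leb n.+1 (box e a) = (@lebesgueC R \x leb n)%E ((@cons_row R n) @^-1` box e a).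
  by [].
rewrite E product_measure1E; [|exact: measurable_cbox|exact: measurable_box].
by rewrite mule_gt0// lebesgueC_cbox_gt0.
Qed.

End lebesgue_space.

(** * Goursat's theorem *)

Section complex_differentiability.
Variable R : realType.
Local Notation C := R[i].

Lemma normr_normc (c : C) : `|c| = (normc c)%:C.
Proof. by rewrite normc_def normcE_sqrt. Qed.

(** Exponentials and Bergman projections are shown to be entire this way: the derivative is written
    down and the error is quadratic. [K] is complex because the norm of a normed module over [C] is
    [C]-valued. *)
Lemma differentiable_quadratic (V : normedModType C) (f : V -> C) (x : V)
  (L : {linear V -> C}) (K : C) : continuous L -> 0 <= K ->
  (forall h, `|h| <= 1 -> `|f (x + h) - f x - L h| <= K * `|h| ^+ 2) ->
  differentiable f x.
Proof.
move=> cL K0 fL.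
have E : f \o shift x = cst (f x) + L +o_ 0 id.
  apply/eqaddoP => e e0; near=> h.
  have h1 : `|h| <= 1 by near: h; exact: nbhs0_le.
  have he : `|h| <= e / (K + 1) by near: h; apply: nbhs0_le; rewrite divr_gt0// ltr_wpDl.
  rewrite -[X in `|X|]/(f (h + x) - (f x + L h)) opprD addrA addrC [h + x]addrC.
  rewrite [- L h + _]addrC (le_trans (fL h h1))// expr2 mulrA ler_wpM2r//.
  rewrite (le_trans (ler_wpM2l K0 he))// mulrCA ler_piMr ?(ltW e0)//.
  by rewrite ler_pdivrMr ?ltr_wpDl// mul1r lerDl.
apply/diff_locallyP; have dE := diff_unique cL E.
by rewrite dE; split.
Unshelve. all: by end_near. Qed.

(** Complex differentiability with real radii and [normc], the form that Goursat's estimate uses;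
    [l] is the differential applied to 1. *)
Definition cder (G : C -> C) (z l : C) := forall e : R, 0 < e ->
  exists2 d : R, 0 < d & forall h, normc h < d ->
    normc (G (z + h) - G z - l * h) <= e * normc h.

Lemma differentiable_cder (G : C -> C) z : differentiable G z -> exists l, cder G z l.
Proof.
move=> /diff_locallyP[_ /eqaddoP dG]; exists ('d G z 1) => e e0.
have /dG : 0 < e%:C by rewrite ltcR.
move=> /nbhs_ballP[d /= d0 dGe].
have dE : d = (complex.Re d)%:C by rewrite RRe_real// gtr0_real.
exists (complex.Re d) => [|h hd]; first by move: d0; rewrite dE ltcR.
have := dGe h; rewrite /ball/= sub0r normrN normr_normc dE ltcR => /(_ hd).
rewrite -[X in `|X|]/(G (h + z) - (G z + 'd G z h)) !normr_normc -rmorphM lecR.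
have -> : 'd G z h = 'd G z 1 * h.
  by rewrite -[h in LHS]mulr1 -[_ * 1]/(h *: 1) linearZ mulrC.
by rewrite opprD addrA addrC [h + z]addrC [- _ + _]addrC.
Qed.

Lemma differentiable_cexp (z : C) : differentiable (@cexp R) z.
Proof.
pose L : {linear C -> C} := *:%R (cexp z).
have K0 : 0 <= normc (cexp z) * expR 1 :> R by rewrite mulr_ge0 ?normc_ge0 ?expR_ge0.
apply: (@differentiable_quadratic _ _ z L (normc (cexp z) * expR 1)%:C).
- exact: scaler_continuous.
- by rewrite lecR.
move=> h; rewrite !normr_normc -rmorphXn -rmorphM !lecR => h1.
rewrite cexpD -[L h]/(cexp z * h) -[X in _ - X - _]mulr1 -!mulrBr normcMl -mulrA.
rewrite ler_wpM2l ?normc_ge0// (le_trans (cexp_sub1_lin h))// mulrC.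
by rewrite ler_wpM2r ?sqr_ge0// ler_expR.
Qed.

End complex_differentiability.

Section goursat.
Variable R : realType.
Local Notation C := R[i].
Local Notation leb := (@lebesgue_measure R).
Variable G : C -> C.
Hypothesis dG : forall z, exists l, cder G z l.

Definition continuousC (f : R -> C) := continuous (fun t => complex.Re (f t)) /\
  continuous (fun t => complex.Im (f t)).

Lemma holo_near z (e : R) : 0 < e ->
  exists2 d, 0 < d & forall h, normc h < d -> normc (G (z + h) - G z) <= e.
Proof.
move=> e0; have [l /(_ 1 ltr01)[d d0 Gd]] := dG z.
have l0 : 0 < 1 + normc l by rewrite ltr_wpDr ?normc_ge0.
exists (Order.min d (e / (1 + normc l))) => [|h].
  by rewrite lt_min d0 divr_gt0.
rewrite lt_min => /andP[/Gd]; rewrite mul1r ltr_pdivlMr// => hd /ltW he.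
rewrite (le_trans _ he)// -[G (z + h) - G z](subrK (l * h)).
by rewrite (le_trans (normc_add _ _))// normcMl mulrDr mulr1 lerD// mulrC.
Qed.

Lemma continuousC_line (p q : C) : continuousC (fun t : R => G (p + t%:C * q)).
Proof.
suff near t (e : R) : 0 < e -> exists2 d : R, 0 < d & forall s, `|t - s| < d ->
    normc (G (p + t%:C * q) - G (p + s%:C * q)) <= e.
  split=> t; apply/cvgrPdist_le => e e0; have [d d0 td] := near t e e0;
    apply/nbhs_ballP; exists d => //= s ts.
    by rewrite -ReN -ReD (le_trans (normc_Re _))// td.
  by rewrite -ImN -ImD (le_trans (normc_Im _))// td.
move=> e0; have [d d0 Gd] := holo_near (p + t%:C * q) e0.
have q0 : 0 < 1 + normc q by rewrite ltr_wpDr ?normc_ge0.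
exists (d / (1 + normc q)) => [|s]; first exact: divr_gt0.
rewrite ltr_pdivlMr// => ts; rewrite normc_distrC.
rewrite (_ : p + s%:C * q = p + t%:C * q + (s - t)%:C * q); last first.
  by rewrite rmorphB/=; ring.
apply: Gd; rewrite normcMl normc_real distrC (le_lt_trans _ ts)//.
by rewrite ler_wpM2l// lerDr.
Qed.

End goursat.

Section segment_integrals.
Variable R : realType.
Local Notation C := R[i].
Local Notation leb := (@lebesgue_measure R).
Implicit Types (f g : R -> C) (a b m : R).

Lemma continuousC_measurable f : continuousC f ->
  measurable_fun [set: measurableTypeR R] f.
Proof.
by move=> [cr ci]; apply: measurable_fun_complex; exact: continuous_measurable_fun.
Qed.

Lemma continuous_segment_integrable (f : R -> R) a b : continuous f ->
  leb.-integrable `[a, b] (EFin \o f).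
Proof.
move=> cf; apply: continuous_compact_integrable; first exact: segment_compact.
exact: continuous_subspaceT.
Qed.

Lemma continuousC_cintble f a b : continuousC f -> cintble leb `[a, b] f.
Proof.
move=> cf; have [cr ci] := cf.
have mI : measurable (`[a, b] : set (measurableTypeR R)) by exact: measurable_itv.
have := @le_cintble _ (measurableTypeR R) R leb `[a, b]%classic f
  (fun x => `|complex.Re (f x)| + `|complex.Im (f x)|) mI.
apply => //.
- by apply: measurable_funTS; exact: continuousC_measurable.
- have iR : leb.-integrable `[a, b] (EFin \o (fun x => `|complex.Re (f x)|)).
    apply: continuous_segment_integrable => x.
    exact: cvg_norm (cr x).
  have iI : leb.-integrable `[a, b] (EFin \o (fun x => `|complex.Im (f x)|)).
    apply: continuous_segment_integrable => x.
    exact: cvg_norm (ci x).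
  exact: (integrableD mI iR iI).
- by move=> x _; exact: normc_le_ReIm.
Qed.

Lemma continuousCB f g : continuousC f -> continuousC g -> continuousC (fun t => f t - g t).
Proof.
move=> [fr fi] [gr gi]; split.
  rewrite (_ : (fun _ => _) = (fun t => complex.Re (f t) - complex.Re (g t))); last first.
    by apply/funext => t; rewrite ReD ReN.
  by move=> t; exact: cvgB (fr t) (gr t).
rewrite (_ : (fun _ => _) = (fun t => complex.Im (f t) - complex.Im (g t))); last first.
  by apply/funext => t; rewrite ImD ImN.
by move=> t; exact: cvgB (fi t) (gi t).
Qed.

Lemma cint_segment_split f a m b : a <= m -> m <= b -> continuousC f ->
  cint leb `[a, b] f = cint leb `[a, m] f + cint leb `[m, b] f.
Proof.
move=> am mb [cr ci].
have key (h : R -> R) : continuous h ->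
    \int[leb]_(x in `[a, b]) h x =
    \int[leb]_(x in `[a, m]) h x + \int[leb]_(x in `[m, b]) h x.
  move=> ch; have := @Rintegral_itvB _ h (BLeft a) (BRight b) m.
  rewrite !bnd_simp => /(_ (continuous_segment_integrable a b ch) am mb).
  rewrite Rintegral_itv_obnd_cbnd => [<-|]; first by rewrite addrC subrK.
  apply: integrableS (continuous_segment_integrable a b ch) => //.
  by apply: subset_itv; rewrite bnd_simp.
by apply: complex_ext; rewrite ?ReD ?ImD/= key.
Qed.

Lemma normc_cint_segment f (M : R) a b : a <= b -> continuousC f ->
  (forall x, a <= x <= b -> normc (f x) <= M) ->
  normc (cint leb `[a, b] f) <= M * (b - a).
Proof.
move=> ab cf fM.
have fin : (leb `[a, b] < +oo)%E by rewrite lebesgue_measure_itv/=; case: ifP => _; rewrite ?ltry.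
have mI : measurable (`[a, b] : set (measurableTypeR R)) by exact: measurable_itv.
have := @normc_cint_le _ (measurableTypeR R) R leb `[a, b]%classic f (cst M) mI.
move=> /(_ _ _ _)/le_trans; apply.
- by apply: measurable_funTS; exact: continuousC_measurable.
- apply: continuous_segment_integrable => x; exact: cvg_cst.
- by move=> x /=; rewrite in_itv/= => /fM.
rewrite Rintegral_cst//= lebesgue_measure_itv/= lte_fin.
by move: ab; rewrite le_eqVlt => /predU1P[->|->//]; rewrite ltxx subrr.
Qed.

Lemma cint_segment_cst (c : C) a b : a <= b -> cint leb `[a, b] (fun=> c) = c * (b - a)%:C.
Proof.
move=> ab; apply: complex_ext; rewrite ?ReM ?ImM/= mulr0 ?subr0 ?add0r ?addr0;
  rewrite Rintegral_cst//= lebesgue_measure_itv/= lte_fin;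
  by move: ab; rewrite le_eqVlt => /predU1P[->|->//]; rewrite ltxx subrr.
Qed.

End segment_integrals.

Section nested_intervals.
Variable R : realType.

Lemma nested_intervals (a b : nat -> R) : (forall k, a k <= a k.+1) ->
  (forall k, b k.+1 <= b k) -> (forall k, a k <= b k) ->
  exists x, forall k, a k <= x <= b k.
Proof.
move=> aS bS ab.
have am : nondecreasing_seq a by exact/nondecreasing_seqP.
have bm : nonincreasing_seq b by exact/nonincreasing_seqP.
have aub : ubound (range a) (b 0).
  by move=> _ [k _ <-]; exact: le_trans (ab k) (bm _ _ _).
exists (sup (range a)) => k; apply/andP; split.
  by apply: ub_le_sup; [exists (b 0)|exists k].
apply: ge_sup; first by exists (a 0), 0.
move=> _ [j _ <-]; have [jk|/ltnW kj] := leqP j k.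
  by rewrite (le_trans (am _ _ jk)).
by rewrite (le_trans (ab j))// bm.
Qed.

End nested_intervals.

Section rectangle_bisection.
Variables (R : realType) (N : R -> R -> R -> R -> R).
Implicit Types a b c d m : R.
Hypothesis N_ge0 : forall a b c d, 0 <= N a b c d.
Hypothesis N_hor : forall a m b c d, a <= m -> m <= b ->
  N a b c d <= N a m c d + N m b c d.
Hypothesis N_ver : forall a b c m d, c <= m -> m <= d ->
  N a b c d <= N a b c m + N a b m d.
Hypothesis N_small : forall x y e, 0 < e -> exists2 del, 0 < del &
  forall a b c d, a <= x <= b -> c <= y <= d -> (b - a) + (d - c) < del ->
  N a b c d <= e * ((b - a) + (d - c)) ^+ 2.

Let Q := ((R * R) * (R * R))%type.
Let NQ (q : Q) := N q.1.1 q.1.2 q.2.1 q.2.2.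
Let halve (I : R * R) (left : bool) :=
  if left then (I.1, (I.1 + I.2) / 2) else ((I.1 + I.2) / 2, I.2).
(** The left half is kept if it carries at least half of [N]; otherwise subadditivity forces the
    right half to do so. *)
Let stepx (q : Q) : Q := (halve q.1 (NQ q / 2 <= NQ (halve q.1 true, q.2)), q.2).
Let stepy (q : Q) : Q := (q.1, halve q.2 (NQ q / 2 <= NQ (q.1, halve q.2 true))).
Let step q := stepy (stepx q).
Let good (q : Q) := q.1.1 <= q.1.2 /\ q.2.1 <= q.2.2.

Let halveP (I : R * R) left : I.1 <= I.2 ->
  [/\ I.1 <= (halve I left).1, (halve I left).1 <= (halve I left).2,
      (halve I left).2 <= I.2 &
      (halve I left).2 - (halve I left).1 = (I.2 - I.1) / 2].
Proof. by case: I => a b /= ab; case: left => /=; split; lra. Qed.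

Let N_stepx q : good q -> NQ q / 2 <= NQ (stepx q).
Proof.
case: q => -[a b] [c d] [/= ab cd]; rewrite /stepx /NQ /halve /=.
case: ifPn => //=; rewrite -ltNge => lt.
have : N a b c d <= N a ((a + b) / 2) c d + N ((a + b) / 2) b c d by apply: N_hor; lra.
lra.
Qed.

Let N_stepy q : good q -> NQ q / 2 <= NQ (stepy q).
Proof.
case: q => -[a b] [c d] [/= ab cd]; rewrite /stepy /NQ /halve /=.
case: ifPn => //=; rewrite -ltNge => lt.
have : N a b c d <= N a b c ((c + d) / 2) + N a b ((c + d) / 2) d by apply: N_ver; lra.
lra.
Qed.

Let seqQ (q : Q) k := iter k step q.

Let seqQP q k : good q ->
  [/\ good (seqQ q k), (seqQ q k).1.1 <= (seqQ q k.+1).1.1,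
      (seqQ q k.+1).1.2 <= (seqQ q k).1.2, (seqQ q k).2.1 <= (seqQ q k.+1).2.1 &
      (seqQ q k.+1).2.2 <= (seqQ q k).2.2] /\
  [/\ NQ q <= 4 ^+ k * NQ (seqQ q k) &
   2 ^+ k * (((seqQ q k).1.2 - (seqQ q k).1.1) + ((seqQ q k).2.2 - (seqQ q k).2.1)) =
     (q.1.2 - q.1.1) + (q.2.2 - q.2.1)].
Proof.
move=> gq.
have gx p : good p -> good (stepx p).
  move=> [g1 g2]; split => //=.
  by have [] := halveP (NQ p / 2 <= NQ (halve p.1 true, p.2)) g1.
have gy p : good p -> good (stepy p).
  move=> [g1 g2]; split => //=.
  by have [] := halveP (NQ p / 2 <= NQ (p.1, halve p.2 true)) g2.
have gk j : good (seqQ q j) by elim: j => //= j /gx/gy.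
split.
  have [g1 g2] := gk k; split=> //.
  - by have [] := halveP (NQ (seqQ q k) / 2 <= NQ (halve (seqQ q k).1 true, (seqQ q k).2)) g1.
  - by have [] := halveP (NQ (seqQ q k) / 2 <= NQ (halve (seqQ q k).1 true, (seqQ q k).2)) g1.
  - by have [] := halveP (NQ (stepx (seqQ q k)) / 2 <=
      NQ ((stepx (seqQ q k)).1, halve (seqQ q k).2 true)) g2.
  - by have [] := halveP (NQ (stepx (seqQ q k)) / 2 <=
      NQ ((stepx (seqQ q k)).1, halve (seqQ q k).2 true)) g2.
elim: k => [|k [IH1 IH2]]; first by rewrite !expr0 !mul1r.
split.
  have := N_stepx (gk k); have := N_stepy (gx _ (gk k)).
  rewrite -[stepy _]/(seqQ q k.+1) => h1 h2.
  rewrite (le_trans IH1)// exprSr -mulrA ler_wpM2l ?exprn_ge0//; lra.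
rewrite -IH2 exprSr -mulrA; congr (_ * _).
have [g1 g2] := gk k.
have [_ _ _ E1] := halveP (NQ (seqQ q k) / 2 <= NQ (halve (seqQ q k).1 true, (seqQ q k).2)) g1.
have [_ _ _ E2] := halveP (NQ (stepx (seqQ q k)) / 2 <=
  NQ ((stepx (seqQ q k)).1, halve (seqQ q k).2 true)) g2.
by rewrite [X in 2 * (X + _)]E1 [X in 2 * (_ + X)]E2; field.
Qed.

(** Goursat's argument for an arbitrary nonnegative subadditive function of rectangles. One step
    halves both sides and keeps at least a quarter of [N]. At depth [k] the loss [4^k] is balanced
    by the square of the half-perimeter in [N_small], which has gained [4^-k]; so [N] is at most
    [e * s^2] for every [e > 0]. *)
Lemma rectangle_bisection a b c d : a <= b -> c <= d -> N a b c d = 0.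
Proof.
move=> ab cd; pose q : Q := ((a, b), (c, d)).
have gq : good q by [].
have [x hx] : exists x, forall k, (seqQ q k).1.1 <= x <= (seqQ q k).1.2.
  by apply: (@nested_intervals _ (fun k => (seqQ q k).1.1) (fun k => (seqQ q k).1.2))
    => k; have [[[? ?] ? ? ? ?] _] := seqQP k gq.
have [y hy] : exists y, forall k, (seqQ q k).2.1 <= y <= (seqQ q k).2.2.
  by apply: (@nested_intervals _ (fun k => (seqQ q k).2.1) (fun k => (seqQ q k).2.2))
    => k; have [[[? ?] ? ? ? ?] _] := seqQP k gq.
apply/eqP; rewrite eq_le N_ge0 andbT.
set s := (b - a) + (d - c).
have s0 : 0 <= s by rewrite addr_ge0// subr_ge0.
have s1 : 0 < s ^+ 2 + 1 by rewrite ltr_wpDl// sqr_ge0.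
apply/ler_addgt0Pl => eps eps0; rewrite addr0.
(* The summand 1 keeps the denominator positive for a degenerate rectangle. *)
have [e e0 eE] : exists2 e, 0 < e & e * (s ^+ 2 + 1) = eps.
  by exists (eps / (s ^+ 2 + 1)); [exact: divr_gt0|rewrite mulfVK// gt_eqF].
have [del del0 Ndel] := N_small x y e0.
have [k hk] : exists k, s < del * 2 ^+ k.
  by exists (Num.bound (s / del)); rewrite mulrC -ltr_pdivrMr// upper_nthrootP.
have [_ [r1 r2]] := seqQP k gq.
have := Ndel _ _ _ _ (hx k) (hy k).
move: r2; set t := _ + _ => r2; rewrite -/s in r2.
have tdel : t < del.
  by rewrite -(ltr_pM2l (_ : 0 < 2 ^+ k)) ?exprn_gt0// r2 mulrC.
move=> /(_ tdel) small.
rewrite (le_trans r1)// (le_trans (ler_wpM2l _ small)) ?exprn_ge0//.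
rewrite mulrCA -eE (_ : 4 ^+ k * t ^+ 2 = s ^+ 2) ?ler_pM2l ?lerDl//.
by rewrite -r2 exprMn -exprM mulnC exprM; congr (_ ^+ _ * _); ring.
Qed.

End rectangle_bisection.

Section goursat_rectangle.
Variable R : realType.
Local Notation C := R[i].
Local Notation leb := (@lebesgue_measure R).
Variable G : C -> C.
Hypothesis dG : forall z, exists l, cder G z l.
Implicit Types (a b c d m : R).

Let hor y (x : R) := G (Complex x y).
Let ver x (y : R) := G (Complex x y).

Let chor y : continuousC (hor y).
Proof.
have := continuousC_line dG (Complex 0 y) 1.
rewrite (_ : (fun _ => _) = hor y)//; apply/funext => t; congr G.
by apply: complex_ext; rewrite ?ReD ?ImD ?ReM ?ImM/=; ring.
Qed.

Let cver x : continuousC (ver x).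
Proof.
have := continuousC_line dG (Complex x 0) 'i.
rewrite (_ : (fun _ => _) = ver x)//; apply/funext => t; congr G.
by apply: complex_ext; rewrite ?ReD ?ImD ?ReM ?ImM/=; ring.
Qed.

Let Ih a b y := cint leb `[a, b] (hor y).
Let Iv x c d := cint leb `[c, d] (ver x).

(** The counterclockwise contour integral: bottom minus top, and [dz = i dy] on the vertical
    sides. *)
Let rect a b c d := (Ih a b c - Ih a b d) + 'i * (Iv b c d - Iv a c d).

Let rect_hor a m b c d : a <= m -> m <= b ->
  rect a b c d = rect a m c d + rect m b c d.
Proof.
move=> am mb; rewrite /rect /Ih !(@cint_segment_split _ _ a m b)//; ring.
Qed.

Let rect_ver a b c m d : c <= m -> m <= d ->
  rect a b c d = rect a b c m + rect a b m d.
Proof.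
move=> cm md; rewrite /rect /Iv !(@cint_segment_split _ _ c m d)//; ring.
Qed.

Let rect_small a b c d x0 y0 l (e : R) : a <= x0 <= b -> c <= y0 <= d -> 0 <= e ->
  (forall x y, a <= x <= b -> c <= y <= d ->
    normc (G (Complex x y) - G (Complex x0 y0) - l * Complex (x - x0) (y - y0))
      <= e * normc (Complex (x - x0) (y - y0))) ->
  normc (rect a b c d) <= 2 * e * ((b - a) + (d - c)) ^+ 2.
Proof.
move=> /andP[ax xb] /andP[cy yd] e0 Ge.
have ab := le_trans ax xb; have cd := le_trans cy yd.
set s := (b - a) + (d - c).
have Ges x y : a <= x <= b -> c <= y <= d ->
    normc (G (Complex x y) - G (Complex x0 y0) - l * Complex (x - x0) (y - y0)) <= e * s.
  move=> /[dup] hx /andP[ax' xb'] /[dup] hy /andP[cy' yd'].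
  rewrite (le_trans (Ge _ _ hx hy))// ler_wpM2l// (le_trans (normc_le_ReIm _))//=.
  by rewrite lerD// ler_norml; apply/andP; split; lra.
have es0 : 0 <= e * s by rewrite mulr_ge0// addr_ge0// subr_ge0.
(* Opposite sides are paired, which cancels [G(z0)] and reduces the linear part [l * (z - z0)] to a
   constant. The constants of [H] and [V] contribute opposite amounts, so the contour integral is
   unchanged, while each of [H], [V] is a difference of two errors of size at most [e * s]. *)
pose H (x : R) := hor c x - hor d x - l * Complex 0 (c - d).
pose V (y : R) := ver b y - ver a y - l * Complex (b - a) 0.
have ccst (k : C) : continuousC (fun=> k) by split=> ?; exact: cvg_cst.
have cH : continuousC H by apply: continuousCB => //; exact: continuousCB.
have cV : continuousC V by apply: continuousCB => //; exact: continuousCB.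
have -> : rect a b c d = cint leb `[a, b] H + 'i * cint leb `[c, d] V.
  rewrite /H /V !cintB ?cint_segment_cst//;
    try (by apply: continuousC_cintble => //; exact: continuousCB);
    try exact: continuousC_cintble.
  rewrite /rect /Ih /Iv -![Complex _ 0]/(_%:C).
  rewrite (_ : Complex 0 (c - d) = - 'i * (d - c)%:C); first by ring.
  by apply: complex_ext; rewrite ?ReM ?ImM ?ReN ?ImN/=; ring.
have nH : normc (cint leb `[a, b] H) <= 2 * (e * s) * (b - a).
  apply: normc_cint_segment => // x hx.
  rewrite (_ : H x = (hor c x - G (Complex x0 y0) - l * Complex (x - x0) (c - y0)) -
     (hor d x - G (Complex x0 y0) - l * Complex (x - x0) (d - y0))).
    rewrite (le_trans (normc_sub _ _))// mulr_natl mulr2n.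
    by rewrite lerD// Ges// ?lexx ?cd.
  rewrite /H (_ : Complex 0 (c - d) = Complex (x - x0) (c - y0) - Complex (x - x0) (d - y0)).
    by ring.
  by apply: complex_ext; rewrite ?ReD ?ImD ?ReN ?ImN/=; ring.
have nV : normc (cint leb `[c, d] V) <= 2 * (e * s) * (d - c).
  apply: normc_cint_segment => // y hy.
  rewrite (_ : V y = (ver b y - G (Complex x0 y0) - l * Complex (b - x0) (y - y0)) -
     (ver a y - G (Complex x0 y0) - l * Complex (a - x0) (y - y0))).
    rewrite (le_trans (normc_sub _ _))// mulr_natl mulr2n.
    by rewrite lerD// Ges// ?lexx ?ab.
  rewrite /V (_ : Complex (b - a) 0 = Complex (b - x0) (y - y0) - Complex (a - x0) (y - y0)).
    by ring.
  by apply: complex_ext; rewrite ?ReD ?ImD ?ReN ?ImN/=; ring.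
rewrite (le_trans (normc_add _ _))// normcMl.
have -> : normc ('i : C) = 1 by rewrite /= expr0n add0r expr1n sqrtr1.
rewrite mul1r (le_trans (lerD nH nV))// -mulrDr -/s.
by rewrite le_eqVlt; apply/orP; left; apply/eqP; ring.
Qed.

Lemma goursat_rectangle a b c d : a <= b -> c <= d -> rect a b c d = 0.
Proof.
move=> ab cd; apply: Normc.eq0_normc.
apply: (rectangle_bisection (N := fun a b c d => normc (rect a b c d))) => //.
- by move=> *; exact: normc_ge0.
- by move=> a' m b' c' d' am mb; rewrite (rect_hor _ _ am mb) normc_add.
- by move=> a' b' c' m d' cm md; rewrite (rect_ver _ _ cm md) normc_add.
move=> x y e e0; have [l Gl] := dG (Complex x y).
have e2 : 0 < e / 2 by rewrite divr_gt0.
have [del del0 Gdel] := Gl _ e2.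
exists del => // a' b' c' d' hx hy small.
rewrite -[e](@divfK _ 2) ?pnatr_eq0// [e / 2 * 2]mulrC.
apply: (rect_small hx hy (ltW e2) (l := l)) => x' y' hx' hy'.
have := Gdel (Complex (x' - x) (y' - y)).
rewrite (_ : Complex x y + Complex (x' - x) (y' - y) = Complex x' y'); last first.
  by apply: complex_ext; rewrite ?ReD ?ImD/=; ring.
apply; apply: le_lt_trans small; rewrite (le_trans (normc_le_ReIm _))//=.
move/andP : hx => [? ?]; move/andP : hy => [? ?].
move/andP : hx' => [? ?]; move/andP : hy' => [? ?].
by rewrite lerD// ler_norml; apply/andP; split; lra.
Qed.

(** The horizontal sides of the rectangle cancel by periodicity. In the coordinate [w] of [z = e^w]
    this says that circle means do not depend on the radius, which takes the place of Cauchy's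
    formula. *)
Lemma periodic_vertical_mean (p : R) (s t : R) : 0 <= p -> s <= t ->
  (forall z, G (z + Complex 0 p) = G z) ->
  cint leb `[0, p] (fun y => G (Complex s y)) = cint leb `[0, p] (fun y => G (Complex t y)).
Proof.
move=> p0 st Gp; have := goursat_rectangle st p0; rewrite /rect.
have -> : Ih s t p = Ih s t 0.
  apply: eq_cint => x _; rewrite /hor -(Gp (Complex x 0)); congr G.
  by apply: complex_ext; rewrite ?ReD ?ImD/= ?addr0 ?add0r.
rewrite subrr add0r => /eqP; rewrite mulf_eq0 => /orP[|].
  by rewrite eq_complex/= oner_eq0 andbF.
by rewrite subr_eq0 => /eqP.
Qed.

End goursat_rectangle.

(** * The mean value property and the reproducing formula *)

Lemma eq_cintble d (T : measurableType d) (R : realType)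
    (mu : {measure set T -> \bar R}) D (f g : T -> R[i]) :
  f =1 g -> cintble mu D f -> cintble mu D g.
Proof. by move=> /funext ->. Qed.

Section circle_mean.
Variable R : realType.
Local Notation C := R[i].
Local Notation leb := (@lebesgue_measure R).

Lemma cexp_periodic (w : C) : cexp (w + Complex 0 (2 * pi)) = cexp w.
Proof.
rewrite cexpD (_ : cexp (Complex 0 _) = 1) ?mulr1//.
apply: complex_ext; rewrite /= expR0 mul1r.
  by rewrite mulr_natl cos2pi.
by rewrite mulr_natl sin2pi.
Qed.

(** As a function of [w], [F (z * cexp w)] has period [2 pi i], so the mean is the same for every
    radius [|z| e^s] with [s <= 0]; as the radius shrinks, continuity of [F] at 0 gives the
    value. *)
Lemma circle_mean (F : C -> C) (z : C) : (forall w, differentiable F w) ->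
  cint leb `[0, 2 * pi] (fun t => F (z * cexp (Complex 0 t))) = (2 * pi)%:C * F 0.
Proof.
move=> dF; pose G w := F (z * cexp w).
have dG w : exists l, cder G w l.
  apply: differentiable_cder; apply: differentiable_comp; last exact: dF.
  by apply: differentiableM => //; exact: differentiable_cexp.
have pi0 : 0 <= 2 * pi :> R by rewrite mulr_ge0// pi_ge0.
have mean s : s <= 0 -> cint leb `[0, 2 * pi] (fun t => G (Complex s t)) =
    cint leb `[0, 2 * pi] (fun t => F (z * cexp (Complex 0 t))).
  move=> s0; rewrite (periodic_vertical_mean dG pi0 s0)// => w.
  by rewrite /G cexp_periodic.
apply/eqP; rewrite -subr_eq0; apply/eqP/Normc.eq0_normc/eqP.
rewrite eq_le normc_ge0 andbT; apply/ler_addgt0Pl => e e0; rewrite addr0.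
have e1 : 0 < e / (2 * pi) by rewrite divr_gt0// mulr_gt0// pi_gt0.
have dF' w := differentiable_cder (dF w).
have [d d0 Fd] := holo_near dF' 0 e1.
have z0 : 0 < normc z + 1 by rewrite ltr_wpDl// normc_ge0.
(* Far enough to the left that the circle of radius [normc z * expR s] lies in the [d]-disc around
   0; the minimum with 0 ensures [s <= 0]. *)
pose s := Order.min 0 (ln (d / (normc z + 1))).
have es : normc z * expR s < d.
  apply: (@le_lt_trans _ _ (normc z * (d / (normc z + 1)))).
    rewrite ler_wpM2l ?normc_ge0// -[leRHS]lnK ?posrE ?divr_gt0// ler_expR.
    by rewrite /s ge_min lexx orbT.
  by rewrite mulrCA gtr_pMr// ltr_pdivrMr// mul1r ltrDl.
rewrite -(mean s) ?ge_min ?lexx//.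
have cG : continuousC (fun t => G (Complex s t)).
  have := continuousC_line dG (Complex s 0) 'i.
  rewrite (_ : (fun _ => _) = (fun t => G (Complex s t)))//; apply/funext => t; congr G.
  by apply: complex_ext; rewrite ?ReD ?ImD ?ReM ?ImM/=; ring.
have cc : continuousC (fun=> F 0) by split=> ?; exact: cvg_cst.
rewrite [_ * F 0]mulrC -[in X in F 0 * X](subr0 (2 * pi)) -cint_segment_cst//.
rewrite -cintB//; [|exact: continuousC_cintble..].
rewrite (le_trans (normc_cint_segment (M := e / (2 * pi)) _ _ _))//.
- exact: continuousCB.
- move=> t _; rewrite /G -[z * _]add0r; apply: Fd.
  by rewrite normcMl normc_cexp.
- by rewrite subr0 divfK// gt_eqF// mulr_gt0// pi_gt0.
Qed.

(** Instead of polar coordinates, the integral is averaged over the rotations [z -> e^(it) z], each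
    of which leaves it unchanged. After Fubini the inner integral is a circle mean of [F], since the
    Gaussian factor is radial. *)
Lemma mean_valueC (F : C -> C) (g : R) : (forall w, differentiable F w) -> 0 < g ->
  measurable_fun setT F ->
  cintble (@lebesgueC R) setT (fun z => (expR (- g * normc z ^+ 2))%:C * F z) ->
  cint (@lebesgueC R) setT (fun z => (expR (- g * normc z ^+ 2))%:C * F z) =
  (pi / g)%:C * F 0.
Proof.
move=> dF g0 mF; set Phi := fun z => _ => iPhi; have [mPhi foo] := iPhi.
set I := cint _ _ _.
pose e (t : R) : C := cexp (Complex 0 t).
have e1 t : normc (e t) = 1 by rewrite normc_cexp/= expR0.
(* The indicator of one period puts the double integral on the whole product space, where
   [cint_fubini] applies. *)
pose chi (t : R) : C := (\1_(`[0, 2 * pi]%classic) t)%:C.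
have rot t := lebesgueC_rotation (e1 t).
have nuE t A : measurable A -> @lebesgueC R A = @lebesgueC R ((fun z => e t * z) @^-1` A).
  by move=> mA; have [_ ->] := rot t.
have IE t : cint (@lebesgueC R) setT (fun z => Phi (e t * z)) = I.
  by have [mr _] := rot t; exact/esym/(cint_image mr (nuE t) iPhi).
have iPhit t : cintble (@lebesgueC R) setT (fun z => Phi (e t * z)).
  by have [mr _] := rot t; exact: (cintble_image mr (nuE t) mPhi).1.
pose Psi (p : measurableTypeR R * C) := chi p.1 * Phi (e p.1 * p.2).
have me : measurable_fun setT (e : measurableTypeR R -> C).
  apply: measurable_cexp; apply: measurable_fun_complex => /=.
    exact: measurable_cst.
  exact: measurable_id.
have mchi : measurable_fun setT (chi : measurableTypeR R -> C).
  by apply: measurable_cR; exact: measurable_indic.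
have mPsi : measurable_fun setT Psi.
  apply: measurable_cM; first by apply: (measurableT_comp mchi); exact: measurable_fst.
  apply: (measurableT_comp mPhi); apply: measurable_cM; last exact: measurable_snd.
  by apply: (measurableT_comp me); exact: measurable_fst.
(* Rotation invariance makes the inner integral of the modulus depend on [t] only through [chi], so
   the double integral is finite with that of [Phi]. *)
have iPsi : cintble (leb \x @lebesgueC R)%E setT Psi.
  apply: cintbleP => //.
  have mn : measurable_fun setT (fun p => (normc (Psi p))%:E).
    by apply/measurable_EFinP/measurable_normc.
  apply/(integrable12ltyP _ _ mn).
  under eq_integral => t _.
    under eq_integral => z _ do
      rewrite gee0_abs ?lee_fin ?normc_ge0// /Psi/= normcMl EFinM.
    rewrite ge0_integralZl_EFin; last 4 first.
    + exact: measurableT.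
    + by move=> z _; rewrite lee_fin normc_ge0.
    + by apply/measurable_EFinP/measurable_normc; have [] := iPhit t.
    + exact: normc_ge0.
    have -> : (\int[@lebesgueC R]_z (normc (Phi (e t * z)))%:E =
        \int[@lebesgueC R]_z (normc (Phi z))%:E)%E.
      have [mr _] := rot t.
      rewrite [RHS](ge0_integral_image mr (nuE t))//.
      + by apply/measurable_EFinP/measurable_normc.
      + by move=> z; rewrite lee_fin normc_ge0.
    rewrite normc_real ger0_norm ?indicE// muleC.
    over.
  rewrite /=; set J := (\int[@lebesgueC R]_z (normc (Phi z))%:E)%E.
  have J0 : (0 <= J)%E by apply: integral_ge0 => z _; rewrite lee_fin normc_ge0.
  have Jfin : J \is a fin_num by rewrite ge0_fin_numE.
  rewrite -(fineK Jfin) ge0_integralZl_EFin; last 4 first.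
  + exact: measurableT.
  + by move=> t _; rewrite lee_fin.
  + by apply/measurable_EFinP; exact: measurable_indic.
  + exact: fine_ge0.
  under eq_integral do rewrite -indicE.
  rewrite integral_indic//= setIT lebesgue_measure_itv/=; case: ifP => _.
    by rewrite -EFinD -EFinM ltry.
  by rewrite mule0 ltry.
have := cint_fubini iPsi.
have -> : cint leb setT (fun t => cint (@lebesgueC R) setT (fun z => Psi (t, z))) =
    (2 * pi)%:C * I.
  transitivity (cint leb setT (fun t => chi t * I)).
    by apply: eq_cint => t _; rewrite -(IE t) -(cintZ (chi t) measurableT (iPhit t)).
  rewrite -[2 * pi]subr0 [RHS]mulrC -cint_segment_cst ?mulr_ge0 ?pi_ge0//.
  rewrite [RHS]cint_mkcond; apply: eq_cint => t _.
  by rewrite patchE /chi indicE; case: ifP => _; rewrite ?mul1r ?mul0r.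
have -> : cint (@lebesgueC R) setT (fun z => cint leb setT (fun t => Psi (t, z))) =
    cint (@lebesgueC R) setT (fun z => ((2 * pi)%:C * F 0) * (expR (- g * normc z ^+ 2))%:C).
  apply: eq_cint => z _; rewrite -(circle_mean z dF) mulrC.
  rewrite [X in _ * X]cint_mkcond -cintZ//.
    apply: eq_cint => t _; rewrite patchE /Psi /Phi /chi /= normcMl e1 mul1r indicE.
    by rewrite [e t * z]mulrC; case: ifP => _; rewrite ?mul1r// !mul0r mulr0.
  have cf : continuousC (fun t => F (z * e t)).
    have dG w : exists l, cder (fun w => F (z * cexp w)) w l.
      apply: differentiable_cder; apply: differentiable_comp; last exact: dF.
      by apply: differentiableM => //; exact: differentiable_cexp.
    have := continuousC_line dG 0 'i.
    rewrite (_ : (fun _ => _) = (fun t => F (z * e t)))//; apply/funext => t.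
    congr (F (z * cexp _)).
    by apply: complex_ext; rewrite ?ReD ?ImD ?ReM ?ImM/=; ring.
  have [mi fi] := continuousC_cintble 0 (2 * pi) cf; split.
    apply/(measurable_restrictT _ _).1 => //.
  rewrite (_ : (fun x => _) = (fun t => (normc (F (z * e t)))%:E) \_ `[0, 2 * pi]).
    by rewrite -integral_mkcond.
  by apply/funext => t; rewrite !patchE; case: ifP => //; rewrite Normc.normc0.
have gi : (@lebesgueC R).-integrable setT (fun z => (expR (- g * normc z ^+ 2))%:E).
  apply/integrableP; split.
    apply/measurable_EFinP/measurableT_comp => //.
    apply: measurable_funM; first exact: measurable_cst.
    by apply: measurable_funX; apply: measurable_normc; exact: measurable_id.
  under eq_integral do rewrite gee0_abs ?lee_fin ?expR_ge0//.
  have := gauss_integralC 0 g0 => E.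
  rewrite [X in (X < _)%E](_ : _ = (pi / g)%:E) ?ltry// -E.
  by apply: eq_integral => z _; rewrite subr0.
have gC : cintble (@lebesgueC R) setT (fun z => (expR (- g * normc z ^+ 2))%:C).
  apply: cintbleP; first by apply: measurable_cR; have [/measurable_EFinP] := integrableP _ _ _ gi.
  by under eq_fun do rewrite normc_real ger0_norm ?expR_ge0//.
rewrite cintZ// => /eqP; rewrite -mulrA => /eqP /mulfI-> //; last first.
  by apply/eqP => -[] /eqP; rewrite mulf_eq0 pnatr_eq0/= gt_eqF// pi_gt0.
rewrite mulrC; congr (_ * _); apply: complex_ext => /=.
  rewrite /Rintegral -[RHS]/(fine (pi / g)%:E) -(gauss_integralC 0 g0).
  by congr fine; apply: eq_integral => z _; rewrite subr0.
by rewrite /Rintegral integral0.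
Qed.

End circle_mean.

(** * The Hermitian form on C^n and holomorphy along lines *)

Section hermitian.
Variables (R : realType) (n : nat).
Local Notation C := R[i].
Local Notation Cn := 'rV[C]_n.
Implicit Types u v w z : Cn.

Definition dot u v : C := \sum_(j < n) u ord0 j * (v ord0 j)^*%C.

Lemma dotDl u v w : dot (u + v) w = dot u w + dot v w.
Proof. by rewrite -big_split; apply: eq_bigr => j _; rewrite mxE mulrDl. Qed.

Lemma dotZl c u v : dot (c *: u) v = c * dot u v.
Proof. by rewrite mulr_sumr; apply: eq_bigr => j _; rewrite mxE mulrA. Qed.

Lemma dotC u v : dot u v = (dot v u)^*%C.
Proof.
rewrite /dot rmorph_sum; apply: eq_bigr => j _.
by rewrite rmorphM/= conjcK mulrC.
Qed.

Lemma dotDr u v w : dot u (v + w) = dot u v + dot u w.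
Proof. by rewrite dotC dotDl rmorphD/= -!dotC. Qed.

Lemma dotZr c u v : dot u (c *: v) = c^*%C * dot u v.
Proof. by rewrite dotC dotZl rmorphM/= -dotC. Qed.

Lemma dotNl u v : dot (- u) v = - dot u v.
Proof. by rewrite -scaleN1r dotZl mulN1r. Qed.

Lemma dotNr u v : dot u (- v) = - dot u v.
Proof. by rewrite dotC dotNl rmorphN/= -dotC. Qed.

Lemma dotBl u v w : dot (u - v) w = dot u w - dot v w.
Proof. by rewrite dotDl dotNl. Qed.

Lemma dotBr u v w : dot u (v - w) = dot u v - dot u w.
Proof. by rewrite dotDr dotNr. Qed.

Lemma dot_enorm u : dot u u = (enorm u ^+ 2)%:C.
Proof.
by rewrite enorm_sqr rmorph_sum; apply: eq_bigr => j _; rewrite mulcJ_normc.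
Qed.

Lemma enormD_sqr u v : enorm (u + v) ^+ 2 =
  enorm u ^+ 2 + enorm v ^+ 2 + 2 * complex.Re (dot u v).
Proof.
have := dot_enorm (u + v); rewrite dotDl !dotDr !dot_enorm.
rewrite [dot v u]dotC => /(congr1 (@complex.Re R)) /=; rewrite !ReD ReJ /= => <-.
by ring.
Qed.

Lemma enormN u : enorm (- u) = enorm u.
Proof.
by rewrite /enorm; under eq_bigr do rewrite mxE normc_opp.
Qed.

Lemma enormB_sqr u v : enorm (u - v) ^+ 2 =
  enorm u ^+ 2 + enorm v ^+ 2 - 2 * complex.Re (dot u v).
Proof. by rewrite enormD_sqr enormN dotNr ReN mulrN. Qed.

Lemma enorm_distC u v : enorm (u - v) = enorm (v - u).
Proof. by rewrite -enormN opprB. Qed.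

Lemma normc_coor_le u j : normc (u ord0 j) <= enorm u.
Proof.
rewrite -[leLHS]ger0_norm ?normc_ge0// -sqrtr_sqr ler_sqrt; last first.
  by rewrite sumr_ge0// => i _; exact: sqr_ge0.
by rewrite (bigD1 j)//= lerDl sumr_ge0// => i _; exact: sqr_ge0.
Qed.

Lemma normc_dot_le2 u v : 2 * normc (dot u v) <= enorm u ^+ 2 + enorm v ^+ 2.
Proof.
have [c c1 cE] := complex_norm_unit (dot u v).
have := sqr_ge0 (enorm (c *: u - v)); rewrite enormB_sqr dotZl cE.
have -> : enorm (c *: u) ^+ 2 = normc c ^+ 2 * enorm u ^+ 2.
  rewrite !enorm_sqr mulr_sumr; apply: eq_bigr => j _.
  by rewrite mxE normcMl exprMn.
have : normc c ^+ 2 * enorm u ^+ 2 <= enorm u ^+ 2.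
  by rewrite ler_piMl ?sqr_ge0// expr_le1// normc_ge0.
by lra.
Qed.

Lemma enormZ c u : enorm (c *: u) = normc c * enorm u.
Proof.
rewrite /enorm; under eq_bigr do rewrite mxE normcMl exprMn.
by rewrite -mulr_sumr sqrtrM ?sqr_ge0// sqrtr_sqr ger0_norm// normc_ge0.
Qed.

Lemma enorm0 : enorm (0 : Cn) = 0.
Proof. by rewrite -(scale0r (0 : Cn)) enormZ Normc.normc0 mul0r. Qed.

Lemma enorm_eq0 u : enorm u = 0 -> u = 0.
Proof.
move=> u0; apply/rowP => j; rewrite mxE; apply: Normc.eq0_normc.
by apply/eqP; rewrite eq_le normc_ge0 andbT -u0 normc_coor_le.
Qed.

Lemma normc_dot_le u v : normc (dot u v) <= enorm u * enorm v.
Proof.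
have [/enorm_eq0 ->|u0] := eqVneq (enorm u) 0.
  by rewrite -(scale0r (0 : Cn)) dotZl mul0r Normc.normc0 mulr_ge0 ?enorm_ge0.
have [/enorm_eq0 ->|v0] := eqVneq (enorm v) 0.
  by rewrite -(scale0r (0 : Cn)) dotZr conjc0 mul0r Normc.normc0 mulr_ge0 ?enorm_ge0.
have up : 0 < enorm u by rewrite lt_def u0 enorm_ge0.
have vp : 0 < enorm v by rewrite lt_def v0 enorm_ge0.
have := normc_dot_le2 ((enorm u)^-1%:C *: u) ((enorm v)^-1%:C *: v).
rewrite dotZl dotZr conjc_real !normcMl !enormZ !normc_real.
rewrite !ger0_norm ?invr_ge0 ?enorm_ge0// !mulVf// expr1n -mulr2n -[leRHS]mulr_natl.
by rewrite ler_pM2l// mulrA -invfM mulrC ler_pdivrMr ?mulr_gt0// mul1r.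
Qed.

Lemma enorm_add u v : enorm (u + v) <= enorm u + enorm v.
Proof.
rewrite -(@ler_pXn2r _ 2)// ?nnegrE ?addr_ge0 ?enorm_ge0// enormD_sqr.
have := le_trans (Re_le_normc _) (normc_dot_le u v).
by rewrite sqrrD -mulr_natl; lra.
Qed.

Lemma enormD_sqr_le u v : enorm (u + v) ^+ 2 <= 2 * enorm u ^+ 2 + 2 * enorm v ^+ 2.
Proof.
rewrite enormD_sqr; have := le_trans (ler_wpM2l _ (Re_le_normc (dot u v))) (normc_dot_le2 u v).
by move=> /(_ (ler0n _ _)); lra.
Qed.

Lemma enorm_coor u (p : R) j : (complex.Re (u ord0 j) - p) ^+ 2 <=
  enorm (u - p%:C *: delta_mx ord0 j) ^+ 2.
Proof.
have := normc_coor_le (u - p%:C *: delta_mx ord0 j) j.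
rewrite !mxE !eqxx mulr1 => h.
have {}h := le_trans (normc_Re _) h; rewrite ReD ReN/= in h.
by rewrite -(real_normK (num_real (_ - p))) ler_sqr ?nnegrE ?enorm_ge0.
Qed.

Lemma measurable_dot d (T : measurableType d) (f g : T -> Cn) :
  measurable_fun setT f -> measurable_fun setT g ->
  measurable_fun setT (fun x => dot (f x) (g x)).
Proof.
move=> mf mg; apply: measurable_csum => j; apply: measurable_cM.
  exact: (measurableT_comp (measurable_coor j) mf).
by apply: measurable_cJ; exact: (measurableT_comp (measurable_coor j) mg).
Qed.

Lemma measurable_enormf d (T : measurableType d) (f : T -> Cn) :
  measurable_fun setT f -> measurable_fun setT (fun x => enorm (f x)).
Proof. by move=> mf; apply: (measurableT_comp (@measurable_enorm R n)). Qed.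

Lemma measurable_rowB d (T : measurableType d) (f g : T -> Cn) :
  measurable_fun setT f -> measurable_fun setT g ->
  measurable_fun setT (fun x => f x - g x).
Proof.
move=> mf mg; apply: measurable_rowP => j; under eq_fun do rewrite !mxE.
by apply: measurable_cB; apply: (measurableT_comp (measurable_coor j)).
Qed.

(* Holomorphy along complex lines is all that the mean value property needs,
   and, unlike Fréchet differentiability, it passes to slices for free. *)
Definition line_holomorphic (F : Cn -> C) :=
  forall (x v : Cn) (c : C), differentiable (fun c : C => F (x + c *: v)) c.

Lemma entire_line_holomorphic F : entire F -> line_holomorphic F.
Proof.
move=> eF x v c; apply: differentiable_comp; last exact: eF.
exact: differentiableD.
Qed.

Lemma line_holomorphicM F G : line_holomorphic F -> line_holomorphic G ->
  line_holomorphic (fun z => F z * G z).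
Proof. by move=> hF hG x v c; exact: differentiableM. Qed.

Lemma line_holomorphic_shift F a : line_holomorphic F ->
  line_holomorphic (fun z => F (z + a)).
Proof.
move=> hF x v c.
rewrite (_ : (fun _ => _) = (fun c => F (x + a + c *: v))); first exact: hF.
by apply/funext => b; rewrite addrAC.
Qed.

Lemma line_holomorphic_cexp_dot u : line_holomorphic (fun z => cexp (dot z u)).
Proof.
move=> x v c; apply: differentiable_comp; last exact: differentiable_cexp.
rewrite (_ : (fun _ => _) = (fun c => dot x u + c * dot v u)).
  by apply: differentiableD => //; exact: differentiableM.
by apply/funext => b; rewrite dotDl dotZl.
Qed.

End hermitian.

Section mean_value.
Variable R : realType.
Local Notation C := R[i].
Local Notation leb n := (@lebesgueCn R n).

Lemma cons_row_line n (c : C) (x v : 'rV[C]_n) b :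
  cons_row (c, x + b *: v) = cons_row (c, x) + b *: cons_row (0, v).
Proof.
apply/rowP => i; rewrite !mxE; case: unliftP => [j _|_] /=; rewrite ?mxE//.
by rewrite mulr0 addr0.
Qed.

Lemma gaussC_cons n (g : R) c (z : 'rV[C]_n) :
  (expR (- g * enorm (cons_row (c, z)) ^+ 2))%:C =
  (expR (- g * normc c ^+ 2))%:C * (expR (- g * enorm z ^+ 2))%:C.
Proof. by rewrite enorm_cons_sqr mulrDr expRD rmorphM. Qed.

Lemma mulKfA (a b c : C) : a != 0 -> a^-1 * (a * b * c) = b * c.
Proof. by move=> a0; rewrite -mulrA mulKf. Qed.

(** Induction on the dimension: the Gaussian factors over the first coordinate, slices of [F] stay
    line-holomorphic, and the integral left over is that of [mean_valueC]. *)
Lemma mean_valueCn n (F : 'rV[C]_n -> C) (g : R) :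
  line_holomorphic F -> 0 < g -> measurable_fun setT F ->
  cintble (leb n) setT (fun z => (expR (- g * enorm z ^+ 2))%:C * F z) ->
  cint (leb n) setT (fun z => (expR (- g * enorm z ^+ 2))%:C * F z) =
  ((pi / g) ^+ n)%:C * F 0.
Proof.
move=> + g0; elim: n F => [|n IH] F hF mF iF.
  rewrite expr0 mul1r.
  have mG : measurable_fun setT (fun z => (expR (- g * enorm z ^+ 2))%:C * F z).
    by case: iF.
  have E0 : (expR (- g * enorm (0 : 'rV[C]_0) ^+ 2))%:C * F 0 = F 0.
    by rewrite enorm0 expr0n/= mulr0 expR0 mul1r.
  have Rd (h : 'rV[C]_0 -> R) : measurable_fun setT h -> \int[leb 0]_z h z = h 0.
    move=> mh; rewrite /Rintegral integral_dirac//; last exact/measurable_EFinP.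
    by rewrite diracT mul1e.
  rewrite -[RHS]E0; apply: complex_ext; rewrite [LHS]/= Rd//.
    exact: measurable_fun_Re.
  exact: measurable_fun_Im.
pose Phi c := (expR (- g * normc c ^+ 2))%:C * F (cons_row (c, 0)).
have gn0 (x : R) : (expR x)%:C != 0 :> C by rewrite (inj_eq (@complexI R)) gt_eqF ?expR_gt0.
have mcons c : measurable_fun setT (fun z : 'rV[C]_n => F (cons_row (c, z))).
  apply: (measurableT_comp mF); apply: (measurableT_comp (@measurable_cons_row R n)).
  by apply: measurable_fun_pair; [exact: measurable_cst|exact: measurable_id].
(* Fubini makes the slice at [c] integrable only for almost every [c], so the induction hypothesis
   yields an almost everywhere identity. *)
have inner : {ae @lebesgueC R, forall c, setT c ->
    cint (leb n) setT (fun z => (expR (- g * enorm (cons_row (c, z)) ^+ 2))%:C *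
      F (cons_row (c, z))) = ((pi / g) ^+ n)%:C * Phi c}.
  have := ae_cintble_cons iF; apply: filterS => c ic _.
  have ic' : cintble (leb n) setT (fun z => (expR (- g * enorm z ^+ 2))%:C *
      F (cons_row (c, z))).
    apply: eq_cintble (cintbleZ ((expR (- g * normc c ^+ 2))%:C)^-1 measurableT ic) => z.
    exact: etrans (congr1 (fun w => _ * (w * _)) (gaussC_cons g c z)) (mulKfA _ _ (gn0 _)).
  rewrite (@eq_cint _ _ _ _ _ _ (fun z => (expR (- g * normc c ^+ 2))%:C *
    ((expR (- g * enorm z ^+ 2))%:C * F (cons_row (c, z))))); last first.
    move=> z _.
    exact: etrans (congr1 (fun w => w * _) (gaussC_cons g c z)) (esym (mulrA _ _ _)).
  rewrite (cintZ _ measurableT ic') (IH (fun z => F (cons_row (c, z))))//; first exact: mulrCA.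
  move=> x v b.
  rewrite (_ : (fun _ => _) = (fun b => F (cons_row (c, x) + b *: cons_row (0, v)))).
    exact: hF.
  by apply/funext => d; rewrite cons_row_line.
have mcons0 : measurable_fun setT (fun c : C => F (cons_row (c, 0))).
  apply: (measurableT_comp mF); apply: (measurableT_comp (@measurable_cons_row R n)).
  by apply: measurable_fun_pair; [exact: measurable_id|exact: measurable_cst].
have mPhi : measurable_fun setT Phi.
  apply: measurable_cM => //; apply: measurable_cR; apply: measurableT_comp => //.
  apply: measurable_funM; first exact: measurable_cst.
  by apply: measurable_funX; apply: measurable_normc; exact: measurable_id.
have pn0 : ((pi / g) ^+ n)%:C != 0 :> C.
  by rewrite (inj_eq (@complexI R)) expf_neq0// gt_eqF// divr_gt0// pi_gt0.
have [mI fI] := cintble_cons iF.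
(* Integrability of the one-variable integrand is inherited from the iterated integral, after
   division by a nonzero constant. *)
have iPhi : cintble (@lebesgueC R) setT Phi.
  have : cintble (@lebesgueC R) setT (fun c => ((pi / g) ^+ n)%:C * Phi c).
    split; first exact: measurable_cZ.
    apply: le_lt_trans fI; rewrite le_eqVlt; apply/orP; left; apply/eqP.
    apply: ae_eq_integral => //.
    + by apply/measurable_EFinP/measurable_normc/measurable_cZ.
    + by apply/measurable_EFinP/measurable_normc.
    + by apply: filterS inner => c /[apply] ->.
  move=> /(cintbleZ ((pi / g) ^+ n)%:C^-1 measurableT).
  by apply: eq_cintble => c; rewrite (mulKf pn0).
rewrite cint_cons// (@cint_eq_ae _ _ _ _ _ _ (fun c => ((pi / g) ^+ n)%:C * Phi c))//;
  last exact: measurable_cZ.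
rewrite cintZ// mean_valueC//; last first.
  move=> w; have := hF (cons_row (0, 0)) (cons_row (1, 0)) w.
  rewrite (_ : (fun _ => _) = (fun c => F (cons_row (c, 0))))//.
  apply/funext => c; congr F; apply/rowP => i; rewrite !mxE.
  by case: unliftP => [j _|_] /=; rewrite ?mxE ?mulr0 ?add0r ?mulr1.
rewrite mulrA -rmorphM -exprSr; congr (_ * F _).
by apply/rowP => i; rewrite !mxE; case: unliftP => [j _|_]; rewrite ?mxE.
Qed.

(** Translating by [a = u / g] completes the square: the antiholomorphic exponential is absorbed,
    and the factor left over, [cexp (dot z (- u))], is holomorphic and equal to 1 at 0, so the mean
    value property applies. This single formula yields the reproducing property of the Fock kernel,
    the Toeplitz operator of a bump symbol, and its heat transform. *)
Lemma reproducing n (F : 'rV[C]_n -> C) (g : R) (u : 'rV[C]_n) :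
  line_holomorphic F -> 0 < g -> measurable_fun setT F ->
  cintble (leb n) setT (fun z => (expR (- g * enorm z ^+ 2))%:C * cexp (dot u z) * F z) ->
  cint (leb n) setT (fun z => (expR (- g * enorm z ^+ 2))%:C * cexp (dot u z) * F z) =
  ((pi / g) ^+ n)%:C * F ((g^-1)%:C *: u).
Proof.
move=> hF g0 mF iF; pose a := (g^-1)%:C *: u.
have uE : u = g%:C *: a.
  by rewrite /a scalerA -rmorphM divff ?gt_eqF// scale1r.
have E z : (expR (- g * enorm (z + a) ^+ 2))%:C * cexp (dot u (z + a)) * F (z + a) =
    (expR (- g * enorm z ^+ 2))%:C * (cexp (dot z (- u)) * F (z + a)).
  have e1 w : (- g * enorm w ^+ 2)%:C = - g%:C * dot w w.
    by rewrite dot_enorm rmorphM rmorphN.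
  rewrite -!cexp_real !e1 !mulrA -!cexpD; congr (cexp _ * _).
  move: a uE => b ->.
  by rewrite dotDl !dotDr dotNr !dotZl !dotZr !conjc_real; ring.
rewrite -(cint_shift a iF); have iF' := eq_cintble E (cintble_shift a iF).
refine (etrans (@eq_cint _ _ _ _ setT _ _ (fun z _ => E z)) _).
rewrite mean_valueCn//.
- by rewrite add0r -(scale0r u) dotZl mul0r cexp0 mul1r.
- by apply: line_holomorphicM; [exact: line_holomorphic_cexp_dot|exact: line_holomorphic_shift].
- apply: measurable_cM; last by have [ms _] := lebesgueCn_shift a; apply: (measurableT_comp mF).
  by apply: measurable_cexp; apply: measurable_dot; [exact: measurable_id|exact: measurable_cst].
Qed.

End mean_value.

(** * Schur's test *)

Section integral_tools.
Context d (T : measurableType d) (R : realType) (mu : {measure set T -> \bar R}).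

Lemma cauchy_schwarz (a b : T -> R) : measurable_fun setT a -> measurable_fun setT b ->
  (forall x, 0 <= a x) -> (forall x, 0 <= b x) ->
  ((\int[mu]_x (a x * b x)%:E) * (\int[mu]_x (a x * b x)%:E) <=
   (\int[mu]_x (a x ^+ 2)%:E) * (\int[mu]_x (b x ^+ 2)%:E))%E.
Proof.
move=> ma mb a0 b0.
have h2 : (2%R : R)^-1 + 2%R^-1 = 1 by rewrite -mulr2n -[_ *+ 2]mulr_natr mulVf.
have sqr (x : \bar R) : (0 <= x)%E -> (x `^ 2 = x * x)%E.
  move=> x0; have := @poweRD R x 1 1; rewrite /poweRD_def !poweRe1// => <-//.
  by rewrite -(natrD R 1 1) pnatr_eq0.
have sq (f : T -> R) : ('N[mu]_2%:E[EFin \o f] * 'N[mu]_2%:E[EFin \o f] =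
    \int[mu]_x (f x ^+ 2)%:E)%E.
  rewrite -sqr ?Lnorm_ge0// poweR_Lnorm//; apply: eq_integral => x _.
  by rewrite /= powR_mulrn// real_normK// num_real.
have := hoelder mu ma mb (ltr0n _ 2) (ltr0n _ 2) h2.
rewrite Lnorm1; under eq_integral do rewrite /= ger0_norm ?mulr_ge0//.
move=> h; rewrite -(sq a) -(sq b) muleACA; apply: lee_pmul => //.
  by apply: integral_ge0 => x _; rewrite lee_fin mulr_ge0.
by apply: integral_ge0 => x _; rewrite lee_fin mulr_ge0.
Qed.

Lemma ge0_integrable (f : T -> R) : measurable_fun setT f -> (forall x, 0 <= f x) ->
  (\int[mu]_x (f x)%:E < +oo)%E -> mu.-integrable setT (fun x => (f x)%:E).
Proof.
move=> mf f0 foo; apply/integrableP; split; first exact/measurable_EFinP.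
by under eq_integral do rewrite gee0_abs ?lee_fin//.
Qed.

Lemma le_ge0_integrable (f g : T -> R) : measurable_fun setT f ->
  (forall x, 0 <= f x) -> (forall x, f x <= g x) ->
  mu.-integrable setT (fun x => (g x)%:E) -> mu.-integrable setT (fun x => (f x)%:E).
Proof.
move=> mf f0 fg ig; apply: le_integrable ig => //; first exact/measurable_EFinP.
by move=> x _; rewrite /= lee_fin !ger0_norm// (le_trans (f0 x)).
Qed.

Lemma integrable_scale (k : R) (f : T -> R) :
  mu.-integrable setT (fun x => (f x)%:E) ->
  mu.-integrable setT (fun x => (k * f x)%:E).
Proof. exact: (@integrable_mull _ T R mu setT k f measurableT). Qed.

Lemma integrable_add (f g : T -> R) :
  mu.-integrable setT (fun x => (f x)%:E) -> mu.-integrable setT (fun x => (g x)%:E) ->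
  mu.-integrable setT (fun x => (f x + g x)%:E).
Proof. by move=> fi gi; exact: (integrableD measurableT fi gi). Qed.

End integral_tools.

Section measurable_section_integral.
Context d1 d2 (T1 : measurableType d1) (T2 : measurableType d2) (R : realType).
Variable m2 : {sigma_finite_measure set T2 -> \bar R}.

(** Positive and negative parts are treated separately by Tonelli. This is what makes the images
    under kernel operators measurable. *)
Lemma measurable_Rintegral_section (h : T1 * T2 -> R) : measurable_fun setT h ->
  measurable_fun setT (fun x => \int[m2]_y h (x, y)).
Proof.
move=> mh; have mhE : measurable_fun setT (EFin \o h) by exact/measurable_EFinP.
rewrite /Rintegral; apply: measurableT_comp => //.
have -> : (fun x => \int[m2]_y (h (x, y))%:E)%E = (fun x =>
    \int[m2]_y (EFin \o h)^\+ (x, y) - \int[m2]_y (EFin \o h)^\- (x, y))%E.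
  apply/funext => x; rewrite integralE.
  by congr (_ - _)%E; apply: eq_integral => y _; rewrite ?funeposE ?funenegE.
have key (k : T1 * T2 -> \bar R) : measurable_fun setT k -> (forall p, 0 <= k p)%E ->
    measurable_fun setT (fun x => \int[m2]_y k (x, y))%E.
  by move=> mk k0; exact: (measurable_fun_fubini_tonelli_F k).
apply: emeasurable_funB.
  exact: (key _ (measurable_funepos mhE) (funepos_ge0 _)).
exact: (key _ (measurable_funeneg mhE) (funeneg_ge0 _)).
Qed.

Lemma measurable_cint_section (f : T1 * T2 -> R[i]) : measurable_fun setT f ->
  measurable_fun setT (fun x => cint m2 setT (fun y => f (x, y))).
Proof.
move=> mf; apply: measurable_fun_complex.
  exact: (measurable_Rintegral_section (measurable_fun_Re mf)).
exact: (measurable_Rintegral_section (measurable_fun_Im mf)).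
Qed.

End measurable_section_integral.

Section schur_test.
Context d (T : measurableType d) (R : realType).
Variable mu : {sigma_finite_measure set T -> \bar R}.

(** Cauchy-Schwarz for [k F = sqrt k * (sqrt k F)] gives [H^2 <= A * int k F^2], and Tonelli then
    uses the other marginal. [H] is only dominated by an integral, which suits the moduli of complex
    kernel operators. *)
Lemma schur_test (k : T * T -> R) (F H : T -> R) (A : R) :
  measurable_fun setT k -> (forall p, 0 <= k p) -> 0 <= A ->
  (forall w, \int[mu]_z (k (w, z))%:E <= A%:E)%E ->
  (forall z, \int[mu]_w (k (w, z))%:E <= A%:E)%E ->
  measurable_fun setT F -> (forall z, 0 <= F z) ->
  measurable_fun setT H -> (forall z, 0 <= H z) ->
  (forall w, (H w)%:E <= \int[mu]_z (k (w, z) * F z)%:E)%E ->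
  (\int[mu]_w (H w ^+ 2)%:E <= (A ^+ 2)%:E * \int[mu]_z (F z ^+ 2)%:E)%E.
Proof.
move=> mk k0 A0 kA kA' mF F0 mH H0 HF.
have mkz w : measurable_fun setT (fun z => k (w, z)).
  by apply: measurableT_comp => //; exact: measurable_pair1.
have mkw z : measurable_fun setT (fun w => k (w, z)).
  by apply: measurableT_comp => //; exact: measurable_pair2.
have msq (u : T -> R) : measurable_fun setT u -> measurable_fun setT (fun z => Num.sqrt (u z)).
  move=> mu'; apply: measurableT_comp mu'.
  exact: (continuous_measurable_fun (@sqrt_continuous R)).
have mF2 : measurable_fun setT (fun z => (F z ^+ 2)%:E).
  by apply/measurable_EFinP/measurable_funX.
pose K (p : T * T) := (k p * F p.2 ^+ 2)%:E.
have mK : measurable_fun setT K.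
  apply/measurable_EFinP/measurable_funM => //; apply: measurable_funX.
  by apply: (measurableT_comp mF); exact: measurable_snd.
have K0 p : (0 <= K p)%E by rewrite lee_fin mulr_ge0 ?sqr_ge0.
pose In w := (\int[mu]_z K (w, z))%E.
have mIn : measurable_fun setT In by exact: (measurable_fun_fubini_tonelli_F K).
have In0 w : (0 <= In w)%E by apply: integral_ge0.
have step w : ((H w ^+ 2)%:E <= A%:E * In w)%E.
  have cs := cauchy_schwarz mu (msq _ (mkz w))
    (measurable_funM (msq _ (mkz w)) mF) (fun z => sqrtr_ge0 _)
    (fun z => mulr_ge0 (sqrtr_ge0 _) (F0 z)).
  rewrite (eq_integral (fun z => (k (w, z) * F z)%:E)) in cs; last first.
    by move=> z _; rewrite /= mulrA -expr2 sqr_sqrtr.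
  rewrite [X in (_ <= X * _)%E](eq_integral (fun z => (k (w, z))%:E)) in cs; last first.
    by move=> z _; rewrite sqr_sqrtr.
  rewrite [X in (_ <= _ * X)%E](eq_integral (fun z => K (w, z))) in cs; last first.
    by move=> z _; rewrite /= exprMn sqr_sqrtr.
  rewrite expr2 EFinM.
  apply: (@le_trans _ _ (\int[mu]_z (k (w, z) * F z)%:E *
     \int[mu]_z (k (w, z) * F z)%:E)%E).
    by apply: lee_pmul => //; rewrite lee_fin.
  by apply: (le_trans cs); apply: lee_wpmul2r; [exact: In0|exact: kA].
apply: (@le_trans _ _ (\int[mu]_w (A%:E * In w))%E).
  apply: ge0_le_integral => //.
  - by move=> w _; rewrite lee_fin sqr_ge0.
  - by apply/measurable_EFinP/measurable_funX.
  - exact: (measurable_funeM A%:E mIn).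
rewrite (ge0_integralZl_EFin mu measurableT (fun w _ => In0 w) mIn A0).
rewrite expr2 EFinM -muleA; apply: lee_wpmul2l; first by rewrite lee_fin.
rewrite /In (fubini_tonelli K)// -ge0_integralZl_EFin//; last first.
  by move=> z _; rewrite lee_fin sqr_ge0.
apply: ge0_le_integral => //=.
- by move=> z _; apply: integral_ge0.
- exact: (measurable_fun_fubini_tonelli_G K).
- exact: (measurable_funeM A%:E mF2).
move=> z _; rewrite /K /=; under eq_integral do rewrite mulrC EFinM.
rewrite ge0_integralZl_EFin ?sqr_ge0//; first last.
- exact/measurable_EFinP.
- by move=> w _; rewrite lee_fin.
by rewrite muleC; apply: lee_wpmul2r; rewrite ?lee_fin ?sqr_ge0.
Qed.

End schur_test.

(** * Gaussian weights and the norm of L^2(mu) *)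

Section gaussian_weights.
Variables (R : realType) (n : nat).
Local Notation C := R[i].
Local Notation Cn := 'rV[C]_n.
Local Notation leb := (@lebesgueCn R n).
Implicit Types (f h : Cn -> C) (z w a : Cn) (g c : R).

Lemma gaussE z : gaussian z = (2 * pi) ^- n * expR (- (2^-1) * enorm z ^+ 2).
Proof. by rewrite /gaussian !mulNr [_ ^+ 2 / 2]mulrC. Qed.

Lemma gaussian_gt0 z : 0 < gaussian z.
Proof. by rewrite mulr_gt0 ?expR_gt0// invr_gt0 exprn_gt0// mulr_gt0// pi_gt0. Qed.

Lemma gaussian_ge0 z : 0 <= gaussian z.
Proof. exact/ltW/gaussian_gt0. Qed.

Lemma twopi_ge0 : 0 <= (2 * pi) ^- n :> R.
Proof. by rewrite invr_ge0 exprn_ge0// mulr_ge0// pi_ge0. Qed.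

Lemma measurable_expR_enorm d (T : measurableType d) g (p : T -> Cn) :
  measurable_fun setT p -> measurable_fun setT (fun x => expR (g * enorm (p x) ^+ 2)).
Proof.
move=> mp; apply: measurableT_comp => //; apply: measurable_funM; first exact: measurable_cst.
by apply: measurable_funX; exact: measurable_enormf.
Qed.

Lemma measurable_gaussian : measurable_fun setT (@gaussian R n).
Proof.
rewrite (funext gaussE).
by apply: measurable_funM; [exact: measurable_cst|exact: measurable_expR_enorm].
Qed.

Lemma gauss_integrable g a : 0 < g ->
  leb.-integrable setT (fun z => (expR (- g * enorm (z - a) ^+ 2))%:E).
Proof.
move=> g0; apply: ge0_integrable.
- apply: measurable_expR_enorm; apply: measurable_rowB; first exact: measurable_id.
  exact: measurable_cst.
- by move=> z; exact: expR_ge0.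
- by rewrite gauss_integralCn// ltry.
Qed.

Lemma gauss_integrable0 g : 0 < g ->
  leb.-integrable setT (fun z => (expR (- g * enorm z ^+ 2))%:E).
Proof. by move=> /(gauss_integrable 0); under eq_fun do rewrite subr0. Qed.

Definition sqnorm f : \bar R := (\int[leb]_z (normc (f z) ^+ 2 * gaussian z)%:E)%E.

Lemma sqnorm_ge0 f : (0 <= sqnorm f)%E.
Proof.
by apply: integral_ge0 => z _; rewrite lee_fin mulr_ge0 ?sqr_ge0 ?gaussian_ge0.
Qed.

Lemma L2norm_ge0 f : (0 <= L2norm f)%E. Proof. exact: poweR_ge0. Qed.

Lemma L2norm_le f c : 0 <= c -> (L2norm f <= c%:E)%E = (sqnorm f <= (c ^+ 2)%:E)%E.
Proof.
move=> c0; rewrite /L2norm -/(sqnorm f).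
case: (sqnorm f) (sqnorm_ge0 f) => [r|_|//]; last by rewrite poweRyr// !leye_eq.
rewrite lee_fin => r0; rewrite poweR_EFin powR12_sqrt// !lee_fin.
rewrite -[X in _ <= X]ger0_norm// -sqrtr_sqr; apply/idP/idP => [|h].
  by rewrite ler_sqrt ?sqr_ge0.
by rewrite ler_sqrt ?sqr_ge0.
Qed.

Lemma L2norm_eqvE f : (L2norm f < +oo)%E = (sqnorm f < +oo)%E.
Proof.
rewrite /L2norm -/(sqnorm f); apply/idP/idP; first by apply: lty_poweRy; rewrite invr_neq0.
exact: poweR_lty.
Qed.

Lemma L2E f : L2 f <-> measurable_fun setT f /\ (sqnorm f < +oo)%E.
Proof. by rewrite /L2 L2norm_eqvE. Qed.

Lemma sqnormE f : sqnorm f = (L2norm f * L2norm f)%E.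
Proof.
rewrite /L2norm -/(sqnorm f).
case: (sqnorm f) (sqnorm_ge0 f) => [r|_|//]; last by rewrite poweRyr.
rewrite lee_fin => r0.
by rewrite poweR_EFin powR12_sqrt// -EFinM -expr2 sqr_sqrtr.
Qed.

Lemma measurable_sqnormf f : measurable_fun setT f ->
  measurable_fun setT (fun z => normc (f z) ^+ 2 * gaussian z).
Proof.
move=> mf; apply: measurable_funM; last exact: measurable_gaussian.
by apply: measurable_funX; exact: measurable_normc.
Qed.

Lemma sqnorm_integrable f : L2 f ->
  leb.-integrable setT (fun z => (normc (f z) ^+ 2 * gaussian z)%:E).
Proof.
move=> /L2E[mf foo]; apply: ge0_integrable => //; first exact: measurable_sqnormf.
by move=> z; rewrite mulr_ge0 ?sqr_ge0 ?gaussian_ge0.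
Qed.

Lemma L2_le f (p : Cn -> R) : measurable_fun setT f ->
  leb.-integrable setT (fun z => (p z)%:E) ->
  (forall z, normc (f z) ^+ 2 * gaussian z <= p z) -> L2 f.
Proof.
move=> mf ip fp; apply/L2E; split=> //.
have : leb.-integrable setT (fun z => (normc (f z) ^+ 2 * gaussian z)%:E).
  apply: le_ge0_integrable ip => //; first exact: measurable_sqnormf.
  by move=> z; rewrite mulr_ge0 ?sqr_ge0 ?gaussian_ge0.
by move=> /(integrable_lty measurableT).
Qed.

Lemma expo_gauss_le c z : expR (c * enorm z) * expR (- (2^-1) * enorm z ^+ 2) <=
  expR (c ^+ 2) * expR (- (4^-1) * enorm z ^+ 2).
Proof.
rewrite -!expRD ler_expR; have := sqr_ge0 (enorm z / 2 - c).
by rewrite sqrrB; lra.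
Qed.

(** The product is split by [a b <= a^2 + b^2], and half of the Gaussian exponent absorbs the
    exponential. It makes integrals against kernels of exponential growth in [z] converge
    ([kernel_cintble_expo]). *)
Lemma L2_expo_integrable f c : L2 f ->
  leb.-integrable setT (fun z => (normc (f z) * expR (c * enorm z) * gaussian z)%:E).
Proof.
move=> Lf; have [mf _] := Lf.
apply: (@le_ge0_integrable _ _ _ _ _ (fun z => normc (f z) ^+ 2 * gaussian z +
   ((2 * pi) ^- n * expR ((2 * c) ^+ 2)) * expR (- (4^-1) * enorm z ^+ 2))).
- apply: measurable_funM; last exact: measurable_gaussian.
  apply: measurable_funM; first exact: measurable_normc.
  apply: measurableT_comp => //; apply: measurable_funM; first exact: measurable_cst.
  exact: measurable_enorm.
- by move=> z; rewrite mulr_ge0 ?gaussian_ge0// mulr_ge0 ?normc_ge0 ?expR_ge0.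
- move=> z; have := expo_gauss_le (2 * c) z.
  have -> : expR (2 * c * enorm z) = expR (c * enorm z) ^+ 2.
    by rewrite -mulrA expRM_natl.
  have g0 := gaussian_ge0 z; rewrite gaussE in g0 *.
  set e := expR (c * enorm z); set q := expR (- 2^-1 * _); set k := (2 * pi) ^- n in g0 *.
  move=> le1; have k0 : 0 <= k := twopi_ge0.
  have le2 := ler_wpM2l k0 le1.
  have : normc (f z) * e <= normc (f z) ^+ 2 + e ^+ 2.
    by have := sqr_ge0 (normc (f z) - e); have := sqr_ge0 (normc (f z) + e);
      rewrite sqrrB sqrrD; lra.
  move=> /(ler_wpM2r g0) => /le_trans; apply.
  rewrite mulrDl lerD2l -[leRHS]mulrA; apply: le_trans le2.
  by rewrite mulrCA; exact: lexx.
- apply: integrable_add; first exact: sqnorm_integrable.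
  apply: integrable_scale; apply: gauss_integrable0; rewrite invr_gt0; exact: ltr0n.
Qed.

(** Multiplying by the square root of the weight turns [L^2(mu)] into unweighted [L^2], up to the
    constant [(2 pi)^-n]. In this picture the modulus of the Fock kernel becomes the
    translation-invariant [heat_kernel], so Schur's test only sees Gaussians. *)
Definition damped f z : R := normc (f z) * expR (- (4^-1) * enorm z ^+ 2).

Lemma damped_ge0 f z : 0 <= damped f z.
Proof. by rewrite mulr_ge0 ?normc_ge0 ?expR_ge0. Qed.

Lemma measurable_damped f : measurable_fun setT f -> measurable_fun setT (damped f).
Proof.
move=> mf; apply: measurable_funM; first exact: measurable_normc.
by apply: measurable_expR_enorm; exact: measurable_id.
Qed.

Lemma damped_sqr f z : normc (f z) ^+ 2 * gaussian z = (2 * pi) ^- n * damped f z ^+ 2.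
Proof.
rewrite gaussE /damped.
have -> : expR (- (2^-1) * enorm z ^+ 2) = expR (- (4^-1) * enorm z ^+ 2) ^+ 2.
  by rewrite -expRM_natl; congr expR; field.
by ring.
Qed.

Lemma sqnorm_damped f : measurable_fun setT f ->
  sqnorm f = (((2 * pi) ^- n)%:E * \int[leb]_z (damped f z ^+ 2)%:E)%E.
Proof.
move=> mf; have mf2 : measurable_fun setT (fun z => (damped f z ^+ 2)%:E).
  by apply/measurable_EFinP; apply: measurable_funX; exact: measurable_damped.
rewrite -(ge0_integralZl_EFin leb measurableT _ mf2 twopi_ge0).
  by apply: eq_integral => z _; rewrite damped_sqr.
by move=> z _; rewrite lee_fin sqr_ge0.
Qed.

Lemma sqnorm_schur (k : Cn * Cn -> R) (f h : Cn -> C) (A : R) :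
  measurable_fun setT k -> (forall p, 0 <= k p) -> 0 <= A ->
  (forall w, \int[leb]_z (k (w, z))%:E <= A%:E)%E ->
  (forall z, \int[leb]_w (k (w, z))%:E <= A%:E)%E ->
  measurable_fun setT f -> measurable_fun setT h ->
  (forall w, (damped h w)%:E <= \int[leb]_z (k (w, z) * damped f z)%:E)%E ->
  (sqnorm h <= (A ^+ 2)%:E * sqnorm f)%E.
Proof.
move=> mk k0 A0 kA kA' mf mh hf.
have := schur_test mk k0 A0 kA kA' (measurable_damped mf) (damped_ge0 f)
  (measurable_damped mh) (damped_ge0 h) hf.
rewrite (sqnorm_damped mf) (sqnorm_damped mh) muleCA => le.
by apply: lee_wpmul2l => //; rewrite lee_fin twopi_ge0.
Qed.

End gaussian_weights.

(** * The Bergman projection *)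

Section kernel_operators.
Variables (R : realType) (n : nat).
Local Notation C := R[i].
Local Notation Cn := 'rV[C]_n.
Local Notation leb := (@lebesgueCn R n).
Implicit Types (f h : Cn -> C) (z w v a : Cn) (kap : Cn * Cn -> C).

Definition kernel_op kap f w : C :=
  cint leb setT (fun z => f z * kap (w, z) * (gaussian z)%:C).

Definition kernel_cintble kap f := forall w,
  cintble leb setT (fun z => f z * kap (w, z) * (gaussian z)%:C).

Lemma measurable_kernel kap f : measurable_fun setT kap -> measurable_fun setT f ->
  measurable_fun setT (fun p => f p.2 * kap p * (gaussian p.2)%:C).
Proof.
move=> mk mf; apply: measurable_cM.
  by apply: measurable_cM => //; apply: (measurableT_comp mf); exact: measurable_snd.
by apply: measurable_cR; apply: (measurableT_comp (@measurable_gaussian R n)); exact: measurable_snd.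
Qed.

Lemma measurable_kernel_op kap f : measurable_fun setT kap -> measurable_fun setT f ->
  measurable_fun setT (kernel_op kap f).
Proof.
by move=> mk mf; exact: (measurable_cint_section leb (measurable_kernel mk mf)).
Qed.

Lemma kernel_opD kap f g : kernel_cintble kap f -> kernel_cintble kap g ->
  forall w, kernel_op kap (fun z => f z + g z) w = kernel_op kap f w + kernel_op kap g w.
Proof.
move=> fi gi w; rewrite -(cintD measurableT (fi w) (gi w)).
by apply: eq_cint => z _; rewrite -!mulrA mulrDl.
Qed.

Lemma kernel_opZ kap c f : kernel_cintble kap f ->
  forall w, kernel_op kap (fun z => c * f z) w = c * kernel_op kap f w.
Proof.
move=> fi w; rewrite -(cintZ c measurableT (fi w)).
by apply: eq_cint => z _; rewrite -!mulrA.
Qed.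

Lemma kernel_cintble_expo kap f : L2 f -> measurable_fun setT kap ->
  (forall w, exists K c : R, forall z, normc (kap (w, z)) <= K * expR (c * enorm z)) ->
  kernel_cintble kap f.
Proof.
move=> Lf mk kb w; have [K [c kc]] := kb w; have [mf _] := Lf.
have ig := integrable_scale K (L2_expo_integrable c Lf).
apply: (le_cintble measurableT _ ig).
  apply: measurable_cM.
    apply: measurable_cM => //; apply: measurableT_comp => //; exact: measurable_pair1.
  by apply: measurable_cR; exact: measurable_gaussian.
move=> z _; rewrite !normcMl normc_real (ger0_norm (gaussian_ge0 z)).
rewrite [leRHS](_ : _ = normc (f z) * (K * expR (c * enorm z)) * gaussian z); last by ring.
by rewrite ler_wpM2r ?gaussian_ge0// ler_wpM2l ?normc_ge0// kc.
Qed.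

(** Schur's test in the unweighted picture: [k] majorizes the kernel flanked by two half-weights,
    and the other half of the weight at [z] goes into [damped f]. *)
Lemma sqnorm_kernel_op kap (k : Cn * Cn -> R) f (A : R) :
  measurable_fun setT kap -> measurable_fun setT k -> (forall p, 0 <= k p) -> 0 <= A ->
  (forall w, \int[leb]_z (k (w, z))%:E <= A%:E)%E ->
  (forall z, \int[leb]_w (k (w, z))%:E <= A%:E)%E ->
  (forall w z, (2 * pi) ^- n * normc (kap (w, z)) * expR (- (4^-1) * enorm w ^+ 2)
     * expR (- (4^-1) * enorm z ^+ 2) <= k (w, z)) ->
  L2 f -> kernel_cintble kap f ->
  (sqnorm (kernel_op kap f) <= (A ^+ 2)%:E * sqnorm f)%E.
Proof.
move=> mkap mk k0 A0 kA kA' kk Lf fi; have [mf _] := Lf.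
have mT := measurable_kernel_op mkap mf.
apply: (sqnorm_schur mk k0 A0 kA kA' mf mT) => w.
set e := expR (- (4^-1) * enorm w ^+ 2).
have e0 : 0 <= e by exact: expR_ge0.
have mn : measurable_fun setT (fun z => (normc (f z * kap (w, z) * (gaussian z)%:C))%:E).
  by apply/measurable_EFinP/measurable_normc; have [] := fi w.
rewrite /damped EFinM muleC.
apply: (@le_trans _ _ (e%:E * \int[leb]_z (normc (f z * kap (w, z) * (gaussian z)%:C))%:E)%E).
  by apply: lee_wpmul2l; rewrite ?lee_fin//; exact: (normc_cint measurableT (fi w)).
rewrite -(ge0_integralZl_EFin leb measurableT _ mn e0); last first.
  by move=> z _; rewrite lee_fin normc_ge0.
apply: ge0_le_integral.
- exact: measurableT.
- by move=> z _; rewrite lee_fin mulr_ge0 ?normc_ge0.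
- exact: (measurable_funeM e%:E mn).
- apply/measurable_EFinP/measurable_funM; last exact: measurable_damped.
  by apply: measurableT_comp => //; exact: measurable_pair1.
move=> z _; rewrite -EFinM lee_fin !normcMl normc_real (ger0_norm (gaussian_ge0 z)).
have d0 := damped_ge0 f z; have := ler_wpM2r d0 (kk w z); rewrite -/e; apply: le_trans.
rewrite gaussE /damped.
have -> : expR (- (2^-1) * enorm z ^+ 2) = expR (- (4^-1) * enorm z ^+ 2) ^+ 2.
  by rewrite -expRM_natl; congr expR; field.
by rewrite le_eqVlt; apply/orP; left; apply/eqP; ring.
Qed.

End kernel_operators.

Section bergman.
Variables (R : realType) (n : nat).
Local Notation C := R[i].
Local Notation Cn := 'rV[C]_n.
Local Notation leb := (@lebesgueCn R n).
Implicit Types (f h : Cn -> C) (z w v a x : Cn).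

Definition fock_kernel (p : Cn * Cn) : C := cexp ((2^-1)%:C * dot p.1 p.2).

Definition berg h : Cn -> C := kernel_op fock_kernel h.

Lemma measurable_fock_kernel : measurable_fun setT fock_kernel.
Proof.
apply: measurable_cexp; apply: measurable_cZ; apply: measurable_dot.
  exact: measurable_fst.
exact: measurable_snd.
Qed.

Lemma normc_fock_kernel w z :
  normc (fock_kernel (w, z)) = expR (2^-1 * complex.Re (dot w z)).
Proof. by rewrite normc_cexp ReM/= mul0r subr0. Qed.

Lemma normc_fock_kernel_le w z :
  normc (fock_kernel (w, z)) <= expR (2^-1 * enorm w * enorm z).
Proof.
rewrite normc_fock_kernel ler_expR -mulrA ler_wpM2l ?invr_ge0//.
exact: le_trans (Re_le_normc _) (normc_dot_le _ _).
Qed.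

Lemma fock_kernel_cintble h : L2 h -> kernel_cintble fock_kernel h.
Proof.
move=> Lh; apply: kernel_cintble_expo => //; first exact: measurable_fock_kernel.
by move=> w; exists 1, (2^-1 * enorm w) => z; rewrite mul1r normc_fock_kernel_le.
Qed.

Definition heat_kernel (p : Cn * Cn) : R :=
  (2 * pi) ^- n * expR (- (4^-1) * enorm (p.2 - p.1) ^+ 2).

Lemma measurable_heat_kernel : measurable_fun setT heat_kernel.
Proof.
apply: measurable_funM; first exact: measurable_cst.
apply: measurable_expR_enorm; apply: measurable_rowB.
  exact: measurable_snd.
exact: measurable_fst.
Qed.

Lemma heat_kernel_ge0 p : 0 <= heat_kernel p.
Proof. by rewrite mulr_ge0 ?twopi_ge0 ?expR_ge0. Qed.

Lemma integral_scaled_gauss (g c : R) a : 0 < g -> 0 <= c ->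
  (\int[leb]_z (c * expR (- g * enorm (z - a)%R ^+ 2))%:E = (c * (pi / g) ^+ n)%:E)%E.
Proof.
move=> g0 c0.
have mg : measurable_fun setT (fun z => (expR (- g * enorm (z - a) ^+ 2))%:E).
  have /measurable_int := gauss_integrable a g0; exact.
have := ge0_integralZl_EFin leb measurableT _ mg c0.
rewrite gauss_integralCn// -EFinM => <-.
  by apply: eq_integral => z _; rewrite EFinM.
by move=> z _; rewrite lee_fin expR_ge0.
Qed.

Lemma twopi_four : (2 * pi) ^- n * (pi / 4^-1) ^+ n = 2 ^+ n :> R.
Proof.
have pin : (pi : R) != 0 by rewrite gt_eqF ?pi_gt0.
have key (x : R) : x != 0 -> (2 * x)^-1 * (x / 4^-1) = 2 by move=> x0; field.
by rewrite -exprVn -exprMn key.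
Qed.

Lemma integral_heat_kernel1 w : (\int[leb]_z (heat_kernel (w, z))%:E = (2 ^+ n)%:E)%E.
Proof. by rewrite integral_scaled_gauss ?invr_gt0 ?twopi_ge0// twopi_four. Qed.

Lemma integral_heat_kernel2 z : (\int[leb]_w (heat_kernel (w, z))%:E = (2 ^+ n)%:E)%E.
Proof.
rewrite -(integral_heat_kernel1 z); apply: eq_integral => w _.
by rewrite /heat_kernel/= enorm_distC.
Qed.

Lemma fock_kernel_damped w z : (2 * pi) ^- n * normc (fock_kernel (w, z)) *
  expR (- (4^-1) * enorm w ^+ 2) * expR (- (4^-1) * enorm z ^+ 2) = heat_kernel (w, z).
Proof.
rewrite normc_fock_kernel -!mulrA -!expRD /heat_kernel/=; congr (_ * expR _).
by rewrite enormB_sqr [dot z w]dotC ReJ; field.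
Qed.

Lemma sqnorm_berg h : L2 h -> (sqnorm (berg h) <= ((2 ^+ n) ^+ 2)%:E * sqnorm h)%E.
Proof.
move=> Lh; apply: (@sqnorm_kernel_op R n fock_kernel heat_kernel h (2 ^+ n)
  measurable_fock_kernel measurable_heat_kernel heat_kernel_ge0 _ _ _ _ Lh
  (fock_kernel_cintble Lh)).
- by rewrite exprn_ge0.
- by move=> w; rewrite integral_heat_kernel1.
- by move=> z; rewrite integral_heat_kernel2.
- by move=> w z; rewrite fock_kernel_damped.
Qed.

Lemma berg_L2 h : L2 h -> L2 (berg h).
Proof.
move=> Lh; have [mh _] := Lh; have /L2E[_ foo] := Lh; apply/L2E; split.
  exact: (measurable_kernel_op measurable_fock_kernel mh).
by apply: (le_lt_trans (sqnorm_berg Lh)); rewrite lte_mul_pinfty ?lee_fin ?sqr_ge0.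
Qed.

Lemma normc_coor_le_norm v j : (normc (v ord0 j))%:C <= `|v|.
Proof.
rewrite -normr_normc -[leRHS]/(mx_norm v) mx_normE.
exact: (@le_bigmax _ _ _ 0%:nng (fun i : 'I_1 * 'I_n => `|v i.1 i.2|%:nng) (ord0, j)).
Qed.

Lemma enorm_le_norm v : (enorm v)%:C <= n%:R * `|v|.
Proof.
have vE : `|v| = (complex.Re `|v|)%:C by rewrite RRe_real// ger0_real.
rewrite vE -(rmorph_nat (real_complex R)) -rmorphM lecR.
have N0 : 0 <= complex.Re `|v| by have := normr_ge0 v; rewrite vE lecR.
rewrite -(@ler_pXn2r _ 2)// ?nnegrE ?mulr_ge0 ?enorm_ge0// enorm_sqr.
apply: (@le_trans _ _ (\sum_(j < n) complex.Re `|v| ^+ 2)).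
  apply: ler_sum => j _; rewrite ler_sqr ?nnegrE ?normc_ge0//.
  by have := normc_coor_le_norm v j; rewrite vE lecR.
rewrite sumr_const card_ord -[leLHS]mulr_natl exprMn ler_wpM2r ?sqr_ge0//.
by rewrite -natrX ler_nat; case: (n) => // m; rewrite leq_pmulr.
Qed.

(** Differentiation under the integral sign: the candidate derivative integrates the linear term of
    the exponential, and the remainder is quadratic in [v] with a dominating function of exponential
    growth. *)
Lemma berg_entire h : L2 h -> entire (berg h).
Proof.
move=> Lh x; have [mh _] := Lh.
have mcoor : measurable_fun setT (fun z : Cn => (z : Cn)) by exact: measurable_id.
have mKx : measurable_fun setT (fun z => fock_kernel (x, z)).
  by apply: measurableT_comp; [exact: measurable_fock_kernel|exact: measurable_pair1].
pose G z := h z * fock_kernel (x, z) * (gaussian z)%:C.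
have mG : measurable_fun setT G.
  apply: measurable_cM; first exact: measurable_cM.
  by apply: measurable_cR; exact: measurable_gaussian.
have normG z : normc (G z) <= normc (h z) * expR (2^-1 * enorm x * enorm z) * gaussian z.
  rewrite !normcMl normc_real (ger0_norm (gaussian_ge0 z)).
  by rewrite ler_wpM2r ?gaussian_ge0// ler_wpM2l ?normc_ge0// normc_fock_kernel_le.
have expo_ge (t : R) : t <= expR t by have := expR_ge1Dx t; lra.
pose D (v z : Cn) : C := (2^-1)%:C * dot v z.
have normD v z : normc (D v z) <= enorm v * enorm z.
  rewrite normcMl normc_real ger0_norm ?invr_ge0//.
  rewrite (le_trans (ler_piMl (normc_ge0 _) _) (normc_dot_le _ _))//.
  by rewrite invf_le1// ler1n.
have mD v : measurable_fun setT (D v).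
  by apply: measurable_cZ; apply: measurable_dot; [exact: measurable_cst|exact: measurable_id].
have iGD v : cintble leb setT (fun z => G z * D v z).
  apply: (le_cintble measurableT (measurable_cM mG (mD v))
    (integrable_scale (enorm v) (L2_expo_integrable (2^-1 * enorm x + 1) Lh))).
  move=> z _; rewrite normcMl (le_trans (ler_wpM2r (normc_ge0 _) (normG z)))//.
  have h0 : 0 <= normc (h z) * expR (2^-1 * enorm x * enorm z) * gaussian z.
    by rewrite mulr_ge0 ?gaussian_ge0// mulr_ge0 ?normc_ge0 ?expR_ge0.
  rewrite (le_trans (ler_wpM2l h0 (normD v z)))//.
  rewrite mulrDl mul1r expRD.
  set A := normc (h z); set B := expR (2^-1 * enorm x * enorm z); set g := gaussian z.
  rewrite (_ : A * B * g * (enorm v * enorm z) = enorm v * (A * B * g) * enorm z); last by ring.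
  rewrite (_ : enorm v * (A * (B * expR (enorm z)) * g) = enorm v * (A * B * g) * expR (enorm z));
    last by ring.
  by rewrite ler_wpM2l// mulr_ge0 ?enorm_ge0.
(* The derivative is built from its values on coordinate vectors, which makes its continuity
   evident; [L0E] identifies it with the integral. *)
pose l j := cint leb setT (fun z => G z * D (delta_mx ord0 j) z).
pose L0 v : C := \sum_(j < n) v ord0 j * l j.
have L0E v : L0 v = cint leb setT (fun z => G z * D v z).
  rewrite /L0 /l.
  rewrite (eq_bigr (fun j => cint leb setT
     (fun z => v ord0 j * (G z * D (delta_mx ord0 j) z)))); last first.
    by move=> j _; rewrite (cintZ _ measurableT (iGD _)).
  rewrite -cint_sum//; last by move=> j; exact: (cintbleZ _ measurableT (iGD _)).
  apply: eq_cint => z _; rewrite {2}/D.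
  have -> : dot v z = \sum_(j < n) v ord0 j * dot (delta_mx ord0 j) z.
    apply: eq_bigr => j _; congr (_ * _); rewrite /dot (bigD1 j)//= mxE !eqxx mul1r.
    by rewrite big1 ?addr0// => i ij; rewrite mxE (negbTE ij) andbF mul0r.
  rewrite !mulr_sumr; apply: eq_bigr => j _; rewrite /D; ring.
have L0lin : linear L0.
  move=> c u v; rewrite /L0 scaler_sumr -big_split/=; apply: eq_bigr => j _.
  by rewrite !mxE mulrDl -mulrA.
pose Lm := GRing.isLinear.Build C Cn C *:%R L0 L0lin.
pose L : {linear Cn -> C} := HB.pack L0 Lm.
have cL : continuous L.
  have : forall v, differentiable L0 v.
    move=> v; rewrite (_ : L0 = \sum_(j < n) (fun v : Cn => v ord0 j * l j)); last first.
      by apply/funext => u; rewrite fct_sumE.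
    apply: differentiable_sum => j; apply: differentiableM => //.
    exact: differentiable_coord.
  by move=> dL v; exact: (differentiable_continuous (dL v)).
(* The exponent of the dominating function: [|x|/2] from the kernel at [x], [n] from [exp |D v z|]
   because [enorm v <= n] when the sup norm of [v] is at most 1, and 2 from
   [|z|^2 <= exp (2 |z|)]. *)
pose c := 2^-1 * enorm x + (n%:R + 2).
pose K := \int[leb]_z (normc (h z) * expR (c * enorm z) * gaussian z).
have K0 : 0 <= K.
  by apply: Rintegral_ge0 => z _; rewrite mulr_ge0 ?gaussian_ge0// mulr_ge0 ?normc_ge0 ?expR_ge0.
apply: (@differentiable_quadratic _ _ _ x L (n%:R ^+ 2 * K)%:C) => //.
  by rewrite lecR mulr_ge0// sqr_ge0.
move=> v v1; set N := complex.Re `|v|.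
have vE : `|v| = N%:C by rewrite RRe_real// ger0_real.
have N0 : 0 <= N by rewrite -lecR -vE; exact: normr_ge0.
have N1 : N <= 1 by rewrite -lecR -vE; exact: v1.
have nv : enorm v <= n%:R * N by rewrite -lecR rmorphM rmorph_nat /= -vE enorm_le_norm.
rewrite vE -(rmorphXn (real_complex R)) -(rmorphM (real_complex R)) normr_normc lecR.
have vn : enorm v <= n%:R by rewrite (le_trans nv)// ler_piMr.
have ig := L2_expo_integrable c Lh.
have iE y : cintble leb setT (fun z => h z * fock_kernel (y, z) * (gaussian z)%:C).
  exact: (fock_kernel_cintble Lh y).
have rem : berg h (x + v) - berg h x - L v =
    cint leb setT (fun z => G z * (cexp (D v z) - 1 - D v z)).
  rewrite -[L v]/(L0 v) L0E /berg /kernel_op.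
  rewrite -(cintB measurableT (iE (x + v)) (iE x)).
  rewrite -(cintB measurableT (cintbleB measurableT (iE (x + v)) (iE x)) (iGD v)).
  apply: eq_cint => z _.
  have -> : fock_kernel (x + v, z) = fock_kernel (x, z) * cexp (D v z).
    by rewrite /fock_kernel/= dotDl mulrDr cexpD.
  by rewrite /G; ring.
rewrite rem.
have mrem : measurable_fun setT (fun z => G z * (cexp (D v z) - 1 - D v z)).
  apply: measurable_cM => //; apply: measurable_cB => //; apply: measurable_cB.
    exact: measurable_cexp.
  exact: measurable_cst.
rewrite (le_trans (normc_cint_le measurableT mrem
  (integrable_scale (enorm v ^+ 2) ig) _))//.
  move=> z _; rewrite normcMl.
  rewrite (le_trans (ler_wpM2r (normc_ge0 _) (normG z)))//.
  have h0 : 0 <= normc (h z) * expR (2^-1 * enorm x * enorm z) * gaussian z.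
    by rewrite mulr_ge0 ?gaussian_ge0// mulr_ge0 ?normc_ge0 ?expR_ge0.
  rewrite (le_trans (ler_wpM2l h0 (cexp_sub1_lin _)))//.
  rewrite /c mulrDl expRD.
  set A := normc (h z); set B := expR (2^-1 * enorm x * enorm z); set g := gaussian z in h0 *.
  rewrite (_ : enorm v ^+ 2 * (A * (B * expR ((n%:R + 2) * enorm z)) * g) =
     A * B * g * (enorm v ^+ 2 * expR ((n%:R + 2) * enorm z))); last by ring.
  rewrite ler_wpM2l//.
  apply: (@le_trans _ _ ((enorm v * enorm z) ^+ 2 * expR (n%:R * enorm z))).
    apply: ler_pM; rewrite ?sqr_ge0 ?expR_ge0//.
      by rewrite ler_sqr ?nnegrE ?normc_ge0 ?mulr_ge0 ?enorm_ge0.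
    by rewrite ler_expR (le_trans (normD v z))// ler_wpM2r ?enorm_ge0.
  rewrite exprMn -mulrA ler_wpM2l ?sqr_ge0// mulrDl expRD mulrC ler_wpM2l ?expR_ge0//.
  by rewrite expRM_natl ler_sqr ?nnegrE ?enorm_ge0 ?expR_ge0.
rewrite RintegralZl// -/K (_ : _ * N ^+ 2 = (n%:R * N) ^+ 2 * K); last by ring.
by rewrite ler_wpM2r// ler_sqr ?nnegrE ?enorm_ge0// mulr_ge0.
Qed.

(** [reproducing] with [g = 1/2] and [u = w/2], whose evaluation point [u / g] is [w]. *)
Lemma berg_fock f : entire f -> L2 f -> forall w, berg f w = f w.
Proof.
move=> ef Lf w; have [mf _] := Lf.
have twopi0 : ((2 * pi) ^+ n)%:C != 0 :> C.
  by rewrite (inj_eq (@complexI R)) expf_neq0// mulf_neq0// gt_eqF// pi_gt0.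
have E z : ((2 * pi) ^+ n)%:C * (f z * fock_kernel (w, z) * (gaussian z)%:C) =
   (expR (- (2^-1) * enorm z ^+ 2))%:C * cexp (dot ((2^-1)%:C *: w) z) * f z.
  have gen (P p q e : C) : P != 0 -> P * (p * q * (P^-1 * e)) = e * q * p.
    by move=> P0; field.
  rewrite dotZl gaussE (rmorphM (real_complex R)) (fmorphV (real_complex R)).
  exact: gen.
have iE := eq_cintble E (cintbleZ ((2 * pi) ^+ n)%:C measurableT (fock_kernel_cintble Lf w)).
have g0 : 0 < 2^-1 :> R by rewrite invr_gt0.
have := reproducing (entire_line_holomorphic ef) g0 mf iE.
rewrite -(eq_cint leb (fun z _ => E z)) (cintZ _ measurableT (fock_kernel_cintble Lf w)).
rewrite invrK [pi * _]mulrC => /(mulfI twopi0).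
move=> h; rewrite /berg /kernel_op h scalerA.
by rewrite -(rmorphM (real_complex R)) mulfV ?pnatr_eq0// scale1r.
Qed.

End bergman.

Section schur_bilinear.
Context d (T : measurableType d) (R : realType).
Variable mu : {sigma_finite_measure set T -> \bar R}.

(** From [F H <= F^2 + H^2] and the two marginals. It provides the absolute convergence behind
    Fubini in [inner_berg]. *)
Lemma schur_bilinear (k : T * T -> R) (F H : T -> R) (A : R) :
  measurable_fun setT k -> (forall p, 0 <= k p) -> 0 <= A ->
  (forall w, \int[mu]_z (k (w, z))%:E <= A%:E)%E ->
  (forall z, \int[mu]_w (k (w, z))%:E <= A%:E)%E ->
  measurable_fun setT F -> (forall z, 0 <= F z) ->
  measurable_fun setT H -> (forall z, 0 <= H z) ->
  (\int[mu]_z (F z ^+ 2)%:E < +oo)%E -> (\int[mu]_z (H z ^+ 2)%:E < +oo)%E ->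
  (\int[mu]_w \int[mu]_z (k (w, z) * (F z * H w))%:E < +oo)%E.
Proof.
move=> mk k0 A0 kA kA' mF F0 mH H0 iF iH.
have mkz w : measurable_fun setT (fun z => k (w, z)).
  by apply: measurableT_comp => //; exact: measurable_pair1.
have mkw z : measurable_fun setT (fun w => k (w, z)).
  by apply: measurableT_comp => //; exact: measurable_pair2.
have mF2 : measurable_fun setT (fun z => (F z ^+ 2)%:E).
  by apply/measurable_EFinP/measurable_funX.
have mH2 : measurable_fun setT (fun z => (H z ^+ 2)%:E).
  by apply/measurable_EFinP/measurable_funX.
pose K1 (p : T * T) := (k p * F p.2 ^+ 2)%:E.
pose K2 (p : T * T) := (k p * H p.1 ^+ 2)%:E.
pose K (p : T * T) := (k p * (F p.2 * H p.1))%:E.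
have mK1 : measurable_fun setT K1.
  apply/measurable_EFinP/measurable_funM => //; apply: measurable_funX.
  by apply: (measurableT_comp mF); exact: measurable_snd.
have mK2 : measurable_fun setT K2.
  apply/measurable_EFinP/measurable_funM => //; apply: measurable_funX.
  by apply: (measurableT_comp mH); exact: measurable_fst.
have mK : measurable_fun setT K.
  apply/measurable_EFinP/measurable_funM => //; apply: measurable_funM.
    by apply: (measurableT_comp mF); exact: measurable_snd.
  by apply: (measurableT_comp mH); exact: measurable_fst.
have K10 p : (0 <= K1 p)%E by rewrite lee_fin mulr_ge0 ?sqr_ge0.
have K20 p : (0 <= K2 p)%E by rewrite lee_fin mulr_ge0 ?sqr_ge0.
have K0 p : (0 <= K p)%E by rewrite lee_fin mulr_ge0// mulr_ge0.
have b1 : (\int[mu]_w \int[mu]_z K1 (w, z) <= A%:E * \int[mu]_z (F z ^+ 2)%:E)%E.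
  have F20 z : setT z -> (0 <= (F z ^+ 2)%:E)%E by rewrite lee_fin sqr_ge0.
  rewrite (fubini_tonelli K1)// -(ge0_integralZl_EFin mu measurableT F20 mF2 A0).
  apply: ge0_le_integral => //=.
  - by move=> z _; apply: integral_ge0.
  - exact: (measurable_fun_fubini_tonelli_G K1).
  - exact: (measurable_funeM A%:E mF2).
  move=> z _; rewrite /K1 /=; under eq_integral do rewrite mulrC EFinM.
  rewrite ge0_integralZl_EFin ?sqr_ge0//; first last.
  - exact/measurable_EFinP.
  - by move=> w _; rewrite lee_fin.
  by rewrite muleC; apply: lee_wpmul2r; rewrite ?lee_fin ?sqr_ge0.
have b2 : (\int[mu]_w \int[mu]_z K2 (w, z) <= A%:E * \int[mu]_z (H z ^+ 2)%:E)%E.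
  have H20 z : setT z -> (0 <= (H z ^+ 2)%:E)%E by rewrite lee_fin sqr_ge0.
  rewrite -(ge0_integralZl_EFin mu measurableT H20 mH2 A0).
  apply: ge0_le_integral => //=.
  - by move=> z _; apply: integral_ge0.
  - exact: (measurable_fun_fubini_tonelli_F K2).
  - exact: (measurable_funeM A%:E mH2).
  move=> w _; rewrite /K2 /=; under eq_integral do rewrite mulrC EFinM.
  rewrite ge0_integralZl_EFin ?sqr_ge0//; first last.
  - exact/measurable_EFinP.
  - by move=> z _; rewrite lee_fin.
  by rewrite muleC; apply: lee_wpmul2r; rewrite ?lee_fin ?sqr_ge0.
rewrite -(fubini_tonelli1 K)//.
apply: (@le_lt_trans _ _ (\int[(mu \x mu)%E]_p (K1 p + K2 p))%E).
  apply: ge0_le_integral => //.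
  - exact: emeasurable_funD.
  move=> p _; rewrite -EFinD lee_fin -mulrDr ler_wpM2l//.
  by have := sqr_ge0 (F p.2 - H p.1); have := mulr_ge0 (F0 p.2) (H0 p.1);
    rewrite sqrrB; lra.
rewrite ge0_integralD// (fubini_tonelli1 K1)// (fubini_tonelli1 K2)//.
rewrite lte_add_pinfty//.
  by apply: (le_lt_trans b1); rewrite lte_mul_pinfty// lee_fin.
by apply: (le_lt_trans b2); rewrite lte_mul_pinfty// lee_fin.
Qed.

End schur_bilinear.

Section projection.
Variables (R : realType) (n : nat).
Local Notation C := R[i].
Local Notation Cn := 'rV[C]_n.
Local Notation leb := (@lebesgueCn R n).
Local Notation F2 := (fock R n).
Implicit Types (f h : Cn -> C) (z w v a x : Cn).

Lemma fock_entire (u : F2) : entire u.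
Proof. by have /asboolP[] := fockP u. Qed.

Lemma fock_L2 (u : F2) : L2 u.
Proof. by have /asboolP[] := fockP u. Qed.

Lemma fock_ext (u v : F2) : u =1 v -> u = v.
Proof. by move=> uv; apply: val_inj; exact: funext. Qed.

Lemma L2_add f h : L2 f -> L2 h -> L2 (fun z => f z + h z).
Proof.
move=> Lf Lh; have [mf _] := Lf; have [mh _] := Lh.
apply: (L2_le (measurable_cD mf mh) (integrable_scale 2
  (integrable_add (sqnorm_integrable Lf) (sqnorm_integrable Lh)))) => z.
rewrite -mulrDl mulrA ler_wpM2r ?gaussian_ge0//.
have le : normc (f z + h z) ^+ 2 <= (normc (f z) + normc (h z)) ^+ 2.
  by rewrite ler_sqr ?nnegrE ?addr_ge0 ?normc_ge0 ?normc_add.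
apply: (le_trans le); have := sqr_ge0 (normc (f z) - normc (h z)).
by rewrite sqrrB sqrrD; lra.
Qed.

Lemma L2_bounded (M : R) h f : measurable_fun setT h -> (forall z, normc (h z) <= M) ->
  L2 f -> L2 (fun z => h z * f z).
Proof.
move=> mh hM Lf; have [mf _] := Lf.
apply: (L2_le (measurable_cM mh mf) (integrable_scale (M ^+ 2) (sqnorm_integrable Lf))) => z.
rewrite normcMl exprMn -mulrA ler_wpM2r//.
  by rewrite mulr_ge0 ?sqr_ge0 ?gaussian_ge0.
by rewrite ler_sqr ?nnegrE ?normc_ge0// (le_trans (normc_ge0 _) (hM z)).
Qed.

Lemma L2_scale c f : L2 f -> L2 (fun z => c * f z).
Proof. by move=> Lf; apply: (@L2_bounded (normc c)) => //; exact: measurable_cst. Qed.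

Lemma L2_sub f h : L2 f -> L2 h -> L2 (fun z => f z - h z).
Proof.
move=> Lf /(L2_scale (-1)) Lh; have := L2_add Lf Lh.
by under eq_fun do rewrite mulN1r.
Qed.

Lemma L2_inner_cintble f h : L2 f -> L2 h ->
  cintble leb setT (fun z => f z * (h z)^*%C * (gaussian z)%:C).
Proof.
move=> Lf Lh; have [mf _] := Lf; have [mh _] := Lh.
apply: (le_cintble measurableT _ (integrable_add (sqnorm_integrable Lf) (sqnorm_integrable Lh))).
  apply: measurable_cM; first by apply: measurable_cM => //; exact: measurable_cJ.
  by apply: measurable_cR; exact: measurable_gaussian.
move=> z _; rewrite !normcMl normc_conj normc_real (ger0_norm (gaussian_ge0 z)) -mulrDl.
rewrite ler_wpM2r ?gaussian_ge0//.
have := sqr_ge0 (normc (f z) - normc (h z)).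
have := mulr_ge0 (normc_ge0 (f z)) (normc_ge0 (h z)).
by rewrite sqrrB; lra.
Qed.

Lemma conjcM (a b : C) : (a * b)^*%C = a^*%C * b^*%C.
Proof. exact: rmorphM. Qed.

Lemma fock_kernel_conj z w : (fock_kernel (z, w))^*%C = fock_kernel (w, z).
Proof. by rewrite cexp_conj conjcM conjc_real -dotC. Qed.

Lemma damped_sq_fin f : L2 f -> (\int[leb]_z (damped f z ^+ 2)%:E < +oo)%E.
Proof.
move=> Lf; have [mf _] := Lf; have /L2E[_] := Lf; rewrite (sqnorm_damped mf).
have p0 : 0 < (2 * pi) ^- n :> R by rewrite invr_gt0 exprn_gt0// mulr_gt0// pi_gt0.
have I0 : (0 <= \int[leb]_z (damped f z ^+ 2)%:E)%E.
  by apply: integral_ge0 => z _; rewrite lee_fin sqr_ge0.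
case: (\int[leb]_z _)%E I0 => [r _ _|_|]; [exact: ltry| |by []].
by rewrite gt0_muley ?lte_fin.
Qed.

(** The Fock kernel is Hermitian, so Fubini moves [berg] from [h] onto [f], which it fixes. Hence
    [h - berg h] is orthogonal to the Fock space. *)
Lemma inner_berg h (f : F2) : L2 h -> inner (berg h) f = inner h f.
Proof.
move=> Lh; have Lf := fock_L2 f; have [mh _] := Lh; have [mf _] := Lf.
pose Phi (p : Cn * Cn) : C := h p.2 * fock_kernel p * (gaussian p.2)%:C *
  ((f p.1)^*%C * (gaussian p.1)%:C).
have mPhi : measurable_fun setT Phi.
  apply: measurable_cM; first exact: (measurable_kernel (@measurable_fock_kernel R n) mh).
  apply: measurable_cM.
    by apply: measurable_cJ; apply: (measurableT_comp mf); exact: measurable_fst.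
  by apply: measurable_cR; apply: (measurableT_comp (@measurable_gaussian R n));
    exact: measurable_fst.
have iPhi : cintble (leb \x leb)%E setT Phi.
  split=> //; pose nPhi p := (normc (Phi p))%:E.
  have mn : measurable_fun setT nPhi by apply/measurable_EFinP; exact: measurable_normc.
  have n0 p : (0 <= nPhi p)%E by rewrite lee_fin normc_ge0.
  rewrite -/nPhi (fubini_tonelli1 nPhi mn n0).
  pose k (p : Cn * Cn) : R := (2 * pi) ^- n * heat_kernel p.
  have t0 := @twopi_ge0 R n.
  have mk : measurable_fun setT k.
    by apply: measurable_funM; [exact: measurable_cst|exact: measurable_heat_kernel].
  have ik1 w : (\int[leb]_z (k (w, z))%:E <= ((2 * pi) ^- n * 2 ^+ n)%:E)%E.
    rewrite /k; under eq_integral do rewrite EFinM.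
    rewrite ge0_integralZl_EFin ?integral_heat_kernel1//.
    + by move=> z _; rewrite lee_fin heat_kernel_ge0.
    + apply/measurable_EFinP; apply: measurableT_comp; first exact: measurable_heat_kernel.
      exact: measurable_pair1.
  have ik2 z : (\int[leb]_w (k (w, z))%:E <= ((2 * pi) ^- n * 2 ^+ n)%:E)%E.
    rewrite /k; under eq_integral do rewrite EFinM.
    rewrite ge0_integralZl_EFin ?integral_heat_kernel2//.
    + by move=> w _; rewrite lee_fin heat_kernel_ge0.
    + apply/measurable_EFinP; apply: measurableT_comp; first exact: measurable_heat_kernel.
      exact: measurable_pair2.
  have HS := schur_bilinear mk (fun p => mulr_ge0 t0 (heat_kernel_ge0 p))
    (mulr_ge0 t0 (exprn_ge0 n (ler0n R 2))) ik1 ik2 (measurable_damped mh) (damped_ge0 h)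
    (measurable_damped mf) (damped_ge0 f) (damped_sq_fin Lh) (damped_sq_fin Lf).
  refine (le_lt_trans _ HS); rewrite le_eqVlt; apply/orP; left; apply/eqP.
  apply: (@eq_integral _ _ _ leb) => w _; apply: (@eq_integral _ _ _ leb) => z _.
  congr (_%:E); apply: esym; rewrite /k -fock_kernel_damped /damped.
  rewrite -[RHS]/(normc (h z * fock_kernel (w, z) * (gaussian z)%:C *
    ((f w)^*%C * (gaussian w)%:C))).
  rewrite !normcMl normc_conj !normc_real !(ger0_norm (gaussian_ge0 _)) !gaussE.
  have E (t : R) : expR (- (2^-1) * t) = expR (- (4^-1) * t) ^+ 2.
    by rewrite -expRM_natl; congr expR; field.
  rewrite !E.
  move: (normc (fock_kernel (w, z))) (normc (h z)) (normc (f w)) ((2 * pi) ^- n : R).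
  move: (expR (- (4^-1) * enorm w ^+ 2)) (expR (- (4^-1) * enorm z ^+ 2)).
  by move=> x1 x2 x3 x4 x5 x6; ring.
have HA : inner (berg h) f = cint leb setT (fun w => cint leb setT (fun z => Phi (w, z))).
  apply: (@eq_cint _ _ _ leb) => w _.
  refine (etrans (esym (mulrA _ _ _)) (etrans (mulrC _ _) _)).
  refine (etrans (esym (cintZ _ measurableT (fock_kernel_cintble Lh w))) _).
  by apply: (@eq_cint _ _ _ leb) => z _; exact: mulrC.
refine (etrans HA (etrans (cint_fubini iPhi) _)).
apply: (@eq_cint _ _ _ leb) => z _.
have iF := cintble_conj (fock_kernel_cintble Lf z).
transitivity (h z * (gaussian z)%:C * cint leb setT
   (fun w => (f w * fock_kernel (z, w) * (gaussian w)%:C)^*%C)).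
  rewrite -(cintZ _ measurableT iF); apply: eq_cint => w _.
  by rewrite /Phi/= !conjcM conjc_real fock_kernel_conj; ring.
rewrite (cint_conj measurableT (fock_kernel_cintble Lf z)).
by rewrite -[cint _ _ _]/(berg f z) (berg_fock (fock_entire f) Lf) mulrAC.
Qed.

Lemma bergD f h : L2 f -> L2 h -> forall w, berg (fun z => f z + h z) w = berg f w + berg h w.
Proof. by move=> Lf Lh; apply: kernel_opD; exact: fock_kernel_cintble. Qed.

Lemma bergZ c f : L2 f -> forall w, berg (fun z => c * f z) w = c * berg f w.
Proof. by move=> Lf; apply: kernel_opZ; exact: fock_kernel_cintble. Qed.

Lemma bergB f h : L2 f -> L2 h -> forall w, berg (fun z => f z - h z) w = berg f w - berg h w.
Proof.
move=> Lf Lh w; rewrite -[- berg h w]mulN1r -(bergZ _ Lh) -(bergD Lf (L2_scale _ Lh)).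
by apply: (congr1 (fun F => berg F w)); apply/funext => z; rewrite mulN1r.
Qed.

Lemma dot_entire w : entire (fun z => dot z w).
Proof.
move=> z; rewrite (_ : (fun _ => _) = \sum_(j < n) (fun z : Cn => z ord0 j * (w ord0 j)^*%C)).
  apply: differentiable_sum => j; apply: differentiableM => //.
  exact: differentiable_coord.
by apply/funext => u; rewrite fct_sumE.
Qed.

Lemma cexp_dot_entire (c : C) w (b : C) : entire (fun z => cexp (c * dot z w + b)).
Proof.
move=> z; apply: differentiable_comp; last exact: differentiable_cexp.
apply: differentiableD => //; apply: differentiableM => //; exact: dot_entire.
Qed.

Lemma fock_kernel_L2 w : L2 (fun z => fock_kernel (z, w)).
Proof.
have mK : measurable_fun setT (fun z => fock_kernel (z, w)).
  by apply: measurableT_comp; [exact: measurable_fock_kernel|exact: measurable_pair2].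
have g0 : 0 < 4^-1 :> R by rewrite invr_gt0.
have ig : leb.-integrable setT (fun z => ((2 * pi) ^- n * expR (enorm w ^+ 2) *
    expR (- 4^-1 * enorm z ^+ 2))%:E).
  by apply: integrable_scale; exact: gauss_integrable0 g0.
apply: (L2_le mK ig) => z.
rewrite normc_fock_kernel -expRM_natl gaussE mulrCA -[leRHS]mulrA.
rewrite ler_wpM2l ?twopi_ge0// (le_trans _ (expo_gauss_le (enorm w) z))//.
rewrite ler_wpM2r ?expR_ge0// ler_expR mulrA divff ?pnatr_eq0// mul1r.
by rewrite (le_trans (Re_le_normc _))// mulrC normc_dot_le.
Qed.

Lemma fock_kernel_entire w : entire (fun z => fock_kernel (z, w)).
Proof.
rewrite (_ : (fun _ => _) = (fun z => cexp ((2^-1)%:C * dot z w + 0))).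
  exact: cexp_dot_entire.
by apply/funext => z; rewrite addr0.
Qed.

Lemma fock_memP h : entire h -> L2 h -> h \in @fock_pred R n.
Proof. by move=> eh Lh; apply/asboolP. Qed.

Definition kernel_fock w : F2 :=
  Fock (fock_memP (fock_kernel_entire w) (fock_kernel_L2 w)).

Lemma inner_kernel h w : inner h (kernel_fock w) = berg h w.
Proof.
apply: (@eq_cint _ _ _ leb) => z _.
by rewrite -[kernel_fock w z]/(fock_kernel (z, w)) fock_kernel_conj.
Qed.

(** Existence is [inner_berg]. For uniqueness, testing against [kernel_fock w] evaluates [berg] at
    [w], and [berg] fixes the competitor. Thus the abstract choice in [fock_proj] becomes a concrete
    integral operator. *)
Lemma fock_projE h : L2 h -> forall w, fock_proj h w = berg h w.
Proof.
move=> Lh; pose u : F2 := Fock (fock_memP (berg_entire Lh) (berg_L2 Lh)).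
suff -> : fock_proj h = u by [].
apply: xget_unique.
  move=> f; have LB := berg_L2 Lh; have Lf := fock_L2 f.
  have E z : (h z - u z) * (f z)^*%C * (gaussian z)%:C =
      h z * (f z)^*%C * (gaussian z)%:C - berg h z * (f z)^*%C * (gaussian z)%:C.
    by rewrite !mulrBl.
  rewrite /inner -[cintegral _]/(cint leb setT _) (eq_cint leb (fun z _ => E z)).
  rewrite (cintB measurableT (L2_inner_cintble Lh Lf) (L2_inner_cintble LB Lf)).
  by rewrite -/(inner h f) -[X in _ - X]/(inner (berg h) f) inner_berg// subrr.
move=> y yP; apply: fock_ext => w; have Ly := fock_L2 y.
have := yP (kernel_fock w); rewrite inner_kernel (bergB Lh Ly).
by rewrite (berg_fock (fock_entire y) Ly) => /eqP; rewrite subr_eq0 => /eqP.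
Qed.

End projection.

(** * Toeplitz operators and singular numbers *)

Section operators.
Variables (R : realType) (n : nat).
Local Notation C := R[i].
Local Notation Cn := 'rV[C]_n.
Local Notation leb := (@lebesgueCn R n).
Local Notation F2 := (fock R n).
Implicit Types (f : F2) (h : Cn -> C) (A B : F2 -> F2) (T S : {linear F2 -> F2}).

Lemma fock_addE (u v : F2) z : (u + v) z = u z + v z. Proof. by []. Qed.

Lemma fock_scaleE c (u : F2) z : (c *: u) z = c * u z. Proof. by []. Qed.

Lemma fock_subE (u v : F2) z : (u - v) z = u z - v z.
Proof. by []. Qed.

Lemma fock_zeroE z : (0 : F2) z = 0. Proof. by []. Qed.

Lemma fock_sumE k (F : 'I_k -> F2) z : (\sum_(i < k) F i) z = \sum_(i < k) F i z.
Proof.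
by elim/big_rec2 : _ => [|i y x _ <-]; [exact: fock_zeroE|exact: fock_addE].
Qed.

Lemma L2norm_zero : L2norm (0 : F2) = 0%E.
Proof.
apply/eqP; rewrite eq_le L2norm_ge0 andbT (L2norm_le _ (lexx 0)) expr0n/=.
rewrite /sqnorm integral0_eq// => z _.
by rewrite -[X in normc X]/(0 : C) Normc.normc0 expr0n/= mul0r.
Qed.

Lemma L2norm_opnorm A (f : F2) : (L2norm f <= 1)%E -> (L2norm (A f) <= opnorm A)%E.
Proof. by move=> f1; apply: ereal_sup_ubound; exists f. Qed.

Lemma opnorm_ge0 A : (0 <= opnorm A)%E.
Proof.
apply: (le_trans (L2norm_ge0 (A 0))); apply: L2norm_opnorm.
by rewrite L2norm_zero lee_fin ler01.
Qed.

Lemma opnorm_le A (b : R) : 0 <= b ->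
  (forall f : F2, (sqnorm (A f) <= (b ^+ 2)%:E * sqnorm f)%E) -> (opnorm A <= b%:E)%E.
Proof.
move=> b0 Ab; apply: ub_ereal_sup => _ [f /= f1 <-]; rewrite (L2norm_le _ b0).
apply: (le_trans (Ab f)).
move: f1; rewrite (L2norm_le _ (@ler01 R)) expr1n => f1.
by rewrite -[leRHS]mule1; apply: lee_wpmul2l; rewrite ?lee_fin ?sqr_ge0.
Qed.

Lemma sqnorm_add (f h : Cn -> C) : measurable_fun setT f -> measurable_fun setT h ->
  (sqnorm (fun z => (f z + h z)%R) <= 2%:E * (sqnorm f + sqnorm h))%E.
Proof.
move=> mf mh.
have sq0 (g : Cn -> C) z : setT z -> (0 <= (normc (g z) ^+ 2 * gaussian z)%:E :> \bar R)%E.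
  by move=> _; rewrite lee_fin mulr_ge0 ?sqr_ge0 ?gaussian_ge0.
have msq (g : Cn -> C) : measurable_fun setT g ->
    measurable_fun setT (fun z => (normc (g z) ^+ 2 * gaussian z)%:E : \bar R).
  by move=> mg; apply/measurable_EFinP; exact: measurable_sqnormf.
rewrite -(ge0_integralD leb measurableT (sq0 f) (msq _ mf) (sq0 h) (msq _ mh)).
have m2 := emeasurable_funD (msq _ mf) (msq _ mh).
have p2 z : setT z -> (0 <= (normc (f z) ^+ 2 * gaussian z)%:E +
    (normc (h z) ^+ 2 * gaussian z)%:E :> \bar R)%E.
  by move=> _; rewrite adde_ge0//; [exact: sq0|exact: sq0].
rewrite -(ge0_integralZl_EFin leb measurableT p2 m2 (ler0n R 2)).
apply: ge0_le_integral => //.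
- by move=> z _; exact: (sq0 (fun z => f z + h z)).
- exact: (msq _ (measurable_cD mf mh)).
- exact: (measurable_funeM 2%:E m2).
move=> z _; rewrite -EFinD -EFinM lee_fin -mulrDl [leRHS]mulrA ler_wpM2r ?gaussian_ge0//.
have le : normc (f z + h z) ^+ 2 <= (normc (f z) + normc (h z)) ^+ 2.
  by rewrite ler_sqr ?nnegrE ?addr_ge0 ?normc_ge0 ?normc_add.
apply: (le_trans le); have := sqr_ge0 (normc (f z) - normc (h z)).
by rewrite sqrrB sqrrD; lra.
Qed.

Lemma L2norm_fin h : (L2norm h < +oo)%E -> exists2 x : R, 0 <= x & L2norm h = x%:E.
Proof.
have := L2norm_ge0 h; case: (L2norm h) => [x x0 _|//|//]; exists x => //.
Qed.

(** The constant 2 comes from [(a + b)^2 <= 2 a^2 + 2 b^2]. Finiteness, convergence to 0 and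
    Schatten membership do not see it, so it is carried through [opnorm_add] and
    [singular_number_add]. *)
Lemma L2norm_add (f h : Cn -> C) : L2 f -> L2 h ->
  (L2norm (fun z => (f z + h z)%R) <= 2%:E * (L2norm f + L2norm h))%E.
Proof.
move=> [mf Lf] [mh Lh]; have := sqnorm_add mf mh.
have [x x0 ex] := L2norm_fin Lf; have [y y0 ey] := L2norm_fin Lh.
have sx : sqnorm f = (x * x)%:E by rewrite sqnormE ex -EFinM.
have sy : sqnorm h = (y * y)%:E by rewrite sqnormE ey -EFinM.
rewrite sx sy ex ey -!EFinD -!EFinM => le.
have xy0 : 0 <= 2 * (x + y) by rewrite mulr_ge0 ?addr_ge0.
rewrite (L2norm_le _ xy0); apply: (le_trans le); rewrite lee_fin.
by have := mulr_ge0 x0 y0; have := sqr_ge0 x; have := sqr_ge0 y; nra.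
Qed.

Lemma opnorm_add A B : (opnorm (fun f => (A f + B f)%R) <= 2%:E * (opnorm A + opnorm B))%E.
Proof.
apply: ub_ereal_sup => _ [f /= f1 <-].
apply: (le_trans (L2norm_add (fock_L2 (A f)) (fock_L2 (B f)))).
apply: lee_wpmul2l; first by rewrite lee_fin.
by apply: leeD; exact: L2norm_opnorm.
Qed.

Lemma linear_opP A : linear A -> exists T, forall f, T f = A f.
Proof.
move=> lA; pose m := GRing.isLinear.Build C F2 F2 *:%R A lA.
by exists (HB.pack_for {linear F2 -> F2} A m).
Qed.

Lemma rank_le_add k l S1 S2 S : rank_le k S1 -> rank_le l S2 ->
  (forall f, S f = S1 f + S2 f) -> rank_le (k + l) S.
Proof.
move=> [u1 H1] [u2 H2] SE.
exists (fun i : 'I_(k + l) => match fintype.split i with inl j => u1 j | inr j => u2 j end) => f.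
have [c1 e1] := H1 f; have [c2 e2] := H2 f.
exists (fun i : 'I_(k + l) => match fintype.split i with inl j => c1 j | inr j => c2 j end).
rewrite SE e1 e2 big_split_ord/=; congr (_ + _); apply: eq_bigr => i _.
  by rewrite (unsplitK (inl i)).
by rewrite (unsplitK (inr i)).
Qed.

Lemma rank_le_mono k l S : (k <= l)%N -> rank_le k S -> rank_le l S.
Proof.
move=> /subnKC <- rS.
have r0 : rank_le (l - k) (\0 : {linear F2 -> F2}).
  by exists (fun=> 0) => f; exists (fun=> 0); rewrite big1// => i _; rewrite scaler0.
by apply: (rank_le_add rS r0) => f; rewrite addr0.
Qed.

Lemma singular_number_ge0 k T : (0 <= singular_number k T)%E.
Proof. by apply: le_ereal_inf_tmp => _ [S _ <-]; exact: opnorm_ge0. Qed.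

Lemma singular_number_le k T S (b : R) : bounded_op S -> rank_le k S ->
  (opnorm (fun f => T f - S f)%R <= b%:E)%E -> (singular_number k T <= b%:E)%E.
Proof. by move=> bS rS; apply: le_trans; apply: ereal_inf_lbound; exists S. Qed.

Lemma singular_number_anti k l T : (k <= l)%N ->
  (singular_number l T <= singular_number k T)%E.
Proof.
move=> kl; apply: le_ereal_inf_tmp => _ [S [bS rS] <-].
by apply: ereal_inf_lbound; exists S => //; split=> //; exact: rank_le_mono rS.
Qed.

Lemma bounded_op0 : bounded_op (\0 : {linear F2 -> F2}).
Proof.
rewrite /bounded_op (@le_lt_trans _ _ 0%E) ?ltry//.
apply: opnorm_le => // f; rewrite expr0n/= mul0e /sqnorm integral0_eq// => z _.
by rewrite -[X in normc X]/(0 : C) Normc.normc0 expr0n/= mul0r.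
Qed.

Lemma singular_number_opnorm k T : (singular_number k T <= opnorm T)%E.
Proof.
apply: (@le_trans _ _ (opnorm (fun f => T f - (\0 : {linear F2 -> F2}) f)%R)).
  apply: ereal_inf_lbound; exists (\0 : {linear F2 -> F2}) => //; split; first exact: bounded_op0.
  apply: (@rank_le_mono 0) => //.
  by exists (fun=> 0) => f; exists (fun=> 0); rewrite big_ord0.
rewrite (_ : (fun f => _) = T :> (F2 -> F2)) //.
by apply/funext => f; exact: subr0.
Qed.

Lemma bounded_op_add T1 T2 T : bounded_op T1 -> bounded_op T2 ->
  (forall f, T f = T1 f + T2 f) -> bounded_op T.
Proof.
move=> b1 b2 TE; rewrite /bounded_op (funext TE : (T : F2 -> F2) = _).
apply: (le_lt_trans (opnorm_add T1 T2)); rewrite lte_mul_pinfty// ?lee_fin//.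
exact: lte_add_pinfty.
Qed.

Lemma ereal_double_split (x y : \bar R) (e : R) : x \is a fin_num -> y \is a fin_num ->
  (2%:E * (x + (e / 4)%:E + (y + (e / 4)%:E)) <= 2%:E * (x + y) + e%:E)%E.
Proof.
case: x => // x _; case: y => // y _.
rewrite -[leLHS]/(2 * (x + e / 4 + (y + e / 4)))%:E -[leRHS]/(2 * (x + y) + e)%:E lee_fin.
by have : e = 4 * (e / 4) by [field]; lra.
Qed.

(** Near-optimal approximants of ranks [k] and [l] add up to an approximant of rank [k + l]. *)
Lemma singular_number_add k l T1 T2 T : (forall f, T f = T1 f + T2 f) ->
  bounded_op T1 -> bounded_op T2 ->
  (singular_number (k + l) T <= 2%:E * (singular_number k T1 + singular_number l T2))%E.
Proof.
move=> TE b1 b2.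
have f1 : singular_number k T1 \is a fin_num.
  by rewrite ge0_fin_numE ?singular_number_ge0// (le_lt_trans (singular_number_opnorm k T1)).
have f2 : singular_number l T2 \is a fin_num.
  by rewrite ge0_fin_numE ?singular_number_ge0// (le_lt_trans (singular_number_opnorm l T2)).
apply/lee_addgt0Pr => e e0.
(* Two errors [e / 4], doubled by [opnorm_add], make up [e]. *)
have e4 : 0 < e / 4 by rewrite divr_gt0.
have [_ [S1 [bS1 rS1] <-] lt1] := lb_ereal_inf_adherent e4 f1.
have [_ [S2 [bS2 rS2] <-] lt2] := lb_ereal_inf_adherent e4 f2.
have [S SE] : exists S, forall f, S f = S1 f + S2 f by exists (S1 \+ S2).
have bS := bounded_op_add bS1 bS2 SE; have rS := rank_le_add rS1 rS2 SE.
apply: (@le_trans _ _ (opnorm (fun f => T f - S f)%R)).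
  by apply: ereal_inf_lbound; exists S.
have -> : (fun f => T f - S f) = (fun f => (T1 f - S1 f) + (T2 f - S2 f)).
  by apply/funext => f; rewrite TE SE opprD addrACA.
apply: (le_trans (opnorm_add _ _)).
have le := leeD (ltW lt1) (ltW lt2).
apply: (@le_trans _ _ (2%:E * (singular_number k T1 + (e / 4)%:E +
   (singular_number l T2 + (e / 4)%:E)))%E).
  by apply: lee_wpmul2l; rewrite ?lee_fin.
exact: ereal_double_split.
Qed.

End operators.

Section toeplitz_operators.
Variables (R : realType) (n : nat).
Local Notation C := R[i].
Local Notation Cn := 'rV[C]_n.
Local Notation leb := (@lebesgueCn R n).
Local Notation F2 := (fock R n).
Implicit Types (d g h : Cn -> C) (T : {linear F2 -> F2}).

Definition bounded_symbol h := measurable_fun setT h /\ exists M, forall z, normc (h z) <= M.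

Lemma bounded_symbol_L2 h (f : Cn -> C) : bounded_symbol h -> L2 f -> L2 (fun z => h z * f z).
Proof. by move=> [mh [M hM]]; exact: L2_bounded hM. Qed.

(** Every [f] is in the domain, so the operator is [berg] after multiplication by [h]; the norm
    bound [2^n * M] comes from Schur's test for [berg]. *)
Lemma toeplitz_bounded h : bounded_symbol h ->
  exists2 T, toeplitz_extension h T &
    forall (f : F2) w, T f w = berg (fun z => h z * f z) w.
Proof.
move=> bh; have Lh (f : F2) : L2 (fun z => h z * f z).
  exact: bounded_symbol_L2 bh (fock_L2 f).
have [|T TE] := @linear_opP R n (fun f => fock_proj (fun z => h z * f z)).
  move=> a f g; apply: fock_ext => w.
  rewrite fock_addE fock_scaleE !(fock_projE (Lh _)) -(bergZ _ (Lh f)).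
  rewrite -(bergD (L2_scale _ (Lh f)) (Lh g)).
  apply: (congr1 (fun F => berg F w)); apply/funext => z.
  by rewrite fock_addE fock_scaleE; ring.
have TE' (f : F2) w : T f w = berg (fun z => h z * f z) w.
  by rewrite TE (fock_projE (Lh f)).
exists T => //; split; last by move=> f _; rewrite TE.
have [mh [M hM]] := bh.
pose b := 2 ^+ n * M.
have M0 : 0 <= M by exact: le_trans (normc_ge0 _) (hM 0).
have b0 : 0 <= b by rewrite mulr_ge0 ?exprn_ge0.
rewrite /bounded_op (@le_lt_trans _ _ b%:E) ?ltry//; apply: opnorm_le => // f.
rewrite (_ : fock_fun (T f) = berg (fun z => h z * f z)); last exact/funext/TE'.
apply: (le_trans (sqnorm_berg (Lh f))); have -> : b ^+ 2 = (2 ^+ n) ^+ 2 * M ^+ 2 by rewrite exprMn.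
rewrite [X in (_ <= X * _)%E]EFinM -[leRHS]muleA.
apply: lee_wpmul2l; first by rewrite lee_fin sqr_ge0.
have [mf _] := fock_L2 f.
rewrite -(ge0_integralZl_EFin leb measurableT _ _ (sqr_ge0 M)); last 2 first.
- by move=> z _; rewrite lee_fin mulr_ge0 ?sqr_ge0 ?gaussian_ge0.
- by apply/measurable_EFinP; exact: measurable_sqnormf.
apply: ge0_le_integral => //.
- by move=> z _; rewrite lee_fin mulr_ge0 ?sqr_ge0 ?gaussian_ge0.
- by apply/measurable_EFinP; apply: measurable_sqnormf; exact: measurable_cM.
- by apply: measurable_funeM; apply/measurable_EFinP; exact: measurable_sqnormf.
move=> z _; rewrite -EFinM lee_fin [leRHS]mulrA ler_wpM2r ?gaussian_ge0// normcMl exprMn.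
by rewrite ler_wpM2r ?sqr_ge0// ler_sqr ?nnegrE ?normc_ge0.
Qed.

(** [fock_proj] picks from a set of functions characterized by inner products; almost everywhere
    equal functions give the same set, hence the same choice. *)
Lemma fock_proj_ae (f g : Cn -> C) : measurable_fun setT f -> measurable_fun setT g ->
  ae_eq leb setT f g -> fock_proj f = fock_proj g.
Proof.
move=> mf mg fg; rewrite /fock_proj; congr xget; apply/funext => u; apply/propext.
suff E (v : F2) : inner (fun z => f z - u z) v = inner (fun z => g z - u z) v.
  by split=> H v; rewrite ?E// -E.
have [mu _] := fock_L2 (u : F2); have [mv _] := fock_L2 v.
have m (k : Cn -> C) : measurable_fun setT k ->
    measurable_fun setT (fun z => (k z - u z) * (v z)^*%C * (gaussian z)%:C).
  move=> mk; apply: measurable_cM; last by apply: measurable_cR; exact: measurable_gaussian.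
  by apply: measurable_cM; [exact: measurable_cB|exact: measurable_cJ].
apply: (cint_eq_ae measurableT (m _ mf) (m _ mg)).
by apply: filterS fg => z e Dz; rewrite (e Dz).
Qed.

Lemma ae_L2 (f g : Cn -> C) : measurable_fun setT g -> ae_eq leb setT f g -> L2 f -> L2 g.
Proof.
move=> mg fg /L2E[mf Lf]; apply/L2E; split=> //.
suff -> : sqnorm g = sqnorm f by [].
apply: ae_eq_integral => //.
- by apply/measurable_EFinP; exact: measurable_sqnormf.
- by apply/measurable_EFinP; exact: measurable_sqnormf.
- by apply: filterS fg => z e Dz; rewrite (e Dz).
Qed.

(** Since [h] is bounded, multiplication by [d] sends all of [F2] into [L2]; an extension of [T_d]
    is prescribed everywhere and the choice in [toeplitz] has no freedom. The conclusion equates the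
    underlying functions, leaving aside the bundled linearity proofs. *)
Lemma toeplitz_ae d h T : measurable_fun setT d -> bounded_symbol h ->
  ae_eq leb setT d h -> toeplitz_extension h T ->
  (toeplitz d : F2 -> F2) = T.
Proof.
move=> md bh dh [bT TE].
have Lh (f : F2) : L2 (fun z => h z * f z) by exact: bounded_symbol_L2 bh (fock_L2 f).
have aeM (f : F2) : ae_eq leb setT (fun z => d z * f z) (fun z => h z * f z).
  by apply: filterS dh => z e Dz; rewrite (e Dz).
have mM (f : F2) : measurable_fun setT (fun z => d z * f z).
  by apply: measurable_cM => //; have [] := fock_L2 f.
have Ld (f : F2) : L2 (fun z => d z * f z).
  by apply: (ae_L2 (mM f) _ (Lh f)); apply: filterS (aeM f) => z e Dz; rewrite (e Dz).
have E (f : F2) : T f = fock_proj (fun z => d z * f z).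
  rewrite TE//; apply/esym/fock_proj_ae => //; by have [] := Lh f.
have ex : exists T, toeplitz_extension d T by exists T; split.
have [_ tE] := xgetPex (\0 : {linear F2 -> F2}) ex.
by apply/funext => f; rewrite E; exact: tE.
Qed.

Lemma toeplitz_extension_ae d g T : measurable_fun setT d -> measurable_fun setT g ->
  ae_eq leb setT d g -> toeplitz_extension g T -> toeplitz_extension d T.
Proof.
move=> md mg dg [bT TE]; split=> // f Ld.
have [mf _] := fock_L2 f.
have md' := measurable_cM md mf; have mg' := measurable_cM mg mf.
have aeM : ae_eq leb setT (fun z => d z * f z) (fun z => g z * f z).
  by apply: filterS dg => z e Dz; rewrite (e Dz).
by rewrite (fock_proj_ae md' mg' aeM); apply: TE; exact: (ae_L2 mg' aeM Ld).
Qed.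

(** Boundedness of [h] puts the domain of [T_(g+h)] inside that of [T_g], so both given extensions
    can be evaluated there. *)
Lemma toeplitz_extension_add g h T0 T1 T : bounded_symbol h ->
  toeplitz_extension g T0 -> toeplitz_extension h T1 ->
  (forall f, T f = T0 f + T1 f) -> toeplitz_extension (fun z => g z + h z) T.
Proof.
move=> bh [b0 E0] [b1 E1] TE; split; first exact: bounded_op_add TE.
move=> f L; have Lh := bounded_symbol_L2 bh (fock_L2 f).
have Lg : L2 (fun z => g z * f z).
  by have := L2_sub L Lh; under eq_fun do rewrite mulrDl addrK.
rewrite TE E0// E1//; apply: fock_ext => w; rewrite fock_addE !fock_projE//.
refine (etrans (esym (bergD Lg Lh w)) (congr1 (fun F => berg F w) _)).
by apply/funext => z; rewrite mulrDl.
Qed.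

End toeplitz_operators.

(** * Gaussian symbols *)

Section real_to_complex.
Variable R : realType.
Implicit Types (x y : R).

Lemma rcD x y : (x + y)%:C = x%:C + y%:C. Proof. exact: (rmorphD (real_complex R)). Qed.
Lemma rcN x : (- x)%:C = - x%:C. Proof. exact: (rmorphN (real_complex R)). Qed.
Lemma rcM x y : (x * y)%:C = x%:C * y%:C. Proof. exact: (rmorphM (real_complex R)). Qed.
Lemma rcV x : (x^-1)%:C = x%:C^-1. Proof. exact: (fmorphV (real_complex R)). Qed.
Lemma rcX k x : (x ^+ k)%:C = x%:C ^+ k. Proof. exact: (rmorphXn (real_complex R)). Qed.
Lemma rcn k : (k%:R : R)%:C = k%:R. Proof. exact: (rmorph_nat (real_complex R)). Qed.
Lemma rc1 : (1 : R)%:C = 1. Proof. by []. Qed.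
Lemma rc0 : (0 : R)%:C = 0. Proof. by []. Qed.
Lemma rc_eq0 x : (x%:C == 0) = (x == 0). Proof. exact: (fmorph_eq0 (real_complex R)). Qed.
Definition rcE := (rcD, rcN, rcM, rcV, rcX, rcn, rc1, rc0).

End real_to_complex.

Section first_vector.
Variables (R : realType) (n' : nat).
Local Notation n := n'.+1.
Local Notation C := R[i].
Local Notation Cn := 'rV[C]_n.
Implicit Types (z w : Cn).

Definition e1 : Cn := delta_mx ord0 ord0.

Lemma dot_e1r z : dot z e1 = z ord0 ord0.
Proof.
rewrite /dot (bigD1 ord0)//= big1 ?addr0; last first.
  by move=> j /negPf j0; rewrite mxE j0 andbF conjc0 mulr0.
by rewrite mxE !eqxx conjc1 mulr1.
Qed.

Lemma dot_e1l z : dot e1 z = (z ord0 ord0)^*%C.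
Proof. by rewrite dotC dot_e1r. Qed.

Lemma e1E : e1 ord0 ord0 = 1 :> C. Proof. by rewrite mxE !eqxx. Qed.

Lemma dot_e1e1 : dot e1 e1 = 1.
Proof. by rewrite dot_e1r e1E. Qed.

Lemma enorm_e1 (t : R) : enorm (t%:C *: e1) = `|t|.
Proof.
rewrite enormZ normc_real; suff -> : enorm e1 = 1 by rewrite mulr1.
have : (enorm e1 ^+ 2)%:C = 1 :> C by rewrite -dot_enorm dot_e1e1.
move=> /(congr1 (@complex.Re R))/= /eqP.
by rewrite sqrp_eq1 ?enorm_ge0// => /eqP.
Qed.

Lemma dot_shift (p q : R) w z :
  dot (w - q%:C *: e1) (z - p%:C *: e1) =
  dot w z - p%:C * w ord0 ord0 - q%:C * (z ord0 ord0)^*%C + q%:C * p%:C.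
Proof.
by rewrite dotBl !dotBr !dotZl !dotZr dot_e1e1 dot_e1r dot_e1l !conjc_real; ring.
Qed.

Lemma enorm_shift (p : R) z : (enorm (z - p%:C *: e1) ^+ 2) =
  enorm z ^+ 2 - 2 * p * complex.Re (z ord0 ord0) + p ^+ 2.
Proof.
rewrite enormB_sqr dotZr dot_e1r conjc_real ReM/= enorm_e1 real_normK ?num_real//.
by ring.
Qed.

End first_vector.
Arguments e1 {R n'}.

Section symbol.
Variables (R : realType) (n' : nat).
Local Notation n := n'.+1.
Local Notation C := R[i].
Local Notation Cn := 'rV[C]_n.
Local Notation leb := (@lebesgueCn R n).
Local Notation F2 := (fock R n).
Implicit Types (f : F2) (z w : Cn).
Variable x : R.
Hypotheses (x0 : 0 < x) (x1 : x <= 4^-1).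

(** [s] is the decay rate of the symbol. Against the weight of [mu] the rate becomes
    [s + 1/2 = 1/(2 x)], against the endpoint heat kernel [s + 1 = sg]; these are the two rates at
    which [reproducing] is applied to bumps. *)
Let sg : R := (1 + x) / (2 * x).
Let s : R := (1 - x) / (2 * x).

(** The term in [z_1 - conj z_1] is imaginary, so the modulus is a Gaussian around [t e_1]. This
    oscillation, of frequency proportional to [d], moves the centres of the operator's kernel apart
    to [t + d] and [t - d]; the constant [sg * d^2] keeps the heat transform at [t e_1] independent
    of [d]. For [t = d = 0] the operator is the dilation [f(w) -> f(x w)], which explains [x^-n]. *)
Definition bump_symbol (t d : R) z : C := (x ^- n)%:C *
  cexp ((- s * enorm (z - t%:C *: e1) ^+ 2 + sg * d ^+ 2)%:C -
        (sg * d)%:C * (z ord0 ord0 - (z ord0 ord0)^*%C)).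

(** The first two factors are [k_q(w)] and the conjugate of [k_p(z)], with centres on the first
    axis: the kernel of a rank-one operator. The third is expanded in powers of [x] later. *)
Definition bump_kernel (p q : R) (v : Cn * Cn) : C :=
  cexp ((q / 2)%:C * v.1 ord0 ord0 - (q ^+ 2 / 4)%:C) *
  cexp ((p / 2)%:C * (v.2 ord0 ord0)^*%C - (p ^+ 2 / 4)%:C) *
  cexp ((x / 2)%:C * dot (v.1 - q%:C *: e1) (v.2 - p%:C *: e1)).

Let xC0 : x%:C != 0. Proof. by rewrite rc_eq0 gt_eqF. Qed.

Lemma enormC z : (enorm z ^+ 2)%:C = dot z z. Proof. by rewrite dot_enorm. Qed.

(** Sorts the exponent into a Gaussian, an antiholomorphic and a holomorphic exponential in [z], the
    shape that [reproducing] expects. *)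
Lemma bump_symbolE t d z : bump_symbol t d z = (x ^- n)%:C *
  ((expR (- s * enorm z ^+ 2))%:C * cexp (dot ((s * t + sg * d)%:C *: e1) z) *
   cexp ((s * t - sg * d)%:C * dot z e1 + (sg * d ^+ 2 - s * t ^+ 2)%:C)).
Proof.
rewrite -cexp_real -!cexpD; congr (_ * cexp _).
rewrite dotZl dot_e1l dot_e1r rcD (rcM (- s)) enormC dot_shift (rcM (- s)) enormC.
by rewrite !rcE; ring.
Qed.

Lemma normc_bump_symbol t d z : normc (bump_symbol t d z) =
  x ^- n * expR (- s * enorm (z - t%:C *: e1) ^+ 2 + sg * d ^+ 2).
Proof.
rewrite normcMl normc_cexp normc_real ger0_norm ?invr_ge0 ?exprn_ge0 ?ltW//.
congr (_ * expR _); rewrite ReD/= ReN ReM/= mul0r subr0 ReD ReN ReJ subrr mulr0 subr0.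
by [].
Qed.

Lemma measurable_e1 (t : R) : measurable_fun setT (fun z : Cn => z - t%:C *: e1).
Proof. by apply: measurable_rowB; [exact: measurable_id|exact: measurable_cst]. Qed.

Lemma measurable_bump_symbol t d : measurable_fun setT (bump_symbol t d).
Proof.
apply: measurable_cZ; apply: measurable_cexp; apply: measurable_cB.
  apply: measurable_cR; apply: measurable_funD; last exact: measurable_cst.
  apply: measurable_funM; first exact: measurable_cst.
  by apply: measurable_funX; apply: measurable_enormf; exact: measurable_e1.
apply: measurable_cZ; apply: measurable_cB; first exact: measurable_coor.
by apply: measurable_cJ; exact: measurable_coor.
Qed.

(** From [x <= 1/4]. It gives [s >= 5/8], the rate assumed in [weighted_norm_bump]. *)
Lemma s_ge : 1 + 4^-1 <= 2 * s.
Proof.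
have -> : 2 * s = (1 - x) / x by rewrite /s; field; rewrite gt_eqF.
rewrite ler_pdivlMr//.
by move: x1; lra.
Qed.

Lemma s_gt0 : 0 < s. Proof. by have := s_ge; lra. Qed.

Lemma bump_symbol_bound t d z : normc (bump_symbol t d z) <= x ^- n * expR (sg * d ^+ 2).
Proof.
rewrite normc_bump_symbol ler_wpM2l ?invr_ge0 ?exprn_ge0 ?(ltW x0)//.
by rewrite ler_expR gerDr mulNr oppr_le0 mulr_ge0 ?sqr_ge0 ?(ltW s_gt0).
Qed.

Lemma bump_symbol_bounded t d : bounded_symbol (bump_symbol t d).
Proof.
by split; [exact: measurable_bump_symbol|eexists => z; exact: bump_symbol_bound].
Qed.

Lemma bump_kernelE p q w z : bump_kernel p q (w, z) =
  cexp (((q - x * p) / 2)%:C * w ord0 ord0 + (x * p * q / 2 - q ^+ 2 / 4 - p ^+ 2 / 4)%:C) *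
  fock_kernel (x%:C *: w + (p - x * q)%:C *: e1, z).
Proof.
rewrite /bump_kernel/= /fock_kernel/= -!cexpD; congr cexp.
by rewrite dot_shift dotDl !dotZl dot_e1l !rcE; field.
Qed.

(** In [z] the kernel is a multiple of the Fock kernel at the point [v], so the reproducing property
    gives a weighted composition operator: contraction by [x], translation, multiplication by an
    exponential. *)
Lemma bump_kernel_op p q f w : kernel_op (bump_kernel p q) f w =
  cexp (((q - x * p) / 2)%:C * w ord0 ord0 + (x * p * q / 2 - q ^+ 2 / 4 - p ^+ 2 / 4)%:C) *
  f (x%:C *: w + (p - x * q)%:C *: e1).
Proof.
set v := _ + _ *: e1; set c := cexp _.
rewrite -[in RHS](berg_fock (fock_entire f) (fock_L2 f)).
refine (etrans _ (cintZ c measurableT (fock_kernel_cintble (fock_L2 f) v))).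
by apply: (@eq_cint _ _ _ leb) => z _; rewrite bump_kernelE mulrCA !mulrA.
Qed.

Lemma line_holomorphic_fock_cexp f (a b : C) :
  line_holomorphic (fun z => f z * cexp (a * dot z e1 + b)).
Proof.
apply: line_holomorphicM; first by apply: entire_line_holomorphic; exact: fock_entire.
by apply: entire_line_holomorphic; exact: cexp_dot_entire.
Qed.

Lemma measurable_cexp_dot (a b : C) : measurable_fun setT (fun z => cexp (a * dot z e1 + b)).
Proof.
apply: measurable_cexp; apply: measurable_cD; last exact: measurable_cst.
apply: measurable_cZ; apply: measurable_dot; first exact: measurable_id.
exact: measurable_cst.
Qed.

(** [reproducing] at rate [1/(2 x)] evaluates [f] at the same point as in [bump_kernel_op]; that the
    exponential prefactors agree is the algebra behind [s] and [sg]. *)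
Lemma berg_bump_symbol t d f w :
  berg (fun z => bump_symbol t d z * f z) w = kernel_op (bump_kernel (t + d) (t - d)) f w.
Proof.
pose g : R := (2 * x)^-1.
have g0 : 0 < g by rewrite invr_gt0 mulr_gt0.
have eg : g = s + 2^-1 by rewrite /g /s; field; rewrite gt_eqF.
have xn0 : x != 0 by rewrite gt_eqF.
have eu : g^-1 * (s * t + sg * d) = t + d - x * (t - d).
  by rewrite /g invrK /s /sg; field.
have ew : g^-1 * 2^-1 = x by rewrite /g invrK; field.
pose u : Cn := (s * t + sg * d)%:C *: e1 + (2^-1)%:C *: w.
pose a := (s * t - sg * d)%:C; pose b := (sg * d ^+ 2 - s * t ^+ 2)%:C.
pose F z := f z * cexp (a * dot z e1 + b).
have Lh : L2 (fun z => bump_symbol t d z * f z).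
  exact: bounded_symbol_L2 (bump_symbol_bounded t d) (fock_L2 f).
pose c : C := ((2 * pi) ^- n * x ^- n)%:C.
have E z : bump_symbol t d z * f z * fock_kernel (w, z) * (gaussian z)%:C =
    c * ((expR (- g * enorm z ^+ 2))%:C * cexp (dot u z) * F z).
  rewrite bump_symbolE gaussE /c /fock_kernel/= /F -!/a -!/b !rcM.
  rewrite /u dotDl cexpD (dotZl (2^-1)%:C).
  have -> : (expR (- g * enorm z ^+ 2))%:C =
      (expR (- s * enorm z ^+ 2))%:C * (expR (- 2^-1 * enorm z ^+ 2))%:C.
    by rewrite -rcM -expRD -mulrDl -opprD -eg.
  by ring.
have c0 : c != 0.
  by rewrite rc_eq0 mulf_neq0// invr_neq0// expf_neq0 ?gt_eqF// mulr_gt0 ?pi_gt0.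
have iF : cintble leb setT (fun z => (expR (- g * enorm z ^+ 2))%:C * cexp (dot u z) * F z).
  apply: (eq_cintble _ (cintbleZ c^-1 measurableT (fock_kernel_cintble Lh w))) => z.
  by rewrite E mulKf.
have mF : measurable_fun setT F.
  by apply: measurable_cM; [have [] := fock_L2 f|exact: measurable_cexp_dot].
refine (etrans (@eq_cint _ _ _ leb setT _ _ (fun z _ => E z)) _).
refine (etrans (cintZ c measurableT iF) _).
rewrite (reproducing (line_holomorphic_fock_cexp f a b) g0 mF iF) bump_kernel_op.
have -> : (g^-1)%:C *: u = x%:C *: w + (t + d - x * (t - d))%:C *: e1.
  by rewrite /u scalerDr !scalerA addrC -!rcM eu ew.
rewrite /F mulrA.
have -> : c * ((pi / g) ^+ n)%:C = 1.
  rewrite /c -rcM -!exprVn -!exprMn /g invrK.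
  rewrite (_ : _ * _ * _ = 1) ?expr1n// -mulrA; have p0 := pi_gt0 R.
  by move: (pi : R) p0 => y y0; field; rewrite !gt_eqF.
rewrite mul1r mulrC; congr (cexp _ * _).
rewrite dotDl !dotZl dot_e1e1 dot_e1r mulr1 /a /b /s /sg !rcE.
by field; exact: xC0.
Qed.

End symbol.

Section bump_estimates.
Variables (R : realType) (n' : nat).
Local Notation n := n'.+1.
Local Notation C := R[i].
Local Notation Cn := 'rV[C]_n.
Local Notation leb := (@lebesgueCn R n).
Local Notation F2 := (fock R n).
Implicit Types (f : F2) (z w : Cn) (h : Cn -> C).

(** At rate [sg] the evaluation point of [reproducing] is [(t + d) e_1], where the holomorphic
    factor has exponent 0. What remains is the product of [pi^-n], [x^-n] and [(pi / sg)^n]. *)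
Lemma heat_bump_symbol (x t d : R) : 0 < x -> x <= 4^-1 ->
  heat_transform (@bump_symbol R n' x t d) (t%:C *: e1) = ((2 / (1 + x)) ^+ n)%:C.
Proof.
move=> x0 x1; pose sg : R := (1 + x) / (2 * x).
have xn0 : x != 0 by rewrite gt_eqF.
have xC0 : x%:C != 0 by rewrite rc_eq0.
have x10 : 1 + x != 0 by rewrite gt_eqF// addr_gt0.
have sg0 : 0 < sg by rewrite divr_gt0 ?addr_gt0 ?mulr_gt0.
pose u : Cn := (sg * t + sg * d)%:C *: e1.
pose a := (sg * t - sg * d)%:C; pose b := (sg * d ^+ 2 - sg * t ^+ 2)%:C.
pose F z := cexp (a * dot z e1 + b).
pose G z := bump_symbol x t d z * (expR (- enorm (z - t%:C *: e1) ^+ 2))%:C.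
pose c : C := (x ^- n)%:C.
have E z : G z = c * ((expR (- sg * enorm z ^+ 2))%:C * cexp (dot u z) * F z).
  rewrite /G /F /bump_symbol -/c -!cexp_real -mulrA -!cexpD; congr (_ * cexp _).
  rewrite /u dotZl dot_e1l dot_e1r /a /b /sg !rcD !(rcM (- _)) !rcN !enormC dot_shift !rcE.
  by field.
have mG : measurable_fun setT G.
  apply: measurable_cM; first exact: measurable_bump_symbol.
  apply: measurable_cR; apply: measurableT_comp => //; apply: measurableT_comp => //.
  by apply: measurable_funX; apply: measurable_enormf; exact: measurable_e1.
pose K : R := x ^- n * expR (sg * d ^+ 2).
have iG : cintble leb setT G.
  apply: (le_cintble measurableT mG
    (integrable_scale K (gauss_integrable (t%:C *: e1) (@ltr01 R)))) => z _.
  rewrite normcMl normc_real ger0_norm ?expR_ge0// mulN1r.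
  by rewrite ler_wpM2r ?expR_ge0// bump_symbol_bound.
have c0 : c != 0 by rewrite rc_eq0 invr_neq0// expf_neq0.
have iF : cintble leb setT (fun z => (expR (- sg * enorm z ^+ 2))%:C * cexp (dot u z) * F z).
  apply: (eq_cintble _ (cintbleZ c^-1 measurableT iG)) => z.
  by rewrite E mulKf.
have lF : line_holomorphic F by apply: entire_line_holomorphic; exact: cexp_dot_entire.
rewrite /heat_transform.
have -> : cintegral (fun w => bump_symbol x t d w * (expR (- enorm (w - t%:C *: e1) ^+ 2))%:C) =
    c * ((pi / sg) ^+ n)%:C * F ((sg^-1)%:C *: u).
  refine (etrans (@eq_cint _ _ _ leb setT _ _ (fun z _ => E z)) _).
  refine (etrans (cintZ c measurableT iF) _).
  by rewrite (reproducing lF sg0 (measurable_cexp_dot a b) iF) mulrA.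
have -> : F ((sg^-1)%:C *: u) = 1.
  rewrite /F /u !dotZl dot_e1e1 mulr1 -!rcM -rcD.
  suff -> : (sg * t - sg * d) * (sg^-1 * (sg * t + sg * d)) +
      (sg * d ^+ 2 - sg * t ^+ 2) = 0 by rewrite cexp0.
  by rewrite /sg; field; rewrite x10 xn0.
rewrite mulr1 -!rcM; congr (_%:C); rewrite /c mulrA -!exprVn -!exprMn.
congr (_ ^+ _); have p0 := pi_gt0 R; move: (pi : R) p0 => y y0.
by rewrite /sg; field; rewrite x10 xn0 gt_eqF.
Qed.

Lemma poweR_half_le (y : \bar R) (k : R) : (0 <= y)%E -> 0 <= k ->
  (y <= (k ^+ 2)%:E)%E -> (y `^ 2^-1 <= k%:E)%E.
Proof.
case: y => [y|//|//]; rewrite !lee_fin => y0 k0 yk.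
rewrite powR12_sqrt// -[leRHS]ger0_norm// -sqrtr_sqr.
by rewrite ler_sqrt ?sqr_ge0.
Qed.

Lemma weighted_norm_le (m : nat) h (k : R) : 0 <= k -> measurable_fun setT h ->
  (\int[leb]_z (normc (h z) ^+ 2 * expR (- enorm z ^+ 2 / 2 + m%:R * enorm z))%:E <=
    ((2 * pi) ^+ n * k ^+ 2)%:E)%E -> (weighted_norm m h <= k%:E)%E.
Proof.
move=> k0 mh le; apply: poweR_half_le => //.
  apply: mule_ge0; first by rewrite lee_fin; exact: twopi_ge0.
  by apply: integral_ge0 => z _; rewrite lee_fin mulr_ge0 ?sqr_ge0 ?expR_ge0.
apply: (le_trans (lee_wpmul2l _ le)); first by rewrite lee_fin; exact: twopi_ge0.
rewrite -EFinM lee_fin mulrA mulVf ?mul1r//.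
by rewrite expf_neq0// gt_eqF// mulr_gt0 ?pi_gt0.
Qed.

(** Moving the centre [t] away makes [q_m] small, because its weight decays at infinity. Of the rate
    [5/4] of the squared modulus, 1 is kept for the integration; the remaining [1/4], with half of
    the weight's [1/2], produces [exp (- t^2/8)]. *)
Lemma weighted_norm_bump (m : nat) h (K t k : R) : 0 <= k -> 0 <= K ->
  measurable_fun setT h ->
  (forall z, normc (h z) <= K * expR (- (5 / 8) * enorm (z - t%:C *: e1) ^+ 2)) ->
  K ^+ 2 * (expR (m%:R ^+ 2) * expR (- (8^-1) * t ^+ 2)) <= k ^+ 2 ->
  (weighted_norm m h <= k%:E)%E.
Proof.
move=> k0 K0 mh hK Kk; apply: weighted_norm_le => //.
pose c : R := K ^+ 2 * (expR (m%:R ^+ 2) * expR (- (8^-1) * t ^+ 2)).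
apply: (@le_trans _ _ (\int[leb]_z
    (c * expR (- 1 * enorm (z - t%:C *: e1) ^+ 2))%:E)%E).
  apply: ge0_le_integral => //.
  - by move=> z _; rewrite lee_fin mulr_ge0 ?sqr_ge0 ?expR_ge0.
  - apply/measurable_EFinP; apply: measurable_funM.
      by apply: measurable_funX; exact: measurable_normc.
    apply: measurableT_comp => //; apply: measurable_funD.
      apply: measurable_funM => //; apply: measurableT_comp => //.
      by apply: measurable_funX; exact: measurable_enorm.
    by apply: measurable_funM => //; exact: measurable_enorm.
  - apply/measurable_EFinP; apply: measurable_funM => //.
    by apply: measurable_expR_enorm; exact: measurable_e1.
  move=> z _; rewrite lee_fin.
  have h2 : normc (h z) ^+ 2 <=
      K ^+ 2 * expR (- (5 / 4) * enorm (z - t%:C *: e1) ^+ 2).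
    apply: (@le_trans _ _ ((K * expR (- (5 / 8) * enorm (z - t%:C *: e1) ^+ 2)) ^+ 2)).
      by rewrite ler_sqr ?nnegrE ?normc_ge0// mulr_ge0 ?expR_ge0.
    rewrite exprMn ler_wpM2l ?sqr_ge0// -expRM_natl ler_expR.
    by move: (enorm _ ^+ 2) => y; lra.
  apply: (@le_trans _ _ (K ^+ 2 * expR (- (5 / 4) * enorm (z - t%:C *: e1) ^+ 2) *
      expR (- enorm z ^+ 2 / 2 + m%:R * enorm z))).
    by rewrite ler_wpM2r ?expR_ge0.
  rewrite /c -[leLHS]mulrA -[leRHS]mulrA ler_wpM2l ?sqr_ge0// -!expRD ler_expR.
  (* The other half of the weight absorbs [m |z|] at the cost of [m^2]. *)
  have := sqr_ge0 (enorm z / 2 - m%:R).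
  have := enormD_sqr_le z (t%:C *: e1 - z).
  rewrite addrC subrK enorm_e1 real_normK ?num_real// (enorm_distC _ z).
  by rewrite sqrrB; move: (enorm (z - _) ^+ 2) (enorm z) => y y'; lra.
have c0 : 0 <= c by rewrite !mulr_ge0 ?sqr_ge0 ?expR_ge0.
rewrite (integral_scaled_gauss _ (@ltr01 R) c0) lee_fin divr1 mulrC.
apply: ler_pM; rewrite ?exprn_ge0 ?pi_ge0//.
by rewrite ler_pXn2r ?nnegrE ?mulr_ge0 ?pi_ge0// ler_peMl ?pi_ge0// ler1n.
Qed.

End bump_estimates.

(** * Finite-rank approximation *)

Section separated_kernels.
Variables (R : realType) (n : nat).
Local Notation C := R[i].
Local Notation Cn := 'rV[C]_n.
Local Notation leb := (@lebesgueCn R n).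
Local Notation F2 := (fock R n).
Implicit Types (f : F2) (z w : Cn) (kap : Cn * Cn -> C).

Definition exp_growth (h : Cn -> C) := entire h /\ exists K c : R,
  [/\ 0 <= K, 0 <= c & forall z, normc (h z) <= K * expR (c * enorm z)].

Lemma exp_growth_coor (h : Cn -> C) j a : exp_growth h ->
  exp_growth (fun z => h z * (z ord0 j - a)).
Proof.
move=> [eh [K [c [K0 c0 hK]]]]; split.
  move=> z; apply: differentiableM; first exact: eh.
  by apply: differentiableB => //; exact: differentiable_coord.
exists (K * (1 + normc a)), (c + 1); split=> [||z].
- by rewrite mulr_ge0// addr_ge0 ?normc_ge0.
- by rewrite addr_ge0.
rewrite normcMl mulrDl mul1r expRD mulrACA; apply: ler_pM; rewrite ?normc_ge0//.
have := expR_ge1Dx (enorm z); have z0 := enorm_ge0 z; have a0 := normc_ge0 a => e1.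
apply: (le_trans (normc_sub _ _)); apply: (@le_trans _ _ (enorm z + normc a)).
  by rewrite lerD2r normc_coor_le.
by nra.
Qed.

Lemma exp_growth_L2 (h : Cn -> C) : exp_growth h -> measurable_fun setT h ->
  L2 h.
Proof.
move=> [_ [K [c [K0 c0 hK]]]] mh.
have ig : leb.-integrable setT (fun z => (K ^+ 2 * ((2 * pi) ^- n * expR ((2 * c) ^+ 2)) *
    expR (- 4^-1 * enorm z ^+ 2))%:E).
  by apply: integrable_scale; apply: gauss_integrable0; rewrite invr_gt0.
apply: (L2_le mh ig) => z.
apply: (@le_trans _ _ ((K * expR (c * enorm z)) ^+ 2 * gaussian z)).
  rewrite ler_wpM2r ?gaussian_ge0//.
  by rewrite ler_sqr ?nnegrE ?normc_ge0// mulr_ge0 ?expR_ge0.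
rewrite exprMn gaussE -[leLHS]mulrA -[leRHS]mulrA ler_wpM2l ?sqr_ge0//.
rewrite mulrCA -[leRHS]mulrA ler_wpM2l ?twopi_ge0// (le_trans _ (expo_gauss_le (2 * c) z))//.
by rewrite ler_wpM2r ?expR_ge0// -expRM_natl mulrA.
Qed.

(* Measurability is part of the definition: continuity of entire functions does
   not immediately yield it for the Borel structure of [Defs]. *)
Definition separated (N : nat) kap := exists phi psi : 'I_N -> Cn -> C,
  [/\ forall i, exp_growth (phi i) /\ measurable_fun setT (phi i),
      forall i, exp_growth (psi i) /\ measurable_fun setT (psi i) &
      forall w z, kap (w, z) = \sum_(i < N) phi i w * (psi i z)^*%C].

Lemma separated0 : separated 0 (fun=> 0).
Proof. by exists (fun=> 0), (fun=> 0); split=> [[]//|[]//|w z]; rewrite big_ord0. Qed.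

Lemma separated_add N M kap1 kap2 : separated N kap1 -> separated M kap2 ->
  separated (N + M) (fun p => kap1 p + kap2 p).
Proof.
move=> [phi1 [psi1 [g1 m1 e1]]] [phi2 [psi2 [g2 m2 e2]]].
exists (fun i => match fintype.split i with inl j => phi1 j | inr j => phi2 j end).
exists (fun i => match fintype.split i with inl j => psi1 j | inr j => psi2 j end).
split=> [i|i|w z]; try by case: fintype.split.
rewrite e1 e2 big_split_ord/=; congr (_ + _); apply: eq_bigr => i _.
  by rewrite (unsplitK (inl i)).
by rewrite (unsplitK (inr i)).
Qed.

Lemma separated_sum m N (F : 'I_m -> Cn * Cn -> C) : (forall i, separated N (F i)) ->
  separated (m * N) (fun p => \sum_(i < m) F i p).
Proof.
elim: m F => [|m IH] F HF.
  rewrite (_ : (fun _ => _) = fun=> 0); first exact: separated0.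
  by apply/funext => p; rewrite big_ord0.
rewrite mulSn (_ : (fun _ => _) = fun p => F ord0 p + \sum_(i < m) F (lift ord0 i) p).
  by apply: separated_add => //; apply: IH.
by apply/funext => p; rewrite big_ord_recl.
Qed.

Lemma separated_coor N kap j a b : separated N kap ->
  separated N (fun p => kap p * ((p.1 ord0 j - a) * (p.2 ord0 j - b)^*%C)).
Proof.
move=> [phi [psi [g m e]]].
have mc (c : C) : measurable_fun setT (fun z : Cn => z ord0 j - c).
  by apply: measurable_cB; [exact: measurable_coor|exact: measurable_cst].
exists (fun i z => phi i z * (z ord0 j - a)), (fun i z => psi i z * (z ord0 j - b)).
split=> [i|i|w z].
- by have [gi mi] := g i; split; [exact: exp_growth_coor|exact: measurable_cM].
- by have [gi mi] := m i; split; [exact: exp_growth_coor|exact: measurable_cM].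
rewrite /= e mulr_suml; apply: eq_bigr => i _; rewrite conjcM; ring.
Qed.

Lemma separated_dot N kap a b : separated N kap ->
  separated (n * N) (fun p => kap p * dot (p.1 - a) (p.2 - b)).
Proof.
move=> sk; rewrite (_ : (fun _ => _) = fun p => \sum_(j < n)
    kap p * ((p.1 ord0 j - a ord0 j) * (p.2 ord0 j - b ord0 j)^*%C)).
  by apply: separated_sum => j; exact: separated_coor.
by apply/funext => p; rewrite /dot mulr_sumr; apply: eq_bigr => j _; rewrite !mxE.
Qed.

Lemma separated_dotX N kap a b k : separated N kap ->
  separated (n ^ k * N) (fun p => kap p * dot (p.1 - a) (p.2 - b) ^+ k).
Proof.
move=> sk; elim: k => [|k IH].
  by rewrite mul1n; under eq_fun do rewrite expr0 mulr1.
by rewrite expnS -mulnA; under eq_fun do rewrite exprSr mulrA; exact: separated_dot.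
Qed.

Lemma separated_scale N kap c : separated N kap -> separated N (fun p => c * kap p).
Proof.
move=> [phi [psi [g m e]]]; exists (fun i z => c * phi i z), psi; split=> // [i|w z].
  have [[ei [K [r [K0 r0 hK]]]] mi] := g i; split; last exact: measurable_cZ.
  split; first by move=> z; apply: differentiableM => //; exact: ei.
  exists (normc c * K), r; split=> [||z] //; first by rewrite mulr_ge0 ?normc_ge0.
  by rewrite normcMl -mulrA ler_wpM2l ?normc_ge0.
by rewrite e mulr_sumr; apply: eq_bigr => i _; rewrite mulrA.
Qed.

(** The [k]-th power of [dot] expands into [n^k] separated products, one per word in the
    coordinates. Equal monomials are not collected, so the rank is overestimated but has a simple
    closed form. *)
Lemma separated_taylor kap a b (y : C) L : separated 1 kap ->
  separated (\sum_(k < L) n ^ k)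
    (fun p => kap p * \sum_(k < L) (y * dot (p.1 - a) (p.2 - b)) ^+ k / k`!%:R).
Proof.
move=> sk; elim: L => [|L IH].
  rewrite big_ord0; under eq_fun do rewrite big_ord0 mulr0; exact: separated0.
rewrite big_ord_recr/= (_ : (fun _ => _) = fun p =>
    kap p * (\sum_(k < L) (y * dot (p.1 - a) (p.2 - b)) ^+ k / k`!%:R) +
    kap p * ((y * dot (p.1 - a) (p.2 - b)) ^+ L / L`!%:R)); last first.
  by apply/funext => p; rewrite big_ord_recr mulrDr.
apply: (separated_add IH).
rewrite (_ : (fun _ => _) = fun p => (y ^+ L / L`!%:R) *
    (kap p * dot (p.1 - a) (p.2 - b) ^+ L)).
  by apply: separated_scale; have := separated_dotX a b L sk; rewrite muln1.
by apply/funext => p; rewrite exprMn; ring.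
Qed.

Lemma inner_sum_separated N kap : separated N kap -> exists psi e : 'I_N -> F2,
  forall f w, cintble leb setT (fun z => f z * kap (w, z) * (gaussian z)%:C) /\
    kernel_op kap f w = (\sum_(i < N) inner f (psi i) *: e i) w.
Proof.
move=> [phi [psi [g m e]]].
have F2of (h : 'I_N -> Cn -> C) : (forall i, exp_growth (h i) /\ measurable_fun setT (h i)) ->
    exists u : 'I_N -> F2, forall i, u i = h i :> (Cn -> C).
  move=> H; have mem i : h i \in @fock_pred R n.
    by have [gi mi] := H i; apply: fock_memP; [have [] := gi|exact: exp_growth_L2].
  by exists (fun i => Fock (mem i)).
have [E EE] := F2of _ g; have [P PE] := F2of _ m.
exists P, E => f w.
have i1 i : cintble leb setT (fun z => phi i w * (f z * (P i z)^*%C * (gaussian z)%:C)).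
  by apply: cintbleZ => //; exact: (L2_inner_cintble (fock_L2 f) (fock_L2 (P i))).
have eq z : \sum_(i < N) phi i w * (f z * (P i z)^*%C * (gaussian z)%:C) =
    f z * kap (w, z) * (gaussian z)%:C.
  rewrite e mulr_sumr mulr_suml; apply: eq_bigr => i _; rewrite PE; ring.
split; first exact: (eq_cintble eq (cintble_sum _ measurableT i1)).
refine (etrans (@eq_cint _ _ _ leb setT _ _ (fun z _ => esym (eq z))) _).
refine (etrans (cint_sum _ measurableT i1) _).
rewrite fock_sumE; apply: eq_bigr => i _; rewrite fock_scaleE EE mulrC.
exact: (cintZ (phi i w) measurableT (L2_inner_cintble (fock_L2 f) (fock_L2 (P i)))).
Qed.

Lemma separated_measurable N kap : separated N kap -> measurable_fun setT kap.
Proof.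
move=> [phi [psi [g m e]]].
rewrite (_ : kap = fun p => \sum_(i < N) phi i p.1 * (psi i p.2)^*%C).
  apply: measurable_csum => i; apply: measurable_cM.
    by apply: measurableT_comp; [have [] := g i|exact: measurable_fst].
  apply: measurable_cJ.
  by apply: measurableT_comp; [have [] := m i|exact: measurable_snd].
by apply/funext => -[w z]; rewrite e.
Qed.

End separated_kernels.

Section gaussian_sums.
Variable R : realType.

(** At most one centre lies within [A / 2] of [y], and it contributes at most 1. For each other one
    the exponent is at least [A^2 / 32 >= D], so it contributes at most [exp (- D) <= 1 / D], and
    all of them together at most 1. *)
Lemma gaussian_sum_le (D : nat) (A : R) (q : nat -> R) (y : R) : 0 <= A ->
  D%:R * 32 <= A ^+ 2 ->
  (forall i j, (i < D)%N -> (j < D)%N -> i != j -> A <= `|q i - q j|) ->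
  \sum_(j < D) expR (- (8^-1) * (y - q j) ^+ 2) <= 2.
Proof.
move=> A0 DA sep.
have D0 : 0 <= D%:R :> R by [].
have far j : (j < D)%N -> A / 2 <= `|y - q j| ->
    expR (- (8^-1) * (y - q j) ^+ 2) <= D%:R^-1.
  move=> jD le; have Dp : 0 < D%:R :> R by rewrite ltr0n (leq_ltn_trans _ jD).
  have sq : (A / 2) ^+ 2 <= (y - q j) ^+ 2.
    by rewrite -[leRHS]real_normK ?num_real// ler_sqr ?nnegrE ?divr_ge0.
  rewrite mulNr expRN lef_pV2 ?posrE ?expR_gt0//.
  apply: (le_trans _ (expR_ge1Dx _)); move: sq; rewrite exprMn exprVn => sq.
  have : 4 * (A ^+ 2 / 2 ^+ 2) = A ^+ 2 by field.
  by lra.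
have one j : expR (- (8^-1) * (y - q j) ^+ 2) <= 1.
  by rewrite -expR0 ler_expR mulNr oppr_le0 mulr_ge0 ?sqr_ge0.
have sumD (P : pred 'I_D) (F : 'I_D -> R) : (forall j, P j -> F j <= D%:R^-1) ->
    \sum_(j < D | P j) F j <= 1.
  move=> H; apply: (le_trans (ler_sum _ H)).
  apply: (@le_trans _ _ (\sum_(j < D) D%:R^-1)).
    by rewrite [leRHS](bigID P)/= lerDl sumr_ge0// => j _; rewrite invr_ge0.
  rewrite sumr_const card_ord -[leLHS]mulr_natl.
  by case: (D) => [|k]; rewrite ?mul0r// divff ?pnatr_eq0.
have [/existsP[j0 j0n]|/existsPn no] := boolP [exists j : 'I_D, `|y - q j| < A / 2].
  rewrite (bigD1 j0)//= (_ : 2 = 1 + 1 :> R)// lerD//.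
  apply: sumD => j jj0; apply: far => //; rewrite leNgt; apply/negP => jn.
  have := sep _ _ (ltn_ord j) (ltn_ord j0) jj0.
  have -> : q j - q j0 = (y - q j0) - (y - q j) by ring.
  move=> /le_trans/(_ (ler_normB _ _)); move: j0n jn; lra.
apply: (@le_trans _ _ 1); last by rewrite ler1n.
by apply: sumD => j _; apply: far => //; rewrite leNgt no.
Qed.

Lemma expR_ge_coeff (k : nat) (y : R) : 0 <= y -> y ^+ k / k`!%:R <= expR y.
Proof.
case: k => [|k] y0; first by rewrite expr0 fact0 divr1 -expR0 ler_expR.
by apply: (le_trans _ (expR_ge1Dxn k y0)); rewrite lerDr.
Qed.

End gaussian_sums.

(** With [y = a b / 8] one has [r <= 4 x y <= y], hence [r^L / L! <= (4 x)^L e^y] and [e^r <= e^y].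
    The product [e^(2y)] costs half of the Gaussians, as [a b / 4 <= (a^2 + b^2) / 8]. *)
Lemma taylor_gauss_bound (R : realType) (x a b r E : R) (L : nat) : 0 < x -> x <= 4^-1 ->
  0 <= a -> 0 <= b -> 0 <= r -> r <= x / 2 * (a * b) -> E <= r ^+ L / L`!%:R * expR r ->
  E * (expR (- 4^-1 * a ^+ 2) * expR (- 4^-1 * b ^+ 2)) <=
  (4 * x) ^+ L * (expR (- 8^-1 * a ^+ 2) * expR (- 8^-1 * b ^+ 2)).
Proof.
move=> x0 x1 a0 b0 r0 rle Ele.
pose y := a * b / 8; have y0 : 0 <= y by rewrite divr_ge0// mulr_ge0.
have ry : r <= (4 * x) * y by rewrite (le_trans rle)// /y; lra.
have x40 : 0 <= 4 * x by rewrite mulr_ge0// ltW.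
have x41 : 4 * x <= 1 by move: x1; lra.
have ry' : r <= y by rewrite (le_trans ry)// ler_piMl.
have E2 : E <= (4 * x) ^+ L * (expR y * expR y).
  apply: (le_trans Ele); rewrite mulrA; apply: ler_pM; rewrite ?expR_ge0 ?ler_expR//.
    by rewrite divr_ge0// exprn_ge0.
  apply: (@le_trans _ _ (((4 * x) * y) ^+ L / L`!%:R)).
    by rewrite ler_pM2r ?invr_gt0 ?ltr0n ?fact_gt0// lerXn2r ?nnegrE// mulr_ge0.
  by rewrite exprMn -mulrA ler_wpM2l ?exprn_ge0// expR_ge_coeff.
apply: (@le_trans _ _ ((4 * x) ^+ L * (expR y * expR y) *
    (expR (- 4^-1 * a ^+ 2) * expR (- 4^-1 * b ^+ 2)))).
  by rewrite ler_wpM2r// mulr_ge0 ?expR_ge0.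
rewrite -mulrA ler_wpM2l ?exprn_ge0// -!expRD ler_expR /y.
by have := sqr_ge0 (a - b); rewrite sqrrB; lra.
Qed.

Section kernel_sums.
Variables (R : realType) (n : nat).
Local Notation C := R[i].
Local Notation Cn := 'rV[C]_n.
Local Notation leb := (@lebesgueCn R n).
Local Notation F2 := (fock R n).
Implicit Types (f : F2) (z w : Cn).

Lemma kernel_cintble_sum D (F : 'I_D -> Cn * Cn -> C) (c : C) f :
  (forall j, kernel_cintble (F j) f) ->
  kernel_cintble (fun p => c * \sum_(j < D) F j p) f.
Proof.
move=> iF w; apply: (eq_cintble _ (cintbleZ c measurableT
  (cintble_sum _ measurableT (fun j => iF j w)))) => z.
by rewrite -mulr_suml -mulr_sumr; ring.
Qed.

Lemma kernel_op_sum D (F : 'I_D -> Cn * Cn -> C) (c : C) f w :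
  (forall j, kernel_cintble (F j) f) ->
  kernel_op (fun p => c * \sum_(j < D) F j p) f w = c * \sum_(j < D) kernel_op (F j) f w.
Proof.
move=> iF; rewrite -(cint_sum _ measurableT (fun j => iF j w)).
rewrite -(cintZ c measurableT (cintble_sum _ measurableT (fun j => iF j w))).
by apply: (@eq_cint _ _ _ leb) => z _; rewrite -mulr_suml -mulr_sumr; ring.
Qed.

Lemma berg_sum D (b : 'I_D -> Cn -> C) (c : C) f w :
  (forall j, L2 (fun z => b j z * f z)) ->
  berg (fun z => c * (\sum_(j < D) b j z) * f z) w =
  c * \sum_(j < D) berg (fun z => b j z * f z) w.
Proof.
move=> Lb; have iF j := fock_kernel_cintble (Lb j) w.
rewrite -(cint_sum _ measurableT iF) -(cintZ c measurableT (cintble_sum _ measurableT iF)).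
apply: (@eq_cint _ _ _ leb) => z _; rewrite -mulr_suml -mulr_suml -mulr_suml; ring.
Qed.

Lemma integral_gauss_sum D (a : 'I_D -> R) (v : 'I_D -> Cn) (g : R) : 0 < g ->
  (forall j, 0 <= a j) ->
  (\int[leb]_z (\sum_(j < D) a j * expR (- g * enorm (z - v j)%R ^+ 2))%:E =
   ((\sum_(j < D) a j) * (pi / g) ^+ n)%:E)%E.
Proof.
move=> g0 a0.
have mG b u : measurable_fun setT (fun z : Cn => b * expR (- g * enorm (z - u) ^+ 2)).
  apply: measurable_funM; first exact: measurable_cst.
  apply: measurable_expR_enorm; apply: measurable_rowB; first exact: measurable_id.
  exact: measurable_cst.
elim: D a v a0 => [|D IH] a v a0.
  rewrite big_ord0 mul0r -[RHS](integral0 leb setT).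
  by apply: (@eq_integral _ _ _ leb) => z _; rewrite big_ord0.
rewrite big_ord_recl mulrDl EFinD -(IH (fun j => a (lift ord0 j)) (fun j => v (lift ord0 j)))//.
rewrite -(integral_scaled_gauss (v ord0) g0 (a0 ord0)).
rewrite -(ge0_integralD leb measurableT); last 4 first.
- by move=> z _; rewrite lee_fin mulr_ge0 ?expR_ge0.
- by apply/measurable_EFinP; exact: mG.
- by move=> z _; rewrite lee_fin sumr_ge0// => j _; rewrite mulr_ge0 ?expR_ge0.
- by apply/measurable_EFinP; apply: measurable_sum => j; exact: mG.
by apply: (@eq_integral _ _ _ leb) => z _; rewrite big_ord_recl EFinD.
Qed.

End kernel_sums.

Section bump_operator.
Variables (R : realType) (n' : nat).
Local Notation n := n'.+1.
Local Notation C := R[i].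
Local Notation Cn := 'rV[C]_n.
Local Notation leb := (@lebesgueCn R n).
Local Notation F2 := (fock R n).
Implicit Types (f : F2) (z w : Cn).
Variable x : R.
Hypotheses (x0 : 0 < x) (x1 : x <= 4^-1).

Definition bump_base (p q : R) (v : Cn * Cn) : C :=
  cexp ((q / 2)%:C * v.1 ord0 ord0 - (q ^+ 2 / 4)%:C) *
  cexp ((p / 2)%:C * (v.2 ord0 ord0)^*%C - (p ^+ 2 / 4)%:C).

Definition bump_main (L : nat) (p q : R) (v : Cn * Cn) : C := bump_base p q v *
  \sum_(k < L) ((x / 2)%:C * dot (v.1 - q%:C *: e1) (v.2 - p%:C *: e1)) ^+ k / k`!%:R.

Lemma exp_growth_cexp (a b : R) :
  exp_growth (fun z : Cn => cexp (a%:C * dot z e1 + b%:C)).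
Proof.
split; first exact: cexp_dot_entire.
exists (expR b), `|a|; split=> [||z]; rewrite ?expR_ge0//.
rewrite normc_cexp -expRD ler_expR ReD addrC lerD2l dot_e1r (le_trans (Re_le_normc _))//.
by rewrite normcMl normc_real ler_wpM2l// normc_coor_le.
Qed.

Lemma separated_bump_base p q : separated 1 (bump_base p q).
Proof.
exists (fun _ z => cexp ((q / 2)%:C * dot z e1 + (- (q ^+ 2 / 4))%:C)).
exists (fun _ z => cexp ((p / 2)%:C * dot z e1 + (- (p ^+ 2 / 4))%:C)).
split=> [i|i|w z].
- by split; [exact: exp_growth_cexp|exact: measurable_cexp_dot].
- by split; [exact: exp_growth_cexp|exact: measurable_cexp_dot].
rewrite big_ord1 cexp_conj /bump_base !dot_e1r; congr (cexp _ * cexp _).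
  by rewrite rcN.
have cD (a b : C) : (a + b)^*%C = a^*%C + b^*%C by exact: rmorphD.
by rewrite cD conjcM !conjc_real rcN.
Qed.

Lemma separated_bump_main L p q : separated (\sum_(k < L) n ^ k) (bump_main L p q).
Proof. exact: separated_taylor (separated_bump_base p q). Qed.

(** Completing the square in each variable. The localization in [w] around [q e_1] and in [z] around
    [p e_1] is what makes pieces with separated centres almost orthogonal. *)
Lemma bump_base_damped p q w z : normc (bump_base p q (w, z)) *
  expR (- 4^-1 * enorm w ^+ 2) * expR (- 4^-1 * enorm z ^+ 2) =
  expR (- 4^-1 * enorm (w - q%:C *: e1) ^+ 2) * expR (- 4^-1 * enorm (z - p%:C *: e1) ^+ 2).
Proof.
rewrite normcMl !normc_cexp -!expRD; congr expR.
have ReE (a b : R) (u : C) : complex.Re (a%:C * u - b%:C) = a * complex.Re u - b.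
  by rewrite ReD ReN ReM mul0r subr0.
have key (yw yz y1 y2 a b : R) : y1 = yw - 2 * q * a + q ^+ 2 -> y2 = yz - 2 * p * b + p ^+ 2 ->
    q / 2 * a - q ^+ 2 / 4 + (p / 2 * b - p ^+ 2 / 4) + - 4^-1 * yw + - 4^-1 * yz =
    - 4^-1 * y1 + - 4^-1 * y2 by move=> -> ->; field.
have := key _ _ _ _ _ _ (enorm_shift q w) (enorm_shift p z).
rewrite -(ReJ (z ord0 ord0)) -!ReE.
exact.
Qed.

Lemma bump_remainder L p q w z :
  (2 * pi) ^- n * normc (bump_kernel x p q (w, z) - bump_main L p q (w, z)) *
    expR (- 4^-1 * enorm w ^+ 2) * expR (- 4^-1 * enorm z ^+ 2) <=
  (2 * pi) ^- n * (4 * x) ^+ L *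
    (expR (- 8^-1 * enorm (w - q%:C *: e1) ^+ 2) *
     expR (- 8^-1 * enorm (z - p%:C *: e1) ^+ 2)).
Proof.
pose X := (x / 2)%:C * dot (w - q%:C *: e1) (z - p%:C *: e1).
have -> : bump_kernel x p q (w, z) - bump_main L p q (w, z) =
    bump_base p q (w, z) * (cexp X - \sum_(k < L) X ^+ k / k`!%:R) by rewrite mulrBr.
rewrite normcMl; set E := normc (cexp X - _).
rewrite -!mulrA ler_wpM2l ?twopi_ge0//.
rewrite (_ : normc (bump_base p q (w, z)) * _ = E *
  (normc (bump_base p q (w, z)) *
  expR (- 4^-1 * enorm w ^+ 2) * expR (- 4^-1 * enorm z ^+ 2))); last by ring.
have rle : normc X <= x / 2 * (enorm (w - q%:C *: e1) * enorm (z - p%:C *: e1)).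
  rewrite normcMl normc_real ger0_norm ?divr_ge0// ?(ltW x0)//.
  by rewrite ler_wpM2l ?divr_ge0// ?(ltW x0)// normc_dot_le.
rewrite bump_base_damped.
exact (taylor_gauss_bound x0 x1 (enorm_ge0 _) (enorm_ge0 _) (normc_ge0 X) rle (cexp_taylor X L)).
Qed.

Lemma measurable_bump_kernel p q : measurable_fun setT (bump_kernel x p q : Cn * Cn -> C).
Proof.
rewrite (_ : bump_kernel x p q = fun v => bump_base p q v *
  cexp ((x / 2)%:C * dot (v.1 - q%:C *: e1) (v.2 - p%:C *: e1))) //.
apply: measurable_cM; first exact: separated_measurable (separated_bump_base p q).
apply: measurable_cexp; apply: measurable_cZ; apply: measurable_dot.
  by apply: measurable_rowB; [exact: measurable_fst|exact: measurable_cst].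
by apply: measurable_rowB; [exact: measurable_snd|exact: measurable_cst].
Qed.

Lemma bump_kernel_cintble p q f : kernel_cintble (bump_kernel x p q) f.
Proof.
apply: kernel_cintble_expo; [exact: fock_L2|exact: measurable_bump_kernel|].
move=> w; exists (normc (cexp (((q - x * p) / 2)%:C * w ord0 ord0 +
    (x * p * q / 2 - q ^+ 2 / 4 - p ^+ 2 / 4)%:C))).
exists (2^-1 * enorm (x%:C *: w + (p - x * q)%:C *: e1)) => z.
by rewrite bump_kernelE// normcMl ler_wpM2l ?normc_ge0// normc_fock_kernel_le.
Qed.

Variables (D : nat) (A t c : R).
Hypotheses (A0 : 0 <= A) (DA : D%:R * 32 <= A ^+ 2) (c0 : 0 <= c).

Definition bump_sum z : C := c%:C * \sum_(j < D) bump_symbol x t (j%:R * A) z.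

Let p (j : nat) := t + j%:R * A.
Let q (j : nat) := t - j%:R * A.

Lemma nat_separated (i j : nat) : i != j -> 1 <= `|i%:R - j%:R| :> R.
Proof.
wlog ij : i j / (i < j)%N.
  move=> H ij; case: (ltngtP i j) ij => // ij _; first by apply: H; rewrite ?ltn_eqF.
  by rewrite distrC H ?ltn_eqF.
move=> _; rewrite distrC ger0_norm ?subr_ge0 ?ler_nat ?(ltnW ij)//.
by rewrite -natrB ?(ltnW ij)// ler1n subn_gt0.
Qed.

(** The centres [t + j A] and [t - j A] move in opposite directions but are both [A]-separated, so
    the two marginals of Schur's test are bounded independently of [D] and [t]. *)
Lemma bump_centres_sum (y : R) :
  \sum_(j < D) expR (- 8^-1 * (y - p j) ^+ 2) <= 2 /\
  \sum_(j < D) expR (- 8^-1 * (y - q j) ^+ 2) <= 2.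
Proof.
have A1 (i j : nat) : i != j -> A <= `|i%:R - j%:R| * A.
  by move=> ij; rewrite ler_peMl// nat_separated.
split; apply: gaussian_sum_le A0 DA _ => i j _ _ ij; apply: (le_trans (A1 _ _ ij)).
  have -> : p i - p j = (i%:R - j%:R) * A by rewrite /p; ring.
  by rewrite normrM (ger0_norm A0).
have -> : q i - q j = (j%:R - i%:R) * A by rewrite /q; ring.
by rewrite normrM (ger0_norm A0) distrC.
Qed.

Lemma bump_sum_bounded : bounded_symbol bump_sum.
Proof.
split.
  by apply: measurable_cZ; apply: measurable_csum => j; exact: measurable_bump_symbol.
exists (c * \sum_(j < D) (x ^- n * expR ((1 + x) / (2 * x) * (j%:R * A) ^+ 2))) => z.
rewrite normcMl normc_real ger0_norm// ler_wpM2l//.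
by apply: (le_trans (normc_sum _ _ _)); apply: ler_sum => j _; exact: bump_symbol_bound.
Qed.

Let K (v : Cn * Cn) : C := c%:C * \sum_(j < D) bump_kernel x (p j) (q j) v.
Let KL L (v : Cn * Cn) : C := c%:C * \sum_(j < D) bump_main L (p j) (q j) v.

Lemma berg_bump_sum f w : berg (fun z => bump_sum z * f z) w = kernel_op K f w.
Proof.
have Lj (j : 'I_D) : L2 (fun z => bump_symbol x t (j%:R * A) z * f z).
  by apply: bounded_symbol_L2 (fock_L2 f); exact: bump_symbol_bounded.
refine (etrans (berg_sum c%:C w Lj) _); apply: esym.
refine (etrans (kernel_op_sum c%:C w (fun j : 'I_D => bump_kernel_cintble (p j) (q j) f)) _).
by congr (_ * _); apply: eq_bigr => j _; rewrite berg_bump_symbol.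
Qed.

Lemma bump_sum_kernel_le L w z :
  (2 * pi) ^- n * normc (K (w, z) - KL L (w, z)) *
    expR (- 4^-1 * enorm w ^+ 2) * expR (- 4^-1 * enorm z ^+ 2) <=
  c * ((2 * pi) ^- n * (4 * x) ^+ L) * \sum_(j < D)
    (expR (- 8^-1 * enorm (w - (q j)%:C *: e1) ^+ 2) *
     expR (- 8^-1 * enorm (z - (p j)%:C *: e1) ^+ 2)).
Proof.
rewrite /K /KL -mulrBr -sumrB normcMl normc_real (ger0_norm c0).
have le := normc_sum (index_enum 'I_D) xpredT
  (fun j : 'I_D => bump_kernel x (p j) (q j) (w, z) - bump_main L (p j) (q j) (w, z)).
have e0 := mulr_ge0 (expR_ge0 (- 4^-1 * enorm w ^+ 2)) (expR_ge0 (- 4^-1 * enorm z ^+ 2)).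
have t0 := @twopi_ge0 R n.
have alg (a b m g1 g2 : R) : a * (b * m) * g1 * g2 = b * (a * m * (g1 * g2)) by ring.
rewrite alg -[leRHS]mulrA ler_wpM2l//.
apply: (@le_trans _ _ ((2 * pi) ^- n * (\sum_(j < D)
   normc (bump_kernel x (p j) (q j) (w, z) - bump_main L (p j) (q j) (w, z))) *
   (expR (- 4^-1 * enorm w ^+ 2) * expR (- 4^-1 * enorm z ^+ 2)))).
  by rewrite ler_wpM2r// ler_wpM2l.
rewrite mulr_sumr mulr_suml mulr_sumr; apply: ler_sum => j _.
by rewrite [leLHS]mulrA; apply: bump_remainder.
Qed.

(** The 2 is the bound of [bump_centres_sum], and [4^n] is [(2 pi)^-n] times the integral [(8 pi)^n]
    of a Gaussian of rate [1/8]. *)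
Let bound L : R := c * 2 * 4 ^+ n * (4 * x) ^+ L.

Let k L (v : Cn * Cn) : R := c * ((2 * pi) ^- n * (4 * x) ^+ L) * \sum_(j < D)
    (expR (- 8^-1 * enorm (v.1 - (q j)%:C *: e1) ^+ 2) *
     expR (- 8^-1 * enorm (v.2 - (p j)%:C *: e1) ^+ 2)).

Let k_ge0 L : 0 <= c * ((2 * pi) ^- n * (4 * x) ^+ L).
Proof. by rewrite !mulr_ge0 ?twopi_ge0 ?exprn_ge0 ?mulr_ge0 ?(ltW x0). Qed.

Let gauss_bound L (a : 'I_D -> R) (v : 'I_D -> Cn) : (forall j, 0 <= a j) ->
  \sum_(j < D) a j <= 2 ->
  (\int[leb]_z (c * ((2 * pi) ^- n * (4 * x) ^+ L) *
    \sum_(j < D) (a j * expR (- 8^-1 * enorm (z - v j)%R ^+ 2)))%:E <= (bound L)%:E)%E.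
Proof.
move=> a0 a2; pose b := c * ((2 * pi) ^- n * (4 * x) ^+ L).
have g0 : 0 < 8^-1 :> R by rewrite invr_gt0.
have ba0 j : 0 <= b * a j by rewrite mulr_ge0// k_ge0.
have E := integral_gauss_sum v g0 ba0.
apply: (@le_trans _ _ ((\sum_(j < D) b * a j) * (pi / 8^-1) ^+ n)%:E).
  rewrite -E le_eqVlt; apply/orP; left; apply/eqP; apply: (@eq_integral _ _ _ leb) => z _.
  by rewrite mulr_sumr; congr (_%:E); apply: eq_bigr => j _; rewrite mulrA.
rewrite lee_fin -mulr_sumr.
have e4 : (2 * pi) ^- n * (pi / 8^-1) ^+ n = 4 ^+ n :> R.
  rewrite -exprVn -exprMn; congr (_ ^+ _); have := pi_gt0 R; move: (pi : R) => y y0.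
  by field; rewrite gt_eqF.
rewrite (_ : b * _ * _ = c * (4 * x) ^+ L * ((2 * pi) ^- n * (pi / 8^-1) ^+ n) *
  \sum_(j < D) a j); last by rewrite /b; ring.
rewrite e4 (_ : bound L = c * (4 * x) ^+ L * 4 ^+ n * 2); last by rewrite /bound; ring.
by rewrite ler_wpM2l// !mulr_ge0 ?exprn_ge0 ?mulr_ge0 ?(ltW x0).
Qed.

(** Every piece is truncated at degree [L] in its Taylor series, which leaves a separated kernel;
    Schur's test bounds the sum of the tails. For [L = 0] nothing is subtracted and the norm of [T]
    itself is bounded. *)
Lemma bump_sum_approx (T : {linear F2 -> F2}) L :
  (forall f w, T f w = berg (fun z => bump_sum z * f z) w) ->
  exists psi e : 'I_(D * \sum_(k < L) n ^ k) -> F2, forall f,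
    (sqnorm (T f - \sum_i inner f (psi i) *: e i)%R <= (bound L ^+ 2)%:E * sqnorm f)%E.
Proof.
move=> TE.
have sK : separated (D * \sum_(k < L) n ^ k) (KL L).
  apply: separated_scale; apply: separated_sum => j; exact: separated_bump_main.
have [psi [e SE]] := inner_sum_separated sK; exists psi, e => f.
have iK : kernel_cintble K f.
  by apply: kernel_cintble_sum => j; exact: bump_kernel_cintble.
have iKL : kernel_cintble (KL L) f by move=> w; have [] := SE f w.
have iD : kernel_cintble (fun v => K v - KL L v) f.
  move=> w; apply: (eq_cintble _ (cintbleB measurableT (iK w) (iKL w))) => z.
  by rewrite mulrBr mulrBl.
have -> : (T f - \sum_i inner f (psi i) *: e i : F2) = kernel_op (fun v => K v - KL L v) f :> (Cn -> C).
  apply/funext => w; rewrite fock_subE TE berg_bump_sum; have [_ <-] := SE f w.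
  refine (etrans (esym (cintB measurableT (iK w) (iKL w))) _).
  by apply: (@eq_cint _ _ _ leb) => z _; rewrite mulrBr mulrBl.
have mK : measurable_fun setT K.
  by apply: measurable_cZ; apply: measurable_csum => j; exact: measurable_bump_kernel.
have mk : measurable_fun setT (k L).
  apply: measurable_funM; first exact: measurable_cst.
  apply: measurable_sum => j; apply: measurable_funM; apply: measurable_expR_enorm.
    by apply: measurable_rowB; [exact: measurable_fst|exact: measurable_cst].
  by apply: measurable_rowB; [exact: measurable_snd|exact: measurable_cst].
apply: (sqnorm_kernel_op (k := k L)) => //.
- by apply: measurable_cB => //; exact: separated_measurable sK.
- move=> v; apply: mulr_ge0; first exact: k_ge0.
  by apply: sumr_ge0 => j _; rewrite mulr_ge0 ?expR_ge0.
- by rewrite /bound !mulr_ge0 ?exprn_ge0 ?mulr_ge0 ?(ltW x0).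
(* For fixed [w] the Gaussians in [z] all have the same integral, so only the sum over [j] of the
   Gaussians in [w] matters; passing to the real part of the first coordinate reduces it to
   [bump_centres_sum]. *)
- move=> w; pose a (j : 'I_D) : R := expR (- 8^-1 * enorm (w - (q j)%:C *: e1) ^+ 2).
  have a0 j : 0 <= a j by exact: expR_ge0.
  have a2 : \sum_(j < D) a j <= 2.
    have [_] := bump_centres_sum (complex.Re (w ord0 ord0)); apply: le_trans.
    by apply: ler_sum => j _; rewrite ler_expR !mulNr lerN2 ler_wpM2l ?invr_ge0// enorm_coor.
  exact (gauss_bound L (fun j : 'I_D => (p j)%:C *: e1) a0 a2).
- move=> z; pose a (j : 'I_D) : R := expR (- 8^-1 * enorm (z - (p j)%:C *: e1) ^+ 2).
  have a0 j : 0 <= a j by exact: expR_ge0.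
  have a2 : \sum_(j < D) a j <= 2.
    have [+ _] := bump_centres_sum (complex.Re (z ord0 ord0)); apply: le_trans.
    by apply: ler_sum => j _; rewrite ler_expR !mulNr lerN2 ler_wpM2l ?invr_ge0// enorm_coor.
  apply: (le_trans _ (gauss_bound L (fun j : 'I_D => (q j)%:C *: e1) a0 a2)).
  rewrite le_eqVlt; apply/orP; left; apply/eqP; apply: (@eq_integral _ _ _ leb) => w _.
  have E : \sum_(j < D) a j * expR (- 8^-1 * enorm (w - (q j)%:C *: e1) ^+ 2) =
      \sum_(j < D) expR (- 8^-1 * enorm (w - (q j)%:C *: e1) ^+ 2) * a j.
    apply: eq_bigr => j _; exact (mulrC (a j) _).
  exact (esym (congr1 (fun y : R => (c * ((2 * pi) ^- n * (4 * x) ^+ L) * y)%:E) E)).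
- by move=> w z; exact: bump_sum_kernel_le.
- exact: fock_L2.
Qed.

End bump_operator.

(** * Schatten norms *)

Section geometric_blocks.
Variable R : realType.

(** The block [D N^m <= k < D N^(m+1)] has at most [D N^(m+1)] terms, each at most [b^p r^(m+1)]
    since [r <= 1 <= p]; by [N r <= 1/2] it contributes at most [D b^p 2^-(m+1)]. Giving up the
    [p]-th power of [r^(m+1)] makes the constant 2 independent of [p]. *)
Lemma geometric_blocks (a : nat -> R) (D N : nat) (b r p : R) :
  (forall k, 0 <= a k) -> (forall k l, (k <= l)%N -> a l <= a k) ->
  (0 < D)%N -> (1 < N)%N -> 0 <= b -> 0 < r -> N%:R * r <= 2^-1 -> 1 <= p ->
  a 0 <= b -> (forall m, a (D * N ^ m)%N <= b * r ^+ m.+1) ->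
  forall M, \sum_(0 <= k < M) a k `^ p <= 2 * D%:R * b `^ p.
Proof.
move=> a0 anti D0 N1 b0 r0 Nr p1 ab am.
have p0 : 0 <= p by exact: le_trans ler01 p1.
have bp0 : 0 <= b `^ p by exact: powR_ge0.
have N0 : 0 <= N%:R :> R by [].
have r1 : r <= 1.
  apply: (@le_trans _ _ (N%:R * r)); last by apply: (le_trans Nr); lra.
  by rewrite ler_peMl ?(ltW r0)// ler1n ltnW.
have ap0 k : 0 <= a k `^ p by exact: powR_ge0.
have mono (u v : R) : 0 <= u -> u <= v -> u `^ p <= v `^ p.
  by move=> u0 uv; apply: ge0_ler_powR => //; rewrite nnegrE// (le_trans u0).
have block m : \sum_(0 <= k < D * N ^ m) a k `^ p <= D%:R * b `^ p * (2 - 2^-1 ^+ m).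
  elim: m => [|m IH].
    rewrite expn0 muln1 expr0 (_ : 2 - 1 = 1 :> R); last by ring.
    rewrite mulr1; apply: (@le_trans _ _ (\sum_(0 <= k < D) b `^ p)).
      by apply: ler_sum_nat => k _; apply: mono => //; apply: le_trans ab; exact: anti.
    by rewrite sumr_const_nat subn0 mulr_natl.
  have NN : (D * N ^ m <= D * N ^ m.+1)%N.
    by rewrite leq_pmul2l// leq_exp2l.
  rewrite (big_cat_nat (leq0n _) NN)/=.
  have tail : \sum_(D * N ^ m <= k < D * N ^ m.+1) a k `^ p <=
      D%:R * b `^ p * 2^-1 ^+ m.+1.
    apply: (@le_trans _ _ (\sum_(D * N ^ m <= k < D * N ^ m.+1) b `^ p * r ^+ m.+1)).
      apply: ler_sum_nat => k /andP[km _].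
      apply: (@le_trans _ _ ((b * r ^+ m.+1) `^ p)).
        by apply: mono => //; apply: le_trans (am m); exact: anti.
      rewrite powRM ?exprn_ge0 ?(ltW r0)// ler_wpM2l//.
      have rm0 : 0 < r ^+ m.+1 by rewrite exprn_gt0.
      have rm1 : r ^+ m.+1 <= 1 by rewrite exprn_ile1// ltW.
      by rewrite -[leRHS]powRr1 ?(ltW rm0)// ger_powR// rm0 rm1.
    rewrite sumr_const_nat -[leLHS]mulr_natl.
    apply: (@le_trans _ _ ((D * N ^ m.+1)%:R * (b `^ p * r ^+ m.+1))).
      by rewrite ler_wpM2r ?ler_nat ?leq_subr// mulr_ge0// exprn_ge0// ltW.
    rewrite natrM natrX (_ : _ * _ = D%:R * b `^ p * (N%:R * r) ^+ m.+1).
      rewrite ler_wpM2l ?mulr_ge0// lerXn2r ?nnegrE ?invr_ge0//.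
      by rewrite mulr_ge0// ltW.
    by rewrite exprMn; ring.
  apply: (le_trans (lerD IH tail)); rewrite -mulrDr ler_wpM2l ?mulr_ge0//.
  by rewrite exprS; lra.
move=> M; have MM : (M <= D * N ^ M)%N.
  by apply: (leq_trans (ltnW (ltn_expl M N1))); rewrite leq_pmull.
apply: (@le_trans _ _ (\sum_(0 <= k < D * N ^ M) a k `^ p)).
  by rewrite [leRHS](big_cat_nat (leq0n _) MM)/= lerDl sumr_ge0.
apply: (le_trans (block M)).
have -> : 2 * D%:R * b `^ p = D%:R * b `^ p * 2 by ring.
by rewrite ler_wpM2l ?mulr_ge0// gerBl exprn_ge0// invr_ge0.
Qed.

(** Bounds the rank of a Taylor truncation by a power of [n + 1], the block ratio in
    [geometric_blocks]. *)
Lemma sum_geom_le (n L : nat) : (\sum_(k < L.+1) n ^ k <= n.+1 ^ L)%N.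
Proof.
elim: L => [|L IH]; first by rewrite big_ord1.
rewrite big_ord_recr/=; apply: (leq_trans (leq_add IH (leqnn _))).
rewrite [X in (_ <= X)%N]expnS mulSn leq_add2l expnS leq_mul2l.
by case: L {IH} => [|L]; rewrite ?orbT// leq_exp2r// leqnSn orbT.
Qed.

Lemma powR_add_le (u v w p : R) : 0 <= u -> 0 <= v -> 0 <= w -> 0 <= p ->
  w <= 2 * (u + v) -> w `^ p <= 4 `^ p * (u `^ p + v `^ p).
Proof.
move=> u0 v0 w0 p0 le.
have key (y : R) : 0 <= y -> w <= 4 * y -> w `^ p <= 4 `^ p * y `^ p.
  move=> y0 wy; rewrite -powRM//; apply: ge0_ler_powR => //; rewrite nnegrE//.
  by rewrite mulr_ge0.
have [uv|/ltW vu] := leP u v.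
  apply: (le_trans (key v v0 _)); first lra.
  by rewrite ler_wpM2l ?powR_ge0// lerDr powR_ge0.
apply: (le_trans (key u u0 _)); first lra.
by rewrite ler_wpM2l ?powR_ge0// lerDl powR_ge0.
Qed.

(** Subadditivity controls only the even indices [k + k]; monotonicity bounds each odd-indexed term
    by its predecessor, whence the factor 2. It is the reason why Schatten classes are closed under
    addition. *)
Lemma sum_powR_add (a a1 a2 : nat -> R) (p y1 y2 : R) : 0 <= p ->
  (forall k, 0 <= a k) -> (forall k, 0 <= a1 k) -> (forall k, 0 <= a2 k) ->
  (forall k l, (k <= l)%N -> a l <= a k) ->
  (forall k, a (k + k)%N <= 2 * (a1 k + a2 k)) ->
  (forall M, \sum_(0 <= k < M) a1 k `^ p <= y1) ->
  (forall M, \sum_(0 <= k < M) a2 k `^ p <= y2) ->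
  forall M, \sum_(0 <= k < M) a k `^ p <= 2 * (4 `^ p * (y1 + y2)).
Proof.
move=> p0 a_ge0 a1_ge0 a2_ge0 anti add h1 h2 M.
have ap0 k : 0 <= a k `^ p by exact: powR_ge0.
have double : \sum_(0 <= k < M.*2) a k `^ p <= 2 * \sum_(0 <= k < M) a (k + k)%N `^ p.
  elim: M => [|M IH]; first by rewrite !big_geq// mulr0.
  rewrite doubleS !big_nat_recr//= mulrDr -addrA; apply: lerD => //.
  have : a M.*2.+1 `^ p <= a M.*2 `^ p.
    by apply: ge0_ler_powR => //; rewrite ?nnegrE//; exact: anti.
  by rewrite addnn; lra.
apply: (@le_trans _ _ (\sum_(0 <= k < M.*2) a k `^ p)).
  have MM : (M <= M.*2)%N by rewrite -addnn leq_addr.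
  by rewrite [leRHS](big_cat_nat (leq0n _) MM)/= lerDl sumr_ge0.
apply: (le_trans double); rewrite ler_pM2l//.
apply: (@le_trans _ _ (\sum_(0 <= k < M) 4 `^ p * (a1 k `^ p + a2 k `^ p))).
  by apply: ler_sum_nat => k _; exact: powR_add_le.
rewrite -mulr_sumr ler_wpM2l ?powR_ge0// big_split/=.
by apply: lerD; [exact: h1|exact: h2].
Qed.

End geometric_blocks.

Section schatten.
Variables (R : realType) (n : nat).
Local Notation C := R[i].
Local Notation Cn := 'rV[C]_n.
Local Notation leb := (@lebesgueCn R n).
Local Notation F2 := (fock R n).
Implicit Types (f g : F2) (A B : F2 -> F2) (T S : {linear F2 -> F2}) (p : R).

Lemma inner_linear (a : C) f g (h : F2) : inner (a *: f + g) h = a * inner f h + inner g h.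
Proof.
have i1 := L2_inner_cintble (fock_L2 f) (fock_L2 h).
have i2 := L2_inner_cintble (fock_L2 g) (fock_L2 h).
rewrite -[inner f h]/(cint leb setT (fun z => f z * (h z)^*%C * (gaussian z)%:C)).
rewrite -(cintZ a measurableT i1) -(cintD measurableT (cintbleZ a measurableT i1) i2).
by apply: (@eq_cint _ _ _ leb) => z _; rewrite fock_addE fock_scaleE; ring.
Qed.

Lemma normc_inner_le f g : ((normc (inner f g))%:E <= sqnorm f + sqnorm g)%E.
Proof.
have [mf _] := fock_L2 f; have [mg _] := fock_L2 g.
have sq0 (h : F2) z : setT z -> (0 <= (normc (h z) ^+ 2 * gaussian z)%:E :> \bar R)%E.
  by move=> _; rewrite lee_fin mulr_ge0 ?sqr_ge0 ?gaussian_ge0.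
have msq (h : F2) : measurable_fun setT (fun z => (normc (h z) ^+ 2 * gaussian z)%:E : \bar R).
  by have [mh _] := fock_L2 h; apply/measurable_EFinP; exact: measurable_sqnormf.
have i1 := L2_inner_cintble (fock_L2 f) (fock_L2 g).
apply: (le_trans (normc_cint measurableT i1)).
rewrite -(ge0_integralD leb measurableT (sq0 f) (msq f) (sq0 g) (msq g)).
apply: ge0_le_integral => //.
- by move=> z _; rewrite lee_fin normc_ge0.
- by apply/measurable_EFinP; apply: measurable_normc; have [] := i1.
- exact: (emeasurable_funD (msq f) (msq g)).
move=> z _; rewrite -EFinD lee_fin !normcMl normc_conj normc_real.
rewrite (ger0_norm (gaussian_ge0 z)) -mulrDl ler_wpM2r ?gaussian_ge0//.
have := sqr_ge0 (normc (f z) - normc (g z)).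
have := mulr_ge0 (normc_ge0 (f z)) (normc_ge0 (g z)).
by rewrite sqrrB; lra.
Qed.

Lemma finite_rank_op N (psi e : 'I_N -> F2) : exists2 S : {linear F2 -> F2},
  (forall f, S f = \sum_i inner f (psi i) *: e i) & rank_le N S.
Proof.
have [|S SE] := @linear_opP R n (fun f => \sum_i inner f (psi i) *: e i).
  move=> a f g; rewrite scaler_sumr -big_split/=; apply: eq_bigr => i _.
  by rewrite inner_linear scalerDl scalerA.
by exists S => //; exists e => f; exists (fun i => inner f (psi i)).
Qed.

Lemma opnorm_subC A B : opnorm (fun f => A f - B f) = opnorm (fun f => B f - A f).
Proof.
rewrite /opnorm; congr ereal_sup; apply: eq_imagel => f _.
rewrite /L2norm; congr (_ `^ _)%E; apply: (@eq_integral _ _ _ leb) => z _.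
by rewrite !fock_subE normc_distrC.
Qed.

Lemma bounded_op_near T S (b : R) : bounded_op T ->
  (opnorm (fun f => T f - S f)%R <= b%:E)%E -> bounded_op S.
Proof.
move=> bT TS; rewrite /bounded_op.
have -> : (S : F2 -> F2) = (fun f => T f + (S f - T f)).
  by apply/funext => f; rewrite addrC subrK.
apply: (le_lt_trans (opnorm_add _ _)); rewrite lte_mul_pinfty// ?lee_fin//.
by rewrite lte_add_pinfty// opnorm_subC (le_lt_trans TS)// ltry.
Qed.

(** Compactness and all Schatten norms are read off from this property. [L = 0] gives rank 0, so
    that [b] bounds the norm; [L = m + 1] gives rank at most [D (n + 1)^m] with error
    [b r^(m+1)]. *)
Definition finite_rank_approx T (D : nat) (b r : R) := forall L,
  exists psi e : 'I_(D * \sum_(k < L) n ^ k) -> F2, forall f,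
    (sqnorm (T f - \sum_i inner f (psi i) *: e i)%R <= ((b * r ^+ L) ^+ 2)%:E * sqnorm f)%E.

Lemma finite_rank_approx_opnorm T D b r : 0 <= b -> finite_rank_approx T D b r ->
  (opnorm T <= b%:E)%E.
Proof.
move=> b0 /(_ 0%N)[psi [e H]]; apply: opnorm_le => // f.
have := H f; rewrite expr0 mulr1 (_ : \sum_i _ = 0) ?subr0//.
move: psi e {H}; rewrite big_ord0 muln0 => psi e; by rewrite big_ord0.
Qed.

Lemma finite_rank_approx_singular T D b r L : 0 <= b -> 0 < r ->
  finite_rank_approx T D b r ->
  (singular_number (D * \sum_(k < L) n ^ k) T <= (b * r ^+ L)%:E)%E.
Proof.
move=> b0 r0 H; have bT := finite_rank_approx_opnorm b0 H.
have [psi [e He]] := H L; have [S SE rS] := finite_rank_op psi e.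
have le : (opnorm (fun f => T f - S f)%R <= (b * r ^+ L)%:E)%E.
  by apply: opnorm_le => [|f]; [rewrite mulr_ge0// exprn_ge0// ltW|rewrite SE].
have bT' : bounded_op T by rewrite /bounded_op (le_lt_trans bT)// ltry.
exact: (singular_number_le (bounded_op_near bT' le) rS le).
Qed.

Lemma singular_number_fin k T : bounded_op T -> singular_number k T \is a fin_num.
Proof.
by move=> bT; rewrite ge0_fin_numE ?singular_number_ge0//
  (le_lt_trans (singular_number_opnorm k T)).
Qed.

Lemma schatten_series_le p T (y : R) : bounded_op T ->
  (forall M, \sum_(0 <= k < M) fine (singular_number k T) `^ p <= y) ->
  (\sum_(0 <= k <oo) singular_number k T `^ p <= y%:E)%E.
Proof.
move=> bT H; apply: lime_le; first by apply: is_cvg_nneseries => k _ _; exact: poweR_ge0.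
apply: nearW => M; rewrite (eq_bigr (fun k => (fine (singular_number k T) `^ p)%:E)).
  by rewrite sumEFin lee_fin.
by move=> k _; rewrite -poweR_EFin fineK// singular_number_fin.
Qed.

Lemma schatten_norm_le p T (y : R) : 0 < p -> bounded_op T ->
  (forall M, \sum_(0 <= k < M) fine (singular_number k T) `^ p <= y) ->
  (schatten_norm p T <= (y `^ p^-1)%:E)%E.
Proof.
move=> p0 bT H; have le := schatten_series_le bT H.
have s0 : (0 <= \sum_(0 <= k <oo) singular_number k T `^ p)%E.
  by apply: nneseries_ge0 => k _ _; exact: poweR_ge0.
rewrite /schatten_norm -poweR_EFin; apply: gt0_ler_poweR => //.
- by rewrite invr_ge0 ltW.
- by rewrite in_itv/= s0 leey.
- by rewrite in_itv/= leey (le_trans s0 le).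
Qed.

Lemma finite_rank_approx_schatten T (D : nat) (b r p : R) : (0 < n)%N -> (0 < D)%N -> 0 <= b ->
  0 < r -> n.+1%:R * r <= 2^-1 -> finite_rank_approx T D b r -> 1 <= p ->
  (schatten_norm p T <= (((2 * D%:R * b `^ p)) `^ p^-1)%:E)%E.
Proof.
move=> n0 D0 b0 r0 nr H p1; have bT0 := finite_rank_approx_opnorm b0 H.
have bT : bounded_op T by rewrite /bounded_op (le_lt_trans bT0)// ltry.
have fs k := singular_number_fin k bT.
have anti k l : (k <= l)%N -> fine (singular_number l T) <= fine (singular_number k T).
  by move=> kl; apply: fine_le; rewrite ?fs//; exact: singular_number_anti.
have sing L : fine (singular_number (D * \sum_(k < L) n ^ k) T) <= b * r ^+ L.
  by rewrite -lee_fin fineK//; exact: finite_rank_approx_singular.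
apply: schatten_norm_le => //; first exact: lt_le_trans ltr01 p1.
apply: (geometric_blocks (N := n.+1) (r := r)) => //.
- by move=> k; rewrite fine_ge0// singular_number_ge0.
- by have := sing 0; rewrite big_ord0 muln0 expr0 mulr1.
- move=> m; apply: (le_trans _ (sing m.+1)); apply: anti.
  by rewrite leq_mul2l sum_geom_le orbT.
Qed.

Lemma schatten_class_add p T1 T2 T : 1 < p -> schatten_class p T1 -> schatten_class p T2 ->
  (forall f, T f = T1 f + T2 f) -> schatten_class p T.
Proof.
move=> p1 [b1 s1] [b2 s2] TE; have bT := bounded_op_add b1 b2 TE; split; first exact bT.
have p0 : 0 < p by exact: lt_trans ltr01 p1.
have pge0 := ltW p0.
have fs k : fine (singular_number k T) `^ p >= 0 by exact: powR_ge0.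
have series_fin T' : bounded_op T' -> (schatten_norm p T' < +oo)%E -> exists y : R,
    forall M, \sum_(0 <= k < M) fine (singular_number k T') `^ p <= y.
  have pV0 : p^-1 != 0 by rewrite invr_neq0// gt_eqF.
  move=> bT' /(lty_poweRy pV0).
  have t0 k : (0 <= singular_number k T' `^ p)%E by exact: poweR_ge0.
  have s0 : (0 <= \sum_(0 <= k <oo) singular_number k T' `^ p)%E.
    by apply: nneseries_ge0 => k _ _.
  have lim M := nneseries_lim_ge (P := xpredT) (m := 0%N) M (fun k _ _ => t0 k).
  move E : (\sum_(0 <= k <oo) _)%E s0 => [y| |]// _ _; exists y => M.
  rewrite -lee_fin -E -sumEFin (eq_bigr (fun k => singular_number k T' `^ p)%E).
    exact: lim.
  by move=> k _; rewrite -poweR_EFin fineK// singular_number_fin.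
have [y1 h1] := series_fin _ b1 s1; have [y2 h2] := series_fin _ b2 s2.
pose a1 k := fine (singular_number k T1); pose a2 k := fine (singular_number k T2).
pose a k := fine (singular_number k T).
have a1_ge0 k : 0 <= a1 k by rewrite fine_ge0// singular_number_ge0.
have a2_ge0 k : 0 <= a2 k by rewrite fine_ge0// singular_number_ge0.
have a_ge0 k : 0 <= a k by rewrite fine_ge0// singular_number_ge0.
have anti k l : (k <= l)%N -> a l <= a k.
  by move=> kl; apply: fine_le; rewrite ?singular_number_fin//; exact: singular_number_anti.
have add k : a (k + k)%N <= 2 * (a1 k + a2 k).
  rewrite -lee_fin fineK ?singular_number_fin//.
  apply: (le_trans (singular_number_add k k TE b1 b2)).
  by rewrite -(fineK (singular_number_fin k b1)) -(fineK (singular_number_fin k b2)).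
have total := sum_powR_add pge0 a_ge0 a1_ge0 a2_ge0 anti add h1 h2.
exact (le_lt_trans (schatten_norm_le p0 bT total) (ltry _)).
Qed.

End schatten.

(** * Compactness *)

Section real_sequences.
Variable R : realType.
Implicit Types (x dl : nat -> R).

(* The limit is the supremum of the lower bounds [x j - dl j]. *)
Lemma nested_cauchy x dl :
  (forall j l, (j <= l)%N -> `|x l - x j| <= dl j) -> exists y, forall j, `|x j - y| <= dl j.
Proof.
move=> H; pose E := [set x j - dl j | j in [set: nat]].
have dl0 j : 0 <= dl j by exact: le_trans (normr_ge0 _) (H j j (leqnn j)).
have ubE l : ubound E (x l + dl l).
  move=> _ [j _ <-]; have [jl|/ltnW lj] := leqP j l.
    by have := H _ _ jl; rewrite ler_distl => /andP[le _]; apply: (le_trans le); rewrite lerDl.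
  have := H _ _ lj; rewrite ler_distl => /andP[_ le].
  by rewrite lerBlDr (le_trans le)// lerDl.
have E0 : E !=set0 by exists (x 0 - dl 0), 0.
exists (sup E) => j; rewrite ler_distlC; apply/andP; split.
  by apply: ub_le_sup; [exists (x 0 + dl 0); exact: ubE|exists j].
by apply: ge_sup => //; exact: ubE.
Qed.

Lemma cvg_geometric_dist (u : nat -> R) (y s : R) :
  (forall j, `|u j - y| <= s * 2^-1 ^+ j) -> u @ \oo --> y.
Proof.
move=> H; have h1 : `|2^-1 : R| < 1 by rewrite ger0_norm ?invr_ge0// invf_lt1// ltr1n.
have c0 : (fun j => s * 2^-1 ^+ j) @ \oo --> (0 : R).
  by rewrite -[X in _ --> X](mulr0 s); apply: cvgM; [exact: cvg_cst|exact: cvg_expr].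
have c1 : (fun j => y + s * 2^-1 ^+ j) @ \oo --> (y : R).
  by rewrite -[X in _ --> X]addr0; apply: cvgD => //; exact: cvg_cst.
have c2 : (fun j => y - s * 2^-1 ^+ j) @ \oo --> (y : R).
  by rewrite -[X in _ --> X]subr0; apply: cvgB => //; exact: cvg_cst.
apply: (squeeze_cvgr _ c2 c1); apply: nearW => j.
by have := H j; rewrite ler_distl.
Qed.

Lemma geometric_small (r e : R) : 0 <= r -> r < 1 -> 0 < e -> exists L : nat, r ^+ L <= e.
Proof.
move=> r0 r1 e0; have c : GRing.exp r @ \oo --> (0 : R).
  by apply: cvg_expr; rewrite ger0_norm.
have [L _ HL] : \forall L \near \oo, `|0 - r ^+ L| < e by move/cvgrPdist_lt : c => /(_ e e0).
exists L; have := HL L (leqnn L); rewrite /= sub0r normrN => /ltW.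
exact: le_trans (ler_norm _).
Qed.

Lemma geometric_le0 (y s : R) : (forall j : nat, y <= s * 2^-1 ^+ j) -> y <= 0.
Proof.
move=> H; rewrite leNgt; apply/negP => y0.
have [s0|s0] := leP s 0.
  by have := H 0%N; rewrite expr0 mulr1; move: s0 y0; lra.
have [L] := @geometric_small 2^-1 (y / s / 2) (ltac:(by rewrite invr_ge0))
  (ltac:(by rewrite invf_lt1// ltr1n)) (divr_gt0 (divr_gt0 y0 s0) (ltr0n R 2)).
move=> /(ler_wpM2l (ltW s0)); have -> : s * (y / s / 2) = y / 2 by field; rewrite gt_eqF.
by have := H L; move: y0; lra.
Qed.

(** Compactness of the segment gives a cluster point along [U]; an ultrafilter contains either the
    indices near it or the others, and the latter contradicts clustering. A single ultrafilter
    serves for all coefficients and all precisions, which replaces repeated extraction of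
    subsequences. *)
Lemma ultra_cauchy (U : set_system nat) x (M dl : R) : UltraFilter U ->
  (forall k, `|x k| <= M) -> 0 < dl ->
  exists2 A, U A & forall k l, A k -> A l -> `|x k - x l| <= dl.
Proof.
move=> uU xM dl0; have PU : ProperFilter U by exact: ultra_proper.
have FA : (x @ U) `[- M, M]%classic.
  apply: (@filterS _ U _ setT) => [k _|]; last exact: filterT.
  by rewrite /= in_itv/= -ler_norml.
have [p [_ clp]] := @segment_compact R (- M) M (x @ U) _ FA.
pose B := [set k | `|x k - p| < dl / 2].
have [UB|UB] := in_ultra_setVsetC B uU.
  exists B => // k l Bk Bl; rewrite (_ : x k - x l = (x k - p) - (x l - p)); last by ring.
  apply: (le_trans (ler_normB _ _)); move: Bk Bl; rewrite /B/=; lra.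
have [] := clp (x @` (~` B)) (ball p (dl / 2)).
- by apply: (@filterS _ U _ (~` B)) => // k nB /=; exists k.
- by apply: nbhsx_ballx; rewrite divr_gt0.
move=> _ [[k nB <-]]; rewrite /ball/= distrC => xk; exfalso; exact: nB.
Qed.

Lemma ultra_cauchyC (U : set_system nat) (c : nat -> R[i]) (M dl : R) : UltraFilter U ->
  (forall k, normc (c k) <= M) -> 0 < dl ->
  exists2 A, U A & forall k l, A k -> A l -> normc (c k - c l) <= dl.
Proof.
move=> uU cM dl0; have d2 : 0 < dl / 2 by rewrite divr_gt0.
have PU : ProperFilter U by exact: ultra_proper.
have [A1 U1 H1] := ultra_cauchy uU (fun k => le_trans (normc_Re (c k)) (cM k)) d2.
have [A2 U2 H2] := ultra_cauchy uU (fun k => le_trans (normc_Im (c k)) (cM k)) d2.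
exists (A1 `&` A2) => [|k l [k1 k2] [l1 l2]]; first exact: filterI.
apply: (le_trans (normc_le_ReIm _)); rewrite ReD ImD ReN ImN.
by have := H1 k l k1 l1; have := H2 k l k2 l2; lra.
Qed.

End real_sequences.

(** * Completeness of the Fock space *)

Section completeness.
Variables (R : realType) (n : nat).
Local Notation C := R[i].
Local Notation Cn := 'rV[C]_n.
Local Notation leb := (@lebesgueCn R n).
Local Notation F2 := (fock R n).
Implicit Types (f g h : Cn -> C) (z w : Cn).

Lemma inner_cauchy_schwarz f g : L2 f -> L2 g ->
  ((normc (inner f g) ^+ 2)%:E <= sqnorm f * sqnorm g)%E.
Proof.
move=> Lf Lg; have [mf _] := Lf; have [mg _] := Lg.
have i1 := L2_inner_cintble Lf Lg.
have c0 : (0 <= ((2 * pi) ^- n)%:E :> \bar R)%E by rewrite lee_fin twopi_ge0.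
have md := measurable_damped mf; have md' := measurable_damped mg.
pose I : \bar R := (\int[leb]_z (damped f z * damped g z)%:E)%E.
have I0 : (0 <= I)%E by apply: integral_ge0 => z _; rewrite lee_fin mulr_ge0 ?damped_ge0.
have le : ((normc (inner f g))%:E <= ((2 * pi) ^- n)%:E * I)%E.
  have m0 z : setT z -> (0 <= (damped f z * damped g z)%:E)%E.
    by move=> _; rewrite lee_fin mulr_ge0 ?damped_ge0.
  have mm : measurable_fun setT (fun z => (damped f z * damped g z)%:E).
    by apply/measurable_EFinP; exact: measurable_funM.
  rewrite /I -(ge0_integralZl_EFin leb measurableT m0 mm (@twopi_ge0 R n)).
  apply: (le_trans (normc_cint measurableT i1)).
  apply: ge0_le_integral => //.
  - by move=> z _; rewrite lee_fin normc_ge0.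
  - by apply/measurable_EFinP; apply: measurable_normc; have [] := i1.
  - exact: (measurable_funeM _ mm).
  move=> z _; rewrite lee_fin !normcMl normc_conj normc_real (ger0_norm (gaussian_ge0 z)).
  rewrite gaussE /damped le_eqVlt; apply/orP; left; apply/eqP.
  have -> : expR (- 2^-1 * enorm z ^+ 2) = expR (- 4^-1 * enorm z ^+ 2) ^+ 2.
    by rewrite -expRM_natl; congr expR; field.
  by ring.
rewrite expr2 EFinM (sqnorm_damped mf) (sqnorm_damped mg).
have n0 : (0 <= (normc (inner f g))%:E)%E by rewrite lee_fin normc_ge0.
apply: (le_trans (lee_pmul n0 n0 le le)); rewrite muleACA [leRHS]muleACA.
apply: lee_wpmul2l; first by rewrite mule_ge0.
by apply: cauchy_schwarz => //; exact: damped_ge0.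
Qed.

Lemma sqnorm_kernel_fin w : exists2 s : R, 0 <= s & sqnorm (@kernel_fock R n w) = (s ^+ 2)%:E.
Proof.
have [_ fin] := fock_L2 (kernel_fock w); have [s s0 e] := L2norm_fin fin.
by exists s => //; rewrite sqnormE e -EFinM.
Qed.

Lemma berg_point_bound w : exists2 s : R, 0 <= s & forall h (e : R), L2 h -> 0 <= e ->
  (sqnorm h <= (e ^+ 2)%:E)%E -> normc (berg h w) <= s * e.
Proof.
have [s s0 E] := sqnorm_kernel_fin w; exists s => // h e Lh e0 he.
rewrite -(inner_kernel h w).
have := inner_cauchy_schwarz Lh (fock_L2 (kernel_fock w)); rewrite E => le.
have : ((normc (inner h (kernel_fock w)) ^+ 2)%:E <= ((s * e) ^+ 2)%:E)%E.
  rewrite exprMn mulrC EFinM; apply: (le_trans le).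
  by apply: lee_wpmul2r he; rewrite lee_fin sqr_ge0.
by rewrite lee_fin ler_sqr ?nnegrE ?normc_ge0// mulr_ge0.
Qed.

(** Point evaluations are bounded, so the sequence converges pointwise; Fatou carries the norm
    estimate to the limit, and the limit is entire because it is its own Bergman projection. *)
Lemma fock_complete (g : nat -> F2) :
  (forall j l, (j <= l)%N -> (sqnorm (g l - g j)%R <= ((2^-1 ^+ j) ^+ 2)%:E)%E) ->
  exists v : F2, forall j, (sqnorm (g j - v)%R <= ((2^-1 ^+ j) ^+ 2)%:E)%E.
Proof.
move=> H; have h0 j : 0 <= 2^-1 ^+ j :> R by rewrite exprn_ge0// invr_ge0.
have pt w : exists s : R, 0 <= s /\ forall h (e : R), L2 h -> 0 <= e ->
    (sqnorm h <= (e ^+ 2)%:E)%E -> normc (berg h w) <= s * e.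
  by have [s s0 Hs] := berg_point_bound w; exists s.
have [s Hs] := choice pt; have s0 w := (Hs w).1.
have diff w j l : (j <= l)%N -> normc (g l w - g j w) <= s w * 2^-1 ^+ j.
  move=> jl; have Ld := fock_L2 (g l - g j).
  have := (Hs w).2 _ _ Ld (h0 j) (H _ _ jl).
  by rewrite (berg_fock (fock_entire (g l - g j)) Ld).
have lim w : exists c : C, forall j, normc (g j w - c) <= 2 * s w * 2^-1 ^+ j /\
    `|complex.Re (g j w) - complex.Re c| <= s w * 2^-1 ^+ j /\
    `|complex.Im (g j w) - complex.Im c| <= s w * 2^-1 ^+ j.
  have [j l jl|x hx] := @nested_cauchy R (fun j => complex.Re (g j w)) (fun j => s w * 2^-1 ^+ j).
    by rewrite -ReN -ReD (le_trans (normc_Re _))// diff.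
  have [j l jl|y hy] := @nested_cauchy R (fun j => complex.Im (g j w)) (fun j => s w * 2^-1 ^+ j).
    by rewrite -ImN -ImD (le_trans (normc_Im _))// diff.
  exists (Complex x y) => j; split; last by split; [exact: hx|exact: hy].
  apply: (le_trans (normc_le_ReIm _)); rewrite ReD ImD ReN ImN.
  by have := hx j; have := hy j; rewrite /=; lra.
have [v Hv] := choice lim.
have mg j : measurable_fun setT (g j) by have [] := fock_L2 (g j).
have mv : measurable_fun setT v.
  apply: measurable_fun_complex.
    apply: (@measurable_fun_cvg _ _ _ _ (fun j w => complex.Re (g j w))) => [j|w _].
      by apply: measurable_fun_Re; exact: mg.
    by apply: cvg_geometric_dist => j; exact: (Hv w j).2.1.
  apply: (@measurable_fun_cvg _ _ _ _ (fun j w => complex.Im (g j w))) => [j|w _].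
    by apply: measurable_fun_Im; exact: mg.
  by apply: cvg_geometric_dist => j; exact: (Hv w j).2.2.
have near j : (sqnorm (fun z => (g j z - v z)%R) <= ((2^-1 ^+ j) ^+ 2)%:E)%E.
  pose F l z : \bar R := (normc ((g (j + l)%N - g j) z) ^+ 2 * gaussian z)%:E.
  have mF l : measurable_fun setT (F l).
    by apply/measurable_EFinP; apply: measurable_sqnormf; have [] := fock_L2 (g (j + l)%N - g j).
  have F0 l z : setT z -> (0 <= F l z)%E.
    by move=> _; rewrite lee_fin mulr_ge0 ?sqr_ge0 ?gaussian_ge0.
  (* The pointwise limit inherits the bound at [j], which is uniform in [l], before [v] is known to
     be square integrable. *)
  have := fatou leb measurableT mF F0.
  have -> : (\int[leb]_(x in setT) limn_einf (F^~ x))%E = sqnorm (fun z => g j z - v z).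
    apply: (@eq_integral _ _ _ leb) => z _.
    have c : F^~ z @ \oo --> (normc (g j z - v z) ^+ 2 * gaussian z)%:E.
      apply: cvg_EFin; first exact: nearW.
      have nc : (fun l => normc ((g (j + l)%N - g j) z)) @ \oo --> normc (g j z - v z).
        apply: (@cvg_geometric_dist _ _ _ (2 * s z)) => l.
        rewrite fock_subE (normc_distrC _ (g j z)).
        have tri (a b : C) : `|normc a - normc b| <= normc (a - b).
          rewrite ler_norml; apply/andP; split.
            rewrite lerNl opprB lerBlDr (normc_distrC a).
            by apply: (le_trans _ (normc_add _ _)); rewrite subrK.
          by rewrite lerBlDr (le_trans _ (normc_add _ _))// subrK.
        apply: (le_trans (tri _ _)).
        rewrite (_ : g j z - g (j + l)%N z - (g j z - v z) = - (g (j + l)%N z - v z)); last by ring.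
        rewrite normc_opp; apply: (le_trans (Hv z (j + l)%N).1).
        rewrite ler_wpM2l ?mulr_ge0 ?s0// exprD ler_piMl//.
        by rewrite exprn_ile1 ?invr_ge0// invf_le1// ler1n.
      by apply: cvgM; [exact: (cvgM nc nc)|exact: cvg_cst].
    by rewrite (cvg_limn_einf_sup c).1.
  move=> le; apply: (le_trans le); rewrite limn_einf_lim; apply: lime_le.
    exact: is_cvg_einfs.
  apply: nearW => k; apply: (@le_trans _ _ (\int[leb]_x F k x)%E).
    by apply: ereal_inf_lbound; exists k => //=.
  by apply: H; exact: leq_addr.
have Ld j : L2 (fun z => g j z - v z).
  apply/L2E; split; first exact: measurable_cB.
  by apply: (le_lt_trans (near j)); exact: ltry.
have Lv : L2 v.
  have := L2_sub (fock_L2 (g 0%N)) (Ld 0%N).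
  by under eq_fun do rewrite opprB addrC subrK.
(* Both values are within a constant times [2^-j] of [g j w], the second because [berg] is bounded
   at a point. *)
have bv w : berg v w = v w.
  apply/eqP; rewrite -subr_eq0; apply/eqP/Normc.eq0_normc/eqP; rewrite eq_le normc_ge0 andbT.
  apply: (@geometric_le0 _ _ (3 * s w)) => j.
  have := bergB (fock_L2 (g j)) Lv w.
  have := (Hs w).2 _ _ (Ld j) (h0 j) (near j).
  move=> + E; rewrite E (berg_fock (fock_entire (g j)) (fock_L2 (g j))) => le.
  rewrite (_ : berg v w - v w = (g j w - v w) - (g j w - berg v w)); last by ring.
  apply: (le_trans (normc_sub _ _)); have := (Hv w j).1.
  by move: le; lra.
have ev : entire v.
  by rewrite (_ : v = berg v); [exact: berg_entire|apply/funext => w; rewrite bv].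
by exists (Fock (fock_memP ev Lv)) => j; exact: near.
Qed.

End completeness.

Lemma quarters (R : realType) (e : R) : 2 * (e / 4 + e / 4) = e.
Proof. by field. Qed.

Lemma tail_bound (R : realType) (b M y e : R) : 0 <= y -> y <= 1 ->
  y * (16 * (b ^+ 2 * M ^+ 2 + 1)) <= e -> (b * y) ^+ 2 * (4 * M ^+ 2) <= e / 4.
Proof.
move=> y0 y1 ye; have yy : y ^+ 2 <= y by rewrite expr2 ler_piMl.
have bM0 : 0 <= b ^+ 2 * M ^+ 2 by rewrite mulr_ge0 ?sqr_ge0.
have := ler_wpM2r bM0 yy; rewrite exprMn.
by move: (b ^+ 2) (M ^+ 2) (y ^+ 2) ye => b2 M2 y2; lra.
Qed.

(** * Compactness from geometric finite-rank approximation *)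

Section compact_operators.
Variables (R : realType) (n : nat).
Local Notation C := R[i].
Local Notation Cn := 'rV[C]_n.
Local Notation leb := (@lebesgueCn R n).
Local Notation F2 := (fock R n).
Implicit Types (f g : F2) (T S : {linear F2 -> F2}).

Lemma sqnorm_zero : sqnorm (0 : F2) = 0%E.
Proof. by rewrite sqnormE L2norm_zero mule0. Qed.

Lemma sqnorm_scale (c : C) f : sqnorm (c *: f) = ((normc c ^+ 2)%:E * sqnorm f)%E.
Proof.
have [mf _] := fock_L2 f.
have m0 z : setT z -> (0 <= (normc (f z) ^+ 2 * gaussian z)%:E :> \bar R)%E.
  by move=> _; rewrite lee_fin mulr_ge0 ?sqr_ge0 ?gaussian_ge0.
have mm : measurable_fun setT (fun z => (normc (f z) ^+ 2 * gaussian z)%:E : \bar R).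
  by apply/measurable_EFinP; exact: measurable_sqnormf.
rewrite -(ge0_integralZl_EFin leb measurableT m0 mm (sqr_ge0 (normc c))).
apply: (@eq_integral _ _ _ leb) => z _.
by rewrite fock_scaleE normcMl exprMn -EFinM -[in LHS]mulrA.
Qed.

Lemma sqnorm_addF f g : (sqnorm (f + g)%R <= 2%:E * (sqnorm f + sqnorm g))%E.
Proof. by have [mf _] := fock_L2 f; have [mg _] := fock_L2 g; exact: sqnorm_add. Qed.

Lemma sqnorm_oppF f : sqnorm (- f)%R = sqnorm f.
Proof.
rewrite -scaleN1r sqnorm_scale normc_opp -rc1 normc_real normr1 expr1n.
exact: mul1e.
Qed.

Lemma sqnorm_add_le f g (a b : R) : (sqnorm f <= a%:E)%E -> (sqnorm g <= b%:E)%E ->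
  (sqnorm (f + g)%R <= (2 * (a + b))%:E)%E.
Proof.
move=> fa gb; apply: (le_trans (sqnorm_addF f g)); rewrite EFinM (EFinD a b).
by apply: lee_wpmul2l; [rewrite lee_fin|exact: leeD].
Qed.

Lemma small_sum N (e : 'I_N -> F2) (eta : R) : 0 < eta ->
  exists2 dl : R, 0 < dl & forall d : 'I_N -> C, (forall i, normc (d i) <= dl) ->
    (sqnorm (\sum_i d i *: e i)%R <= eta%:E)%E.
Proof.
elim: N e eta => [|N IH] e eta eta0.
  by exists 1 => // d _; rewrite big_ord0 sqnorm_zero lee_fin ltW.
have e4 : 0 < eta / 4 by rewrite divr_gt0.
have [d1 d10 H1] := IH (fun i => e (lift ord0 i)) _ e4.
have [s s0 es] : exists2 s : R, 0 <= s & sqnorm (e ord0) = (s ^+ 2)%:E.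
  have [_ fin] := fock_L2 (e ord0); have [s s0 E] := L2norm_fin fin.
  by exists s => //; rewrite sqnormE E -EFinM.
pose q := Num.sqrt eta; have q0 : 0 < q by rewrite sqrtr_gt0.
have qq : q ^+ 2 = eta by rewrite sqr_sqrtr// ltW.
(* Chosen so that [d2 * s <= q / 2], which squares to [eta / 4]; [s + 1] covers [s = 0]. *)
pose d2 := q / (2 * (s + 1)).
have s1 : 0 < s + 1 by rewrite ltr_wpDl.
have d20 : 0 < d2 by rewrite divr_gt0// mulr_gt0.
have d2s : (d2 * s) ^+ 2 <= eta / 4.
  rewrite -qq (_ : q ^+ 2 / 4 = (q / 2) ^+ 2); last by field.
  rewrite ler_sqr ?nnegrE ?mulr_ge0 ?invr_ge0 ?addr_ge0 ?(ltW q0) ?(ltW d20)//; last by rewrite ltW ?mulr_gt0.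
  rewrite (_ : d2 * s = q / 2 * (s / (s + 1))); last by rewrite /d2; field; rewrite gt_eqF.
  by rewrite ler_piMr ?divr_ge0 ?(ltW q0)// ler_pdivrMr// mul1r lerDl.
exists (Order.min d1 d2) => [|d dd]; first by rewrite lt_min d10.
have le1 i : normc (d i) <= d1 by rewrite (le_trans (dd i))// ge_min lexx.
have le2 i : normc (d i) <= d2 by rewrite (le_trans (dd i))// ge_min lexx orbT.
rewrite big_ord_recl.
have h1 : (sqnorm (d ord0 *: e ord0)%R <= (eta / 4)%:E)%E.
  rewrite sqnorm_scale es -EFinM lee_fin -exprMn (le_trans _ d2s)//.
  have ds0 : 0 <= normc (d ord0) * s by rewrite mulr_ge0 ?normc_ge0.
  have le : normc (d ord0) * s <= d2 * s by rewrite ler_wpM2r.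
  by rewrite ler_sqr ?nnegrE// (le_trans ds0).
have h2 := H1 (fun i => d (lift ord0 i)) (fun i => le1 (lift ord0 i)).
by apply: (le_trans (sqnorm_add_le h1 h2)); rewrite lee_fin quarters.
Qed.

Lemma inner_sub f g h : inner (f - g : F2) (h : F2) = inner f h - inner g h.
Proof. by rewrite addrC -scaleN1r inner_linear mulN1r addrC. Qed.

Section total_boundedness.
Variables (T : {linear F2 -> F2}) (D : nat) (b r : R).
Hypotheses (r0 : 0 < r) (r1 : r < 1) (H : finite_rank_approx T D b r).
Variables (u : nat -> F2) (M : R).
Hypotheses (uM : forall k, (sqnorm (u k) <= (M ^+ 2)%:E)%E).

(** The tail of norm [b r^L] is small on bounded sets. On the finite-rank part only finitely many
    bounded coefficients have to be close, which one set of the ultrafilter achieves. *)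
Lemma ultra_cauchy_image (U : set_system nat) (eta : R) : UltraFilter U -> 0 < eta ->
  exists2 A, U A & forall k l, A k -> A l -> (sqnorm (T (u k) - T (u l))%R <= eta%:E)%E.
Proof.
move=> uU eta0; have PU : ProperFilter U by exact: ultra_proper.
have bM0 : 0 <= b ^+ 2 * M ^+ 2 by rewrite mulr_ge0 ?sqr_ge0.
have bM1 : 0 < 16 * (b ^+ 2 * M ^+ 2 + 1) by rewrite mulr_gt0// ltr_wpDl.
(* The tail contributes [(b r^L)^2] times [4 M^2], a bound on the square norm of [u k - u l]; this
   denominator makes the product at most [eta / 4], and the added 1 covers [b M = 0]. *)
have [L HL] := geometric_small (ltW r0) r1 (divr_gt0 eta0 bM1).
have [psi [e He]] := H L.
have e4 : 0 < eta / 4 by rewrite divr_gt0.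
have [dl dl0 Hdl] := small_sum e e4.
have coef i : exists A, U A /\ forall k l, A k -> A l ->
    normc (inner (u k) (psi i) - inner (u l) (psi i)) <= dl.
  have [s es] : exists s : R, sqnorm (psi i) = s%:E.
    have /L2E[_] := fock_L2 (psi i); have := sqnorm_ge0 (psi i).
    by case: (sqnorm _) => // s _ _; exists s.
  have cM k : normc (inner (u k) (psi i)) <= M ^+ 2 + s.
    rewrite -lee_fin; apply: (le_trans (normc_inner_le _ _)); rewrite es EFinD.
    exact: leeD.
  by have [A UA HA] := ultra_cauchyC uU cM dl0; exists A.
have [A HA] := choice coef.
exists [set k | forall i, A i k] => [|k l Ak Al].
  by apply: filter_forall => i; exact: (HA i).1.
have -> : T (u k) - T (u l) =
    (T (u k - u l) - \sum_i inner (u k - u l) (psi i) *: e i) +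
    \sum_i inner (u k - u l) (psi i) *: e i by rewrite subrK linearB.
have h2 : (sqnorm (\sum_i inner (u k - u l) (psi i) *: e i)%R <= (eta / 4)%:E)%E.
  by apply: Hdl => i; rewrite inner_sub; exact: (HA i).2.
have h3 : (sqnorm (u k - u l)%R <= (4 * M ^+ 2)%:E)%E.
  have ul : (sqnorm (- u l)%R <= (M ^+ 2)%:E)%E by rewrite sqnorm_oppF.
  apply: (le_trans (sqnorm_add_le (uM k) ul)).
  by rewrite (_ : 2 * (M ^+ 2 + M ^+ 2) = 4 * M ^+ 2); last by ring.
have rL0 : 0 <= r ^+ L by rewrite exprn_ge0// ltW.
have rL1 : r ^+ L <= 1 by rewrite exprn_ile1// ltW.
have h1 : (sqnorm (T (u k - u l) - \sum_i inner (u k - u l) (psi i) *: e i)%R <= (eta / 4)%:E)%E.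
  apply: (le_trans (He (u k - u l))).
  apply: (@le_trans _ _ (((b * r ^+ L) ^+ 2)%:E * (4 * M ^+ 2)%:E)%E).
    by apply: lee_wpmul2l; rewrite ?lee_fin ?sqr_ge0.
  by move: HL; rewrite -EFinM lee_fin ler_pdivlMr// => /(tail_bound rL0 rL1).
by apply: (le_trans (sqnorm_add_le h1 h2)); rewrite lee_fin quarters.
Qed.

End total_boundedness.

Lemma finite_rank_approx_compact T D (b r : R) : 0 <= b -> 0 < r -> r < 1 ->
  finite_rank_approx T D b r -> compact_op T.
Proof.
move=> b0 r0 r1 H; split.
  by rewrite /bounded_op (le_lt_trans (finite_rank_approx_opnorm b0 H))// ltry.
move=> u [M uM].
have M0 : 0 <= M by rewrite -lee_fin; exact: le_trans (L2norm_ge0 _) (uM 0%N).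
have uM' k : (sqnorm (u k) <= (M ^+ 2)%:E)%E by rewrite -L2norm_le.
have [U [uU Uoo]] := @ultraFilterLemma nat \oo _.
have PU : ProperFilter U by exact: ultra_proper.
pose ep j : R := (2^-1 ^+ j) ^+ 2.
have ep0 j : 0 < ep j by rewrite exprn_gt0// exprn_gt0// invr_gt0.
have exA j : exists A, U A /\ forall k l, A k -> A l ->
    (sqnorm (T (u k) - T (u l))%R <= (ep j)%:E)%E.
  by have [A UA HA] := ultra_cauchy_image r0 r1 H uM' uU (ep0 j); exists A.
have [A HA] := choice exA.
have UB j : U [set k | forall i, (i <= j)%N -> A i k].
  elim: j => [|j IH].
    by apply: filterS (HA 0%N).1 => k Ak i; rewrite leqn0 => /eqP ->.
  apply: filterS (filterI IH (HA j.+1).1) => k [Bk Ak] i.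
  by rewrite leq_eqVlt => /orP[/eqP ->//|]; rewrite ltnS; exact: Bk.
(* The indices that satisfy all precisions up to [jm.1] and lie beyond [jm.2] form a set of the
   ultrafilter, hence a nonempty one; iterating the choice gives a strictly increasing [phi]. *)
have expick (jm : nat * nat) : exists k,
    (forall i, (i <= jm.1)%N -> A i k) /\ (jm.2 < k)%N.
  have Um : U [set k | (jm.2 < k)%N] by apply: Uoo; exists jm.2.+1.
  by have [k [Bk mk]] := filter_ex (filterI (UB jm.1) Um); exists k.
have [pick Hpick] := choice expick.
pose phi := fix phi j := if j is j'.+1 then pick (j, phi j') else pick (0, 0)%N.
have phiA j i : (i <= j)%N -> A i (phi j).
  by case: j => [|j] ij; exact: (Hpick (_, _)).1.
have phiS j : (phi j < phi j.+1)%N by exact: (Hpick (_, _)).2.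
exists phi; split.
  by apply: homo_ltn => [y x z|]; [exact: ltn_trans|exact: phiS].
have [j l jl|v Hv] := @fock_complete R n (fun j => T (u (phi j))).
  by apply: (HA j).2; exact: phiA.
exists v; have c0 : (2^-1 ^+ j)%:E @[j --> \oo] --> (0%:E : \bar R).
  apply: cvg_EFin; first exact: nearW.
  apply: (@cvg_geometric_dist _ _ _ 1) => j.
  by rewrite subr0 mul1r /= ger0_norm// exprn_ge0// invr_ge0.
apply: (squeeze_cvge _ (cvg_cst 0%:E) c0); apply: nearW => j.
have j0 : 0 <= 2^-1 ^+ j :> R by rewrite exprn_ge0// invr_ge0.
by rewrite L2norm_ge0/= (L2norm_le _ j0); exact: Hv.
Qed.

Lemma increasing_cvgy (phi : nat -> nat) : {homo phi : i j / (i < j)%N} ->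
  phi @ \oo --> \oo.
Proof.
move=> hphi; have ge k : (k <= phi k)%N.
  by elim: k => // k IH; exact: leq_ltn_trans IH (hphi _ _ (ltnSn k)).
by move=> A [N _ NA]; exists N => // k /= Nk; apply: NA => /=; exact: leq_trans Nk (ge k).
Qed.

Lemma L2norm_sub_add (a b c v1 v2 : F2) : c = a + b ->
  (L2norm (c - (v1 + v2))%R <= 2%:E * (L2norm (a - v1)%R + L2norm (b - v2)%R))%E.
Proof.
move=> ->; have -> : a + b - (v1 + v2) = (a - v1) + (b - v2) by rewrite opprD addrACA.
exact (L2norm_add (fock_L2 (a - v1)) (fock_L2 (b - v2))).
Qed.

Lemma compact_op_add T1 T2 T : compact_op T1 -> compact_op T2 ->
  (forall f, T f = T1 f + T2 f) -> compact_op T.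
Proof.
move=> [b1 c1] [b2 c2] TE; split; first exact: (bounded_op_add b1 b2 TE).
move=> u [M uM].
have [phi1 [h1 [v1 l1]]] := c1 u (ex_intro _ M uM).
have [phi2 [h2 [v2 l2]]] := c2 (u \o phi1) (ex_intro _ M (fun k => uM (phi1 k))).
exists (phi1 \o phi2); split; first by move=> i j ij /=; apply: h1; exact: h2.
exists (v1 + v2).
pose n1 j : \bar R := L2norm (T1 (u (phi1 (phi2 j))) - v1).
pose n2 j : \bar R := L2norm (T2 (u (phi1 (phi2 j))) - v2).
have l1' : n1 @ \oo --> (0%:E : \bar R) := cvg_comp _ _ (increasing_cvgy h2) l1.
have l2' : n2 @ \oo --> (0%:E : \bar R) := l2.
have f0 : (0%:E : \bar R) \is a fin_num by [].
have f2 : (EFin (2 : R)) \is a fin_num by [].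
have s0 := cvgeD (FF := eventually_filter) (fin_num_adde_defl _ f0) l1' l2'.
have c0 := @cvgeZl _ _ _ _ _ _ f2 s0.
rewrite adde0 mule0 in c0.
apply: (squeeze_cvge _ (cvg_cst 0%:E) c0); apply: nearW => j.
rewrite L2norm_ge0/=.
exact (L2norm_sub_add v1 v2 (TE (u (phi1 (phi2 j))))).
Qed.

End compact_operators.

(** * Small operators with large heat transform *)

Section perturbation.
Variable R : realType.

(** Any [D >= Q^(1/(1 - al))] will do, since then [Q <= (2 D)^(1 - al)]. It is applied with
    [al = 1/p0], below 1 because [p0 > 1]. *)
Lemma powR_dominated (Q al : R) : 0 <= Q -> 0 <= al -> al < 1 ->
  exists2 D : nat, (0 < D)%N & Q * (2 * D%:R) `^ al <= 2 * D%:R.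
Proof.
move=> Q0 al0 al1; have b0 : 0 < 1 - al by rewrite subr_gt0.
pose y := Q `^ (1 - al)^-1; pose D := (Num.trunc y).+1; exists D => //.
have Dy : y <= 2 * D%:R.
  have y0 : 0 <= y by exact: powR_ge0.
  have /ltW : y < D%:R by exact: truncnS_gt.
  by move=> /le_trans; apply; rewrite ler_peMl// ler1n.
have D0 : 0 < 2 * D%:R :> R by rewrite mulr_gt0// ltr0n.
have Qle : Q <= (2 * D%:R) `^ (1 - al).
  apply: (@le_trans _ _ (y `^ (1 - al))).
    by rewrite /y -powRrM mulVf ?powRr1// gt_eqF.
  by apply: ge0_ler_powR => //; rewrite ?ltW// nnegrE ?powR_ge0// ltW.
apply: (le_trans (ler_wpM2r (powR_ge0 _ _) Qle)).
by rewrite -powRD ?subrK ?powRr1 ?(ltW D0)//; apply/implyP => _; rewrite gt_eqF.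
Qed.

Variable n' : nat.
Local Notation n := n'.+1.
Local Notation C := R[i].
Local Notation Cn := 'rV[C]_n.
Local Notation leb := (@lebesgueCn R n).
Local Notation F2 := (fock R n).
Implicit Types (z w : Cn) (h : Cn -> C).

Lemma heat_cintble h (a : Cn) : bounded_symbol h ->
  cintble leb setT (fun w => h w * (expR (- enorm (w - a) ^+ 2))%:C).
Proof.
move=> [mh [M hM]].
have mG : measurable_fun setT (fun w => h w * (expR (- enorm (w - a) ^+ 2))%:C).
  apply: measurable_cM => //; apply: measurable_cR; apply: measurableT_comp => //.
  apply: measurableT_comp => //; apply: measurable_funX; apply: measurable_enormf.
  by apply: measurable_rowB; [exact: measurable_id|exact: measurable_cst].
apply: (le_cintble measurableT mG
  (integrable_scale M (gauss_integrable a (@ltr01 R)))) => z _.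
by rewrite normcMl normc_real ger0_norm ?expR_ge0// mulN1r ler_wpM2r ?expR_ge0.
Qed.

Lemma heat_bump_sum (x : R) (D : nat) (A t c : R) : 0 < x -> x <= 4^-1 ->
  heat_transform (@bump_sum R n' x D A t c) (t%:C *: e1) =
  (c * D%:R * (2 / (1 + x)) ^+ n)%:C.
Proof.
move=> x0 x1; pose a : Cn := t%:C *: e1.
have iF (j : 'I_D) := heat_cintble a (bump_symbol_bounded n' x0 x1 t (j%:R * A)).
rewrite /heat_transform.
have -> : cintegral (fun w => bump_sum x D A t c w * (expR (- enorm (w - a) ^+ 2))%:C) =
    c%:C * \sum_(j < D) cintegral
      (fun w => bump_symbol x t (j%:R * A) w * (expR (- enorm (w - a) ^+ 2))%:C).
  refine (etrans _ (etrans (cintZ c%:C measurableT (cintble_sum _ measurableT iF)) _)).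
    apply: (@eq_cint _ _ _ leb) => w _.
    by rewrite /bump_sum -mulrA mulr_suml.
  by congr (_ * _); exact: cint_sum.
rewrite mulrCA mulr_sumr.
rewrite (eq_bigr (fun=> ((2 / (1 + x)) ^+ n)%:C)); last first.
  by move=> j _; exact: heat_bump_symbol.
by rewrite sumr_const card_ord -[X in _ * X]mulr_natl -(rcn R D) -!rcM mulrA.
Qed.

Lemma bump_sum_decay (x : R) (D : nat) (A c : R) : 0 < x -> x <= 4^-1 -> 0 <= c ->
  exists2 K : R, 0 <= K & forall t z, normc (@bump_sum R n' x D A t c z) <=
    K * expR (- (5 / 8) * enorm (z - t%:C *: e1) ^+ 2).
Proof.
move=> x0 x1 c0; pose sg := (1 + x) / (2 * x).
exists (c * \sum_(j < D) (x ^- n * expR (sg * (j%:R * A) ^+ 2))) => [|t z].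
  rewrite mulr_ge0// sumr_ge0// => j _.
  by rewrite mulr_ge0 ?expR_ge0// invr_ge0 exprn_ge0// ltW.
rewrite normcMl normc_real ger0_norm// -mulrA ler_wpM2l//.
apply: (le_trans (normc_sum _ _ _)); rewrite mulr_suml; apply: ler_sum => j _.
rewrite normc_bump_symbol// -[leRHS]mulrA ler_wpM2l ?invr_ge0 ?exprn_ge0 ?(ltW x0)//.
rewrite -expRD ler_expR addrC lerD2l ler_wpM2r ?sqr_ge0// lerN2.
by have := s_ge x0 x1; lra.
Qed.

Lemma perturbation (N M : nat) (eta p0 : R) : 0 < eta -> 1 < p0 ->
  exists h (T : {linear F2 -> F2}) (c : Cn),
  [/\ bounded_symbol h /\ toeplitz_extension h T,
      N%:R <= normc (heat_transform h c),
      forall m, (m <= M)%N -> (weighted_norm m h <= eta%:E)%E,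
      (opnorm T <= eta%:E)%E /\
        (forall p, p0 <= p -> (schatten_norm p T <= eta%:E)%E) &
      compact_op T /\ (forall p, 1 < p -> schatten_class p T)].
Proof.
move=> eta0 p01; have p0_gt0 : 0 < p0 by exact: lt_trans ltr01 p01.
(* Then [r = 4 x] satisfies [(n + 1) r = 1/2], the balance between rank growth and decay required by
   [finite_rank_approx_schatten]. *)
pose x : R := (8 * n.+1%:R)^-1.
have n10 : 0 < n.+1%:R :> R by rewrite ltr0n.
have x0 : 0 < x by rewrite invr_gt0 mulr_gt0.
have x1 : x <= 4^-1.
  rewrite lef_pV2 ?posrE ?mulr_gt0//.
  have : 1 <= n.+1%:R :> R by rewrite ler1n.
  by lra.
pose r : R := 4 * x; have r0 : 0 < r by rewrite mulr_gt0.
have nr : n.+1%:R * r = 2^-1 by rewrite /r /x; field; rewrite gt_eqF.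
have r1 : r < 1.
  have : r <= n.+1%:R * r by rewrite ler_peMl ?ler1n ?(ltW r0).
  by rewrite nr; lra.
pose K0 : R := N%:R + 1; have K00 : 0 <= K0 by rewrite addr_ge0.
pose B0 : R := 2 * 4 ^+ n; have B00 : 0 <= B0 by rewrite mulr_ge0// exprn_ge0.
(* With this [Q], the inequality [Q (2 D)^(1/p0) <= 2 D] says exactly [(2 D)^(1/p0) b <= eta] for
   the [b] below. *)
pose Q := 2 * K0 * B0 / eta.
have Q0 : 0 <= Q by rewrite divr_ge0 ?(ltW eta0)// !mulr_ge0.
have al0 : 0 <= p0^-1 by rewrite invr_ge0 ltW.
have al1 : p0^-1 < 1 by rewrite invf_lt1.
have [D D0 HD] := powR_dominated Q0 al0 al1.
have Dp : 0 < D%:R :> R by rewrite ltr0n.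
have D1 : 1 <= D%:R :> R by rewrite ler1n.
(* With this scaling the [D] contributions to the heat transform add up to at least [K0], while the
   norm bound [b] decreases like [1 / D]. *)
pose c := K0 / D%:R; have c0 : 0 <= c by rewrite divr_ge0.
pose b := c * 2 * 4 ^+ n; have b0 : 0 <= b by rewrite !mulr_ge0// exprn_ge0.
have D2 : 1 <= 2 * D%:R :> R by lra.
have key : (2 * D%:R) `^ p0^-1 * b <= eta.
  have : eta * (Q * (2 * D%:R) `^ p0^-1) <= eta * (2 * D%:R) by rewrite ler_pM2l.
  rewrite (_ : eta * (Q * _) = (2 * D%:R) * ((2 * D%:R) `^ p0^-1 * b)).
    by rewrite [leLHS]mulrC ler_pM2r ?mulr_gt0.
  by rewrite /Q /b /c /B0; move: (_ `^ _) => y; field; rewrite !gt_eqF.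
have pow1 al : 0 <= al -> 1 <= (2 * D%:R) `^ al :> R.
  by move=> al0'; rewrite -[leLHS](powRr0 (2 * D%:R)) ler_powR.
have beta : b <= eta.
  by apply: le_trans key; rewrite ler_peMl// pow1.
(* As [D >= 1], this ensures the separation [A^2 >= 32 D] of [gaussian_sum_le]. *)
pose A : R := 32 * D%:R.
have A0 : 0 <= A by rewrite mulr_ge0.
have DA : D%:R * 32 <= A ^+ 2.
  rewrite /A; have : D%:R <= D%:R ^+ 2 :> R by rewrite expr2 ler_peMl.
  by move: (D%:R : R) Dp => y y0; nra.
(* [K] does not depend on the centre, so [t] can be chosen after it: [exp (t^2/8) >= 1 + t^2/8 >= q]
   for [t = 1 + 8 q]. *)
have [K KK0 HK] := @bump_sum_decay x D A c x0 x1 c0.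
pose q := K ^+ 2 * expR (M%:R ^+ 2) / eta ^+ 2.
have q0 : 0 <= q by apply: divr_ge0; [apply: mulr_ge0; [exact: sqr_ge0|exact: expR_ge0]|exact: sqr_ge0].
pose t : R := 1 + 8 * q.
pose h := @bump_sum R n' x D A t c.
have bh : bounded_symbol h by exact: bump_sum_bounded.
have [T eT TE] := toeplitz_bounded bh.
have approx : finite_rank_approx T D b r.
  by move=> L; exact: (bump_sum_approx x0 x1 A0 DA c0 L TE).
have n0 : (0 < n)%N by [].
have nr' : n.+1%:R * r <= 2^-1 by rewrite nr.
have schatten p : 1 <= p -> (schatten_norm p T <= ((2 * D%:R * b `^ p) `^ p^-1)%:E)%E.
  by move=> p1; exact: finite_rank_approx_schatten nr' approx p1.
have cT : compact_op T := finite_rank_approx_compact b0 r0 r1 approx.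
exists h, T, (t%:C *: e1); split => //.
- rewrite heat_bump_sum// normc_real.
  have e1 : 1 <= (2 / (1 + x)) ^+ n.
    rewrite -[leLHS](expr1n _ n) lerXn2r ?nnegrE ?divr_ge0 ?addr_ge0 ?(ltW x0)//.
    by rewrite ler_pdivlMr ?addr_gt0// mul1r; move: x1; lra.
  rewrite (_ : c * D%:R = K0); last by rewrite /c mulfVK// gt_eqF.
  apply: (le_trans _ (ler_norm _)); apply: (@le_trans _ _ K0).
    by rewrite /K0 lerDl.
  by rewrite ler_peMr.
- move=> m mM; apply: (weighted_norm_bump (ltW eta0) KK0 _ (HK t)); first by have [] := bh.
  apply: (@le_trans _ _ (K ^+ 2 * expR (M%:R ^+ 2) * expR (- 8^-1 * t ^+ 2))).
    rewrite mulrA ler_wpM2r ?expR_ge0// ler_wpM2l ?sqr_ge0// ler_expR.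
    by rewrite ler_sqr ?nnegrE// ler_nat.
  rewrite mulNr expRN ler_pdivrMr ?expR_gt0//.
  have e2 : 0 < eta ^+ 2 by rewrite exprn_gt0.
  rewrite [leRHS]mulrC -ler_pdivrMr// -/q; apply: (le_trans _ (expR_ge1Dx _)).
  by rewrite /t; have := sqr_ge0 q; lra.
(* Since [(2 D b^p)^(1/p) = (2 D)^(1/p) b] decreases in [p], as [2 D >= 1], the estimate at [p0]
   covers all [p >= p0]. *)
- split=> [|p pp0].
    by apply: (le_trans (finite_rank_approx_opnorm b0 approx)); rewrite lee_fin.
  have p_gt0 : 0 < p by exact: lt_le_trans p0_gt0 pp0.
  apply: (le_trans (schatten p _)); first exact: le_trans (ltW p01) pp0.
  rewrite lee_fin; apply: le_trans key.
  rewrite powRM ?mulr_ge0 ?powR_ge0// -powRrM mulfV ?gt_eqF// powRr1//.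
  by rewrite ler_wpM2r// ler_powR// lef_pV2.
- split=> // p p1; split; first by have [] := eT.
  by rewrite (le_lt_trans (schatten p (ltW p1)))// ltry.
Qed.

End perturbation.

(** * The category argument *)

Section heat_estimates.
Variables (R : realType) (n : nat).
Local Notation C := R[i].
Local Notation Cn := 'rV[C]_n.
Local Notation leb := (@lebesgueCn R n).
Local Notation F2 := (fock R n).
Implicit Types (f g h : Cn -> C) (z w a b : Cn).

(** The endpoint heat kernel relative to [mu], up to [pi^-n]. It lies in [L^2(mu)], so the heat
    transform is an inner product and [q_0] alone controls it at each point. *)
Definition heat_density a w : R := (2 * pi) ^+ n * expR (- enorm (w - a) ^+ 2 + enorm w ^+ 2 / 2).

Lemma twopi_gt0 : 0 < (2 * pi) ^+ n :> R.
Proof. by rewrite exprn_gt0// mulr_gt0// pi_gt0. Qed.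

Lemma heat_density_gaussian a w : heat_density a w * gaussian w = expR (- enorm (w - a) ^+ 2).
Proof.
rewrite gaussE /heat_density mulrACA mulfV ?gt_eqF ?twopi_gt0// mul1r -expRD.
by congr expR; rewrite mulNr mulrC addrK.
Qed.

Lemma heat_inner g a : heat_transform g a =
  (pi ^- n)%:C * inner g (fun w => (heat_density a w)%:C).
Proof.
congr (_ * _); apply: (@eq_cint _ _ _ leb) => w _.
by rewrite conjc_real -mulrA -rcM heat_density_gaussian.
Qed.

Lemma measurable_heat_density a : measurable_fun setT (fun w => (heat_density a w)%:C).
Proof.
apply: measurable_cR; apply: measurable_funM; first exact: measurable_cst.
apply: measurableT_comp => //; apply: measurable_funD.
  apply: measurableT_comp => //; apply: measurable_funX; apply: measurable_enormf.
  by apply: measurable_rowB; [exact: measurable_id|exact: measurable_cst].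
by apply: measurable_funM => //; apply: measurable_funX; exact: measurable_enorm.
Qed.

Lemma enorm_split w a : enorm w ^+ 2 <= 2 * enorm (w - a) ^+ 2 + 2 * enorm a ^+ 2.
Proof. by have := enormD_sqr_le (w - a) a; rewrite subrK. Qed.

Lemma heat_density_L2 a : L2 (fun w => (heat_density a w)%:C).
Proof.
have ig : leb.-integrable setT (fun w => ((2 * pi) ^+ n * expR (enorm a ^+ 2) *
    expR (- 1 * enorm (w - a) ^+ 2))%:E).
  by apply: integrable_scale; exact: gauss_integrable.
apply: (L2_le (measurable_heat_density a) ig) => w.
have h0 : 0 <= heat_density a w by rewrite mulr_ge0 ?expR_ge0// ltW// twopi_gt0.
rewrite normc_real (ger0_norm h0) expr2 -mulrA heat_density_gaussian /heat_density.
rewrite -[leLHS]mulrA -[leRHS]mulrA ler_wpM2l ?(ltW twopi_gt0)// -!expRD ler_expR.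
by have := enorm_split w a; lra.
Qed.

Lemma expR_sub1_le (y : R) : `|expR y - 1| <= `|y| * expR `|y|.
Proof. by have := cexp_sub1 y%:C; rewrite cexp_real -rc1 -rcN -rcD !normc_real. Qed.

Lemma gaussian_lipschitz (u v dl : R) : 0 <= u -> 0 <= v -> dl <= 1 -> `|v - u| <= dl ->
  `|expR (- v ^+ 2) - expR (- u ^+ 2)| <= dl * expR (- u ^+ 2 + (4 * u + 1)).
Proof.
move=> u0 v0 dl1 vu; have dl0 : 0 <= dl by exact: le_trans (normr_ge0 _) vu.
pose y := u ^+ 2 - v ^+ 2.
have -> : expR (- v ^+ 2) - expR (- u ^+ 2) = expR (- u ^+ 2) * (expR y - 1).
  by rewrite mulrBr mulr1 -expRD /y addrA addNr add0r.
rewrite normrM (ger0_norm (expR_ge0 _)) (expRD (- u ^+ 2)) [leRHS]mulrCA ler_wpM2l ?expR_ge0//.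
apply: (le_trans (expR_sub1_le y)).
have vle : v <= u + dl by move: vu; rewrite ler_norml => /andP[_]; lra.
have ym : `|y| <= dl * (2 * u + 1).
  rewrite /y subr_sqr normrM distrC ler_pM// ger0_norm ?addr_ge0//; lra.
have y1 : `|y| <= 2 * u + 1.
  by apply: (le_trans ym); rewrite ler_piMl// addr_ge0// mulr_ge0.
have e2 : 2 * u + 1 <= expR (2 * u) by rewrite addrC expR_ge1Dx.
apply: (@le_trans _ _ (dl * expR (2 * u) * expR (2 * u + 1))).
  apply: ler_pM => //; rewrite ?expR_ge0 ?ler_expR//.
  by apply: (le_trans ym); rewrite ler_wpM2l.
rewrite -mulrA -expRD ler_wpM2l// ler_expR; lra.
Qed.

Lemma heat_density_lipschitz a b : enorm (b - a) <= 1 ->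
  L2 (fun w => (heat_density b w)%:C - (heat_density a w)%:C) /\
  (sqnorm (fun w => ((heat_density b w)%:C - (heat_density a w)%:C)%R) <=
    ((enorm (b - a)) ^+ 2 * ((2 * pi) ^+ n * expR (enorm a ^+ 2 + 34) * (pi / 2^-1) ^+ n))%:E)%E.
Proof.
move=> ba1; set dl := enorm (b - a).
have L : L2 (fun w => (heat_density b w)%:C - (heat_density a w)%:C).
  by apply: L2_sub; exact: heat_density_L2.
split=> //; pose K := (2 * pi) ^+ n * expR (enorm a ^+ 2 + 34).
have K0 : 0 <= K by rewrite mulr_ge0 ?expR_ge0// ltW// twopi_gt0.
have g0 : 0 < 2^-1 :> R by rewrite invr_gt0.
have c0 : 0 <= dl ^+ 2 * K by rewrite mulr_ge0 ?sqr_ge0.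
have := integral_scaled_gauss a g0 c0; rewrite -mulrA => <-.
apply: ge0_le_integral => //.
- by move=> w _; rewrite lee_fin mulr_ge0 ?sqr_ge0 ?gaussian_ge0.
- by apply/measurable_EFinP; apply: measurable_sqnormf; have [] := L.
- apply/measurable_EFinP; apply: measurable_funM; first exact: measurable_cst.
  apply: measurable_expR_enorm; apply: measurable_rowB; first exact: measurable_id.
  exact: measurable_cst.
move=> w _; rewrite lee_fin -rcN -rcD normc_real real_normK ?num_real//.
pose u := enorm (w - a); pose v := enorm (w - b).
have u0 : 0 <= u := enorm_ge0 _; have v0 : 0 <= v := enorm_ge0 _.
have vu : `|v - u| <= dl.
  rewrite ler_norml; apply/andP; split.
    rewrite lerNl opprB lerBlDr /u /v /dl -[w - a](subrKA b).
    by rewrite addrC; exact: enorm_add.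
  rewrite lerBlDr /u /v /dl (enorm_distC b) -[w - b](subrKA a) addrC.
  exact: enorm_add.
have lip := gaussian_lipschitz u0 v0 ba1 vu.
have -> : (heat_density b w - heat_density a w) ^+ 2 * gaussian w =
    (2 * pi) ^+ n * ((expR (- v ^+ 2) - expR (- u ^+ 2)) ^+ 2 * expR (enorm w ^+ 2 / 2)).
  have E c : heat_density c w = (2 * pi) ^+ n * expR (- enorm (w - c) ^+ 2) *
      expR (enorm w ^+ 2 / 2) by rewrite /heat_density expRD mulrA.
  have gE : gaussian w * expR (enorm w ^+ 2 / 2) = (2 * pi) ^- n.
    rewrite gaussE -mulrA -expRD.
    have -> : - 2^-1 * enorm w ^+ 2 + enorm w ^+ 2 / 2 = 0 by lra.
    by rewrite expR0 mulr1.
  have p0 := twopi_gt0; rewrite !E -/u -/v.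
  move: gE p0; move: (gaussian w) (expR (enorm w ^+ 2 / 2)) ((2 * pi) ^+ n : R).
  move: (expR (- v ^+ 2)) (expR (- u ^+ 2)) => e1 e2 G W P GW P0.
  rewrite (_ : _ * G = P * (P * (G * W)) * ((e1 - e2) ^+ 2 * W)); last by ring.
  by rewrite GW mulfV ?gt_eqF// mulr1.
have alg (k e g2 : R) : dl ^+ 2 * (k * e) * g2 = k * (dl ^+ 2 * (e * g2)) by ring.
rewrite /K alg ler_wpM2l ?(ltW twopi_gt0)//.
have sq : (expR (- v ^+ 2) - expR (- u ^+ 2)) ^+ 2 <=
    dl ^+ 2 * expR (2 * (- u ^+ 2 + (4 * u + 1))).
  rewrite expRM_natl -exprMn -[leLHS]real_normK ?num_real//.
  by rewrite ler_sqr ?nnegrE// mulr_ge0 ?expR_ge0// enorm_ge0.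
apply: (le_trans (ler_wpM2r (expR_ge0 _) sq)).
rewrite -[leLHS]mulrA ler_wpM2l ?sqr_ge0// -!expRD ler_expR.
(* The exponent [2 (- u^2 + 4 u + 1) + |w|^2/2] is at most [- u^2 + 8 u + 2 + |a|^2], and
   [8 u <= u^2/2 + 32]; hence the constant 34. *)
have := enorm_split w a; have := sqr_ge0 (u - 8); rewrite -/u sqrrB.
by move: (u ^+ 2) (enorm w ^+ 2) (enorm a ^+ 2) => u2 w2 a2; lra.
Qed.

Lemma heatB f g a : L2 f -> L2 g ->
  heat_transform (fun z => f z - g z) a = heat_transform f a - heat_transform g a.
Proof.
move=> Lf Lg; rewrite !heat_inner -mulrBr; congr (_ * _).
have La := heat_density_L2 a.
rewrite -[RHS](cintB measurableT (L2_inner_cintble Lf La) (L2_inner_cintble Lg La)).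
by apply: (@eq_cint _ _ _ leb) => z _; rewrite !mulrBl.
Qed.

Lemma normc_inner_bound f g (q s : R) : L2 f -> L2 g -> 0 <= q -> 0 <= s ->
  (sqnorm f <= (q ^+ 2)%:E)%E -> (sqnorm g <= (s ^+ 2)%:E)%E -> normc (inner f g) <= q * s.
Proof.
move=> Lf Lg q0 s0 fq gs; have := inner_cauchy_schwarz Lf Lg => le.
have : ((normc (inner f g) ^+ 2)%:E <= ((q * s) ^+ 2)%:E)%E.
  have -> : ((q * s) ^+ 2)%:E = ((q ^+ 2)%:E * (s ^+ 2)%:E)%E by rewrite exprMn EFinM.
  exact: (le_trans le (lee_pmul (sqnorm_ge0 f) (sqnorm_ge0 g) fq gs)).
by rewrite lee_fin ler_sqr ?nnegrE ?normc_ge0// mulr_ge0.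
Qed.

Let piVn_ge0 : 0 <= pi ^- n :> R.
Proof. by rewrite invr_ge0 exprn_ge0// pi_ge0. Qed.

Lemma heat_bound a : exists2 K : R, 0 <= K & forall f (q : R), L2 f -> 0 <= q ->
  (sqnorm f <= (q ^+ 2)%:E)%E -> normc (heat_transform f a) <= K * q.
Proof.
have La := heat_density_L2 a; have [_ fin] := La; have [s s0 E] := L2norm_fin fin.
exists (pi ^- n * s) => [|f q Lf q0 fq]; first exact: mulr_ge0.
rewrite heat_inner normcMl normc_real (ger0_norm piVn_ge0) -mulrA ler_wpM2l// mulrC.
by apply: normc_inner_bound => //; rewrite sqnormE E -EFinM.
Qed.

(** [heat_density] is locally Lipschitz into [L^2(mu)] as a function of its centre, so
    Cauchy-Schwarz gives continuity. *)
Lemma heat_continuous g a (e : R) : L2 g -> 0 < e -> exists2 d : R, 0 < d & forall b,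
  enorm (b - a) <= d -> normc (heat_transform g b - heat_transform g a) <= e.
Proof.
move=> Lg e0; have [_ fin] := Lg; have [q q0 E] := L2norm_fin fin.
pose K2 := (2 * pi) ^+ n * expR (enorm a ^+ 2 + 34) * (pi / 2^-1) ^+ n : R.
have K20 : 0 <= K2.
  rewrite !mulr_ge0 ?expR_ge0 ?(ltW twopi_gt0)// exprn_ge0// divr_ge0 ?pi_ge0//.
pose s := Num.sqrt K2; have s0 : 0 <= s by exact: sqrtr_ge0.
have sE : s ^+ 2 = K2 by rewrite sqr_sqrtr.
pose c := pi ^- n * (q * s); have c0 : 0 <= c by rewrite !mulr_ge0.
have c1 : 0 < c + 1 by rewrite ltr_wpDl.
exists (Order.min 1 (e / (c + 1))) => [|b]; first by rewrite lt_min ltr01 divr_gt0.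
rewrite le_min => /andP[b1 be]; rewrite !heat_inner -mulrBr normcMl normc_real.
rewrite (ger0_norm piVn_ge0).
have [Ld sd] := heat_density_lipschitz b1.
have La := heat_density_L2 a; have Lb := heat_density_L2 b.
have conj_diff (u k : C) (x y : R) : u * (x%:C)^*%C * k - u * (y%:C)^*%C * k =
    u * (x%:C - y%:C)^*%C * k by rewrite -rcN -rcD !conjc_real rcD rcN; ring.
have -> : inner g (fun w => (heat_density b w)%:C) - inner g (fun w => (heat_density a w)%:C) =
    inner g (fun w => (heat_density b w)%:C - (heat_density a w)%:C).
  rewrite -[LHS](cintB measurableT (L2_inner_cintble Lg Lb) (L2_inner_cintble Lg La)).
  by apply: (@eq_cint _ _ _ leb) => z _; exact (conj_diff _ _ _ _).
have le : normc (inner g (fun w => (heat_density b w)%:C - (heat_density a w)%:C)) <=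
    q * (enorm (b - a) * s).
  apply: normc_inner_bound => //; first by rewrite mulr_ge0// enorm_ge0.
    by rewrite sqnormE E -EFinM.
  by rewrite exprMn sE.
apply: (le_trans (ler_wpM2l piVn_ge0 le)).
rewrite (_ : _ * _ = c * enorm (b - a)); last by rewrite /c; ring.
apply: (le_trans (ler_wpM2l c0 be)); rewrite mulrCA ler_piMr ?(ltW e0)//.
by rewrite ler_pdivrMr// mul1r lerDl.
Qed.

Lemma box_enorm (d : R) a b : box d a b -> enorm (b - a) <= n%:R * (2 * d).
Proof.
move=> bx; have [->|n0] := eqVneq (enorm (b - a)) 0.
  case: n a b bx => [|k] a b bx; first by rewrite mul0r.
  have [dp _] := bx ord0; rewrite !mulr_ge0//.
  exact: le_trans (normr_ge0 _) (ltW dp).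
have coor j : normc ((b - a) ord0 j) <= 2 * d.
  have [h1 h2] := bx j; apply: (le_trans (normc_le_ReIm _)).
  by move: h1 h2; rewrite !mxE; lra.
have n1 : (0 < n)%N.
  case: n a b n0 {bx coor} => // a b; rewrite (_ : b - a = 0) ?enorm0 ?eqxx//.
  by apply/rowP => -[].
have d0 : 0 <= 2 * d by exact: le_trans (normc_ge0 _) (coor (Ordinal n1)).
have nd0 : 0 <= n%:R * (2 * d) by exact: mulr_ge0.
rewrite -ler_sqr ?nnegrE ?enorm_ge0// enorm_sqr.
apply: (@le_trans _ _ (\sum_(j < n) (2 * d) ^+ 2)).
  by apply: ler_sum => j _; rewrite ler_sqr ?nnegrE ?normc_ge0.
rewrite sumr_const card_ord -(mulr_natl ((2 * d) ^+ 2)) (exprMn 2 n%:R) ler_wpM2r ?sqr_ge0//.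
by rewrite expr2 ler_peMr// ler1n.
Qed.

(** If the bound failed at [a], continuity would make it fail on a box around [a], which has
    positive measure. *)
Lemma heat_ae_bound g (K : R) : L2 g ->
  {ae leb, forall a, normc (heat_transform g a) <= K} ->
  forall a, normc (heat_transform g a) <= K.
Proof.
move=> Lg aeK a; rewrite leNgt; apply/negP => Ka.
have contra (x y : C) : K < normc x -> normc y <= K ->
    normc (y - x) <= (normc x - K) / 2 -> False.
  move=> Kx yK yx; have := normc_add (x - y) y; rewrite subrK (normc_distrC x).
  by move: Kx yK yx; lra.
have e0 : 0 < (normc (heat_transform g a) - K) / 2 by rewrite divr_gt0// subr_gt0.
have [d d0 Hd] := heat_continuous a Lg e0.
(* By [box_enorm] this box reaches at most [n * 2 d' = d n/(n + 1)] from its centre; [n + 1] also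
   covers [n = 0]. *)
pose d' := d / (2 * n.+1%:R).
have d'0 : 0 < d' by rewrite divr_gt0// mulr_gt0.
have [N [mN N0 sN]] := aeK.
have sub : box d' a `<=` N.
  move=> b bx; apply: sN => bK.
  have bd : enorm (b - a) <= d.
    apply: (le_trans (box_enorm bx)); rewrite /d'.
    rewrite (_ : _ * _ = d * (n%:R / n.+1%:R)); last first.
      have n1 : n.+1%:R != 0 :> R by rewrite pnatr_eq0.
      by move: (n.+1%:R : R) (n%:R : R) n1 => y y' y0; field.
    by rewrite ler_piMr ?(ltW d0)// ler_pdivrMr// mul1r ler_nat.
  exact (contra _ (heat_transform g b) Ka bK (Hd b bd)).
have := lebesgueCn_box_gt0 a d'0.
have le : (leb (box d' a) <= leb N)%E.
  by apply: le_measure => //; rewrite inE//; exact: measurable_box.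
by rewrite lt_neqAle => /andP[/eqP bn _]; apply: bn; apply/eqP; rewrite eq_le measure_ge0 -N0.
Qed.

End heat_estimates.

(** * Perturbation of symbol classes *)

Section symbols.
Variables (R : realType) (n : nat).
Local Notation C := R[i].
Local Notation Cn := 'rV[C]_n.
Local Notation leb := (@lebesgueCn R n).
Local Notation F2 := (fock R n).
Implicit Types (f h d : Cn -> C) (z w a : Cn) (g : symbol R n).

Lemma measurable_symbol g : measurable_fun setT (g : Cn -> C).
Proof. exact: measurable_funPT. Qed.

(** A symbol is a quotient class whose chosen representative agrees with [h] only almost everywhere,
    so the statements on perturbed symbols carry an [ae_eq]. *)
Lemma symbol_class h : measurable_fun setT h -> exists g, ae_eq leb setT g h.
Proof.
move=> mh; pose m := isMeasurableFun.Build _ _ _ _ h mh.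
pose f : {mfun Cn >-> C} := HB.pack_for {mfun Cn >-> C} h m.
exists (\pi_(aeEqMfun C leb) f)%qT.
have : ae_eq_op leb (repr (\pi_(aeEqMfun C leb) f)%qT) f.
  by rewrite -eqmodE reprK.
by move=> /asboolP H; apply: filterS H => z e Dz; exact: (e Dz).
Qed.

Definition weight_integral (m : nat) h : \bar R := (\int[leb]_z
  (normc (h z) ^+ 2 * expR (- enorm z ^+ 2 / 2 + m%:R * enorm z))%:E)%E.

Lemma measurable_weight (m : nat) h : measurable_fun setT h -> measurable_fun setT
  (fun z => (normc (h z) ^+ 2 * expR (- enorm z ^+ 2 / 2 + m%:R * enorm z))%:E : \bar R).
Proof.
move=> mh; apply/measurable_EFinP; apply: measurable_funM.
  by apply: measurable_funX; exact: measurable_normc.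
apply: measurableT_comp => //; apply: measurable_funD.
  apply: measurable_funM => //; apply: measurableT_comp => //.
  by apply: measurable_funX; exact: measurable_enorm.
by apply: measurable_funM => //; exact: measurable_enorm.
Qed.

Lemma weight_ge0 (m : nat) h z : setT z -> (0 <= (normc (h z) ^+ 2 *
  expR (- enorm z ^+ 2 / 2 + m%:R * enorm z))%:E :> \bar R)%E.
Proof. by move=> _; rewrite lee_fin mulr_ge0 ?sqr_ge0 ?expR_ge0. Qed.

Lemma weighted_norm_fin (m : nat) h :
  (weighted_norm m h < +oo)%E <-> (weight_integral m h < +oo)%E.
Proof.
have c0 : 0 < (2 * pi) ^- n :> R by rewrite invr_gt0 twopi_gt0.
have I0 : (0 <= weight_integral m h)%E.
  by apply: integral_ge0 => z _; rewrite lee_fin mulr_ge0 ?sqr_ge0 ?expR_ge0.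
rewrite /weighted_norm -/(weight_integral m h); split => [/lty_poweRy|fin].
  rewrite invr_neq0// => /(_ isT).
  by case: (weight_integral m h) I0 => [r _ _|_|//]; rewrite ?ltry// gt0_muley ?lte_fin.
by apply: poweR_lty; rewrite lte_mul_pinfty// ?lee_fin ?(ltW c0).
Qed.

Lemma weight_integral_ae (m : nat) f h : measurable_fun setT f -> measurable_fun setT h ->
  ae_eq leb setT f h -> weight_integral m f = weight_integral m h.
Proof.
move=> mf mh fh; apply: ae_eq_integral => //; [exact: measurable_weight|exact: measurable_weight|].
by apply: filterS fh => z e Dz; rewrite (e Dz).
Qed.

Lemma weighted_norm_ae (m : nat) f h : measurable_fun setT f -> measurable_fun setT h ->
  ae_eq leb setT f h -> weighted_norm m f = weighted_norm m h.
Proof.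
move=> mf mh fh; rewrite /weighted_norm -/(weight_integral m f) -/(weight_integral m h).
by rewrite (weight_integral_ae m mf mh fh).
Qed.

Lemma weight_integral_add (m : nat) f h : measurable_fun setT f -> measurable_fun setT h ->
  (weight_integral m f < +oo)%E -> (weight_integral m h < +oo)%E ->
  (weight_integral m (fun z => f z + h z)%R < +oo)%E.
Proof.
move=> mf mh If Ih.
have mwf := measurable_weight m mf; have mwh := measurable_weight m mh.
apply: (@le_lt_trans _ _ (2%:E * (weight_integral m f + weight_integral m h))%E); last first.
  by rewrite lte_mul_pinfty// ?lee_fin// lte_add_pinfty.
rewrite /weight_integral.
rewrite -(ge0_integralD leb measurableT (@weight_ge0 m f) mwf (@weight_ge0 m h) mwh).
have m2 := emeasurable_funD mwf mwh.
rewrite -(ge0_integralZl_EFin leb measurableT _ m2 (ler0n R 2)); last first.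
  by move=> z _; rewrite -EFinD lee_fin addr_ge0// mulr_ge0 ?sqr_ge0 ?expR_ge0.
apply: ge0_le_integral => //.
- by move=> z; exact: (weight_ge0 m (fun z => f z + h z)).
- exact: (measurable_weight m (measurable_cD mf mh)).
- exact: (measurable_funeM 2%:E m2).
move=> z _; rewrite -EFinD -EFinM lee_fin -mulrDl [leRHS]mulrA ler_wpM2r ?expR_ge0//.
have le : normc (f z + h z) ^+ 2 <= (normc (f z) + normc (h z)) ^+ 2.
  by rewrite ler_sqr ?nnegrE ?addr_ge0 ?normc_ge0 ?normc_add.
apply: (le_trans le); have := sqr_ge0 (normc (f z) - normc (h z)).
by rewrite sqrrB sqrrD; lra.
Qed.

Lemma weight_integral_bounded (m : nat) h : bounded_symbol h ->
  (weight_integral m h < +oo)%E.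
Proof.
move=> [mh [M hM]]; have g0 : 0 < 4^-1 :> R by rewrite invr_gt0.
have M0 : 0 <= M by exact: le_trans (normc_ge0 _) (hM 0).
have c0 : 0 <= M ^+ 2 * expR (m%:R ^+ 2) by rewrite mulr_ge0 ?sqr_ge0 ?expR_ge0.
apply: (@le_lt_trans _ _ (\int[leb]_z (M ^+ 2 * expR (m%:R ^+ 2) *
    expR (- 4^-1 * enorm (z - 0)%R ^+ 2))%:E)%E); last first.
  by rewrite (integral_scaled_gauss 0 g0 c0) ltry.
apply: ge0_le_integral => //.
- exact: weight_ge0.
- exact: measurable_weight.
- apply/measurable_EFinP; apply: measurable_funM; first exact: measurable_cst.
  apply: measurable_expR_enorm; apply: measurable_rowB; first exact: measurable_id.
  exact: measurable_cst.
move=> z _; rewrite lee_fin subr0 -[leRHS]mulrA; apply: ler_pM; rewrite ?sqr_ge0 ?expR_ge0//.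
  by rewrite ler_sqr ?nnegrE ?normc_ge0.
rewrite -expRD ler_expR; have := sqr_ge0 (enorm z / 2 - m%:R).
by rewrite sqrrB; lra.
Qed.

Lemma weighted_norm0 h : measurable_fun setT h -> weighted_norm 0 h = L2norm h.
Proof.
move=> mh; rewrite /weighted_norm /L2norm; congr (_ `^ _)%E.
have m0 z : setT z -> (0 <= (normc (h z) ^+ 2 *
    expR (- enorm z ^+ 2 / 2 + 0%:R * enorm z))%:E :> \bar R)%E := @weight_ge0 0 h z.
rewrite -(ge0_integralZl_EFin leb measurableT m0 (measurable_weight 0 mh) (@twopi_ge0 R n)).
by apply: (@eq_integral _ _ _ leb) => z _; rewrite -EFinM mul0r addr0 mulrCA.
Qed.

Lemma calE_L2 g : calE g -> L2 g.
Proof.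
move=> /(_ 0%N); have mg := measurable_symbol g.
by rewrite (weighted_norm0 mg) => fin; split.
Qed.

Lemma singular_number_ext (k : nat) (T1 T2 : {linear F2 -> F2}) :
  (T1 : F2 -> F2) = T2 -> singular_number k T1 = singular_number k T2.
Proof. by move=> E; rewrite /singular_number E. Qed.

Lemma schatten_norm_ext p (T1 T2 : {linear F2 -> F2}) :
  (T1 : F2 -> F2) = T2 -> schatten_norm p T1 = schatten_norm p T2.
Proof.
move=> E; have F : (fun k => singular_number k T1) = (fun k => singular_number k T2).
  by apply/funext => k; exact: singular_number_ext.
exact (congr1 (fun s : nat -> \bar R => ((\sum_(0 <= k <oo) s k `^ p) `^ p^-1)%E) F).
Qed.

Section perturbed_symbol.
Variables (g0 g1 : symbol R n) (h : Cn -> C) (T : {linear F2 -> F2}).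
Hypotheses (bh : bounded_symbol h) (eT : toeplitz_extension h T).
Hypothesis g1E : ae_eq leb setT g1 (fun z => g0 z + h z).

Let mg0 : measurable_fun setT (g0 : Cn -> C) := measurable_symbol g0.
Let mg1 : measurable_fun setT (g1 : Cn -> C) := measurable_symbol g1.
Let mh : measurable_fun setT h := bh.1.
Let md : measurable_fun setT (fun z => g1 z - g0 z) := measurable_cB mg1 mg0.

Let dE : ae_eq leb setT (fun z => g1 z - g0 z) h.
Proof. by apply: filterS g1E => z e Dz; rewrite (e Dz) addrC addKr. Qed.

Lemma perturbed_weighted_norm (m : nat) :
  weighted_norm m (fun z => g1 z - g0 z) = weighted_norm m h.
Proof. exact: weighted_norm_ae md mh dE. Qed.

Lemma perturbed_toeplitz : (toeplitz (fun z => g1 z - g0 z) : F2 -> F2) = T.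
Proof. exact: toeplitz_ae md bh dE eT. Qed.

Lemma perturbed_calE : calE g0 -> calE g1.
Proof.
move=> E0 m; rewrite (weighted_norm_ae m mg1 (measurable_cD mg0 mh) g1E).
apply/weighted_norm_fin/weight_integral_add => //.
- by apply/weighted_norm_fin; exact: E0.
- exact: weight_integral_bounded.
Qed.

Lemma perturbed_extension (T0 : {linear F2 -> F2}) : toeplitz_extension g0 T0 ->
  toeplitz_extension g1 (T0 \+ T).
Proof.
move=> e0; have e1 : toeplitz_extension (fun z => g0 z + h z) (T0 \+ T).
  exact: (toeplitz_extension_add bh e0 eT).
exact: (toeplitz_extension_ae mg1 (measurable_cD mg0 mh) g1E e1).
Qed.

Lemma perturbed_heat a : calE g0 -> calE g1 ->
  heat_transform g1 a - heat_transform g0 a = heat_transform h a.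
Proof.
move=> /calE_L2 L0 /calE_L2 L1; rewrite -heatB//; congr (_ * _).
have mw f : measurable_fun setT f ->
    measurable_fun setT (fun w => f w * (expR (- enorm (w - a) ^+ 2))%:C).
  move=> mf; apply: measurable_cM => //; apply: measurable_cR.
  apply: measurableT_comp => //; apply: measurableT_comp => //.
  apply: measurable_funX; apply: measurable_enormf.
  by apply: measurable_rowB; [exact: measurable_id|exact: measurable_cst].
apply: (cint_eq_ae measurableT (mw _ md) (mw _ mh)).
by apply: filterS dE => z e Dz; rewrite (e Dz).
Qed.

End perturbed_symbol.

End symbols.

(** * The category argument for an abstract symbol space *)

Section meager.
Variables (R : realType) (n : nat).
Local Notation C := R[i].
Local Notation Cn := 'rV[C]_n.
Local Notation leb := (@lebesgueCn R n).
Local Notation F2 := (fock R n).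
Variables (Y : set (symbol R n)) (rho : nat -> (Cn -> C) -> \bar R).
Local Notation X := (symbol_space Y rho).

Lemma norms_open_nbhs (U : set X) (x : X) : norms_open U -> U x -> nbhs x U.
Proof. by move=> oU Ux; exists U; split. Qed.

(** What the category argument uses of a space: containment in [calE], a first norm dominating
    [q_0], and perturbations that are small in finitely many norms but large in heat transform. The
    last is stated for all classes [g1] almost everywhere equal to [g0 + h], because the sum is
    formed on functions. *)
Hypothesis Y_calE : forall g, Y g -> calE g.
Hypothesis rho_weighted : forall d, (weighted_norm 0 d <= rho 0 d)%E.
Hypothesis Y_perturb : forall (g0 : symbol R n) (N K : nat) (e : R), Y g0 -> 0 < e ->
  exists h c, [/\ bounded_symbol h, K%:R <= normc (heat_transform h c) &
    forall g1 : symbol R n, ae_eq leb setT g1 (fun z => g0 z + h z) ->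
      Y g1 /\ forall m, (m <= N)%N -> (rho m (fun z => (g1 z - g0 z)%R) < e%:E)%E].

Let X_calE (g : X) : calE g.
Proof. by apply: Y_calE; have := svalP g; rewrite inE. Qed.

(** The conjunct [Linfty] makes the union of these sets equal to the set of the theorem, as [meager]
    asks for an equality. *)
Definition heat_le (N : nat) : set X :=
  [set g | Linfty (heat_transform g) /\ forall a, normc (heat_transform g a) <= N%:R].

Lemma heat_gt_open (N : nat) (c : Cn) :
  norms_open [set g : X | N%:R < normc (heat_transform g c)].
Proof.
move=> g /= Ng; have [K K0 HK] := heat_bound c.
pose gap := normc (heat_transform g c) - N%:R.
have gap0 : 0 < gap by rewrite subr_gt0.
have K1 : 0 < K + 1 by rewrite ltr_wpDl.
(* Evaluation at [c] changes by at most [K] times the distance in [q_0], here strictly less than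
   [gap]; [K + 1] covers [K = 0]. *)
exists 0%N, (gap / (K + 1)); split=> [|h hg]; first by rewrite divr_gt0.
have e0 : 0 <= gap / (K + 1) by rewrite divr_ge0 ?ltW.
have Lh := calE_L2 (X_calE h); have Lg := calE_L2 (X_calE g).
have Ld : L2 (fun z => h z - g z) by exact: L2_sub.
have [md _] := Ld.
have := ltW (le_lt_trans (rho_weighted _) (hg 0%N (leqnn 0))).
rewrite (weighted_norm0 md) (L2norm_le _ e0) => /(HK _ _ Ld e0).
rewrite heatB// => le.
have lt : K * (gap / (K + 1)) < gap.
  by rewrite mulrCA gtr_pMr// ltr_pdivrMr// mul1r ltrDl.
have tri (x y : C) : normc y <= normc x + normc (x - y).
  by rewrite normc_distrC; apply: le_trans (normc_add _ _); rewrite addrC subrK.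
have := tri (heat_transform h c) (heat_transform g c).
move: le lt; rewrite /gap /=.
move: (normc (heat_transform h c - heat_transform g c)) => y.
move: (K * _) (normc (heat_transform g c)) (normc (heat_transform h c)) => p q r.
by lra.
Qed.

Lemma heat_le_nowhere_dense (N : nat) : nowhere_dense (heat_le N).
Proof.
apply/seteqP; split=> // g [V [oO Og sO]].
(* [g] lies only in the closure; a point [x0] of [heat_le N] itself in [V] has the pointwise bound
   [N]. *)
have [x0 [Fg0 Og0]] := sO g Og V (norms_open_nbhs oO Og).
pose g0 : symbol R n := space_symbol (x0 : X).
have [M [e [e0 HO]]] := oO x0 Og0.
have Yg0 : Y g0 by have := svalP (x0 : X); rewrite inE.
(* At [c] the old transform is at most [N] and the added one at least [2 N + 1], so the new one
   exceeds [N]. *)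
have [h [c [bh Kh Hh]]] := Y_perturb M (2 * N + 1) Yg0 e0.
have mh := bh.1.
have [g1 g1E] := symbol_class (measurable_cD (measurable_symbol g0) mh).
have [Yg1 small] := Hh g1 g1E.
pose x1 : X := exist _ g1 (mem_set Yg1).
have Ox1 : V x1 by apply: HO => m mM; exact: small.
have big : N%:R < normc (heat_transform x1 c).
  have E := perturbed_heat bh g1E c (Y_calE Yg0) (Y_calE Yg1).
  have := normc_sub (heat_transform g1 c) (heat_transform g0 c); rewrite E.
  have := Fg0.2 c; move: Kh; rewrite natrD natrM.
  rewrite -[heat_transform x1 c]/(heat_transform g1 c).
  move: (normc _) (normc _) (normc _) => p q r.
  have : 0 <= N%:R :> R by [].
  by lra.
(* [x1] still lies in the closure of [heat_le N], yet the transform at [c] exceeds [N] on a whole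
   neighbourhood of [x1]. *)
have [g2 [Fg2 Vg2]] := sO x1 Ox1 _ (norms_open_nbhs (@heat_gt_open N c) big).
by have := Fg2.2 c; rewrite leNgt; move: Vg2 => /= ->.
Qed.

Lemma meager_heat_bounded : meager [set g : X | Linfty (heat_transform g)].
Proof.
exists heat_le; split; first exact: heat_le_nowhere_dense.
apply/seteqP; split=> [g Lg|g [N _ []]//].
have [_] := Lg; rewrite ess_supEae => /ereal_inf_lt[y ae_y yoo].
pose f : Cn -> C := symbol_fun (space_symbol (g : X)).
have [K aeK] : exists K : R, {ae leb, forall a, normc (heat_transform f a) <= K}.
  exists (fine y); apply: filterS ae_y => a; case: y yoo => [y _|//|_].
    by rewrite lee_fin.
  by rewrite leeNy_eq.
have HK := heat_ae_bound (calE_L2 (X_calE (g : X))) aeK.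
exists (Num.trunc K).+1 => //; split=> // a.
apply: (le_trans (HK a)); apply/ltW; exact: truncnS_gt.
Qed.

End meager.

Section toeplitz_spaces.
Variables (R : realType) (n' : nat).
Local Notation n := n'.+1.
Local Notation F2 := (fock R n).
Local Notation Op := {linear F2 -> F2}.
Variables (Q : Op -> Prop) (nu : nat -> Op -> \bar R).
Hypothesis Q_add : forall T0 T1 T : Op, Q T0 ->
  compact_op T1 -> (forall p, 1 < p -> schatten_class p T1) ->
  (forall f, T f = T0 f + T1 f) -> Q T.
Hypothesis nu_ge0 : forall m T, (0 <= nu m T)%E.
Hypothesis nu_ext : forall m (T1 T2 : Op), (T1 : F2 -> F2) = T2 -> nu m T1 = nu m T2.
(** The exponent [p0] may depend on how many norms are considered: for [X_{1+}] the exponents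
    [p_0, ..., p_N] exceed 1 but tend to 1. *)
Hypothesis nu_small : forall N, exists2 p0 : R, 1 < p0 & forall (T : Op) (eta : R),
  (opnorm T <= eta%:E)%E -> (forall p, p0 <= p -> (schatten_norm p T <= eta%:E)%E) ->
  forall m, (m <= N)%N -> (nu m T <= eta%:E)%E.

Lemma toeplitz_space_meager :
  meager [set g : symbol_space [set g : symbol R n | calE g /\ toeplitz_has g Q]
                    (fun m g => (weighted_norm m g + nu m (toeplitz g))%E)
           | Linfty (heat_transform g)].
Proof.
apply: meager_heat_bounded => [g []//|d|g0 N K e [E0 [T0 eT0 QT0]] e0].
  by rewrite leeDl.
(* Both summands of a norm will be at most [e / 3], which leaves room for the strict inequality. *)
have e3 : 0 < e / 3 by rewrite divr_gt0.
have e33 : ((e / 3)%:E + (e / 3)%:E < e%:E)%E by rewrite -EFinD lte_fin; move: e0; lra.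
have [p0 p01 small] := nu_small N.
have [h [T [c [[bh eT] Kh hN [oT sT] [cT scT]]]]] := perturbation n' K N e3 p01.
exists h, c; split=> // g1 g1E; split.
  split; first exact: (perturbed_calE bh g1E E0).
  exists (T0 \+ T); first exact: (perturbed_extension bh eT g1E eT0).
  by apply: (Q_add QT0 cT scT) => f.
move=> m mN; rewrite (perturbed_weighted_norm bh g1E) (nu_ext m (perturbed_toeplitz bh eT g1E)).
exact (le_lt_trans (leeD (hN m mN) (small T _ oT sT m mN)) e33).
Qed.

End toeplitz_spaces.

Theorem theorem3p3 (R : realType) (n : nat) (hn : (1 <= n)%N) :
  [/\ meager [set g : symbol_space (@X_bounded R n) (@norms_op R n)
               | Linfty (heat_transform g)],
      meager [set g : symbol_space (@X_compact R n) (@norms_op R n)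
               | Linfty (heat_transform g)],
      meager [set g : symbol_space (@X_schatten1p R n) (@norms_schatten1p R n)
               | Linfty (heat_transform g)]
    & forall p : R, 1 < p ->
      meager [set g : symbol_space (@X_schatten R n p) (@norms_schatten R n p)
               | Linfty (heat_transform g)]].
Proof.
(* The bumps are placed along the first coordinate axis, which exists as the dimension is
   positive. *)
case: n hn => // n _.
have op_small (N : nat) : exists2 p0 : R, 1 < p0 & forall (T : {linear fock R n.+1 -> fock R n.+1})
    (eta : R), (opnorm T <= eta%:E)%E ->
    (forall p, p0 <= p -> (schatten_norm p T <= eta%:E)%E) ->
    forall m, (m <= N)%N -> (opnorm T <= eta%:E)%E.
  (* The operator norm does not involve a Schatten exponent, so any [p0 > 1] serves. *)
  by exists 2 => //; rewrite ltr1n.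
have schatten_ge0 p (T : {linear fock R n.+1 -> fock R n.+1}) : (0 <= schatten_norm p T)%E.
  exact: poweR_ge0.
split.
- apply: (@toeplitz_space_meager R n (@bounded_op R n.+1) (fun _ T => opnorm T)).
  + by move=> T0 T1 T b0 [b1 _] _; exact: bounded_op_add.
  + by move=> m T; exact: opnorm_ge0.
  + by move=> m T1 T2 ->.
  + exact op_small.
- apply: (@toeplitz_space_meager R n (@compact_op R n.+1) (fun _ T => opnorm T)).
  + move=> T0 T1 T c0 c1 _ TE; exact (compact_op_add c0 c1 TE).
  + by move=> m T; exact: opnorm_ge0.
  + by move=> m T1 T2 ->.
  + exact op_small.
- apply: (@toeplitz_space_meager R n
    (fun T => forall p, 1 < p -> schatten_class p T)
    (fun m T => schatten_norm (1 + m.+1%:R^-1) T)).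
  + move=> T0 T1 T s0 _ s1 TE p p1; exact (schatten_class_add p1 (s0 p p1) (s1 p p1) TE).
  + move=> m T; exact: schatten_ge0.
  + move=> m T1 T2; exact: schatten_norm_ext.
  (* The exponents decrease with [m], so the one of index [N] is the smallest among the first. *)
  + move=> N; exists (1 + N.+1%:R^-1); first by rewrite ltrDl invr_gt0 ltr0n.
    move=> T eta _ H m mN; apply: H; rewrite lerD2l lef_pV2 ?posrE ?ltr0n//.
    by rewrite ler_nat.
- move=> p p1; apply: (@toeplitz_space_meager R n (@schatten_class R n.+1 p)
    (fun _ T => schatten_norm p T)).
  + move=> T0 T1 T s0 _ s1 TE; exact (schatten_class_add p1 s0 (s1 p p1) TE).
  + move=> m T; exact: schatten_ge0.
  + move=> m T1 T2; exact: schatten_norm_ext.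
  + by move=> N; exists p => // T eta _ H m _; exact: H.
Qed.
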